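(* Let $n$ be a positive integer. Let $P$ be a $cA_n$-point of a $\mathbb{Q}$-Gorenstein variety $X$ with terminal singularities. Then any two divisorial contractions to $X$ with centre $P$ are locally analytically equivalent if they are either (1) both of type (1) with the same weights $(r_1, r_2, a, 1)$, (2) both of type (2), or (3) both of type (3).
   Context: A variety is an integral separated scheme of finite type over $\mathbb{C}$; $X^{\mathrm{an}}$ denotes the complex analytic space of a variety $X$. $\mathbb{C}\{x_1,\dots,x_n\}$ is the ring of power series convergent near the origin. For $f\in\mathbb{C}\{\mathbf{x}\}$, $(\mathbb{V}(f),\mathbf 0)$ is the complex space germ it defines. Weight: given positive integer weights $w_1,\dots,w_n$ of $x_1,\dots,x_n$ and non-zero $f\in \mathbb{C}\{x_1,\dots,x_n\}$, $\operatorname{wt} f$ is the minimum of $w_1i_1+\dots+w_ni_n$ over the monomials $x_1^{i_1}\cdots x_n^{i_n}$ with non-zero coefficient in $f$; $\operatorname{wt}0=\infty$. $f_{\operatorname{wt}=d}$ is the quasihomogeneous weight $d$ part of $f$. Divisorial contraction: a proper birational morphism $\varphi\colon Y\to X$ between normal $\mathbb{Q}$-Gorenstein varieties with terminal singularities whose exceptional locus is a prime divisor and such that $-K_Y$ is $\varphi$-ample. The centre of $\varphi$ is the image of its exceptional locus. A $cA_k$-singularity ($k\ge1$) is a complex space germ isomorphic to $(\mathbb{V}(xy+g),\mathbf 0)\subseteq(\mathbb{C}^4,\mathbf 0)$ where $g\in\mathbb{C}\{z,t\}$ has multiplicity $k+1$; $P\in X$ is a $cA_k$-point if $(X^{\mathrm{an}},P)$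 is a $cA_k$-singularity. Weighted blowup: for positive integers $\mathbf{w}=(w_1,\dots,w_n)$ let $\mathbb{C}^*$ act on $\mathbb{C}^{n+1}$ by $\lambda\cdot(u,x_1,\dots,x_n)=(\lambda^{-1}u,\lambda^{w_1}x_1,\dots,\lambda^{w_n}x_n)$, let $T=(\mathbb{C}^{n+1}\setminus\mathbb{V}(x_1,\dots,x_n))/\mathbb{C}^*$ and let $\pi\colon T\to\mathbb{C}^n$, $[u,x_1,\dots,x_n]\mapsto(u^{w_1}x_1,\dots,u^{w_n}x_n)$. For a closed complex subspace $Z$ of an open $D\subseteq\mathbb{C}^n$, the $\mathbf w$-blowup of $Z$ (at $\mathbf 0$) is the restriction $\tilde Z\to Z$ of $\pi$, where $\tilde Z$ is the closure of $\pi^{-1}(Z\setminus\{\mathbf 0\})$ in $\pi^{-1}D$. For $f\in\mathbb{C}\{\mathbf x\}$, $\mathbb{V}(f)$ is taken in a small neighbourhood of $\mathbf 0$. Local analytic equivalence: two birational morphisms of varieties or bimeromorphic holomorphic maps of complex spaces $\varphi\colon Y\to X$, $\varphi'\colon Y'\to X'$ are locally analytically equivalent if there are (analytically) open subsets $U\subseteq X$, $U'\subseteq X'$ containing the centres of $\varphi$ and $\varphi'$ and biholomorphisms $U\cong U'$ and $\varphi^{-1}U\cong\varphi'^{-1}U'$ commuting with $\varphi,\varphi'$ (varieties being replaced by their analytifications). Types of divisorial contractions $\varphi$ to $X$ with centre the $cA_n$-point $P$: Type (1), with weights $(r_1,r_2,a,1)$: $\varphi$ is locally analytically equivalent to the $(r_1,r_2,a,1)$-blowup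 of $\mathbb{V}(f)$ at $\mathbf 0$, where $r_1,r_2,a$ are positive integers with $r_1\le r_2$, $a(n+1)=r_1+r_2$, $a$ coprime to both $r_1$ and $r_2$, and $f=xy+g(z,t)\in\mathbb{C}\{x,y,z,t\}$ with $\operatorname{wt} g=r_1+r_2$ for the weights $(r_1,r_2,a,1)$ of $(x,y,z,t)$. Type (2): $n=1$ and $\varphi$ is locally analytically equivalent to the $(1,5,3,2)$-blowup of $\mathbb{V}(xy+z^2+t^3)$ at $\mathbf 0$. Type (3): $n=2$ and $\varphi$ is locally analytically equivalent to the $(4,3,2,1)$-blowup of $\mathbb{V}(f)$ at $\mathbf 0$, where $f = x^2+y^2+2cxy+2xp(z,t)+2c\,y\,p_{\operatorname{wt}=3}(z,t)+z^3+g(z,t)\in\mathbb{C}\{x,y,z,t\}$ with $c\in\mathbb{C}\setminus\{-1,1\}$, $\operatorname{wt} g\ge6$, $p$ containing only monomials of weight $2$ and $3$ (weights $(4,3,2,1)$ for $(x,y,z,t)$), the coefficient of $t^2$ in $p$ non-zero, and $\deg g(z,1)\le2$. *)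

(* Defs.v *)
(** Complex varieties and reduced complex spaces as spaces with a sheaf of
    C-valued functions, where C := R[i] for R : realType.

    Varieties are the classical ones: the points are the closed points, the
    topology is the Zariski topology, and the structure sheaf is a sheaf of
    functions locally isomorphic to an affine algebraic set.  All complex spaces
    that occur are reduced, hence determined by their sheaves of functions. *)
From HB Require Import structures.
From mathcomp Require Import all_boot all_order all_algebra.
From mathcomp Require Import all_classical all_reals all_analysis.
From mathcomp Require Import generic_quotient complex.
From mathcomp Require mpoly.

Set Implicit Arguments.
Unset Strict Implicit.
Unset Printing Implicit Defensive.

Import Order.TTheory GRing.Theory Num.Theory.
Import numFieldNormedType.Exports.

Local Open Scope classical_set_scope.
Local Open Scope ring_scope.

Definition cplx (R : realType) : numClosedFieldType := R[i].

(** A power series is its family of coefficients, indexed by exponents. *)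
Definition pwseries (R : realType) (n : nat) : Type :=
  {ffun 'I_n -> nat} -> cplx R.

Definition monomial (R : realType) (n : nat) (a : {ffun 'I_n -> nat})
    (x : 'rV[cplx R]_n) : cplx R :=
  \prod_i x 0 i ^+ a i.

Definition psum (R : realType) (n : nat) (c : pwseries R n)
    (x : 'rV[cplx R]_n) (N : nat) : cplx R :=
  \sum_(b : {ffun 'I_n -> 'I_N})
     let a : {ffun 'I_n -> nat} := [ffun i => nat_of_ord (b i)] in
     c a * monomial a x.

Definition psval (R : realType) (n : nat) (c : pwseries R n)
    (x : 'rV[cplx R]_n) : cplx R :=
  lim (psum c x @ \oo).

Definition polydisc (R : realType) (n : nat) (r : cplx R) :
    set 'rV[cplx R]_n :=
  [set x | forall i, `|x 0 i| < r].

(** Implies that [c] converges absolutely on [polydisc r]. *)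
Definition cauchy_bound (R : realType) (n : nat) (r : cplx R)
    (c : pwseries R n) : Prop :=
  exists M : cplx R, forall a, `|c a| * r ^+ (\sum_i a i)%N <= M.

Definition convergent (R : realType) (n : nat) (c : pwseries R n) : Prop :=
  exists2 r : cplx R, 0 < r & cauchy_bound r c.

Definition mon_wt (n : nat) (w : n.-tuple nat) (a : {ffun 'I_n -> nat}) : nat :=
  (\sum_i tnth w i * a i)%N.

Definition wt_ge (R : realType) (n : nat) (w : n.-tuple nat)
    (c : pwseries R n) (d : nat) : Prop :=
  forall a, c a != 0 -> (d <= mon_wt w a)%N.

(** The weight of [c] is the finite number [d]; in particular [c] is not 0. *)
Definition wt_eq (R : realType) (n : nat) (w : n.-tuple nat)
    (c : pwseries R n) (d : nat) : Prop :=
  wt_ge w c d /\ exists2 a, c a != 0 & mon_wt w a = d.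

Definition mult_eq (R : realType) (n : nat) (c : pwseries R n) (d : nat) : Prop :=
  wt_eq [tuple of nseq n 1%N] c d.

Definition wt_part (R : realType) (n : nat) (w : n.-tuple nat) (d : nat)
    (c : pwseries R n) : pwseries R n :=
  fun a => if mon_wt w a == d then c a else 0.

(** [reg x h] means that [h] is a section of the structure sheaf on some
    neighbourhood of [x]; the values of [h] away from [x] are irrelevant. *)
Record fspace (R : realType) := FSpace {
  pts :> topologicalType;
  reg : pts -> (pts -> cplx R) -> Prop;
  reg_eq_near : forall x h k,
    (\forall y \near x, h y = k y) -> reg x h -> reg x k;
  reg_open : forall x h, reg x h -> \forall y \near x, reg y h }.

Arguments reg {R} f x h.

Lemma near_reg_eq (R : realType) (T : topologicalType)
    (P : T -> (T -> cplx R) -> Prop) :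
  (forall (x : T) h k, (\forall y \near x, h y = k y) -> P x h -> P x k) ->
  forall (x : T) h k, (\forall y \near x, h y = k y) ->
    (\forall y \near x, P y h) -> \forall y \near x, P y k.
Proof.
move=> PE x h k /near_join hk Ph; near=> y.
by apply: (PE y h); [near: y | near: y].
Unshelve. all: by end_near. Qed.

Lemma near_reg_open (R : realType) (T : topologicalType)
    (P : T -> (T -> cplx R) -> Prop) :
  forall (x : T) h, (\forall y \near x, P y h) ->
    \forall z \near x, \forall y \near z, P y h.
Proof. by move=> x h /near_join. Qed.

Definition is_morphism (R : realType) (X Y : fspace R) (f : X -> Y) : Prop :=
  continuous f /\ forall x h, reg Y (f x) h -> reg X x (h \o f).

Definition is_iso (R : realType) (X Y : fspace R) (f : X -> Y) : Prop :=
  is_morphism f /\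
  exists g : Y -> X, [/\ is_morphism g, cancel f g & cancel g f].

(** Subsets with the reduced induced structure: functions are regular when they
    locally extend to the ambient space. *)
Section Sub.
Context {R : realType} (X : fspace R) (A : set X).

Definition sub_reg (x : A) (h : A -> cplx R) : Prop :=
  exists2 H : X -> cplx R, reg X (set_val x) H &
    \forall y \near x, h y = H (set_val y).

Lemma sub_reg_eq (x : A) (h k : A -> cplx R) :
  (\forall y \near x, h y = k y) -> sub_reg x h -> sub_reg x k.
Proof.
move=> hk [H Hx hH]; exists H => //; near=> y.
by rewrite -(near hk y)//; near: y.
Unshelve. all: by end_near. Qed.

Lemma sub_reg_open (x : A) (h : A -> cplx R) :
  sub_reg x h -> \forall y \near x, sub_reg y h.
Proof.
move=> [H /reg_open Hx /near_join hH].
have /(_ x _ Hx) {}Hx : continuous (set_val : A -> X).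
  exact: initial_continuous.
by near=> y; exists H; near: y.
Unshelve. all: by end_near. Qed.

Definition sub_space : fspace R := FSpace sub_reg_eq sub_reg_open.

End Sub.

Definition restricts_to_iso (R : realType) (X Y : fspace R) (f : X -> Y)
    (V : set X) (U : set Y) : Prop :=
  exists2 g : sub_space V -> sub_space U, is_iso g &
    forall v, set_val (g v) = f (set_val v).

Definition exceptional_locus (R : realType) (X Y : fspace R) (f : X -> Y) :
    set X :=
  [set x | ~ exists V U, [/\ open V, V x, open U & restricts_to_iso f V U]].

Definition centre (R : realType) (X Y : fspace R) (f : X -> Y) : set Y :=
  f @` exceptional_locus f.

Definition locally_equivalent (R : realType) (Y X Y' X' : fspace R)
    (f : Y -> X) (f' : Y' -> X') : Prop :=
  exists (U : set X) (U' : set X')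
    (alpha : sub_space U -> sub_space U')
    (beta : sub_space (f @^-1` U) -> sub_space (f' @^-1` U')),
    [/\ open U /\ centre f `<=` U, open U' /\ centre f' `<=` U',
        is_iso alpha, is_iso beta &
        forall y x, set_val x = f (set_val y) ->
          set_val (alpha x) = f' (set_val (beta y))].

Definition germ_iso (R : realType) (X X' : fspace R) (P : X) (P' : X') : Prop :=
  exists (U : set X) (U' : set X') (alpha : sub_space U -> sub_space U'),
    [/\ open U /\ U P, open U' /\ U' P', is_iso alpha &
        forall x, set_val x = P -> set_val (alpha x) = P'].

Section AffineSpace.
Context (R : realType) (n : nat).

Definition expands_at (x : 'rV[cplx R]_n) (h : 'rV[cplx R]_n -> cplx R) : Prop :=
  exists2 c : pwseries R n, convergent c &
    \forall z \near x, h z = psval c (z - x).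

Lemma expands_at_eq (x : 'rV[cplx R]_n) (h k : 'rV[cplx R]_n -> cplx R) :
  (\forall y \near x, h y = k y) -> expands_at x h -> expands_at x k.
Proof.
move=> hk [c cc hc]; exists c => //; near=> z.
by rewrite -(near hk z)//; near: z.
Unshelve. all: by end_near. Qed.

Definition analytic_space : fspace R :=
  FSpace (near_reg_eq expands_at_eq) (@near_reg_open R _ expands_at).

Definition peval (p : mpoly.mpoly n (cplx R)) (x : 'rV[cplx R]_n) : cplx R :=
  mpoly.meval (x 0) p.

Definition zariski : Type := 'rV[cplx R]_n.

HB.instance Definition _ := Choice.on zariski.
HB.instance Definition _ := isSubBaseTopological.Build zariski
  [set U : set zariski | exists p, U = [set x | peval p x != 0]] id.

Definition rational_at (x : zariski) (h : zariski -> cplx R) : Prop :=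
  exists p q, peval q x != 0 /\
    \forall y \near x, h y = peval p y / peval q y.

Lemma rational_at_eq (x : zariski) (h k : zariski -> cplx R) :
  (\forall y \near x, h y = k y) -> rational_at x h -> rational_at x k.
Proof.
move=> hk [p [q [qx hpq]]]; exists p, q; split=> //; near=> z.
by rewrite -(near hk z)//; near: z.
Unshelve. all: by end_near. Qed.

Definition affine_space : fspace R :=
  FSpace (near_reg_eq rational_at_eq) (@near_reg_open R _ rational_at).

End AffineSpace.

Arguments analytic_space R n : clear implicits.
Arguments affine_space R n : clear implicits.

Definition irreducible_set (T : topologicalType) (Z : set T) : Prop :=
  Z !=set0 /\
  forall A B, closed A -> closed B -> Z `<=` A `|` B -> Z `<=` A \/ Z `<=` B.

Definition is_affine (R : realType) (X : fspace R) : Prop :=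
  exists n (S : set (affine_space R n)) (f : X -> sub_space S),
    closed S /\ is_iso f.

(** The Zariski topology of a product of varieties: a subbase is given by the
    loci in U x V where some \sum_i f_i(x) g_i(y) does not vanish. *)
Section ZariskiProduct.
Context (R : realType) (X Y : fspace R).

Definition zprod : Type := (X * Y)%type.

HB.instance Definition _ := Choice.on zprod.
HB.instance Definition _ := isSubBaseTopological.Build zprod
  [set W : set zprod |
    exists (U : set X) (V : set Y) k (f : 'I_k -> X -> cplx R)
           (g : 'I_k -> Y -> cplx R),
      [/\ open U, open V, forall i x, U x -> reg X x (f i),
          forall i y, V y -> reg Y y (g i) &
          W = [set p | [/\ U p.1, V p.2 &
                 \sum_(i < k) f i p.1 * g i p.2 != 0]]]] id.

End ZariskiProduct.

Definition is_separated (R : realType) (X : fspace R) : Prop :=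
  closed [set p : zprod X X | p.1 = p.2].

Definition is_variety (R : realType) (X : fspace R) : Prop :=
  [/\ irreducible_set [set: X],
      exists k (U : 'I_k -> set X),
        (forall i, open (U i) /\ is_affine (sub_space (U i))) /\
        \bigcup_i U i = [set: X] &
      is_separated X].

(** Universally closed; a morphism of varieties is automatically separated and
    of finite type. *)
Definition is_proper (R : realType) (Y X : fspace R) (f : Y -> X) : Prop :=
  is_morphism f /\
  forall Z : fspace R, is_variety Z -> forall A : set (zprod Y Z), closed A ->
    closed ((fun p => (f p.1, p.2) : zprod X Z) @` A).

Definition is_birational (R : realType) (Y X : fspace R) (f : Y -> X) : Prop :=
  is_morphism f /\
  exists V U, [/\ open V /\ V !=set0, open U /\ U !=set0 &
                  restricts_to_iso f V U].

(** The local rings are integrally closed in the function field. *)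
Definition is_normal (R : realType) (X : fspace R) : Prop :=
  forall (x : X) (V : set X) (h : X -> cplx R) k (a : 'I_k -> X -> cplx R),
    open V -> V !=set0 -> (forall y, V y -> reg X y h) ->
    (forall i, reg X x (a i)) ->
    (\forall y \near x, V y -> h y ^+ k + \sum_(i < k) a i y * h y ^+ i = 0) ->
    exists2 H, reg X x H & \forall y \near x, V y -> H y = h y.

Definition closed_chain (T : topologicalType) (d : nat) : Prop :=
  exists Z : nat -> set T,
    (forall i, (i <= d)%N -> closed (Z i) /\ irreducible_set (Z i)) /\
    (forall i, (i < d)%N -> Z i `<` Z i.+1).

Definition has_dim (T : topologicalType) (d : nat) : Prop :=
  closed_chain T d /\ ~ closed_chain T d.+1.

Definition prime_divisor (T : topologicalType) (E : set T) : Prop :=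
  [/\ closed E, irreducible_set E, E != [set: T] &
      forall Z, closed Z -> irreducible_set Z -> E `<=` Z ->
        Z = E \/ Z = [set: T]].

(** h = h(p) + \sum_i J_i (v_i - v_i(p)) modulo the square of the maximal ideal
    at p. *)
Definition linear_part (R : realType) (X : fspace R) (d : nat) (p : X)
    (v : 'I_d -> X -> cplx R) (h : X -> cplx R) (J : 'I_d -> cplx R) : Prop :=
  exists k (a b : 'I_k -> X -> cplx R),
    [/\ forall j, reg X p (a j) /\ a j p = 0,
        forall j, reg X p (b j) /\ b j p = 0 &
        \forall y \near p, h y - h p =
          \sum_i J i * (v i y - v i p) + \sum_j a j y * b j y].

(** For d = dim X, [v] is (up to constants) a regular system of parameters at
    [p]; such a system exists exactly at the smooth points. *)
Definition is_coords (R : realType) (X : fspace R) (d : nat) (p : X)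
    (v : 'I_d -> X -> cplx R) : Prop :=
  (forall i, reg X p (v i)) /\
  forall h, reg X p h -> exists J, linear_part p v h J.

(** [om p v] is the value at [p] of the coefficient of (dv_1 ^ ... ^ dv_d)^N.
    As coordinates exist only at smooth points, [is_form N V om] describes the
    sections over [V] of i_* (omega_{Xreg}^N), i : Xreg -> X, i.e. for normal X
    of the divisorial sheaf O_X(N K_X). *)
Definition form_data (R : realType) (X : fspace R) (d : nat) : Type :=
  X -> ('I_d -> X -> cplx R) -> cplx R.

Definition is_form (R : realType) (X : fspace R) (d : nat) (N : int)
    (V : set X) (om : form_data X d) : Prop :=
  (forall p v v' (J : 'M[cplx R]_d), V p -> is_coords p v -> is_coords p v' ->
     (forall i, linear_part p v' (v i) (J i)) ->
     om p v' = om p v * \det J ^ N) /\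
  (forall p v, V p -> is_coords p v -> reg X p (om^~ v)).

(** For X normal of dimension d: [om] generates O_X(N K_X) on [V]. *)
Definition is_generator (R : realType) (X : fspace R) (d : nat) (N : int)
    (V : set X) (om : form_data X d) : Prop :=
  is_form N V om /\ forall p v, V p -> is_coords p v -> om p v != 0.

Definition canonical_cartier (R : realType) (X : fspace R) (d : nat) (N : int) :
    Prop :=
  forall x : X, exists V (om : form_data X d),
    [/\ open V, V x & is_generator N V om].

Definition is_Qgorenstein (R : realType) (X : fspace R) : Prop :=
  [/\ is_variety X, is_normal X &
      forall d, has_dim X d ->
        exists2 m : nat, (0 < m)%N & canonical_cartier X d m%:Z].

(** Every exceptional prime divisor E over X has positive discrepancy: if [om]
    generates O_X(m K_X), then m a(E, X) is the order of vanishing of f^* om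
    along E. *)
Definition is_terminal (R : realType) (X : fspace R) : Prop :=
  forall d, has_dim X d ->
  forall (m : nat) (V : set X) (om : form_data X d),
    (0 < m)%N -> open V -> is_generator m%:Z V om ->
  forall (W : fspace R) (f : W -> X) (E : set W),
    is_variety W -> is_normal W -> is_birational f ->
    prime_divisor E -> E `<=` exceptional_locus f -> E `&` f @^-1` V !=set0 ->
  exists (B : set W) (eta : form_data W d),
    [/\ open B /\ B `<=` f @^-1` V, E `&` B !=set0, is_form m%:Z B eta,
        forall q v, B q -> ~ exceptional_locus f q -> is_coords (f q) v ->
          eta q (fun i => v i \o f) = om (f q) v &
        forall q v, B q -> E q -> is_coords q v -> eta q v = 0].

(** -K_Y is f-ample: over the members of an affine open cover of X, the affine
    loci where a section of a power O(-N K_Y) does not vanish cover Y. *)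
Definition anticanonical_ample (R : realType) (Y X : fspace R) (f : Y -> X) :
    Prop :=
  forall d, has_dim Y d ->
  forall x : X, exists U : set X,
    [/\ open U, U x, is_affine (sub_space U) &
      forall y, U (f y) -> exists (N : nat) (s : form_data Y d),
        let Ys := [set z | U (f z) /\ exists B,
                     [/\ open B, B z & is_generator (- N%:Z) B s]] in
        [/\ (0 < N)%N, canonical_cartier Y d (- N%:Z),
            is_form (- N%:Z) (f @^-1` U) s, Ys y & is_affine (sub_space Ys)]].

Definition divisorial_contraction (R : realType) (Y X : fspace R) (f : Y -> X) :
    Prop :=
  [/\ is_Qgorenstein Y /\ is_terminal Y, is_Qgorenstein X /\ is_terminal X,
      is_proper f /\ is_birational f, prime_divisor (exceptional_locus f) &
      anticanonical_ample f].

Section Analytification.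
Context (R : realType) (X : fspace R).

Definition an_pts : Type := X.

HB.instance Definition _ := Choice.on an_pts.
HB.instance Definition _ := isSubBaseTopological.Build an_pts
  [set W : set an_pts | exists (U : set X) (g : X -> cplx R) (D : set (cplx R)),
     [/\ open U, (forall x, U x -> reg X x g), open D &
         W = [set x | U x /\ D (g x)]]] id.

(** A holomorphic function is locally a holomorphic function of finitely many
    regular ones. *)
Definition an_reg_at (x : an_pts) (h : an_pts -> cplx R) : Prop :=
  exists k (g : 'I_k -> X -> cplx R) (H : 'rV[cplx R]_k -> cplx R),
    [/\ (forall i, reg X x (g i)), reg (analytic_space R k) (\row_i (g i x)) H &
        \forall y \near x, h y = H (\row_i (g i y))].

Lemma an_reg_at_eq (x : an_pts) (h k : an_pts -> cplx R) :
  (\forall y \near x, h y = k y) -> an_reg_at x h -> an_reg_at x k.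
Proof.
move=> hk [j [g [H [gx Hx hH]]]]; exists j, g, H; split=> //; near=> z.
by rewrite -(near hk z)//; near: z.
Unshelve. all: by end_near. Qed.

Definition an : fspace R :=
  FSpace (near_reg_eq an_reg_at_eq) (@near_reg_open R _ an_reg_at).

End Analytification.

Definition an_map (R : realType) (Y X : fspace R) (f : Y -> X) : an Y -> an X :=
  f.

Section WeightedBlowup.
Local Open Scope quotient_scope.
Context (R : realType) (n : nat) (w : n.-tuple nat).

(** A point of C^{n+1} is (u, x_1, ..., x_n), with u at index [ord0] and x_i at
    index [lift ord0 i]. *)
Definition wact (l : cplx R) (p : 'rV[cplx R]_n.+1) : 'rV[cplx R]_n.+1 :=
  \row_i ((if unlift ord0 i is Some j then l ^+ tnth w j else l^-1) * p 0 i).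

Lemma wact1 p : wact 1 p = p.
Proof.
apply/rowP => i; rewrite !mxE.
by case: unlift => [j|]; rewrite ?expr1n ?invr1 mul1r.
Qed.

Lemma wactM l m p : wact l (wact m p) = wact (l * m) p.
Proof.
apply/rowP => i; rewrite !mxE.
by case: unlift => [j|]; rewrite mulrA ?exprMn ?invfM.
Qed.

Definition wdomain : set (analytic_space R n.+1) :=
  [set p | exists i : 'I_n, p 0 (lift ord0 i) != 0].

Definition worbit : rel wdomain := fun p q =>
  `[< exists2 l : cplx R, l != 0 & set_val q = wact l (set_val p) >].

Lemma worbit_refl : reflexive worbit.
Proof. by move=> p; apply/asboolP; exists 1; rewrite ?wact1 ?oner_neq0. Qed.

Lemma worbit_sym : symmetric worbit.
Proof.
move=> p q; apply/asboolP/asboolP => -[l l0 ->]; exists l^-1;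
  by rewrite ?invr_eq0// wactM mulVf// wact1.
Qed.

Lemma worbit_trans : transitive worbit.
Proof.
move=> q p r /asboolP[l l0 ql] /asboolP[m m0 rm]; apply/asboolP.
by exists (m * l); rewrite ?mulf_neq0// rm ql wactM.
Qed.

Definition worbit_equiv : equiv_rel wdomain :=
  EquivRel worbit worbit_refl worbit_sym worbit_trans.

Definition wquot : topologicalType :=
  quotient_topology {eq_quot worbit_equiv}.

Definition wproj (p : wdomain) : wquot := \pi_({eq_quot worbit_equiv}) p.

(** Invariant holomorphic functions. *)
Definition wquot_reg_at (A : wquot) (h : wquot -> cplx R) : Prop :=
  forall p : wdomain, wproj p = A ->
    reg (sub_space wdomain) p (h \o wproj).

Lemma wquot_reg_at_eq (A : wquot) (h k : wquot -> cplx R) :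
  (\forall B \near A, h B = k B) -> wquot_reg_at A h -> wquot_reg_at A k.
Proof.
move=> hk hA p pA; apply: (@reg_eq_near R (sub_space wdomain) p (h \o wproj)).
  have /(_ p) cp : continuous wproj by exact: pi_continuous.
  by rewrite -pA in hk; exact: (cp _ hk).
exact: hA.
Qed.

Definition wspace : fspace R :=
  FSpace (near_reg_eq wquot_reg_at_eq) (@near_reg_open R _ wquot_reg_at).

Definition wpi (A : wspace) : analytic_space R n :=
  let p : 'rV[cplx R]_n.+1 :=
    set_val (repr (A : {eq_quot worbit_equiv})) in
  \row_i (p 0 ord0 ^+ tnth w i * p 0 (lift ord0 i)).

Lemma wpiE (p : wdomain) :
  wpi (wproj p) = \row_i ((set_val p : 'rV[cplx R]_n.+1) 0 ord0 ^+ tnth w i *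
                          (set_val p : 'rV[cplx R]_n.+1) 0 (lift ord0 i)).
Proof.
rewrite /wpi /wproj; set q := repr _.
have : worbit p q.
  apply/(@eqquotP _ worbit_equiv {eq_quot worbit_equiv}).
  by rewrite /q (@reprK _ {eq_quot worbit_equiv}).
case/asboolP => l l0 ->; apply/rowP => i.
rewrite !mxE unlift_none liftK exprMn mulrACA exprVn mulVf ?mul1r//.
by rewrite expf_neq0.
Qed.

Definition wstrict (D Z : set (analytic_space R n)) : set wspace :=
  closure (wpi @^-1` (Z `\ (0 : 'rV[cplx R]_n))) `&` wpi @^-1` D.

(** [b] is the w-blowup at 0 of the closed analytic subset [Z] of the open set
    [D]. *)
Definition is_wblowup (D Z : set (analytic_space R n))
    (b : sub_space (wstrict D Z) -> sub_space Z) : Prop :=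
  forall y, set_val (b y) = wpi (set_val y).

End WeightedBlowup.

Arguments wstrict {R n} w D Z.
Arguments is_wblowup {R n} w D Z b.

Definition zero_locus (R : realType) (n : nat) (r : cplx R)
    (F : 'rV[cplx R]_n -> cplx R) : set (analytic_space R n) :=
  [set x | polydisc r x /\ F x = 0].

(** [f] is locally analytically equivalent to the w-blowup of V(F), taken in the
    polydisc of radius [r]. *)
Definition equivalent_to_wblowup (R : realType) (n : nat) (Y X : fspace R)
    (f : Y -> X) (w : n.-tuple nat) (r : cplx R)
    (F : 'rV[cplx R]_n -> cplx R) : Prop :=
  exists2 b : sub_space (wstrict w (polydisc r) (zero_locus r F)) ->
              sub_space (zero_locus r F),
    is_wblowup w (polydisc r) (zero_locus r F) b &
    locally_equivalent (an_map f) b.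

Section Equations.
Context (R : realType).
Implicit Types x : 'rV[cplx R]_4.

(** The coordinates x, y, z, t of C^4, and the pair (z, t). *)
Definition cx x : cplx R := x 0 (inord 0).
Definition cy x : cplx R := x 0 (inord 1).
Definition cz x : cplx R := x 0 (inord 2).
Definition ct x : cplx R := x 0 (inord 3).
Definition czt x : 'rV[cplx R]_2 :=
  \row_(i < 2) (if i == 0 then cz x else ct x).

Definition eq_cA (g : pwseries R 2) x : cplx R :=
  cx x * cy x + psval g (czt x).

Definition eq_type2 x : cplx R := cx x * cy x + cz x ^+ 2 + ct x ^+ 3.

Definition eq_type3 (c : cplx R) (p g : pwseries R 2) x : cplx R :=
  cx x ^+ 2 + cy x ^+ 2 + 2%:R * c * cx x * cy x
  + 2%:R * cx x * psval p (czt x)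
  + 2%:R * c * cy x * psval (wt_part [tuple 2%N; 1%N] 3 p) (czt x)
  + cz x ^+ 3 + psval g (czt x).

End Equations.

(** The exponent of z^i t^j. *)
Definition zt_exp (i j : nat) : {ffun 'I_2 -> nat} :=
  [ffun k : 'I_2 => if k == 0 then i else j].

Definition is_cA_point (R : realType) (k : nat) (X : fspace R) (P : X) : Prop :=
  (0 < k)%N /\
  exists (g : pwseries R 2) (r : cplx R),
    [/\ 0 < r, cauchy_bound r g, mult_eq g k.+1 &
      exists2 O : sub_space (zero_locus r (eq_cA g)),
        set_val O = (0 : 'rV[cplx R]_4) & germ_iso (P : an X) O].

Definition is_type1 (R : realType) (n : nat) (Y X : fspace R) (f : Y -> X)
    (r1 r2 a : nat) : Prop :=
  [/\ [/\ (0 < r1)%N, (0 < r2)%N, (0 < a)%N & (r1 <= r2)%N],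
      (a * n.+1 = r1 + r2)%N, coprime a r1, coprime a r2 &
      exists (g : pwseries R 2) (r : cplx R),
        [/\ 0 < r, cauchy_bound r g, wt_eq [tuple a; 1%N] g (r1 + r2) &
            equivalent_to_wblowup f [tuple r1; r2; a; 1%N] r (eq_cA g)]].

Definition is_type2 (R : realType) (n : nat) (Y X : fspace R) (f : Y -> X) :
    Prop :=
  n = 1%N /\
  exists2 r : cplx R, 0 < r &
    equivalent_to_wblowup f [tuple 1%N; 5%N; 3%N; 2%N] r (@eq_type2 R).

(** The last condition on [g] is deg g(z,1) <= 2. *)
Definition is_type3 (R : realType) (n : nat) (Y X : fspace R) (f : Y -> X) :
    Prop :=
  n = 2%N /\
  exists (c : cplx R) (p g : pwseries R 2) (r : cplx R),
    [/\ 0 < r /\ cauchy_bound r g, c != -1 /\ c != 1,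
        wt_ge [tuple 2%N; 1%N] g 6 /\
          (forall i j, g (zt_exp i j) != 0 -> (i <= 2)%N),
        (forall e, p e != 0 -> mon_wt [tuple 2%N; 1%N] e = 2%N \/
                               mon_wt [tuple 2%N; 1%N] e = 3%N) /\
          p (zt_exp 0 2) != 0 &
        equivalent_to_wblowup f [tuple 4%N; 3%N; 2%N; 1%N] r
          (eq_type3 c p g)].

(* Main.v *)
From HB Require Import structures.
Require Import Defs.
From mathcomp Require Import all_boot all_order all_algebra.
From mathcomp Require Import finmap.
From mathcomp Require Import all_classical all_reals all_analysis.
From mathcomp Require Import summability.
From mathcomp Require Import complex ring lra zify.
From mathcomp Require mpoly.

Set Implicit Arguments.
Unset Strict Implicit.
Unset Printing Implicit Defensive.

Import Order.TTheory GRing.Theory Num.Theory.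
Import numFieldNormedType.Exports.

Local Open Scope classical_set_scope.
Local Open Scope ring_scope.

(** The centre of each blowup is the origin: limits of arcs on V(f) give infinitely many points
    of the exceptional fibre.  Hence the germ of X at P is that of V(f) at 0, and V(f), V(f') are
    related by a pair (Phi, Psi) of analytic self-maps of (C^4, 0), mutually inverse on the germs.
    Such a pair lifts to the blowups as soon as the i-th components of Phi and Psi have weight at
    least w_i, so it remains to choose Phi and Psi with this property.

    Weights are compared along arcs: if h vanishes on V(f), then its leading form vanishes at the
    limits of (s^(w_i) x_i(s)).  Applied to f'(Phi) this makes the leading forms of the components
    of Phi nearly equal to those of the coordinates, after a permutation of x and y.  In type (1),
    the weight of the z-component is then raised to a by the automorphisms
    (x, y + (g(z,t) - g(z-u,t))/x, z - u, t) of V(xy + g), with u divisible by x, and the weight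
    of the y-component follows from the equation.  In type (2) both germs are the same.  In
    type (3), completing squares turns f into xy + G(z,t); rescaling x and y by inverse constants
    makes Phi compatible with the quadratic parts in t, and the two factors of
    f' = (S - P)(S + P) + ... are separated by their weights. *)

(** * Unconditional sums *)

(** Vanishing on V(f) is known only pointwise; arc limits turn it into identities of leading forms
    on the weighted cone xy + G = 0. These can be split into factors because y = -G/x reduces forms
    linear in y to polynomials in x, z, t.

    The obstacle is that an isomorphism of germs knows nothing of the weights. It is therefore
    probed with auxiliary weights that treat x and y alike and leave a short leading form: ((n+1)e,
    (n+1)e, 2e, 2) with xy + c z^(n+1) in type (1), and (3,3,2,2) with xy + z^3, (6,6,4,3) with xy +
    z^3 - b^2 t^4 in type (3). The factor 2 makes half the weight of g an integer. These weights
    exclude low pure powers of t from the components. For n = 1 and a > 1 the tangent cone has rank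
    3, so x, y and z may mix and linear algebra replaces the factorization. Terms in x too light for
    the z-component exist only if r1 < a; they cannot be excluded, which is why the isomorphism has
    to be changed by automorphisms.

    The cA_n-point enters twice: it forces z^(n+1) to occur in g for a > 1, and it excludes the term
    z from p in type (3). *)

#[global] Instance totally_proper (I : choiceType) : ProperFilter (@totally I).
Proof. exact: totally_filter. Qed.

Lemma ler_fsum (K : numDomainType) (I : choiceType) (A B : {fset I}) (f : I -> K) :
  (A `<=` B)%fset -> (forall i, 0 <= f i) ->
  \sum_(i <- A) f i <= \sum_(i <- B) f i.
Proof.
move=> AB f0; rewrite [leRHS](big_fsetID _ (mem A)) /=.
have -> : [fset x in B | x \in A]%fset = A.
  apply/fsetP => x; rewrite !inE /= andbC; case: (boolP (x \in A)) => //= xA.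
  exact: (fsubsetP AB).
by rewrite lerDl sumr_ge0.
Qed.

(** Locked, since comparing two convergence statements by unfolding is slow. *)
HB.lock Definition hsum (C : numFieldType) (I : choiceType) (f : I -> C) (s : C) :
    Prop :=
  (fun A : {fset I} => \sum_(i <- A) f i) @ totally --> s.

Section Unconditional.
Context {C : numFieldType}.

Lemma hsumE (I : choiceType) (f : I -> C) (s : C) :
  hsum f s = ((fun A : {fset I} => \sum_(i <- A) f i) @ totally --> s).
Proof. by rewrite unlock. Qed.

Definition abs_bdd (I : choiceType) (f : I -> C) (K : C) : Prop :=
  forall A : {fset I}, \sum_(i <- A) `|f i| <= K.

Lemma hsumP (I : choiceType) (f : I -> C) (s : C) :
  hsum f s <-> forall e : C, 0 < e -> exists A : {fset I}, forall B : {fset I},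
    (A `<=` B)%fset -> `|\sum_(i <- B) f i - s| < e.
Proof.
rewrite hsumE; split=> [fs e e0|fs].
  have [A _ AB] := (cvgrPdistC_lt _ _).1 fs e e0.
  by exists A => B BA; exact: (AB B BA).
apply/cvgrPdistC_lt => e e0; have [A AB] := fs _ e0.
by exists A => // B; exact: AB.
Qed.

Lemma hsum_unique (I : choiceType) (f : I -> C) s t :
  hsum f s -> hsum f t -> s = t.
Proof. by rewrite !hsumE => fs ft; apply: (cvg_unique _ fs ft). Qed.

Lemma hsumD (I : choiceType) (f g : I -> C) s t :
  hsum f s -> hsum g t -> hsum (fun i => f i + g i) (s + t).
Proof.
rewrite !hsumE => fs gt; under eq_fun do rewrite big_split /=.
exact: cvgD.
Qed.

Lemma hsumZ (I : choiceType) (f : I -> C) s a :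
  hsum f s -> hsum (fun i => a * f i) (a * s).
Proof.
rewrite !hsumE => fs; under eq_fun do rewrite -big_distrr /=.
by apply: cvgM => //; exact: cvg_cst.
Qed.

Lemma hsum0 (I : choiceType) : hsum (fun _ : I => 0 : C) 0.
Proof.
rewrite hsumE; under eq_fun do rewrite big1 //.
exact: cvg_cst.
Qed.

Lemma hsum_sum (I : choiceType) (J : Type) (r : seq J) (f : J -> I -> C)
    (s : J -> C) : (forall j, hsum (f j) (s j)) ->
  hsum (fun i => \sum_(j <- r) f j i) (\sum_(j <- r) s j).
Proof.
move=> fs; elim: r => [|j r IH].
  by under eq_fun do rewrite big_nil; rewrite big_nil; exact: hsum0.
by under eq_fun do rewrite big_cons; rewrite big_cons; exact: hsumD.
Qed.

Lemma hsum1 (I : choiceType) (f : I -> C) i :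
  (forall j, j != i -> f j = 0) -> hsum f (f i).
Proof.
move=> f0; apply/hsumP => e e0; exists [fset i]%fset => B iB.
have {}iB : i \in B by apply: (fsubsetP iB); rewrite inE.
rewrite (big_fsetD1 i) //= big1_seq ?addr0 ?subrr ?normr0 //.
by move=> j /= /fsetD1P[/f0].
Qed.

(** The order of [C] is partial: the failure of [l <= K] gives [K < l] only once both are known to
    be real. *)
Lemma real_cvg_le (T : Type) (F : set_system T) (FF : ProperFilter F)
    (f : T -> C) (l K : C) :
  f @ F --> l -> l \is Num.real -> K \is Num.real ->
  (\forall x \near F, f x <= K) -> l <= K.
Proof.
move=> fl lr Kr fK; rewrite real_leNgt //; apply/negP => Kl.
have d0 : 0 < l - K by rewrite subr_gt0.
have fd : \forall x \near F, `|f x - l| < l - K.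
  exact: (cvgrPdistC_lt _ _).1 fl _ d0.
have [x [fxK]] := filter_ex (filterI fK fd).
have fxr : f x \is Num.real.
  by rewrite -(subrK K (f x)) realD // ler0_real // subr_le0.
move=> fxd; move: fxd.
rewrite distrC real_ltr_norml ?realB // => /andP[_].
by rewrite ltrD2l ltrN2 real_ltNge // fxK.
Qed.

Lemma hsum_norm_le (I : choiceType) (f : I -> C) s K :
  K \is Num.real -> abs_bdd f K -> hsum f s -> `|s| <= K.
Proof.
rewrite hsumE => Kr fK fs.
apply: (@real_cvg_le _ totally _ (fun A : {fset I} => `|\sum_(i <- A) f i|)).
- exact: cvg_norm.
- exact: normr_real.
- by [].
- by near=> A; apply: le_trans (ler_norm_sum _ _ _) _; exact: fK.
Unshelve. all: by end_near. Qed.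

(** Fubini for summable families: over a finite set [B] of rows the sum of the row sums is a limit
    of sums over finite rectangles, and every large rectangle is within [e / 2] of [T]. The halving
    makes up for the strictness lost in the limit. *)
Lemma hsum_sigma (I J : choiceType) (f : I * J -> C) (S : I -> C) T :
  hsum f T -> (forall i, hsum (fun j => f (i, j)) (S i)) -> hsum S T.
Proof.
move=> fT fS; apply/hsumP => e e0.
have e20 : 0 < e / 2 by rewrite divr_gt0.
have [A0 A0P] := (hsumP _ _).1 fT _ e20.
exists [fset p.1 | p in A0]%fset => B B0.
have h : hsum (fun j => \sum_(i <- B) f (i, j)) (\sum_(i <- B) S i).
  exact: hsum_sum.
apply: (@le_lt_trans _ _ (e / 2)); last by rewrite gtr_pMr // invf_lt1 // ltr1n.
apply: (@real_cvg_le _ totally _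
  (fun D : {fset J} => `|\sum_(j <- D) \sum_(i <- B) f (i, j) - T|)).
- by apply: cvg_norm; apply: cvgB; [rewrite -hsumE|exact: cvg_cst].
- exact: normr_real.
- by rewrite gtr0_real.
exists [fset p.2 | p in A0]%fset => // D /= D0.
have -> : \sum_(j <- D) \sum_(i <- B) f (i, j) =
    \sum_(p <- [fset ((i, j) : I * J) | i in B, j in D]%fset) f p.
  rewrite exchange_big /= big_imfset2 //=.
  by move=> [i j] [k l] _ _ [-> ->].
apply/ltW/A0P; apply/fsubsetP => -[i j] ij; apply/imfset2P.
exists i; first by apply: (fsubsetP B0); apply/imfsetP; exists (i, j).
exists j => //.
by apply: (fsubsetP D0); apply/imfsetP; exists (i, j).
Qed.
Lemma cvg_bigsum (J T : Type) (F : set_system T) (FF : Filter F) (s : seq J)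
    (f : J -> T -> C) (l : J -> C) :
  (forall j, f j @ F --> l j) ->
  (fun x => \sum_(j <- s) f j x) @ F --> \sum_(j <- s) l j.
Proof.
move=> fl; elim: s => [|j s IH].
  by under eq_fun do rewrite big_nil; rewrite big_nil; exact: cvg_cst.
by under eq_fun do rewrite big_cons; rewrite big_cons; exact: cvgD.
Qed.

End Unconditional.

(** * Convergence of absolutely summable complex families *)

Section Completeness.
Context {R : realType}.
Local Notation C := (cplx R).

Lemma real_complex_cvg (T : Type) (F : set_system T) (FF : Filter F)
    (f : T -> R) (l : R) :
  f @ F --> l -> (fun x => (f x)%:C%C : C) @ F --> (l%:C%C : C).
Proof.
move=> fl; apply/cvgrPdistC_lt => e e0.
have eE : e = (complex.Re e)%:C%C by rewrite RRe_real // gtr0_real.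
have e0' : 0 < complex.Re e by move: e0; rewrite {1}eE (ltcR 0).
apply: filterS ((cvgrPdistC_lt _ _).1 fl _ e0') => x xl.
rewrite -rmorphB /= eE normc_def /= expr0n /= addr0 sqrtr_sqr.
by rewrite ltcR.
Qed.

Lemma nneg_hsum (I : choiceType) (f : I -> R) (K : R) :
  (forall i, 0 <= f i) -> (forall A : {fset I}, \sum_(i <- A) f i <= K) ->
  exists s : C, hsum (fun i => (f i)%:C%C) s.
Proof.
move=> f0 fK; pose S := [set \sum_(i <- A) f i | A in [set: {fset I}]].
have hS : has_sup S.
  split; first by exists (\sum_(i <- fset0) f i); exists fset0.
  by exists K => _ [A _ <-].
exists (sup S)%:C%C; rewrite hsumE; under eq_fun do rewrite -rmorph_sum /=.
apply: real_complex_cvg; apply/cvgrPdistC_lt => e e0.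
have [_ [A _ <-] Ae] := sup_adherent e0 hS.
exists A => // B /= AB.
have BS : \sum_(i <- B) f i <= sup S by apply: sup_upper_bound => //; exists B.
rewrite distrC ger0_norm ?subr_ge0 // ltrBlDl -ltrBlDr (lt_le_trans Ae) //.
exact: ler_fsum.
Qed.

(** The only completeness involved is that of the reals under suprema: the positive and negative
    parts of the real and imaginary parts are four families of non-negative reals, each dominated by
    the absolute values of [f]. *)
Lemma abs_hsum (I : choiceType) (f : I -> C) K :
  abs_bdd f K -> exists s, hsum f s.
Proof.
move=> fK; have Kr : K \is Num.real.
  by rewrite ger0_real // (le_trans _ (fK fset0)) // sumr_ge0.
have KE : K = (complex.Re K)%:C%C by rewrite RRe_real.
have part (p : C -> R) : (forall x, 0 <= p x) ->
    (forall x, (p x)%:C%C <= `|x|) -> exists s : C, hsum (fun i => (p (f i))%:C%C) s.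
  move=> p0 px; apply: (@nneg_hsum _ _ (complex.Re K)) => // A.
  rewrite -lecR -KE rmorph_sum /=; apply: le_trans (fK A); exact: ler_sum.
have Rle (x : C) : `|complex.Re x|%:C%C <= `|x| by exact: normc_ge_Re.
have Ile (x : C) : `|complex.Im x|%:C%C <= `|x|.
  by rewrite -[complex.Im x]opprK -ReiNIm normrN (le_trans (Rle _)) // normrM normCi mulr1.
have [a ha] := part (fun x => Num.max (complex.Re x) 0)
  (fun x => ltac:(by rewrite le_max lexx orbT))
  (fun x => ltac:(by apply: le_trans (Rle x); rewrite lecR ge_max ler_norm normr_ge0)).
have [b hb] := part (fun x => Num.max (- complex.Re x) 0)
  (fun x => ltac:(by rewrite le_max lexx orbT))
  (fun x => ltac:(by apply: le_trans (Rle x); rewrite lecR ge_max -normrN ler_norm normr_ge0)).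
have [c hc] := part (fun x => Num.max (complex.Im x) 0)
  (fun x => ltac:(by rewrite le_max lexx orbT))
  (fun x => ltac:(by apply: le_trans (Ile x); rewrite lecR ge_max ler_norm normr_ge0)).
have [d hd] := part (fun x => Num.max (- complex.Im x) 0)
  (fun x => ltac:(by rewrite le_max lexx orbT))
  (fun x => ltac:(by apply: le_trans (Ile x); rewrite lecR ge_max -normrN ler_norm normr_ge0)).
exists ((a + (-1) * b) + 'i%C * (c + (-1) * d)).
have := hsumD (hsumD ha (hsumZ (-1) hb)) (hsumZ 'i%C (hsumD hc (hsumZ (-1) hd))).
congr (hsum _ _); apply/funext => i; rewrite [RHS]complexE !mulN1r -!rmorphN -!rmorphD /=.
have mx (r : R) : Num.max r 0 - Num.max (- r) 0 = r.
  by case: (leP r 0) => r0; [rewrite max_l ?oppr_ge0 // sub0r opprK|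
     rewrite max_r ?subr0 // oppr_le0 ltW].
by rewrite !mx.
Qed.

End Completeness.

#[local] Opaque cplx.

(** * Power series *)

Lemma abs_bdd_pair (K : numFieldType) (I J : choiceType) (f : I * J -> K)
    (k : I -> K) (M : K) :
  (forall i, abs_bdd (fun j => f (i, j)) (k i)) ->
  (forall A : {fset I}, \sum_(i <- A) k i <= M) -> abs_bdd f M.
Proof.
move=> fk kM A.
pose A1 := [fset p.1 | p in A]%fset; pose A2 := [fset p.2 | p in A]%fset.
apply: le_trans (kM A1).
apply: (@le_trans _ _
  (\sum_(p <- [fset ((i, j) : I * J) | i in A1, j in A2]%fset) `|f p|)).
  apply: ler_fsum => //; apply/fsubsetP => -[i j] ij; apply/imfset2P.
  exists i; first by apply/imfsetP; exists (i, j).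
  by exists j => //; apply/imfsetP; exists (i, j).
rewrite big_imfset2 /=; last by move=> [i j] [k' l] _ _ [-> ->].
by apply: ler_sum => i _; exact: fk.
Qed.

Lemma abs_bdd_le (K : numFieldType) (I : choiceType) (f g : I -> K) (M : K) :
  (forall i, `|f i| <= `|g i|) -> abs_bdd g M -> abs_bdd f M.
Proof. by move=> fg gM A; apply: le_trans (gM A); exact: ler_sum. Qed.

Lemma abs_bdd_ge0 (K : numFieldType) (I : choiceType) (f : I -> K) (M : K) :
  abs_bdd f M -> 0 <= M.
Proof. by move=> /(_ fset0); exact: le_trans (sumr_ge0 _ _). Qed.

Lemma hsum_fset (K : numFieldType) (I : choiceType) (f : I -> K) (A : {fset I}) :
  (forall i, i \notin A -> f i = 0) -> hsum f (\sum_(i <- A) f i).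
Proof.
move=> f0; apply/hsumP => e e0; exists A => B AB.
rewrite [X in X - _](big_fsetID _ (mem A)) /=.
rewrite [X in _ + X - _]big1_seq ?addr0.
  rewrite (_ : [fset x in B | x \in A]%fset = A) ?subrr ?normr0 //.
  apply/fsetP => x; rewrite !inE /= andbC; case: (boolP (x \in A)) => //= xA.
  exact: (fsubsetP AB).
by move=> j /=; rewrite !inE /= => /andP[_]; exact: f0.
Qed.

Section PowerSeries.
Context {R : realType}.
Local Notation C := (cplx R).

Definition tdeg n (a : {ffun 'I_n -> nat}) : nat := (\sum_i a i)%N.

Lemma norm_monomial n (a : {ffun 'I_n -> nat}) (x : 'rV[C]_n) :
  `|monomial a x| = \prod_i `|x 0 i| ^+ a i.
Proof. by rewrite /monomial normr_prod; apply: eq_bigr => i _; rewrite normrX. Qed.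

Lemma monomial_le n (a : {ffun 'I_n -> nat}) (x : 'rV[C]_n) (r : C) :
  (forall i, `|x 0 i| <= r) -> `|monomial a x| <= r ^+ tdeg a.
Proof.
move=> xr; rewrite norm_monomial /tdeg expr_sum; apply: ler_prod => i _.
by rewrite exprn_ge0 //= lerXn2r ?nnegrE // (le_trans _ (xr i)).
Qed.

Lemma monomialD n (a b : {ffun 'I_n -> nat}) (x : 'rV[C]_n) :
  monomial [ffun i => (a i + b i)%N] x = monomial a x * monomial b x.
Proof.
by rewrite -big_split /=; apply: eq_bigr => i _; rewrite ffunE exprD.
Qed.

Lemma tdegD n (a b : {ffun 'I_n -> nat}) :
  tdeg [ffun i => (a i + b i)%N] = (tdeg a + tdeg b)%N.
Proof. by rewrite -big_split /=; apply: eq_bigr => i _; rewrite ffunE. Qed.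

(** The rearrangement behind all operations on power series: monomial terms with an arbitrary index
    are grouped by exponent, and the weighted l^1-norm does not grow. Products, substitutions and
    changes of centre all reduce to it. *)
Lemma collect n (P : choiceType) (k : P -> {ffun 'I_n -> nat}) (c : P -> C)
    (r K : C) :
  0 < r -> abs_bdd (fun p => c p * r ^+ tdeg (k p)) K ->
  exists e : pwseries R n,
    abs_bdd (fun a => e a * r ^+ tdeg a) K /\
    forall x T, hsum (fun p => c p * monomial (k p) x) T ->
      hsum (fun a => e a * monomial a x) T.
Proof.
move=> r0 cK.
have Kr : K \is Num.real by rewrite ger0_real // (abs_bdd_ge0 cK).
pose f a p := if k p == a then c p else 0.
have fK a : abs_bdd (f a) (K / r ^+ tdeg a).
  move=> A; rewrite ler_pdivlMr ?exprn_gt0 // mulr_suml.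
  apply: le_trans (cK A); apply: ler_sum => p _; rewrite normrM /f.
  case: eqP => [->|_]; last by rewrite normr0 mul0r mulr_ge0.
  by rewrite ler_wpM2l // ger0_norm // exprn_ge0 // ltW.
have [e eP] := choice (fun a => abs_hsum (fK a)).
exists e; split.
  move=> B.
  have lim : (fun A : {fset P} => \sum_(a <- B) `|(\sum_(p <- A) f a p) * r ^+ tdeg a|)
      @ totally --> \sum_(a <- B) `|e a * r ^+ tdeg a|.
    apply: cvg_bigsum => a; apply: cvg_norm; apply: cvgM; last exact: cvg_cst.
    by have := eP a; rewrite hsumE.
  apply: (@real_cvg_le C _ totally _ _ _ K lim) => //; first by rewrite rpred_sum // => i _; exact: normr_real.
  near=> A; apply: le_trans (cK A).
  apply: (@le_trans _ _ (\sum_(a <- B) \sum_(p <- A) `|f a p * r ^+ tdeg a|)).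
    by apply: ler_sum => a _; rewrite mulr_suml; exact: ler_norm_sum.
  rewrite exchange_big /=; apply: ler_sum => p _.
  rewrite big_seq_fsetE /=.
  have [kB|kB] := boolP (k p \in B).
    rewrite (bigD1 [` kB]%fset) //= big1 ?addr0 /f ?eqxx // => a ak.
    rewrite ifF ?mul0r ?normr0 //; apply: contraNF ak => /eqP kpa.
    by apply/eqP/val_inj.
  rewrite big1 // => a _; rewrite /f ifF ?mul0r ?normr0 //.
  by apply: contraNF kB => /eqP ->; exact: fsvalP.
move=> x T cT.
(* The family on pairs of an exponent and an index is supported on the graph of [k]; summing it row
   by row gives the coefficients [e]. *)
have gT : hsum (fun q : {ffun 'I_n -> nat} * P => f q.1 q.2 * monomial q.1 x) T.
  apply/hsumP => d d0; have [A AP] := (hsumP _ _).1 cT _ d0.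
  exists [fset (k p, p) | p in A]%fset => B AB.
  pose E := [fset q in B | q.1 == k q.2]%fset.
  pose D := [fset q.2 | q in E]%fset.
  have -> : \sum_(q <- B) f q.1 q.2 * monomial q.1 x =
      \sum_(p <- D) c p * monomial (k p) x.
    transitivity (\sum_(q <- E) c q.2 * monomial (k q.2) x).
      have -> : \sum_(q <- B) f q.1 q.2 * monomial q.1 x =
          \sum_(q <- E) f q.1 q.2 * monomial q.1 x +
          \sum_(q <- [fset q in B | q.1 != k q.2]%fset) f q.1 q.2 * monomial q.1 x.
        exact: big_fsetID.
      rewrite [X in _ + X]big1_seq ?addr0.
        rewrite big_seq_cond [RHS]big_seq_cond; apply: eq_bigr => q.
        by rewrite andbT !inE /= => /andP[_ /eqP qk]; rewrite /f -qk eqxx.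
      move=> q /=; rewrite !inE /= => /andP[_ qk].
      by rewrite /f eq_sym (negbTE qk) mul0r.
    rewrite /D [RHS]big_imfset //= => -[a p] [b q].
    by rewrite !inE /= => /andP[_ /eqP ->] /andP[_ /eqP ->] ->.
  apply: AP; apply/fsubsetP => p pA; apply/imfsetP; exists (k p, p) => //.
  rewrite !inE /= eqxx andbT; apply: (fsubsetP AB).
  by apply/imfsetP; exists p.
apply: (hsum_sigma gT) => a /=.
under eq_fun do rewrite mulrC; rewrite mulrC; exact: hsumZ (eP a).
Unshelve. all: by end_near. Qed.

(** [h] is the sum on the closed polydisc of radius [r] about [x0] of a power
    series of l^1-norm at most [K] there. *)
Definition anaK n (x0 : 'rV[C]_n) (r K : C) (h : 'rV[C]_n -> C) : Prop :=
  exists c : pwseries R n, abs_bdd (fun a => c a * r ^+ tdeg a) K /\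
    forall z : 'rV[C]_n, (forall i, `|z 0 i - x0 0 i| <= r) ->
      hsum (fun a => c a * monomial a (z - x0)) (h z).

Lemma series_bdd n (r K : C) (c : pwseries R n) (y : 'rV[C]_n) :
  0 <= r -> abs_bdd (fun a => c a * r ^+ tdeg a) K ->
  (forall i, `|y 0 i| <= r) -> abs_bdd (fun a => c a * monomial a y) K.
Proof.
move=> r0 cK yr; apply: abs_bdd_le cK => a; rewrite !normrM ler_wpM2l //.
by rewrite [leRHS]ger0_norm ?exprn_ge0 // monomial_le.
Qed.

Lemma anaK_mono n (x0 : 'rV[C]_n) (r r' K K' : C) h : 0 <= r' -> r' <= r -> K <= K' ->
  anaK x0 r K h -> anaK x0 r' K' h.
Proof.
move=> r0 rr KK [c [cK ch]]; exists c; split; last first.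
  by move=> z zr; apply: ch => i; exact: le_trans rr.
move=> A; apply: le_trans KK; apply: le_trans (cK A); apply: ler_sum => a _.
rewrite !normrM ler_wpM2l // !normrX lerXn2r ?nnegrE //.
by rewrite !ger0_norm // (le_trans r0).
Qed.

Lemma anaK_eq n (x0 : 'rV[C]_n) (r K : C) h k :
  (forall z : 'rV[C]_n, (forall i, `|z 0 i - x0 0 i| <= r) -> h z = k z) ->
  anaK x0 r K h -> anaK x0 r K k.
Proof.
by move=> hk [c [cK ch]]; exists c; split=> // z zr; rewrite -hk //; exact: ch.
Qed.

Lemma anaK_le n (x0 : 'rV[C]_n) (r K : C) h (z : 'rV[C]_n) : 0 <= r -> anaK x0 r K h ->
  (forall i, `|z 0 i - x0 0 i| <= r) -> `|h z| <= K.
Proof.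
move=> r0 [c [cK ch]] zr.
apply: (hsum_norm_le _ _ (ch z zr)); first by rewrite ger0_real // (abs_bdd_ge0 cK).
by apply: series_bdd cK _ => // i; rewrite !mxE.
Qed.

Lemma anaK_ge0 n (x0 : 'rV[C]_n) (r K : C) h : anaK x0 r K h -> 0 <= K.
Proof. by move=> [c [/abs_bdd_ge0]]. Qed.

Lemma anaK_monomial n (x0 : 'rV[C]_n) (r : C) (d : {ffun 'I_n -> nat}) (b : C) :
  0 < r -> anaK x0 r (`|b| * r ^+ tdeg d) (fun z => b * monomial d (z - x0)).
Proof.
move=> r0; exists (fun a => if a == d then b else 0); split.
  move=> A; have [dA|dA] := boolP (d \in A).
    rewrite (big_fsetD1 d) //= eqxx big1_seq ?addr0.
      by rewrite normrM ler_wpM2l // ger0_norm // exprn_ge0 // ltW.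
    by move=> a /= /fsetD1P[/negbTE ->]; rewrite mul0r normr0.
  rewrite big1_seq ?mulr_ge0 ?exprn_ge0 ?(ltW r0) // => a aA.
  rewrite ifF ?mul0r ?normr0 //; apply: contraNF dA => /eqP <-.
  by move: aA.
move=> z _.
have := @hsum1 _ _ (fun a => (if a == d then b else 0) * monomial a (z - x0)) d.
rewrite eqxx; apply => a /negbTE ->; exact: mul0r.
Qed.

Lemma monomial0 n (x : 'rV[C]_n) : monomial [ffun=> 0%N] x = 1.
Proof. by rewrite /monomial big1 // => i _; rewrite ffunE expr0. Qed.

Lemma tdeg0 n : tdeg ([ffun=> 0%N] : {ffun 'I_n -> nat}) = 0%N.
Proof. by rewrite /tdeg big1 // => i _; rewrite ffunE. Qed.

Definition delta n (i : 'I_n) : {ffun 'I_n -> nat} := [ffun j => (j == i) : nat].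

Lemma monomial_delta n (i : 'I_n) (x : 'rV[C]_n) : monomial (delta i) x = x 0 i.
Proof.
rewrite /monomial (bigD1 i) //= ffunE eqxx expr1 big1 ?mulr1 // => j /negbTE ji.
by rewrite ffunE ji expr0.
Qed.

Lemma tdeg_delta n (i : 'I_n) : tdeg (delta i) = 1%N.
Proof.
rewrite /tdeg (bigD1 i) //= ffunE eqxx big1 ?addn0 // => j /negbTE ji.
by rewrite ffunE ji.
Qed.

Lemma anaK_cst n (x0 : 'rV[C]_n) (r b : C) : 0 < r -> anaK x0 r `|b| (fun=> b).
Proof.
move=> r0; have := @anaK_monomial n x0 r [ffun=> 0%N] b r0.
by rewrite tdeg0 expr0 mulr1; apply: anaK_eq => z _; rewrite monomial0 mulr1.
Qed.

(** A normally convergent sum of analytic functions is analytic, by rearranging the double series.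
    Finite sums, compositions and expansions about another point are all obtained in this way. *)
Lemma anaK_hsum n (J : choiceType) (x0 : 'rV[C]_n) (r : C) (k : J -> C) (K : C)
    (h : J -> 'rV[C]_n -> C) (H : 'rV[C]_n -> C) :
  0 < r -> (forall j, anaK x0 r (k j) (h j)) ->
  (forall A : {fset J}, \sum_(j <- A) k j <= K) ->
  (forall z : 'rV[C]_n, (forall i, `|z 0 i - x0 0 i| <= r) ->
     hsum (fun j => h j z) (H z)) ->
  anaK x0 r K H.
Proof.
move=> r0 /choice[c cP] kK hH.
have bd : abs_bdd (fun p : J * {ffun 'I_n -> nat} => c p.1 p.2 * r ^+ tdeg p.2) K.
  by apply: (abs_bdd_pair (k := k)) => // j; have [] := cP j.
have [e [eK eP]] := collect r0 bd.
exists e; split=> // z zr; apply: eP.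
have bdz : abs_bdd (fun p : J * {ffun 'I_n -> nat} =>
    c p.1 p.2 * monomial p.2 (z - x0)) K.
  apply: (abs_bdd_pair (k := k)) => // j; have [cK _] := cP j.
  by apply: series_bdd cK _ => [|i]; rewrite ?mxE // ltW.
have [T hT] := abs_hsum bdz.
suff <- : T = H z by [].
apply: hsum_unique (hH z zr); apply: (hsum_sigma hT) => j.
by have [_ cPj] := cP j; exact: cPj.
Qed.

Lemma anaKD n (x0 : 'rV[C]_n) (r K L : C) h k : 0 < r ->
  anaK x0 r K h -> anaK x0 r L k -> anaK x0 r (K + L) (fun z => h z + k z).
Proof.
move=> r0 hK kL.
pose kk (b : bool) := if b then K else L.
have K0 := anaK_ge0 hK; have L0 := anaK_ge0 kL.
have kk0 b : 0 <= kk b by case: b.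
have fe (f : bool -> C) : \sum_(b <- [fset true; false]%fset) f b = f true + f false.
  by rewrite big_fsetU1 ?inE //= big_seq_fset1.
apply: (@anaK_hsum _ bool x0 r kk _ (fun b => if b then h else k)) => //.
- by case.
- move=> A; rewrite -(fe kk); apply: ler_fsum => //.
  by apply/fsubsetP => -[]; rewrite !inE.
move=> z _; rewrite -(fe (fun b : bool => (if b then h else k) z)).
by apply: hsum_fset => -[]; rewrite !inE.
Qed.

(** The l^1-norm on a polydisc is submultiplicative: the Cauchy product is the family of products of
    terms, indexed by pairs of exponents and regrouped. *)
Lemma anaKM n (x0 : 'rV[C]_n) (r K L : C) h k : 0 < r ->
  anaK x0 r K h -> anaK x0 r L k -> anaK x0 r (K * L) (fun z => h z * k z).
Proof.
move=> r0 [c [cK ch]] [d [dL dk]].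
have K0 := abs_bdd_ge0 cK; have L0 := abs_bdd_ge0 dL.
pose E := {ffun 'I_n -> nat}.
have bd (u v : E -> C) : abs_bdd u K -> abs_bdd v L ->
    abs_bdd (fun p : E * E => u p.1 * v p.2) (K * L).
  move=> uK vL; apply: (abs_bdd_pair (k := fun a => `|u a| * L)) => [a|] A /=.
    by under eq_bigr do rewrite normrM; rewrite -mulr_sumr ler_wpM2l.
  by rewrite -mulr_suml ler_wpM2r.
have bdr : abs_bdd (fun p : E * E => c p.1 * d p.2 *
    r ^+ tdeg [ffun i => (p.1 i + p.2 i)%N]) (K * L).
  apply: abs_bdd_le (bd _ _ cK dL) => p /=.
  by rewrite tdegD exprD mulrACA.
have [e [eK eP]] := collect r0 bdr.
exists e; split=> // z zr; apply: eP.
have zr' i : `|(z - x0) 0 i| <= r by rewrite !mxE.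
have := bd _ _ (series_bdd (ltW r0) cK zr') (series_bdd (ltW r0) dL zr').
move=> bdz; have [T hT] := abs_hsum bdz.
have -> : h z * k z = T.
  rewrite mulrC; apply: hsum_unique (hsum_sigma hT _); first exact: hsumZ (ch z zr).
  by move=> a /=; rewrite [k z * _]mulrC; exact: hsumZ (dk z zr).
move: hT; congr (hsum _ _); apply/funext => p /=.
by rewrite monomialD mulrACA.
Qed.

Lemma anaKX n (x0 : 'rV[C]_n) (r K : C) h m : 0 < r ->
  anaK x0 r K h -> anaK x0 r (K ^+ m) (fun z => h z ^+ m).
Proof.
move=> r0 hK; elim: m => [|m IH].
  by rewrite expr0 -[X in anaK _ _ X](normr1 C); exact: anaK_cst.
rewrite exprS; under eq_fun do rewrite exprS.
exact: anaKM.
Qed.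

Lemma anaK_prod n (J : Type) (s : seq J) (x0 : 'rV[C]_n) (r : C) (K : J -> C)
    (h : J -> 'rV[C]_n -> C) : 0 < r ->
  (forall j, anaK x0 r (K j) (h j)) ->
  anaK x0 r (\prod_(j <- s) K j) (fun z => \prod_(j <- s) h j z).
Proof.
move=> r0 hK; elim: s => [|j s IH].
  rewrite big_nil; under [X in anaK _ _ _ X]eq_fun do rewrite big_nil.
  by rewrite -[X in anaK _ _ X](normr1 C); exact: anaK_cst.
rewrite big_cons; under [X in anaK _ _ _ X]eq_fun do rewrite big_cons.
exact: anaKM.
Qed.

Lemma anaK_coord n (x0 : 'rV[C]_n) (r : C) i : 0 < r ->
  anaK x0 r (`|x0 0 i| + r) (fun z => z 0 i).
Proof.
move=> r0; have := anaKD r0 (anaK_cst x0 (x0 0 i) r0) (anaK_monomial x0 (delta i) 1 r0).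
rewrite tdeg_delta normr1 mul1r expr1; apply: anaK_eq => z _.
by rewrite monomial_delta mul1r !mxE addrCA subrr addr0.
Qed.

(** Shrinking the radius by a factor [t <= 1] multiplies every term of positive degree by at most
    [t], and the constant term is [h x0 = 0]. It is the norm, not just the values, that becomes
    small; substitution into a series requires this. *)
Lemma anaK_small n (x0 : 'rV[C]_n) (r K : C) h (d : C) : 0 < r -> 0 < d ->
  anaK x0 r K h -> h x0 = 0 -> exists2 r', 0 < r' & anaK x0 r' d h.
Proof.
move=> r0 d0 [c [cK ch]] h0; have K0 := abs_bdd_ge0 cK.
have c0 : c [ffun=> 0%N] = 0.
  have /ch : forall i, `|x0 0 i - x0 0 i| <= r by move=> i; rewrite subrr normr0 ltW.
  rewrite h0 subrr.
  have m0 (a : {ffun 'I_n -> nat}) : a != [ffun=> 0%N] -> monomial a (0 : 'rV[C]_n) = 0.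
    move=> a0; apply/eqP; rewrite prodf_seq_eq0; apply/hasP.
    have [i ai] : exists i, a i != 0%N.
      apply/existsP; apply: contraNT a0; rewrite negb_exists => /forallP a0.
      by apply/eqP/ffunP => i; rewrite ffunE; apply/eqP; rewrite -[_ == _]negbK.
    by exists i; rewrite ?mem_index_enum //= mxE expr0n (negbTE ai) eqxx.
  have := @hsum1 _ _ (fun a => c a * monomial a (0 : 'rV[C]_n)) [ffun=> 0%N].
  rewrite monomial0 mulr1 => h1 h2; apply: hsum_unique (h1 _) h2.
  by move=> a /m0 ->; rewrite mulr0.
(* Chosen so that both [t <= 1] and [K * t <= d] hold, also when [K] is 0. *)
pose t := d / (K + d).
have Kd : 0 < K + d by rewrite ltr_wpDl.
have t0 : 0 < t by rewrite divr_gt0.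
have t1 : t <= 1 by rewrite ler_pdivrMr // mul1r lerDr.
exists (r * t); first by rewrite mulr_gt0.
exists c; split; last first.
  move=> z zr; apply: ch => i; apply: le_trans (zr i) _.
  by rewrite ger_pMr.
move=> A; apply: (@le_trans _ _ (K * t)); last first.
  by rewrite /t mulrA ler_pdivrMr // mulrC ler_pM2l // lerDl ltW.
apply: le_trans (ler_wpM2r (ltW t0) (cK A)); rewrite mulr_suml; apply: ler_sum => a _.
have [->|a0] := eqVneq a [ffun=> 0%N]; first by rewrite c0 !mul0r normr0 mul0r.
rewrite exprMn mulrA normrM ler_wpM2l // ger0_norm ?exprn_ge0 ?(ltW t0) //.
have [da|] := eqVneq (tdeg a) 0%N; last first.
  by rewrite -lt0n; case: (tdeg a) => // m _; rewrite exprS ger_pMr // exprn_ile1 // (ltW t0).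
case/eqP: a0; apply/ffunP => i; rewrite ffunE; apply/eqP.
by move/eqP: da; rewrite sum_nat_eq0 => /forallP /(_ i).
Qed.

End PowerSeries.

(** * Analytic functions *)

Section Analytic.
Context {R : realType}.
Local Notation C := (cplx R).

(** A substitute for the minimum that involves no comparison: [r * f i / (r + f i)] is positive and
    at most both [r] and [f i]. *)
Lemma common_pos (I : Type) (s : seq I) (f : I -> C) :
  (forall i, 0 < f i) -> exists2 r : C, 0 < r & forall i, List.In i s -> r <= f i.
Proof.
move=> f0; elim: s => [|i s [r r0 rs]]; first by exists 1.
have d0 : 0 < r + f i by rewrite addr_gt0.
exists (r * f i / (r + f i)); first by rewrite divr_gt0 // mulr_gt0.
move=> j /= [<-|/rs]; first by rewrite ler_pdivrMr // mulrC ler_pM2l // lerDl ltW.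
by apply: le_trans; rewrite ler_pdivrMr // ler_pM2l // lerDr ltW.
Qed.

Lemma common_pos_fin (I : finType) (f : I -> C) :
  (forall i, 0 < f i) -> exists2 r : C, 0 < r & forall i, r <= f i.
Proof.
move=> /(common_pos (enum I)) [r r0 rs]; exists r => // i; apply: rs.
have : i \in enum I by rewrite mem_enum.
elim: (enum I) => //= j s IH; rewrite inE => /orP[/eqP ->|/IH]; by [left|right].
Qed.

Lemma pos_min2 (a b : C) : 0 < a -> 0 < b ->
  exists r : C, [/\ 0 < r, r <= a & r <= b].
Proof.
move=> a0 b0; have [|r r0 ri] := @common_pos_fin bool (fun i => if i then a else b).
  by case.
by exists r; split=> //; [exact: (ri true)|exact: (ri false)].
Qed.

Lemma norm_term (c r : C) k : 0 < r -> `|c| * r ^+ k = `|c * r ^+ k|.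
Proof. by move=> r0; rewrite normrM [X in _ = _ * X]ger0_norm // exprn_ge0 // ltW. Qed.

Lemma near_rowP n (x : 'rV[C]_n) (P : 'rV[C]_n -> Prop) :
  (\forall z \near x, P z) <->
  exists2 e : C, 0 < e & forall z : 'rV[C]_n, (forall i, `|z 0 i - x 0 i| < e) -> P z.
Proof.
split=> [/nbhs_ballP[e /= e0 eP]|[e e0 eP]].
  exists e => // z ze; apply: eP; split=> // i j.
  by rewrite ord1 /ball /= distrC.
apply/nbhs_ballP; exists e => // z [_ ze]; apply: eP => i.
by have := ze 0 i; rewrite /ball /= distrC.
Qed.

Definition cub n N (b : {ffun 'I_n -> 'I_N}) : {ffun 'I_n -> nat} :=
  [ffun i => nat_of_ord (b i)].

Definition cube n N : {fset {ffun 'I_n -> nat}} :=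
  [fset cub b | b in {ffun 'I_n -> 'I_N}]%fset.

Lemma cub_inj n N : injective (@cub n N).
Proof.
move=> b d /ffunP bd; apply/ffunP => i; apply: val_inj.
by have := bd i; rewrite !ffunE.
Qed.

Lemma mem_cube n N (a : {ffun 'I_n -> nat}) : (forall i, a i < N)%N -> a \in cube n N.
Proof.
move=> aN; apply/imfsetP; exists [ffun i => Ordinal (aN i)] => //.
by apply/ffunP => i; rewrite !ffunE.
Qed.

Lemma big_cube n N (f : {ffun 'I_n -> nat} -> C) :
  \sum_(a <- cube n N) f a = \sum_(b : {ffun 'I_n -> 'I_N}) f (cub b).
Proof.
rewrite big_imfset /=; last by move=> b d _ _; exact: cub_inj.
by rewrite big_enum.
Qed.

Lemma cube_cofinal n (A : {fset {ffun 'I_n -> nat}}) :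
  exists N0, forall N, (N0 <= N)%N -> (A `<=` cube n N)%fset.
Proof.
exists (\max_(a <- A) \max_i (a i)).+1 => N N0; apply/fsubsetP => a aA.
apply: mem_cube => i; apply: leq_trans N0; rewrite ltnS.
apply: leq_trans (leq_bigmax_seq _ aA isT).
exact: (leq_bigmax (F := fun i => a i)).
Qed.

Lemma psumE n (c : pwseries R n) x N :
  psum c x N = \sum_(a <- cube n N) c a * monomial a x.
Proof. by rewrite big_cube. Qed.

(** [psval] is a limit over cubes of exponents, and these are cofinal among all finite sets of
    exponents. *)
Lemma hsum_psval n (c : pwseries R n) x s :
  hsum (fun a => c a * monomial a x) s -> psval c x = s.
Proof.
move=> /hsumP cs.
have h : psum c x @ \oo --> s.
  apply/cvgrPdistC_lt => e e0; have [A AP] := cs _ e0.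
  have [N0 N0P] := cube_cofinal A.
  by exists N0 => // N /= /N0P /AP; rewrite psumE.
exact: (cvg_lim _ h).
Qed.

Lemma geometric_bdd n (r : 'I_n -> C) : (forall i, 0 <= r i) -> (forall i, r i < 1) ->
  abs_bdd (fun a : {ffun 'I_n -> nat} => \prod_i r i ^+ a i) (\prod_i (1 - r i)^-1).
Proof.
move=> r0 r1 A; have [N /(_ _ (leqnn _)) AN] := cube_cofinal A.
apply: le_trans (ler_fsum AN (fun=> normr_ge0 _)) _.
rewrite big_cube (eq_bigr (fun b : {ffun 'I_n -> 'I_N} => \prod_i r i ^+ b i)); last first.
  move=> b _; rewrite ger0_norm; last by rewrite prodr_ge0 // => i _; exact: exprn_ge0.
  by apply: eq_bigr => i _; rewrite ffunE.
rewrite -(bigA_distr_bigA (fun i (k : 'I_N) => r i ^+ k)).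
apply: ler_prod => i _; rewrite sumr_ge0 => [/=|k _]; last exact: exprn_ge0.
have d0 : 0 < 1 - r i by rewrite subr_gt0.
rewrite -(ler_pM2l d0) divff ?gt_eqF // -opprB mulNr -subrX1 opprB.
by rewrite gerBl exprn_ge0.
Qed.

(** Abel's lemma: the terms are dominated by a product of geometric series with ratios [s i / r i].
    The radii depend on the coordinate because the lifts to the blowup converge on polydiscs of that
    kind. *)
Lemma polyradius_bdd n (r : 'I_n -> C) (c : pwseries R n) (M : C) (s : 'I_n -> C) :
  (forall a, `|c a| * \prod_i r i ^+ a i <= M) ->
  (forall i, 0 <= s i) -> (forall i, s i < r i) ->
  exists K, abs_bdd (fun a => c a * \prod_i s i ^+ a i) K.
Proof.
move=> cM s0 sr; have r0 i : 0 < r i by exact: le_lt_trans (sr i).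
exists (M * \prod_i (1 - s i / r i)^-1) => A.
have q0 i : 0 <= s i / r i by rewrite divr_ge0 // ltW.
have q1 i : s i / r i < 1 by rewrite ltr_pdivrMr // mul1r.
have M0 : 0 <= M.
  apply: le_trans (cM [ffun=> 0%N]); rewrite mulr_ge0 // prodr_ge0 // => i _.
  by rewrite exprn_ge0 // ltW.
apply: le_trans (ler_wpM2l M0 (geometric_bdd q0 q1 A)).
rewrite mulr_sumr; apply: ler_sum => a _.
have -> : \prod_i (s i / r i) ^+ a i = (\prod_i s i ^+ a i) / \prod_i r i ^+ a i.
  by rewrite -prodf_div; apply: eq_bigr => i _; rewrite expr_div_n.
have p0 : 0 < \prod_i r i ^+ a i by rewrite prodr_gt0 // => i _; rewrite exprn_gt0.
rewrite !normrM normfV (gtr0_norm p0) mulrA ler_pdivlMr // mulrAC.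
by rewrite ler_wpM2r.
Qed.

Lemma psval_hsum n (r : 'I_n -> C) (c : pwseries R n) (M : C) (x : 'rV[C]_n) :
  (forall a, `|c a| * \prod_i r i ^+ a i <= M) -> (forall i, `|x 0 i| < r i) ->
  hsum (fun a => c a * monomial a x) (psval c x).
Proof.
move=> cM xr.
have [K cK] := polyradius_bdd cM (fun i => normr_ge0 (x 0 i)) xr.
have cx : abs_bdd (fun a => c a * monomial a x) K.
  apply: abs_bdd_le cK => a; rewrite !normrM ler_wpM2l // norm_monomial.
  by rewrite ger0_norm // prodr_ge0 // => i _; exact: exprn_ge0.
by have [s cs] := abs_hsum cx; rewrite (hsum_psval cs).
Qed.

(** Expansion about another point: each monomial is analytic at [x], with norm at most the product
    of the powers of [|x_i| + d], and the resulting bounds are summable because [|x_i| + d] is still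
    less than [r i]. *)
Lemma psval_anaK n (r : 'I_n -> C) (c : pwseries R n) (M : C) (x : 'rV[C]_n) :
  (forall a, `|c a| * \prod_i r i ^+ a i <= M) -> (forall i, `|x 0 i| < r i) ->
  exists s K, 0 < s /\ anaK x s K (psval c).
Proof.
move=> cM xr.
have [d d0 dr] := @common_pos_fin 'I_n (fun i => (r i - `|x 0 i|) / 2)
  (fun i => ltac:(by rewrite divr_gt0 // subr_gt0)).
have xd i : `|x 0 i| + d < r i.
  apply: (@le_lt_trans _ _ (`|x 0 i| + (r i - `|x 0 i|) / 2)); first by rewrite lerD2l.
  by rewrite -ltrBrDl gtr_pMr ?subr_gt0 // invf_lt1 // ltr1n.
have xd0 i : 0 <= `|x 0 i| + d by rewrite addr_ge0 // ltW.
have [K cK] := polyradius_bdd cM xd0 xd.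
exists d, K; split=> //.
apply: (@anaK_hsum _ _ _ x d (fun a => `|c a| * \prod_i (`|x 0 i| + d) ^+ a i) K
   (fun a z => c a * monomial a z)) => //.
- move=> a; apply: anaKM => //; first exact: anaK_cst.
  by apply: anaK_prod => // i; apply: anaKX => //; exact: anaK_coord.
- move=> A; apply: le_trans (cK A); apply: ler_sum => a _.
  rewrite normrM ler_wpM2l // ger0_norm // prodr_ge0 // => i _.
  exact: exprn_ge0.
move=> z zx; apply: (psval_hsum cM) => i; apply: le_lt_trans (xd i).
by rewrite -[z 0 i](subrK (x 0 i)) addrC (le_trans (ler_normD _ _)) // lerD2l.
Qed.

Lemma expands_atP n (x : 'rV[C]_n) h :
  expands_at x h <-> exists r K, 0 < r /\ anaK x r K h.
Proof.
split=> [[c [r r0 [M cM]] /near_rowP[e e0 hc]]|[r [K [r0 [c [cK ch]]]]]].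
  have cM' a : `|c a| * \prod_(i < n) r ^+ a i <= M by rewrite prodrXr.
  have x0 (i : 'I_n) : `|(0 : 'rV[C]_n) 0 i| < r by rewrite mxE normr0.
  have [s [K [s0 sK]]] := psval_anaK cM' x0.
  have [d [d0 ds de]] := pos_min2 s0 (divr_gt0 e0 (ltr0Sn _ 1)).
  exists d, K; split=> //; have := anaK_mono (ltW d0) ds (lexx K) sK.
  move=> [c' [cK' ch']]; exists c'; split=> // z zx.
  rewrite hc; last first.
    move=> i; apply: le_lt_trans (zx i) _; apply: le_lt_trans de _.
    by rewrite gtr_pMr // invf_lt1 // ltr1n.
  by have := ch' (z - x); rewrite subr0; apply=> i; rewrite !mxE subr0.
exists c; first by exists r => //; exists K => a; have := cK [fset a]%fset;
  rewrite big_seq_fset1 -norm_term.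
apply/near_rowP; exists r => // z zr; apply/esym/hsum_psval/ch => i.
exact: ltW.
Qed.

Lemma anaK_near n (x : 'rV[C]_n) (r K : C) h : 0 < r -> anaK x r K h ->
  \forall y \near x, expands_at y h.
Proof.
move=> r0 [c [cK ch]]; apply/near_rowP; exists r => // y yr.
have cK' a : `|c a| * \prod_(i < n) r ^+ a i <= K.
  rewrite prodrXr; have := cK [fset a]%fset.
  by rewrite big_seq_fset1 -norm_term.
have yr' i : `|(y - x) 0 i| < r by rewrite !mxE.
have [s [L [s0 [d [dL hd]]]]] := psval_anaK cK' yr'.
have [e e0 er] := @common_pos_fin 'I_n (fun i => (r - `|y 0 i - x 0 i|) / 2)
  (fun i => ltac:(by rewrite divr_gt0 // subr_gt0)).
have [t [t0 ts te]] := pos_min2 s0 e0.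
apply/expands_atP; exists t, L; split=> //.
have [d' [dL' hd']] : anaK (y - x) t L (psval c).
  by apply: anaK_mono (ltW t0) ts (lexx L) _; exists d.
exists d'; split=> // z zy.
have zr i : `|z 0 i - x 0 i| <= r.
  rewrite -[z 0 i](subrK (y 0 i)) -addrA (le_trans (ler_normD _ _)) //.
  rewrite -lerBrDr (le_trans (zy i)) // (le_trans te) // (le_trans (er i)) //.
  by rewrite ger_pMr ?subr_gt0 // invf_le1 // ler1n.
rewrite -(hsum_psval (ch z zr)).
have -> : z - y = (z - x) - (y - x) by rewrite opprB addrA subrK.
by apply: hd' => i; rewrite !mxE opprB addrA subrK.
Qed.

(** An expansion at [x] yields expansions at all nearby points, so the condition of [reg] on a whole
    neighbourhood reduces to the point itself. *)
Lemma reg_analyticE n (x : 'rV[C]_n) h :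
  reg (analytic_space R n) x h <-> expands_at x h.
Proof.
split=> [/nbhs_singleton //|/expands_atP[r [K [r0 hK]]]].
exact: (anaK_near r0 hK).
Qed.

(** By [anaK_small] the components of [h - h x] get norm at most the radius [s] of [F]; the
    substituted series is then bounded by the norm [K] of [F]. *)
Lemma expands_at_comp n m (F : 'rV[C]_m -> C) (h : 'rV[C]_n -> 'rV[C]_m) (x : 'rV[C]_n) :
  expands_at (h x) F -> (forall i, expands_at x (fun z => h z 0 i)) ->
  expands_at x (F \o h).
Proof.
move=> /expands_atP[s [K [s0 [c [cK cF]]]]] hx.
have sm i : exists r : C, 0 < r /\ anaK x r s (fun z => h z 0 i - h x 0 i).
  have /expands_atP[r [L [r0 hL]]] := hx i.
  have h' := anaKD r0 hL (anaK_cst x (- h x 0 i) r0).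
  have [|r' r'0 r'h] := anaK_small r0 s0 h'; first exact: subrr.
  by exists r'.
have [r rP] := choice sm.
have [d d0 dr] := @common_pos_fin 'I_m r (fun i => proj1 (rP i)).
have hd i : anaK x d s (fun z => h z 0 i - h x 0 i).
  exact: anaK_mono (ltW d0) (dr i) (lexx s) (proj2 (rP i)).
apply/expands_atP; exists d, K; split=> //.
apply: (@anaK_hsum _ _ _ x d (fun a => `|c a| * \prod_i s ^+ a i) K
   (fun a z => c a * \prod_i (h z 0 i - h x 0 i) ^+ a i)) => //.
- move=> a; apply: anaKM => //; first exact: anaK_cst.
  by apply: anaK_prod => // i; apply: anaKX.
- move=> A; apply: le_trans (cK A); apply: ler_sum => a _.
  by rewrite prodrXr norm_term.
move=> z zx; have := cF (h z) (fun i => anaK_le (ltW d0) (hd i) zx).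
congr (hsum _ _); apply/funext => a; congr (_ * _).
by apply: eq_bigr => i _; rewrite !mxE.
Qed.

Lemma expands_at_continuous n (x : 'rV[C]_n) h :
  expands_at x h -> {for x, continuous h}.
Proof.
move=> /expands_atP[r [K [r0 hK]]].
have FF : Filter (nbhs x) by exact: nbhs_filter.
apply/(@cvgrPdistC_lt _ C _ (nbhs x) FF) => e e0.
have e20 : 0 < e / 2 by rewrite divr_gt0.
have [|s s0 hs] := anaK_small r0 e20 (anaKD r0 hK (anaK_cst x (- h x) r0)).
  exact: subrr.
apply/near_rowP; exists s => // z zs.
apply: (@le_lt_trans _ _ (e / 2)); last by rewrite gtr_pMr // invf_lt1 // ltr1n.
by apply: (anaK_le (ltW s0) hs) => i; exact: ltW.
Qed.

Lemma expands_at_cst n (x : 'rV[C]_n) (b : C) : expands_at x (fun=> b).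
Proof. by apply/expands_atP; exists 1, `|b|; split=> //; exact: anaK_cst. Qed.

Lemma expands_at_coord n (x : 'rV[C]_n) i : expands_at x (fun z => z 0 i).
Proof. by apply/expands_atP; exists 1, (`|x 0 i| + 1); split=> //; exact: anaK_coord. Qed.

Lemma expands_atM n (x : 'rV[C]_n) h k :
  expands_at x h -> expands_at x k -> expands_at x (fun z => h z * k z).
Proof.
move=> /expands_atP[r [K [r0 hK]]] /expands_atP[s [L [s0 kL]]].
have [d [d0 dr ds]] := pos_min2 r0 s0.
apply/expands_atP; exists d, (K * L); split=> //; apply: anaKM => //.
  exact: anaK_mono (ltW d0) dr (lexx K) hK.
exact: anaK_mono (ltW d0) ds (lexx L) kL.
Qed.

Lemma expands_atD n (x : 'rV[C]_n) h k :
  expands_at x h -> expands_at x k -> expands_at x (fun z => h z + k z).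
Proof.
move=> /expands_atP[r [K [r0 hK]]] /expands_atP[s [L [s0 kL]]].
have [d [d0 dr ds]] := pos_min2 r0 s0.
apply/expands_atP; exists d, (K + L); split=> //; apply: anaKD => //.
  exact: anaK_mono (ltW d0) dr (lexx K) hK.
exact: anaK_mono (ltW d0) ds (lexx L) kL.
Qed.

Lemma expands_atX n (x : 'rV[C]_n) h m :
  expands_at x h -> expands_at x (fun z => h z ^+ m).
Proof.
move=> hx; elim: m => [|m IH].
  by under eq_fun do rewrite expr0; exact: expands_at_cst.
by under eq_fun do rewrite exprS; exact: expands_atM.
Qed.

Lemma expands_atN n (x : 'rV[C]_n) h : expands_at x h -> expands_at x (fun z => - h z).
Proof.
move=> hx; under eq_fun do rewrite -mulN1r.
by apply: expands_atM => //; exact: expands_at_cst.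
Qed.

End Analytic.

(** * Weighted limits *)

Lemma hsum_reindex (K : numFieldType) (I J : choiceType) (phi : I -> J)
    (psi : J -> I) (f : J -> K) s :
  cancel phi psi -> (forall j, phi (psi j) != j -> f j = 0) ->
  hsum f s -> hsum (f \o phi) s.
Proof.
move=> phiK f0 /hsumP fs; apply/hsumP => e e0; have [A AP] := fs e e0.
exists [fset psi j | j in A]%fset => B AB.
pose D := [fset phi i | i in B]%fset.
have -> : \sum_(i <- B) (f \o phi) i = \sum_(j <- (A `|` D)%fset) f j.
  transitivity (\sum_(j <- D) f j).
    by rewrite /D [RHS]big_imfset //= => i j _ _; exact: (can_inj phiK).
  apply: big_fset_incl; first exact: fsubsetUr.
  move=> j; rewrite inE => /orP[jA|-> //] jD; apply: f0; apply: contraNneq jD => <-.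
  apply/imfsetP; exists (psi j) => //; apply: (fsubsetP AB).
  by apply/imfsetP; exists j.
exact/AP/fsubsetUl.
Qed.

(** Strict inequalities survive a small increase of [u], by continuity. This leaves room for a
    positive radius in the direction of [u], even at [u = 0]. *)
Lemma enlarge_radius (K : numFieldType) n (w : 'I_n -> nat) (u : K) (v : 'I_n -> K)
    (r : K) : (forall i, `|u ^+ w i * v i| < r) ->
  exists2 e : K, 0 < e & forall i, `|(u + e / 2) ^+ w i * v i| < r.
Proof.
have FF : Filter (nbhs (0 : K)) by exact: nbhs_filter.
move=> ur; have near0 i : \forall e \near (0 : K), `|(u + e) ^+ w i * v i| < r.
  have cont : (fun e : K => (u + e) ^+ w i * v i) @ (0 : K) --> (u + 0) ^+ w i * v i.
    have c1 : (fun e : K => u + e) @ (0 : K) --> u + 0 by apply: cvgD; [exact: cvg_cst|exact: cvg_id].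
    have c2 k : (fun e : K => (u + e) ^+ k) @ (0 : K) --> (u + 0) ^+ k.
      elim: k => [|k IH]; first by under eq_fun do rewrite expr0; exact: cvg_cst.
      by under eq_fun do rewrite exprS; rewrite exprS; exact: cvgM.
    exact: cvgM (c2 _) (cvg_cst (v i)).
  by apply: (cvgr_norm_lt _ cont); rewrite addr0.
have : \forall e \near (0 : K), forall i, `|(u + e) ^+ w i * v i| < r.
  by have := @filter_forall _ _ _ (nbhs (0 : K)) FF near0.
move=> /nbhs_ballP[e /= e0 eP]; exists e => // i; apply: eP.
rewrite /ball /= sub0r normrN gtr0_norm ?divr_gt0 //.
by rewrite gtr_pMr // invf_lt1 // ltr1n.
Qed.

Definition wsc (K : numFieldType) n (w : n.-tuple nat) (u : K) (x : 'rV[K]_n) : 'rV[K]_n :=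
  \row_i (u ^+ tnth w i * x 0 i).

(** The limit s -> 0, with s non-zero, and x -> q independently of s: a point on a hypersurface has
    to move with s, so a limit at fixed x would not apply to it. *)
Definition wfilter (K : numFieldType) n (q : 'rV[K]_n) : set_system (K * 'rV[K]_n) :=
  fun P => exists2 e : K, 0 < e & forall (s : K) (x : 'rV[K]_n), s != 0 -> `|s| < e ->
    (forall i, `|x 0 i - q 0 i| < e) -> P (s, x).

Lemma pos_minK (K : numFieldType) (a b : K) : 0 < a -> 0 < b ->
  exists r : K, [/\ 0 < r, r <= a & r <= b].
Proof.
move=> a0 b0; have d0 : 0 < a + b by rewrite addr_gt0.
exists (a * b / (a + b)); split; first by rewrite divr_gt0 // mulr_gt0.
  by rewrite ler_pdivrMr // ler_pM2l // lerDr ltW.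
by rewrite ler_pdivrMr // mulrC ler_pM2l // lerDl ltW.
Qed.

#[global] Instance wfilter_proper (K : numFieldType) n (q : 'rV[K]_n) :
  ProperFilter (wfilter q).
Proof.
apply: Build_ProperFilter_ex.
  move=> P [e e0 eP]; exists (e / 2, q); apply: eP.
  - by rewrite gt_eqF // divr_gt0.
  - by rewrite gtr0_norm ?divr_gt0 // gtr_pMr // invf_lt1 // ltr1n.
  - by move=> i; rewrite subrr normr0.
split.
- by exists 1.
- move=> P Q [e e0 eP] [d d0 dP]; have [r [r0 re rd]] := pos_minK e0 d0.
  exists r => // s x s0 sr xr; split.
    by apply: eP => // [|i]; apply: lt_le_trans re.
  by apply: dP => // [|i]; apply: lt_le_trans rd.
- by move=> P Q PQ [e e0 eP]; exists e => // s x s0 sr xr; exact/PQ/eP.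
Qed.

(** [h] has weight at least [d], with weight [d] part [P]. *)
HB.lock Definition wlim (K : numFieldType) n (w : n.-tuple nat) (d : nat)
    (h P : 'rV[K]_n -> K) : Prop :=
  forall q, (fun sx : K * 'rV[K]_n => h (wsc w sx.1 sx.2) / sx.1 ^+ d) @ wfilter q --> P q.

Section WLim.
Context {K : numFieldType} {n : nat} (w : n.-tuple nat).
Implicit Types (h k P Q : 'rV[K]_n -> K).

Lemma wlimE d h P : wlim w d h P = forall q,
  (fun sx : K * 'rV[K]_n => h (wsc w sx.1 sx.2) / sx.1 ^+ d) @ wfilter q --> P q.
Proof. by rewrite unlock. Qed.

Lemma near_wfilter_neq0 (q : 'rV[K]_n) : \forall sx \near wfilter q, sx.1 != 0.
Proof. by exists 1. Qed.

Lemma wlim_unique d h P Q : wlim w d h P -> wlim w d h Q -> P = Q.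
Proof.
by rewrite !wlimE => hP hQ; apply/funext => q; exact: cvg_unique (hP q) (hQ q).
Qed.

Lemma wlimD d h k P Q : wlim w d h P -> wlim w d k Q ->
  wlim w d (fun x => h x + k x) (fun x => P x + Q x).
Proof.
rewrite !wlimE => hP kQ q; under eq_fun do rewrite mulrDl.
exact: cvgD (hP q) (kQ q).
Qed.

Lemma wlimM d e h k P Q : wlim w d h P -> wlim w e k Q ->
  wlim w (d + e) (fun x => h x * k x) (fun x => P x * Q x).
Proof.
rewrite !wlimE => hP kQ q; under eq_fun do rewrite exprD invfM mulrACA.
exact: cvgM (hP q) (kQ q).
Qed.

Lemma wlim_cst a : wlim w 0 (fun=> a : K) (fun=> a).
Proof.
by rewrite wlimE => q; under eq_fun do rewrite expr0 divr1; exact: cvg_cst.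
Qed.

Lemma wlim_coord i : wlim w (tnth w i) (fun x : 'rV[K]_n => x 0 i) (fun x => x 0 i).
Proof.
rewrite wlimE => q; apply/cvgrPdistC_lt => e e0; exists e => // s x s0 _ xq.
by rewrite /= mxE mulrC mulKf // expf_neq0.
Qed.

Lemma wlimZ d a h P : wlim w d h P -> wlim w d (fun x => a * h x) (fun x => a * P x).
Proof. by move=> hP; have := wlimM (wlim_cst a) hP; rewrite add0n. Qed.

Lemma wlimX d h P m : wlim w d h P -> wlim w (d * m) (fun x => h x ^+ m) (fun x => P x ^+ m).
Proof.
move=> hP; elim: m => [|m IH].
  rewrite muln0; have := wlim_cst 1; congr (wlim _ _ _ _); apply/funext => x; by rewrite expr0.
rewrite mulnS; have := wlimM hP IH; congr (wlim _ _ _ _); apply/funext => x; by rewrite exprS.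
Qed.

Lemma wlim_lower d e h P : (e < d)%N -> wlim w d h P -> wlim w e h (fun=> 0).
Proof.
rewrite !wlimE => ed hP q.
have c0 : (fun sx : K * 'rV[K]_n => sx.1 ^+ (d - e)) @ wfilter q --> (0 : K).
  apply/cvgrPdistC_lt => r r0; have [t [t0 tr t1]] := pos_minK r0 ltr01.
  exists t => // s x s0 st _; rewrite /= subr0 normrX.
  apply: le_lt_trans (lt_le_trans st tr).
  have : (0 < d - e)%N by rewrite subn_gt0.
  case: (d - e)%N => // m _; rewrite exprS ger_pMr ?normr_gt0 // exprn_ile1 //.
  exact: ltW (lt_le_trans st t1).
rewrite -[X in _ --> X](mulr0 (P q)).
apply: cvg_trans (cvgM (hP q) c0); apply: near_eq_cvg.
exists 1 => // s x s0 _ _ /=.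
rewrite -mulrA; congr (_ * _); rewrite -[in X in X^-1 * _](subnK (ltnW ed)) exprD invfM.
by rewrite mulrAC mulVf ?mul1r // expf_neq0.
Qed.

Lemma near_wsc (q : 'rV[K]_n) : (forall i, 0 < tnth w i)%N -> forall e : K, 0 < e ->
  \forall sx \near wfilter q, forall i, `|wsc w sx.1 sx.2 0 i| < e.
Proof.
move=> w0 e e0.
have [B B0 Bq] : exists2 B : K, 0 < B & forall i, `|q 0 i| <= B.
  exists (1 + \sum_i `|q 0 i|); first by rewrite ltr_pwDl // sumr_ge0.
  move=> i; rewrite (bigD1 i) //= addrCA lerDl addr_ge0 // sumr_ge0 //.
have B1 : 0 < B + 1 by rewrite addr_gt0.
have [t [t0 te t1]] := pos_minK (divr_gt0 e0 B1) ltr01.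
exists t => // s x s0 st xq i; rewrite mxE normrM normrX.
have xB : `|x 0 i| < B + 1.
  rewrite -[x 0 i](subrK (q 0 i)) addrC (le_lt_trans (ler_normD _ _)) //.
  by rewrite ler_ltD // (lt_le_trans (xq i)).
have sw : `|s| ^+ tnth w i < e / (B + 1).
  apply: lt_le_trans te; apply: le_lt_trans (st).
  move: (w0 i); case: (tnth w i) => // m _; rewrite exprS ger_pMr ?normr_gt0 //.
  by rewrite exprn_ile1 // ltW // (lt_le_trans st).
apply: (@le_lt_trans _ _ (`|s| ^+ tnth w i * (B + 1))).
  by rewrite ler_wpM2l ?exprn_ge0 // ltW.
by rewrite -ltr_pdivlMr.
Qed.

Lemma wlim_near d h k P : (forall i, 0 < tnth w i)%N ->
  (exists2 e : K, 0 < e & forall z : 'rV[K]_n, (forall i, `|z 0 i| < e) -> h z = k z) ->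
  wlim w d h P -> wlim w d k P.
Proof.
rewrite !wlimE => w0 [e e0 hk] hP q; apply: cvg_trans (hP q).
apply: near_eq_cvg; have := near_wsc q w0 e0; apply: filterS => sx sxe.
by rewrite hk.
Qed.

End WLim.

(** [h] at [s^w x] is [s^v] times a point that tends to [H q]; the limit for [g] allows exactly such
    a moving point. *)
Lemma wlim_comp (K : numFieldType) n m (w : n.-tuple nat) (v : m.-tuple nat) d
    (g G : 'rV[K]_m -> K) (h H : 'rV[K]_n -> 'rV[K]_m) :
  wlim v d g G ->
  (forall i, wlim w (tnth v i) (fun x => h x 0 i) (fun x => H x 0 i)) ->
  wlim w d (g \o h) (G \o H).
Proof.
rewrite wlimE => gG hH; rewrite wlimE => q.
apply/cvgrPdistC_lt => e e0.
have [r r0 rP] := (cvgrPdistC_lt _ _).1 (gG (H q)) _ e0.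
have nh : \forall sx \near wfilter q, forall i,
    `|h (wsc w sx.1 sx.2) 0 i / sx.1 ^+ tnth v i - H q 0 i| < r.
  apply: filter_forall => i; have := hH i; rewrite wlimE => /(_ q).
  by move=> /cvgrPdistC_lt /(_ _ r0).
have ns : \forall sx \near wfilter q, `|sx.1| < r by exists r.
have n0 := near_wfilter_neq0 q.
near=> sx.
have sx0 : sx.1 != 0 by near: sx.
have sxr : `|sx.1| < r by near: sx.
have sxh : forall i, `|h (wsc w sx.1 sx.2) 0 i / sx.1 ^+ tnth v i - H q 0 i| < r by near: sx.
have := rP sx.1 (\row_i (h (wsc w sx.1 sx.2) 0 i / sx.1 ^+ tnth v i)) sx0 sxr.
rewrite /= (_ : wsc v _ _ = h (wsc w sx.1 sx.2)).
  by apply=> i; rewrite mxE.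
by apply/rowP => i; rewrite !mxE mulrC divfK // expf_neq0.
Unshelve. all: by end_near. Qed.

(** * Weights of power series and their lifts to the weighted blowup *)

Section Weights.
Context {R : realType}.
Local Notation C := (cplx R).

Lemma monomial_wsc n (w : n.-tuple nat) a (u : C) (x : 'rV[C]_n) :
  monomial a (wsc w u x) = u ^+ mon_wt w a * monomial a x.
Proof.
rewrite /monomial /mon_wt expr_sum -big_split /=; apply: eq_bigr => i _.
by rewrite mxE exprMn exprM.
Qed.

Definition mcons n (k : nat) (a : {ffun 'I_n -> nat}) : {ffun 'I_n.+1 -> nat} :=
  [ffun i => if unlift ord0 i is Some j then a j else k].

Definition mtail n (b : {ffun 'I_n.+1 -> nat}) : {ffun 'I_n -> nat} :=
  [ffun i => b (lift ord0 i)].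

Lemma mtailK n k (a : {ffun 'I_n -> nat}) : mtail (mcons k a) = a.
Proof. by apply/ffunP => i; rewrite !ffunE liftK. Qed.

Lemma mcons0 n k (a : {ffun 'I_n -> nat}) : mcons k a ord0 = k.
Proof. by rewrite ffunE unlift_none. Qed.

Lemma mconsS n k (a : {ffun 'I_n -> nat}) i : mcons k a (lift ord0 i) = a i.
Proof. by rewrite ffunE liftK. Qed.

Lemma mconsK n (b : {ffun 'I_n.+1 -> nat}) : mcons (b ord0) (mtail b) = b.
Proof. by apply/ffunP => i; rewrite ffunE; case: unliftP => [j|] ->; rewrite ?ffunE. Qed.

(** The coefficients of [u^-d f(u^w x)]. *)
Definition liftc n (w : n.-tuple nat) (d : nat) (c : pwseries R n) : pwseries R n.+1 :=
  fun b => if mon_wt w (mtail b) == (b ord0 + d)%N then c (mtail b) else 0.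

Definition liftf n (w : n.-tuple nat) (d : nat) (c : pwseries R n)
    (p : 'rV[C]_n.+1) : C := psval (liftc w d c) p.

Definition xpart n (p : 'rV[C]_n.+1) : 'rV[C]_n := \row_i p 0 (lift ord0 i).

Definition pcons n (u : C) (x : 'rV[C]_n) : 'rV[C]_n.+1 :=
  \row_i (if unlift ord0 i is Some j then x 0 j else u).

Lemma pcons0 n u (x : 'rV[C]_n) : pcons u x 0 ord0 = u.
Proof. by rewrite mxE unlift_none. Qed.

Lemma pconsS n u (x : 'rV[C]_n) i : pcons u x 0 (lift ord0 i) = x 0 i.
Proof. by rewrite mxE liftK. Qed.

Lemma xpartK n u (x : 'rV[C]_n) : xpart (pcons u x) = x.
Proof. by apply/rowP => i; rewrite mxE pconsS. Qed.

Lemma pconsK n (p : 'rV[C]_n.+1) : pcons (p 0 ord0) (xpart p) = p.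
Proof.
by apply/rowP => i; rewrite mxE; case: unliftP => [j|] ->; rewrite ?mxE.
Qed.

Definition lift_dom n (w : n.-tuple nat) (r : C) (p : 'rV[C]_n.+1) : Prop :=
  forall i, `|p 0 ord0| ^+ tnth w i * `|p 0 (lift ord0 i)| < r.

(** The radius for u is slightly larger than |u|, and the one for x_i is [r] divided by its w_i-th
    power; each term of a lift is then controlled by a term of the original series at radius [r]. *)
Lemma lift_radius n (w : n.-tuple nat) (r : C) (p : 'rV[C]_n.+1) : 0 < r ->
  lift_dom w r p -> exists s : 'I_n.+1 -> C, [/\ forall j, 0 < s j,
    forall j, `|p 0 j| < s j & forall i, s ord0 ^+ tnth w i * s (lift ord0 i) <= r].
Proof.
move=> r0 pr; set u := `|p 0 ord0|.
have [|e e0 eP] := @enlarge_radius C n (tnth w) u (fun i => `|p 0 (lift ord0 i)|) r.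
  move=> i; rewrite ger0_norm; last by rewrite mulr_ge0 // exprn_ge0 // normr_ge0.
  exact: pr.
pose s0 := u + e / 2.
have s00 : 0 < s0 by rewrite ltr_wpDl ?divr_gt0 // normr_ge0.
have sp i : s0 ^+ tnth w i * `|p 0 (lift ord0 i)| < r.
  apply: le_lt_trans (eP i); rewrite [leRHS]ger0_norm //.
  by apply: mulr_ge0; [apply/exprn_ge0/ltW|exact: normr_ge0].
exists (fun j => if unlift ord0 j is Some i then r / s0 ^+ tnth w i else s0); split.
- by move=> j; case: unliftP => [i|] _ //; rewrite divr_gt0 // exprn_gt0.
- move=> j; case: unliftP => [i|] -> //.
    by rewrite ltr_pdivlMr ?exprn_gt0 // mulrC.
  by rewrite -/u ltrDl divr_gt0.
by move=> i; rewrite unlift_none liftK mulrC divfK // gt_eqF // exprn_gt0.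
Qed.

(** A monomial of the lift carries u to the power weight minus [d], so the factor [s ord0 ^+ d]
    completes it to a product of powers of the [s ord0 ^+ w_i * s_i], which are at most [r]. *)
Lemma liftc_bound n (w : n.-tuple nat) d (r M : C) (c : pwseries R n)
    (s : 'I_n.+1 -> C) :
  (forall a, `|c a| * r ^+ (\sum_i a i)%N <= M) -> 0 < r -> (forall j, 0 < s j) ->
  (forall i, s ord0 ^+ tnth w i * s (lift ord0 i) <= r) ->
  forall b, `|liftc w d c b| * \prod_j s j ^+ b j <= M / s ord0 ^+ d.
Proof.
move=> cM r0 s0 sr b; rewrite /liftc.
have M0 : 0 <= M by apply: le_trans (cM [ffun=> 0%N]); rewrite mulr_ge0 // exprn_ge0 // ltW.
case: eqP => [wb|_]; last by rewrite normr0 mul0r divr_ge0 // exprn_ge0 // ltW.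
rewrite ler_pdivlMr ?exprn_gt0 //; apply: le_trans (cM (mtail b)).
rewrite -mulrA ler_wpM2l // big_ord_recl /= mulrAC -exprD -wb /mon_wt.
rewrite !expr_sum -big_split /=; apply: ler_prod => i _; rewrite ffunE.
rewrite exprM -exprMn; apply/andP; split.
  by rewrite exprn_ge0 // mulr_ge0 ?exprn_ge0 // ltW.
by rewrite lerXn2r ?nnegrE ?mulr_ge0 ?exprn_ge0 ?sr // ltW.
Qed.

Lemma liftf_expands n (w : n.-tuple nat) d (r : C) (c : pwseries R n) p :
  cauchy_bound r c -> 0 < r -> lift_dom w r p -> expands_at p (liftf w d c).
Proof.
move=> [M cM] r0 pr; have [s [s0 ps sr]] := lift_radius r0 pr.
by apply/expands_atP; exact: psval_anaK (liftc_bound d cM r0 s0 sr) ps.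
Qed.

Lemma monomial_mcons n k (a : {ffun 'I_n -> nat}) (p : 'rV[C]_n.+1) :
  monomial (mcons k a) p = p 0 ord0 ^+ k * monomial a (xpart p).
Proof.
rewrite /monomial big_ord_recl mcons0; congr (_ * _).
by apply: eq_bigr => i _; rewrite mconsS mxE.
Qed.

Lemma liftf_hsum n (w : n.-tuple nat) d (r : C) (c : pwseries R n) p :
  wt_ge w c d -> cauchy_bound r c -> 0 < r -> lift_dom w r p ->
  hsum (fun a => c a * (p 0 ord0 ^+ (mon_wt w a - d) * monomial a (xpart p)))
    (liftf w d c p).
Proof.
move=> cd [M cM] r0 pr; have [s [s0 ps sr]] := lift_radius r0 pr.
have := psval_hsum (liftc_bound d cM r0 s0 sr) ps.
have z0 b : mcons (mon_wt w (mtail b) - d) (mtail b) != b ->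
    liftc w d c b * monomial b p = 0.
  rewrite /liftc; case: (eqVneq (mon_wt w (mtail b)) (b ord0 + d)%N) => [->|_ _].
    by rewrite addnK mconsK eqxx.
  by rewrite mul0r.
move=> /(@hsum_reindex _ _ _ (fun a => mcons (mon_wt w a - d) a) (@mtail n) _ _
  (fun a => mtailK _ a) z0).
congr (hsum _ _); apply/funext => a /=; rewrite /liftc mtailK mcons0 monomial_mcons.
have [->|/cd da] := eqVneq (c a) 0; first by rewrite if_same !mul0r.
by rewrite subnK // eqxx.
Qed.

Lemma liftfE n (w : n.-tuple nat) d (r : C) (c : pwseries R n) p :
  wt_ge w c d -> cauchy_bound r c -> 0 < r -> lift_dom w r p ->
  p 0 ord0 ^+ d * liftf w d c p = psval c (wsc w (p 0 ord0) (xpart p)).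
Proof.
move=> cd cr r0 pr; have := hsumZ (p 0 ord0 ^+ d) (liftf_hsum cd cr r0 pr).
move=> h; apply/esym/hsum_psval; move: h; congr (hsum _ _); apply/funext => a.
rewrite monomial_wsc mulrCA; have [->|/cd da] := eqVneq (c a) 0; first by rewrite !mul0r.
by congr (_ * _); rewrite mulrA -exprD subnKC.
Qed.

Lemma liftf0 n (w : n.-tuple nat) d (r : C) (c : pwseries R n) x :
  (forall i, 0 < tnth w i)%N ->
  wt_ge w c d -> cauchy_bound r c -> 0 < r ->
  liftf w d c (pcons 0 x) = psval (wt_part w d c) x.
Proof.
move=> w0 cd cr r0; have pr : lift_dom w r (pcons 0 x).
  by move=> i; rewrite pcons0 normr0 expr0n gtn_eqF // mul0r.
have := liftf_hsum cd cr r0 pr => h; apply/esym/hsum_psval; move: h.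
congr (hsum _ _); apply/funext => a; rewrite pcons0 xpartK /wt_part.
have [->|/cd da] := eqVneq (c a) 0; first by rewrite if_same !mul0r.
rewrite expr0n subn_eq0 eqn_leq da andbT.
by case: leqP; rewrite ?mul1r // !mul0r mulr0.
Qed.

Lemma lift_dom0 n (w : n.-tuple nat) (r : C) x :
  (forall i, 0 < tnth w i)%N -> 0 < r -> lift_dom w r (pcons 0 x).
Proof. by move=> w0 r0 i; rewrite pcons0 normr0 expr0n gtn_eqF // mul0r. Qed.

Lemma wact_E n (w : n.-tuple nat) (l : C) (p : 'rV[C]_n.+1) :
  wact w l p = pcons (l^-1 * p 0 ord0) (wsc w l (xpart p)).
Proof.
by apply/rowP => i; rewrite !mxE; case: unliftP => [j|] -> //; rewrite !mxE.
Qed.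

Lemma wsc_wact n (w : n.-tuple nat) (l : C) (p : 'rV[C]_n.+1) : l != 0 ->
  wsc w (wact w l p 0 ord0) (xpart (wact w l p)) = wsc w (p 0 ord0) (xpart p).
Proof.
move=> l0; rewrite wact_E pcons0 xpartK; apply/rowP => i; rewrite !mxE.
by rewrite mulrA -exprMn mulrAC mulVf // mul1r.
Qed.

Lemma lift_domE n (w : n.-tuple nat) (r : C) p :
  lift_dom w r p <-> polydisc r (wsc w (p 0 ord0) (xpart p)).
Proof.
by split=> h i; have := h i; rewrite !mxE normrM normrX.
Qed.

(** Homogeneity of degree [d] under the action is what lets lifted maps descend to the quotient. *)
Lemma liftf_wact n (w : n.-tuple nat) d (r : C) (c : pwseries R n) p l :
  l != 0 -> wt_ge w c d -> cauchy_bound r c -> 0 < r -> lift_dom w r p ->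
  liftf w d c (wact w l p) = l ^+ d * liftf w d c p.
Proof.
move=> l0 cd cr r0 pr.
have pr' : lift_dom w r (wact w l p) by apply/lift_domE; rewrite wsc_wact //; apply/lift_domE.
apply: hsum_unique (liftf_hsum cd cr r0 pr') _.
have := hsumZ (l ^+ d) (liftf_hsum cd cr r0 pr).
congr (hsum _ _); apply/funext => a; have [->|/cd da] := eqVneq (c a) 0.
  by rewrite !mul0r mulr0.
rewrite wact_E pcons0 xpartK monomial_wsc mulrCA; congr (_ * _).
rewrite exprMn !mulrA; congr (_ * _); rewrite mulrAC; congr (_ * _).
rewrite -[in X in _ * X](subnK da) exprD mulrA -exprMn mulVf // expr1n mul1r //.
Qed.

Definition series_at n (h : 'rV[C]_n -> C) (c : pwseries R n) : Prop :=
  convergent c /\ exists2 e : C, 0 < e &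
    forall z : 'rV[C]_n, (forall i, `|z 0 i| < e) -> h z = psval c z.

Lemma expands_at0 n (h : 'rV[C]_n -> C) : expands_at 0 h <-> exists c, series_at h c.
Proof.
split=> [[c cc /near_rowP[e e0 hc]]|[c [cc [e e0 hc]]]]; exists c => //.
  by split=> //; exists e => // z ze; rewrite hc ?subr0 // => i; rewrite mxE subr0.
apply/near_rowP; exists e => // z ze; rewrite subr0 hc // => i.
by have := ze i; rewrite mxE subr0.
Qed.

(** The quotient in the limit is the lift evaluated at (s, x). The lift is continuous at (0, q), and
    its value there is the weight [d] part at [q]. *)
Lemma wlim_series n (w : n.-tuple nat) d (c : pwseries R n) (r : C) :
  (forall i, 0 < tnth w i)%N -> 0 < r -> cauchy_bound r c -> wt_ge w c d ->
  wlim w d (psval c) (psval (wt_part w d c)).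
Proof.
move=> w0 r0 cr cd; rewrite wlimE => q; apply/cvgrPdistC_lt => e e0.
have Lc := expands_at_continuous (liftf_expands d cr r0 (lift_dom0 q w0 r0)).
have FF : Filter (nbhs (pcons (0 : C) q)) by exact: nbhs_filter.
have := (@cvgrPdistC_lt _ C _ _ FF _ _).1 Lc e e0.
move=> /near_rowP[t t0 tP].
have [[s0 s00 sP] [t' t'0 tP']] : (\forall sx \near wfilter q, forall i, `|wsc w sx.1 sx.2 0 i| < r) /\ wfilter q setT.
  by split; [exact: near_wsc|exact: filterT].
have [u [u0 us ut]] := pos_min2 s00 t0.
exists u => // s x sn0 su xq /=.
have pr : lift_dom w r (pcons s x).
  apply/lift_domE; rewrite pcons0 xpartK; apply: (sP s x) => // [|i].
    exact: lt_le_trans us.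
  exact: lt_le_trans us.
have := liftfE cd cr r0 pr; rewrite pcons0 xpartK => <-.
rewrite mulrC mulKf ?expf_neq0 // -(liftf0 q w0 cd cr r0).
apply: tP => i; rewrite !mxE; case: unliftP => [j|] _.
  by apply: lt_le_trans ut.
by rewrite subr0; apply: lt_le_trans ut.
Qed.

Lemma series_wlim n (w : n.-tuple nat) d h (c : pwseries R n) :
  (forall i, 0 < tnth w i)%N -> series_at h c -> wt_ge w c d ->
  wlim w d h (psval (wt_part w d c)).
Proof.
move=> w0 [[r r0 cr] [e e0 hc]] cd.
apply: wlim_near w0 _ (wlim_series w0 r0 cr cd).
by exists e => // z ze; rewrite hc.
Qed.

Lemma wt_min n (w : n.-tuple nat) (c : pwseries R n) : (exists a, c a != 0) ->
  exists e, wt_ge w c e /\ exists2 a, c a != 0 & mon_wt w a = e.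
Proof.
move=> [a0 ca0].
have ex : exists m, `[< exists2 a, c a != 0 & mon_wt w a = m >].
  by exists (mon_wt w a0); apply/asboolP; exists a0.
have [m /asboolP[a ca am] min] := ex_minnP ex.
exists m; split; last by exists a.
by move=> b cb; apply: min; apply/asboolP; exists b.
Qed.

Lemma wt_geN n (w : n.-tuple nat) (c : pwseries R n) d : ~ wt_ge w c d ->
  exists e, [/\ (e < d)%N, wt_ge w c e & exists2 a, c a != 0 & mon_wt w a = e].
Proof.
move=> cd; have [|e [ce [a ca ae]]] := @wt_min n w c.
  apply: contrapT => h; apply: cd => a ca; exfalso; apply: h; by exists a.
exists e; split=> //; last by exists a.
rewrite ltnNge; apply/negP => de; apply: cd => b cb.
exact: leq_trans (ce b cb).
Qed.

Lemma base_inj N (f g : nat -> nat) m :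
  (forall i, f i < N)%N -> (forall i, g i < N)%N ->
  (\sum_(i < m) f i * N ^ i = \sum_(i < m) g i * N ^ i)%N ->
  forall i, (i < m)%N -> f i = g i.
Proof.
elim: m f g => // m IH f g fN gN.
rewrite !big_ord_recl !expn0 !muln1.
have E (h : nat -> nat) : (\sum_(i < m) h (lift ord0 i) * N ^ lift ord0 i =
    N * \sum_(i < m) h i.+1 * N ^ i)%N.
  by rewrite big_distrr /=; apply: eq_bigr => i _; rewrite /bump /= expnS mulnCA.
rewrite !E => fg; have N0 : (0 < N)%N := leq_ltn_trans (leq0n _) (fN 0%N).
have fg0 : f 0%N = g 0%N.
  by move: (congr1 (modn^~ N) fg); rewrite ![(N * _)%N]mulnC ![(_ + _ * N)%N]addnC !modnMDl !modn_small.
case=> // i im; apply: (IH (f \o S) (g \o S)) => //=.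
move: fg; rewrite fg0 => /addnI /eqP; rewrite eqn_pmul2l // => /eqP; exact.
Qed.

(** The weights [M + N ^ i] compare total degrees first and then exponents as digits in base [N], so
    that no two monomials of the least degree [D] have the same weight. *)
Lemma generic_weights n (c : pwseries R n) : (exists a, c a != 0) ->
  exists (w : n.-tuple nat) a, [/\ forall i, (0 < tnth w i)%N, c a != 0 &
    forall b, c b != 0 -> b != a -> (mon_wt w a < mon_wt w b)%N].
Proof.
move=> /(@wt_min _ [tuple of nseq n 1%N])[D [cD [a0 ca0 a0D]]].
have dE (a : {ffun 'I_n -> nat}) : mon_wt [tuple of nseq n 1%N] a = (\sum_i a i)%N.
  by apply: eq_bigr => i _; rewrite (tnth_nth 0%N) nth_nseq ltn_ord mul1n.
(* [N] exceeds every exponent occurring in degree [D], and [M] exceeds every number with such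
   digits. *)
pose N := D.+1; pose M := (D * N ^ n).+1.
pose w : n.-tuple nat := [tuple (M + N ^ i)%N | i < n].
have wE (a : {ffun 'I_n -> nat}) : mon_wt w a = (M * \sum_i a i + \sum_i a i * N ^ i)%N.
  rewrite big_distrr -big_split /=; apply: eq_bigr => i _.
  by rewrite tnth_mktuple mulnDl [(_ * a i)%N in X in (_ + X)%N]mulnC.
have [e [ce [a ca ae]]] := wt_min w (ex_intro _ a0 ca0).
have sumN (b : {ffun 'I_n -> nat}) : (\sum_i b i = D)%N -> (\sum_i b i * N ^ i <= D * N ^ n)%N.
  move=> <-; rewrite big_distrl /=; apply: leq_sum => i _.
  by rewrite leq_mul2l leq_pexp2l ?orbT // ltnW.
have degD b : c b != 0 -> (mon_wt w b <= mon_wt w a)%N -> (\sum_i b i = D)%N.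
  move=> cb ba; apply/eqP; rewrite eqn_leq -[X in _ && (D <= X)%N]dE cD // andbT.
  rewrite -ltnS ltnNge; apply/negP => Db.
  have : (mon_wt w b <= mon_wt w a0)%N by rewrite (leq_trans ba) // ae ce.
  rewrite !wE; apply/negP; rewrite -ltnNge.
  apply: (@leq_trans (M * D.+1)); last by apply: leq_trans (leq_addr _ _); rewrite leq_mul2l Db orbT.
  by rewrite mulnS addnC -dE a0D ltn_add2r ltnS; apply: sumN; rewrite -dE.
exists w, a; split=> //.
  by move=> i; rewrite tnth_mktuple addn_gt0.
move=> b cb ba; rewrite ltnNge; apply/negP => wba.
have wab : mon_wt w b = mon_wt w a by apply/eqP; rewrite eqn_leq wba ae ce.
have bD := degD b cb wba; have aD := degD a ca (leqnn _).
move: wab; rewrite !wE bD aD => /addnI Eab; case/negP: ba; apply/eqP/ffunP => i.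
pose f (d : {ffun 'I_n -> nat}) (k : nat) := if insub k is Some j then d j else 0%N.
have fE d (j : 'I_n) : f d j = d j by rewrite /f valK.
have fN (d : {ffun 'I_n -> nat}) : (\sum_i d i = D)%N -> forall k, (f d k < N)%N.
  move=> dD k; rewrite /f; case: insubP => // j _ _.
  by rewrite ltnS -dD (bigD1 j) //= leq_addr.
rewrite -(fE b) -(fE a); apply: (@base_inj N (f b) (f a) n) => //; [exact: fN|exact: fN|].
by transitivity (\sum_i b i * N ^ i)%N; [|rewrite Eab]; apply: eq_bigr => j _; rewrite fE.
Qed.

(** Identity theorem: for generic weights the leading form of a non-zero series is a single
    monomial, which does not vanish at (1, ..., 1). *)
Lemma series0 n (c : pwseries R n) : convergent c ->
  (exists2 e : C, 0 < e & forall z : 'rV[C]_n, (forall i, `|z 0 i| < e) -> psval c z = 0) ->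
  forall a, c a = 0.
Proof.
move=> cc c0 a1; apply/eqP; apply: contrapT => /negP ca1.
have [w [a [w0 ca min]]] := generic_weights (ex_intro _ a1 ca1).
have sc : series_at (fun=> 0) c.
  by split=> //; case: c0 => e e0 c0; exists e => // z /c0.
have ca' : wt_ge w c (mon_wt w a).
  by move=> b cb; have [->//|ba] := eqVneq b a; rewrite ltnW // min.
have h := series_wlim w0 sc ca'.
have z : wlim w (mon_wt w a) (fun=> 0 : C) (fun=> 0).
  by rewrite wlimE => q; under eq_fun do rewrite mul0r; exact: cvg_cst.
have /(congr1 (@^~ (const_mx 1))) := wlim_unique h z.
rewrite (@hsum_psval _ _ _ _ (c a)) => [/eqP|]; first by rewrite (negbTE ca).
have := @hsum1 _ _ (fun b => wt_part w (mon_wt w a) c b * monomial b (const_mx 1 : 'rV[C]_n)) a.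
rewrite /wt_part eqxx (_ : monomial a _ = 1) ?mulr1; last first.
  by rewrite /monomial big1 // => i _; rewrite mxE expr1n.
apply=> b ba; case: eqP => [wb|_]; last by rewrite mul0r.
have [->|cb] := eqVneq (c b) 0; first by rewrite mul0r.
by have := min b cb ba; rewrite wb ltnn.
Qed.

Lemma wt_part_bound n (w : n.-tuple nat) d (c : pwseries R n) r :
  0 < r -> cauchy_bound r c -> cauchy_bound r (wt_part w d c).
Proof.
move=> r0 [M cM]; exists M => a; rewrite /wt_part; case: ifP => _; first exact: cM.
by rewrite normr0 mul0r; apply: le_trans (cM a); rewrite mulr_ge0 // exprn_ge0 // ltW.
Qed.

Lemma wt_part_neq0 n (w : n.-tuple nat) d (c : pwseries R n) a :
  convergent c -> c a != 0 -> mon_wt w a = d -> exists q, psval (wt_part w d c) q != 0.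
Proof.
move=> [r r0 cr] ca ad; apply: contrapT => h; move: ca.
have /(_ a) : forall b, wt_part w d c b = 0.
  apply: series0; first by exists r => //; exact: wt_part_bound.
  exists 1 => // z _; apply/eqP; apply: contrapT => /negP hz; apply: h; by exists z.
by rewrite /wt_part ad eqxx => ->; rewrite eqxx.
Qed.

(** Being polynomial on every line is the property of leading forms that the proof relies on: it is
    stable under sums, products and linear substitutions, and it implies the domain property. *)
Definition polyline n (F : 'rV[C]_n -> C) : Prop :=
  forall p q : 'rV[C]_n, exists P : {poly C}, forall l : C, F (p + l *: q) = P.[l].

Lemma polyline_cst n (a : C) : polyline (fun _ : 'rV[C]_n => a).
Proof. by move=> p q; exists a%:P => l; rewrite hornerC. Qed.

Lemma polyline_coord n i : polyline (fun x : 'rV[C]_n => x 0 i).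
Proof.
move=> p q; exists ((p 0 i)%:P + (q 0 i)%:P * 'X) => l.
by rewrite !mxE !hornerE mulrC.
Qed.

Lemma polylineD n (F G : 'rV[C]_n -> C) :
  polyline F -> polyline G -> polyline (fun x => F x + G x).
Proof.
move=> hF hG p q; have [P hP] := hF p q; have [Q hQ] := hG p q.
by exists (P + Q) => l; rewrite hornerD hP hQ.
Qed.

Lemma polylineM n (F G : 'rV[C]_n -> C) :
  polyline F -> polyline G -> polyline (fun x => F x * G x).
Proof.
move=> hF hG p q; have [P hP] := hF p q; have [Q hQ] := hG p q.
by exists (P * Q) => l; rewrite hornerM hP hQ.
Qed.

Lemma polylineN n (F : 'rV[C]_n -> C) : polyline F -> polyline (fun x => - F x).
Proof. by move=> hF p q; have [P hP] := hF p q; exists (- P) => l; rewrite hornerN hP. Qed.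

Lemma polylineX n (F : 'rV[C]_n -> C) m : polyline F -> polyline (fun x => F x ^+ m).
Proof. by move=> hF p q; have [P hP] := hF p q; exists (P ^+ m) => l; rewrite horner_exp hP. Qed.

(** Positive weights bound every exponent by [d], so the weight [d] part is a finite sum. *)
Lemma polyline_wt_part n (w : n.-tuple nat) d (c : pwseries R n) :
  (forall i, 0 < tnth w i)%N -> polyline (psval (wt_part w d c)).
Proof.
move=> w0.
have fin x : psval (wt_part w d c) x = \sum_(a <- cube n d.+1) wt_part w d c a * monomial a x.
  apply: hsum_psval; apply: hsum_fset => a aN; rewrite /wt_part; case: eqP => [ad|_].
    case/negP: aN; apply: mem_cube => i; rewrite ltnS -ad /mon_wt (bigD1 i) //=.
    by apply: leq_trans (leq_addr _ _); rewrite leq_pmull.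
  by rewrite mul0r.
move=> p q; have hm (a : {ffun 'I_n -> nat}) : polyline (monomial a).
  rewrite /monomial => p' q'.
  have hP i := polylineX (a i) (polyline_coord i) p' q'.
  have [P hP'] := choice hP.
  by exists (\prod_i P i) => l; rewrite horner_prod; apply: eq_bigr => i _; exact: hP'.
have [P hP] := choice (fun a => polylineM (polyline_cst (wt_part w d c a)) (hm a) p q).
by exists (\sum_(a <- cube n d.+1) P a) => l; rewrite fin horner_sum; apply: eq_bigr => a _.
Qed.

Lemma poly_all_roots (P : {poly C}) : (forall l : C, P.[l] = 0) -> P = 0.
Proof.
move=> P0; apply/eqP; apply: contrapT => /negP Pn0.
have := @max_poly_roots _ P [seq k%:R | k <- iota 0 (size P)] Pn0.
rewrite size_map size_iota ltnn => h; suff: false by []; apply: h.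
  by apply/allP => x _; rewrite /root P0 eqxx.
by rewrite map_inj_uniq ?iota_uniq // => i j /eqP; rewrite eqr_nat => /eqP.
Qed.

(** On the line through a non-zero of [F] and a non-zero of [G], both would be non-zero polynomials
    in one variable. *)
Lemma polyline_domain n (F G : 'rV[C]_n -> C) : polyline F -> polyline G ->
  (forall x, F x * G x = 0) -> (forall x, F x = 0) \/ (forall x, G x = 0).
Proof.
move=> hF hG FG; apply: contrapT => /not_orP[/existsNP[p Fp] /existsNP[q Gq]].
have [P hP] := hF p (q - p); have [Q hQ] := hG p (q - p).
have : P * Q = 0 by apply: poly_all_roots => l; rewrite hornerM -hP -hQ FG.
move=> /eqP; rewrite mulf_eq0 => /orP[] /eqP E.
  by apply: Fp; have := hP 0; rewrite scale0r addr0 E horner0.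
by apply: Gq; have := hQ 1; rewrite scale1r addrC subrK E horner0.
Qed.

End Weights.

(** * Local isomorphisms and analytification *)

Section Morphisms.
Context {R : realType}.
Implicit Types X Y Z W : fspace R.

Definition morph_at X Y (f : X -> Y) (x : X) : Prop :=
  {for x, continuous f} /\ forall h, reg Y (f x) h -> reg X x (h \o f).

Lemma is_morphismP X Y (f : X -> Y) : is_morphism f <-> forall x, morph_at f x.
Proof.
split=> [[cf rf] x|fx]; first by split; [exact: cf|exact: rf].
by split=> [x|x h]; [exact: (fx x).1|exact: (fx x).2].
Qed.

Lemma morph_at_comp X Y Z (f : X -> Y) (g : Y -> Z) x :
  morph_at f x -> morph_at g (f x) -> morph_at (g \o f) x.
Proof.
move=> [cf rf] [cg rg]; split; first exact: continuous_comp.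
by move=> h hx; exact: (rf _ (rg _ hx)).
Qed.

Lemma is_morphism_comp X Y Z (f : X -> Y) (g : Y -> Z) :
  is_morphism f -> is_morphism g -> is_morphism (g \o f).
Proof.
by move=> /is_morphismP hf /is_morphismP hg; apply/is_morphismP => x; exact: morph_at_comp.
Qed.

Lemma set_val_morphism X (A : set X) : is_morphism (set_val : sub_space A -> X).
Proof.
split; first exact: initial_continuous.
by move=> x h hx; exists h => //; exact: filterE.
Qed.

Lemma morph_at_sub X Z (A : set X) (h : Z -> sub_space A) z :
  morph_at (set_val \o h : Z -> X) z -> morph_at h z.
Proof.
move=> [ch rh]; split.
  move=> B [_ [[V oV <-] /= Vh] VB].
  have /ch {}Vh : nbhs ((set_val \o h) z) V by exact: open_nbhs_nbhs.
  have {}Vh : nbhs z ((set_val \o h) @^-1` V) by [].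
  by apply: filterS Vh => w Vw; exact: VB.
move=> k [H HH kH]; apply: reg_eq_near (rh _ HH).
have ch' : h @ z --> h z.
  move=> B [_ [[V oV <-] /= Vh] VB].
  have /ch {}Vh : nbhs ((set_val \o h) z) V by exact: open_nbhs_nbhs.
  have {}Vh : nbhs z ((set_val \o h) @^-1` V) by [].
  by apply: filterS Vh => w Vw; exact: VB.
have {}kH : nbhs z (h @^-1` [set y | k y = H (set_val y)]) by exact: ch'.
by apply: filterS kH => w /= ->.
Qed.

Lemma is_morphism_sub X Z (A : set X) (h : Z -> sub_space A) :
  is_morphism (set_val \o h : Z -> X) -> is_morphism h.
Proof.
by move=> /is_morphismP hh; apply/is_morphismP => z; exact: morph_at_sub.
Qed.

Lemma set_valI X (A : set X) : injective (set_val : sub_space A -> X).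
Proof. exact: val_inj. Qed.

Lemma set_val_in X (A : set X) (a : sub_space A) : A (set_val a).
Proof. exact: set_valP. Qed.

Definition to_sub X (A : set X) (x : X) (Ax : A x) : sub_space A := SigSub (mem_set Ax).

Lemma to_subK X (A : set X) x (Ax : A x) : set_val (to_sub Ax) = x.
Proof. by []. Qed.

(** [r] is the graph of an isomorphism between the subspaces [A] and [B]. *)
Definition iso_rel X Y (A : set X) (B : set Y) (r : X -> Y -> Prop) : Prop :=
  exists2 f : sub_space A -> sub_space B, is_iso f &
    forall x y, r x y <-> exists2 a, set_val a = x & set_val (f a) = y.

Lemma iso_relI X Y (A : set X) (B : set Y) (f : sub_space A -> Y) (g : sub_space B -> X) :
  is_morphism f -> is_morphism g ->
  (forall a, B (f a)) -> (forall b, A (g b)) ->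
  (forall a b, set_val b = f a -> g b = set_val a) ->
  (forall a b, set_val a = g b -> f a = set_val b) ->
  iso_rel A B (fun x y => exists2 a, set_val a = x & f a = y).
Proof.
move=> mf mg fB gA gf fg.
exists (fun a => to_sub (fB a)).
  split; first exact: is_morphism_sub.
  exists (fun b => to_sub (gA b)); split.
  - exact: is_morphism_sub.
  - by move=> a; apply: set_valI; rewrite to_subK; exact: gf.
  - by move=> b; apply: set_valI; rewrite to_subK; exact: fg.
by move=> x y; split=> -[a ax ay]; exists a.
Qed.

Lemma iso_rel_eq X Y (A : set X) (B : set Y) r s :
  (forall x y, r x y <-> s x y) -> iso_rel A B r -> iso_rel A B s.
Proof. by move=> rs [f fi fr]; exists f => // x y; rewrite -rs. Qed.

Lemma iso_rel_total X Y (A : set X) (B : set Y) (f : X -> Y) (g : Y -> X) :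
  (forall x, A x -> morph_at f x) -> (forall y, B y -> morph_at g y) ->
  (forall x, A x -> B (f x) /\ g (f x) = x) -> (forall y, B y -> A (g y) /\ f (g y) = y) ->
  iso_rel A B (fun x y => A x /\ f x = y).
Proof.
move=> mf mg fB gA.
have mv (V : fspace R) (D : set V) (a : sub_space D) : morph_at (set_val : sub_space D -> V) a.
  by have /is_morphismP := @set_val_morphism V D; exact.
have m1 : is_morphism (f \o (set_val : sub_space A -> X)).
  by apply/is_morphismP => a; apply: morph_at_comp; [exact: mv|exact: (mf _ (set_val_in a))].
have m2 : is_morphism (g \o (set_val : sub_space B -> Y)).
  by apply/is_morphismP => a; apply: morph_at_comp; [exact: mv|exact: (mg _ (set_val_in a))].
apply: iso_rel_eq (iso_relI m1 m2 _ _ _ _).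
- move=> x y; split=> [[a <- <-]|[Ax <-]]; first by split=> //; exact: set_val_in.
  by exists (to_sub Ax).
- by move=> a; have [] := fB _ (set_val_in a).
- by move=> b; have [] := gA _ (set_val_in b).
- by move=> a b /= ->; have [] := fB _ (set_val_in a).
- by move=> a b /= ->; have [] := gA _ (set_val_in b).
Qed.

Lemma iso_rel_inv X Y (A : set X) (B : set Y) r :
  iso_rel A B r -> iso_rel B A (fun y x => r x y).
Proof.
move=> [f [mf [g [mg fK gK]]] fr]; exists g; first by split=> //; exists f.
move=> y x; rewrite fr; split=> -[c <- <-].
  by exists (f c) => //; rewrite fK.
by exists (g c) => //; rewrite gK.
Qed.

Lemma iso_rel_comp X Y Z (A : set X) (B : set Y) (D : set Z) r s :
  iso_rel A B r -> iso_rel B D s -> iso_rel A D (fun x z => exists2 y, r x y & s y z).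
Proof.
move=> [f [mf [g [mg fK gK]]] fr] [h [mh [k [mk hK kK]]] hs].
exists (h \o f).
  split; first exact: is_morphism_comp.
  by exists (g \o k); split; [exact: is_morphism_comp|exact: can_comp|exact: can_comp].
move=> x z; split=> [[y /fr[a ax fa] /hs[b bf hb]]|[a ax az]].
  by exists a => //=; rewrite -hb; congr (set_val (h _)); apply: set_valI; rewrite bf.
exists (set_val (f a)); first by apply/fr; exists a.
by apply/hs; exists (f a).
Qed.

Lemma iso_rel_dom X Y (A : set X) (B : set Y) r x y : iso_rel A B r -> r x y -> A x /\ B y.
Proof. by move=> [f _ fr] /fr[a <- <-]; split; exact: set_val_in. Qed.

Lemma iso_rel_fun X Y (A : set X) (B : set Y) r x y y' :
  iso_rel A B r -> r x y -> r x y' -> y = y'.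
Proof. by move=> [f _ fr] /fr[a <- <-] /fr[b /set_valI -> <-]. Qed.

Lemma iso_rel_inj X Y (A : set X) (B : set Y) r x x' y :
  iso_rel A B r -> r x y -> r x' y -> x = x'.
Proof. by move=> /iso_rel_inv h; exact: (iso_rel_fun h). Qed.

Lemma iso_rel_ex X Y (A : set X) (B : set Y) r x :
  iso_rel A B r -> A x -> exists y, r x y.
Proof. by move=> [f _ fr] Ax; exists (set_val (f (to_sub Ax))); apply/fr; exists (to_sub Ax). Qed.

(** Graphs on the ambient points keep restrictions and compositions free of nested subspaces: the
    image of [D] is described by the relation alone. *)
Lemma iso_rel_restrict X Y (A D : set X) (B : set Y) r : iso_rel A B r -> D `<=` A ->
  iso_rel D [set y | exists2 x, D x & r x y] (fun x y => D x /\ r x y).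
Proof.
move=> [f [mf [g [mg fK gK]]] fr] DA.
pose D' := [set y | exists2 x, D x & r x y].
have D'B : D' `<=` B by move=> y [x _ /fr[a _ <-]]; exact: set_val_in.
pose i (d : sub_space D) : sub_space A := to_sub (DA _ (set_val_in d)).
pose j (d : sub_space D') : sub_space B := to_sub (D'B _ (set_val_in d)).
have mi : is_morphism (set_val \o (f \o i) : sub_space D -> Y).
  apply: is_morphism_comp; last exact: set_val_morphism.
  apply: is_morphism_comp mf; apply: is_morphism_sub; exact: set_val_morphism.
have mj : is_morphism (set_val \o (g \o j) : sub_space D' -> X).
  apply: is_morphism_comp; last exact: set_val_morphism.
  apply: is_morphism_comp mg; apply: is_morphism_sub; exact: set_val_morphism.
apply: iso_rel_eq (iso_relI mi mj _ _ _ _).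
- move=> x y; split=> [[a <- <-]|[Dx /fr[a ax ay]]].
    by split; [exact: set_val_in|apply/fr; exists (i a)].
  exists (to_sub Dx) => //; rewrite -ay /=; congr (set_val (f _)).
  by apply: set_valI; rewrite ax.
- by move=> a; exists (set_val a); [exact: set_val_in|apply/fr; exists (i a)].
- move=> b; have [x Dx /fr[a ax ab]] := set_val_in b.
  have jb : j b = f a by apply: set_valI; rewrite ab.
  by rewrite /= jb fK ax.
- move=> a b /= ba; have -> : j b = f (i a) by apply: set_valI.
  by rewrite fK.
- move=> a b /= ab; have -> : i a = g (j b) by apply: set_valI.
  by rewrite gK.
Qed.

Lemma iso_rel_open X Y (A D : set X) (B : set Y) r : iso_rel A B r -> open B -> open D ->
  open [set y | exists2 x, D x & r x y].
Proof.
move=> [f [_ [g [[cg _] fK gK]]] fr] oB oD.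
have cont : continuous (set_val \o g : sub_space B -> X).
  by move=> b; apply: continuous_comp; [exact: cg|exact: initial_continuous].
have /continuousP/(_ _ oD) [V oV VE] := cont.
have -> : [set y | exists2 x, D x & r x y] = V `&` B.
  apply/seteqP; split=> y /=.
    move=> [x Dx /fr[a ax <-]]; split; last exact: set_val_in.
    have : ((set_val \o g) @^-1` D) (f a) by rewrite /= fK ax.
    by rewrite -VE.
  move=> [Vy By]; have : (set_val @^-1` V) (to_sub By) by [].
  rewrite VE /= => Dg; exists (set_val (g (to_sub By))) => //.
  by apply/fr; exists (g (to_sub By)) => //; rewrite gK.
exact: openI.
Qed.

(** A subset of [Z] carries the same structure whether it is induced from [Z] or from the ambient
    space. *)
Lemma iso_rel_sub X Y (Z : set X) (Z' : set Y) (A : set X) (B : set Y) r :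
  A `<=` Z -> B `<=` Z' -> iso_rel A B r ->
  @iso_rel (sub_space Z) (sub_space Z') (set_val @^-1` A) (set_val @^-1` B)
    (fun x y => r (set_val x) (set_val y)).
Proof.
move=> AZ BZ [f [mf [g [mg fK gK]]] fr].
pose dA (a : sub_space (set_val @^-1` A : set (sub_space Z))) : sub_space A :=
  to_sub (set_val_in a : A (set_val (set_val a))).
pose dB (a : sub_space (set_val @^-1` B : set (sub_space Z'))) : sub_space B :=
  to_sub (set_val_in a : B (set_val (set_val a))).
pose uB (b : sub_space B) : sub_space Z' := to_sub (BZ _ (set_val_in b)).
pose uA (b : sub_space A) : sub_space Z := to_sub (AZ _ (set_val_in b)).
have mdA : is_morphism dA.
  apply: is_morphism_sub.
  exact: (is_morphism_comp (@set_val_morphism (sub_space Z) (set_val @^-1` A)) (@set_val_morphism X Z)).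
have mdB : is_morphism dB.
  apply: is_morphism_sub.
  exact: (is_morphism_comp (@set_val_morphism (sub_space Z') (set_val @^-1` B)) (@set_val_morphism Y Z')).
have muA : is_morphism uA by apply: is_morphism_sub; exact: set_val_morphism.
have muB : is_morphism uB by apply: is_morphism_sub; exact: set_val_morphism.
have m1 := is_morphism_comp (is_morphism_comp mdA mf) muB.
have m2 := is_morphism_comp (is_morphism_comp mdB mg) muA.
apply: iso_rel_eq (iso_relI m1 m2 _ _ _ _).
- move=> x y; split=> [[a <- <-]|/fr[a ax ay]]; first by apply/fr; exists (dA a).
  have Ax : A (set_val x) by rewrite -ax; exact: set_val_in.
  exists (@to_sub (sub_space Z) (set_val @^-1` A) x Ax) => //.
  apply: set_valI => /=; rewrite -ay; congr (set_val (f _)).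
  by apply: set_valI.
- by move=> a; exact: (set_val_in (f (dA a))).
- by move=> a; exact: (set_val_in (g (dB a))).
- move=> a b /= ba; apply: set_valI => /=.
  have bE : dB b = f (dA a) by apply: set_valI; exact: (congr1 set_val ba).
  by rewrite bE fK.
- move=> a b /= ba; apply: set_valI => /=.
  have aE : dA a = g (dB b) by apply: set_valI; exact: (congr1 set_val ba).
  by rewrite aE gK.
Qed.

Lemma restricts_to_isoP X Y (f : X -> Y) V U :
  restricts_to_iso f V U <-> iso_rel V U (fun x y => V x /\ f x = y).
Proof.
split=> [[g gi gf]|[g gi gf]]; exists g => //.
  move=> x y; split=> [[Vx <-]|[a <- <-]]; first by exists (to_sub Vx) => //; rewrite gf.
  by split; [exact: set_val_in|rewrite gf].
move=> v; have [_ h] := gf (set_val v) (set_val (g v)).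
by have [|_ ->] := h; first by exists v.
Qed.

Lemma locally_equivalentP X Y X' Y' (f : Y -> X) (f' : Y' -> X') :
  locally_equivalent f f' <-> exists U U' r s,
    [/\ open U /\ centre f `<=` U, open U' /\ centre f' `<=` U',
        iso_rel U U' r, iso_rel (f @^-1` U) (f' @^-1` U') s &
        forall y y', s y y' -> r (f y) (f' y')].
Proof.
split.
  move=> [U [U' [al [be [hU hU' ali bei ab]]]]].
  exists U, U', (fun x y => exists2 a, set_val a = x & set_val (al a) = y),
    (fun x y => exists2 a, set_val a = x & set_val (be a) = y); split=> //.
  - by exists al.
  - by exists be.
  move=> y y' [b <- <-]; exists (to_sub (set_val_in b : U (f (set_val b)))) => //.
  exact: ab.
move=> [U [U' [r [s [hU hU' [al ali alr] [be bei bes] rs]]]]].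
exists U, U', al, be; split=> // y x xy.
have /rs : s (set_val y) (set_val (be y)) by apply/bes; exists y.
rewrite -xy => h; have : r (set_val x) (set_val (al x)) by apply/alr; exists x.
move=> h'; apply: (iso_rel_fun (r := r) (A := U) (B := U') _ h' h); by exists al.
Qed.

Lemma germ_isoP X X' (P : X) (P' : X') :
  germ_iso P P' <-> exists U U' r,
    [/\ open U, open U', iso_rel U U' r & r P P'].
Proof.
split.
  move=> [U [U' [al [[oU UP] [oU' UP'] ali alP]]]].
  exists U, U', (fun x y => exists2 a, set_val a = x & set_val (al a) = y); split=> //.
    by exists al.
  by exists (to_sub UP) => //; exact: alP.
move=> [U [U' [r [oU oU' ir rP]]]]; have [UP UP'] := iso_rel_dom ir rP.
have [al ali alr] := ir; exists U, U', al; split=> // x xP.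
have : r P (set_val (al x)) by apply/alr; exists x.
move=> h; exact: (iso_rel_fun ir h rP).
Qed.

End Morphisms.

(** * Transport of centres; symmetry and transitivity of local equivalence *)

Section LocallyEquivalent.
Context {R : realType}.
Implicit Types X Y Z W : fspace R.

Definition loc_iso X Y (f : X -> Y) (x : X) : Prop :=
  exists V U, [/\ open V, V x, open U & restricts_to_iso f V U].

(** After shrinking [V] so that it lies over [U], the isomorphism induced by [f] is conjugated by
    the two given ones; the graph of the result is that of [f']. *)
Lemma loc_iso_transport Y X Y' X' (f : Y -> X) (f' : Y' -> X') U U' r s y y' :
  continuous f -> continuous f' -> open U -> open U' -> iso_rel U U' r ->
  iso_rel (f @^-1` U) (f' @^-1` U') s -> (forall z z', s z z' -> r (f z) (f' z')) ->
  s y y' -> loc_iso f y -> loc_iso f' y'.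
Proof.
move=> /continuousP cf /continuousP cf' oU oU' ir is_ rs syy' [V [W [oV Vy oW]]].
move=> /restricts_to_isoP iv.
have oV1 : open (V `&` f @^-1` U) by apply: openI => //; exact: cf.
have V1V : V `&` f @^-1` U `<=` V by move=> z [].
have V1U : V `&` f @^-1` U `<=` f @^-1` U by move=> z [].
set V1 := V `&` f @^-1` U in oV1 V1V V1U.
have i1 := iso_rel_restrict iv V1V.
set U1 := [set u | _] in i1.
have oU1 : open U1 by exact: iso_rel_open iv oW oV1.
have U1U : U1 `<=` U by move=> u [v V1v [_ <-]]; exact: V1U.
have i2 := iso_rel_restrict ir U1U.
have i3 := iso_rel_restrict is_ V1U.
exists [set w | exists2 v, V1 v & s v w], [set w | exists2 u, U1 u & r u w]; split.
- by apply: iso_rel_open is_ _ oV1; exact: cf'.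
- by exists y => //; split=> //; have [] := iso_rel_dom is_ syy'.
- exact: iso_rel_open ir oU' oU1.
apply/restricts_to_isoP.
apply: iso_rel_eq (iso_rel_comp (iso_rel_inv i3) (iso_rel_comp i1 i2)) => v' u'.
split.
  move=> [v [V1v svv'] [u [_ [_ vu]] [_ ruu']]]; split; first by exists v.
  by apply: iso_rel_fun ir _ ruu'; rewrite -vu; exact: rs.
move=> [[v V1v svv'] <-]; exists v => //; exists (f v).
  by split=> //; split=> //; exact: V1V.
by split; [exists v => //; split=> //; exact: V1V|exact: rs].
Qed.

Lemma centre_transport Y X Y' X' (f : Y -> X) (f' : Y' -> X') U U' r s x x' :
  continuous f -> continuous f' -> open U -> open U' -> iso_rel U U' r ->
  iso_rel (f @^-1` U) (f' @^-1` U') s -> (forall z z', s z z' -> r (f z) (f' z')) ->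
  r x x' -> centre f x -> centre f' x'.
Proof.
move=> cf cf' oU oU' ir is_ rs rxx' [y ey yx].
have Uy : (f @^-1` U) y by rewrite /= yx; have [] := iso_rel_dom ir rxx'.
have [y' syy'] := iso_rel_ex is_ Uy.
exists y'; last by apply: iso_rel_fun ir _ rxx'; rewrite -yx; exact: rs.
move=> ly'; apply: ey; apply: loc_iso_transport (iso_rel_inv ir) (iso_rel_inv is_) _ syy' ly' => //.
by move=> z' z /rs.
Qed.

Lemma locally_equivalent_sym Y X Y' X' (f : Y -> X) (f' : Y' -> X') :
  locally_equivalent f f' -> locally_equivalent f' f.
Proof.
move=> /locally_equivalentP[U [U' [r [s [hU hU' ir is_ rs]]]]].
apply/locally_equivalentP; exists U', U, (fun x y => r y x), (fun x y => s y x).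
by split=> //; [exact: iso_rel_inv|exact: iso_rel_inv|move=> z' z /rs].
Qed.

(** The middle map comes with two neighbourhoods of its centre, [U1'] and [U2], and everything is
    restricted to their intersection. By [centre_transport] the outer centres correspond to points
    of it; this is where continuity is needed. *)
Lemma locally_equivalent_trans Y X Y' X' Y'' X'' (f : Y -> X) (f' : Y' -> X') (f'' : Y'' -> X'') :
  continuous f -> continuous f' -> continuous f'' ->
  locally_equivalent f f' -> locally_equivalent f' f'' -> locally_equivalent f f''.
Proof.
move=> cf cf' cf''.
move=> /locally_equivalentP[U1 [U1' [r1 [s1 [[oU1 cU1] [oU1' cU1'] ir1 is1 rs1]]]]].
move=> /locally_equivalentP[U2 [U2' [r2 [s2 [[oU2 cU2] [oU2' cU2'] ir2 is2 rs2]]]]].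
have W1 : U1' `&` U2 `<=` U1' by move=> z [].
have W2 : U1' `&` U2 `<=` U2 by move=> z [].
have i1 := iso_rel_restrict (iso_rel_inv ir1) W1.
have i2 := iso_rel_restrict ir2 W2.
have fW1 : f' @^-1` (U1' `&` U2) `<=` f' @^-1` U1' by move=> z [].
have fW2 : f' @^-1` (U1' `&` U2) `<=` f' @^-1` U2 by move=> z [].
have j1 := iso_rel_restrict (iso_rel_inv is1) fW1.
have j2 := iso_rel_restrict is2 fW2.
have oW : open (U1' `&` U2) by exact: openI.
set A := [set x | _] in i1; set B := [set x | _] in i2.
set A' := [set x | _] in j1; set B' := [set x | _] in j2.
have EA : A' = f @^-1` A.
  apply/seteqP; split=> y.
    by move=> [y' Wy' sy]; exists (f' y') => //; exact: rs1.
  move=> [x' Wx' rx]; have [Ux Ux'] := iso_rel_dom ir1 rx.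
  have [y' sy] := iso_rel_ex is1 Ux; exists y' => //=.
  by rewrite -(iso_rel_fun ir1 rx (rs1 _ _ sy)).
have EB : B' = f'' @^-1` B.
  apply/seteqP; split=> y.
    by move=> [y' Wy' sy]; exists (f' y') => //; exact: rs2.
  move=> [x' Wx' rx]; have [Ux Ux'] := iso_rel_dom ir2 rx.
  have [y' sy] := iso_rel_ex (iso_rel_inv is2) Ux'; exists y' => //=.
  by rewrite -(iso_rel_inj ir2 rx (rs2 _ _ sy)).
apply/locally_equivalentP; exists A, B, (fun x z => exists2 y, (U1' `&` U2) y /\ r1 x y & (U1' `&` U2) y /\ r2 y z).
exists (fun x z => exists2 y, (U1' `&` U2) (f' y) /\ s1 x y & (U1' `&` U2) (f' y) /\ s2 y z).
split.
- split; first exact: iso_rel_open (iso_rel_inv ir1) oU1 oW.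
  move=> x cx; have [x' rx] := iso_rel_ex ir1 (cU1 _ cx).
  exists x' => //; split; first by have [] := iso_rel_dom ir1 rx.
  by apply: cU2; exact: centre_transport cf cf' oU1 oU1' ir1 is1 rs1 rx cx.
- split; first exact: iso_rel_open ir2 oU2' oW.
  move=> x cx; have [x' rx] := iso_rel_ex (iso_rel_inv ir2) (cU2' _ cx).
  exists x' => //; split; last by have [] := iso_rel_dom ir2 rx.
  apply: cU1'.
  apply: (centre_transport cf'' cf' oU2' oU2 (iso_rel_inv ir2) (iso_rel_inv is2) _ rx cx).
  by move=> z z' /rs2.
- exact: iso_rel_comp (iso_rel_inv i1) i2.
- by rewrite -EA -EB; exact: iso_rel_comp (iso_rel_inv j1) j2.
by move=> y z [y' [Wy' s1y] [_ s2y]]; exists (f' y'); split=> //; [exact: rs1|exact: rs2].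
Qed.

(** An equivalence takes centre to centre, so [P] can only go to [P']. *)
Lemma locally_equivalent_germ Y X Y' X' (f : Y -> X) (f' : Y' -> X') P P' :
  continuous f -> continuous f' -> locally_equivalent f f' ->
  centre f P -> centre f' `<=` [set P'] -> germ_iso P P'.
Proof.
move=> cf cf' /locally_equivalentP[U [U' [r [s [[oU cU] [oU' cU'] ir is_ rs]]]]] cP cP'.
have [x' rx] := iso_rel_ex ir (cU _ cP).
apply/germ_isoP; exists U, U', r; split=> //.
by rewrite -(cP' _ (centre_transport cf cf' oU oU' ir is_ rs rx cP)).
Qed.

Lemma germ_iso_sym X X' (P : X) (P' : X') : germ_iso P P' -> germ_iso P' P.
Proof.
move=> /germ_isoP[U [U' [r [oU oU' ir rP]]]]; apply/germ_isoP.
by exists U', U, (fun x y => r y x); split=> //; exact: iso_rel_inv.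
Qed.

Lemma germ_iso_trans X X' X'' (P : X) (P' : X') (P'' : X'') :
  germ_iso P P' -> germ_iso P' P'' -> germ_iso P P''.
Proof.
move=> /germ_isoP[U1 [U1' [r1 [oU1 oU1' ir1 rP1]]]] /germ_isoP[U2 [U2' [r2 [oU2 oU2' ir2 rP2]]]].
have W1 : U1' `&` U2 `<=` U1' by move=> z [].
have W2 : U1' `&` U2 `<=` U2 by move=> z [].
have oW : open (U1' `&` U2) by exact: openI.
have WP : (U1' `&` U2) P'.
  by split; [have [] := iso_rel_dom ir1 rP1|have [] := iso_rel_dom ir2 rP2].
have := iso_rel_comp (iso_rel_inv (iso_rel_restrict (iso_rel_inv ir1) W1)) (iso_rel_restrict ir2 W2).
move=> h; apply/germ_isoP; do 3 eexists; split; [| |exact: h|by exists P'].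
  exact: iso_rel_open (iso_rel_inv ir1) oU1 oW.
exact: iso_rel_open ir2 oU2' oW.
Qed.

End LocallyEquivalent.

(** * Functoriality of analytification *)

Section AnFunctor.
Context {R : realType}.
Local Notation C := (cplx R).
Implicit Types X Y Z W : fspace R.

Lemma an_subbase_nbhs X (x : an X) (U : set X) (g : X -> C) (D : set C) :
  open U -> (forall z, U z -> reg X z g) -> open D -> U x -> D (g x) ->
  nbhs x [set z | U z /\ D (g z)].
Proof.
move=> oU gU oD Ux Dx; rewrite nbhsE; exists [set z | U z /\ D (g z)] => //; split=> //.
exists [set [set z | U z /\ D (g z)]]; last first.
  by rewrite predeqE => z; split=> [[_ ->]|] //; exists [set z | U z /\ D (g z)].
move=> _ ->; exists [fset [set z | U z /\ D (g z)]]%fset; last first.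
  rewrite predeqE=> z; split=> [|Dz B]; last by rewrite /= inE => /eqP->.
  by move=> /(_ [set z | U z /\ D (g z)]); apply; rewrite /= inE.
move=> B /fset1P BE; rewrite inE BE; by exists U, g, D.
Qed.

Lemma an_cvg X (T : Type) (F : set_system T) (FF : Filter F) (h : T -> an X) (x : an X) :
  (forall (U : set X) (g : X -> C) (D : set C), open U -> (forall z, U z -> reg X z g) ->
    open D -> U x -> D (g x) -> \forall t \near F, U (h t) /\ D (g (h t))) ->
  h @ F --> x.
Proof.
move=> hF A; rewrite nbhsE => -[_ [[B sB <-] [D BD Dx] sUBA]].
have {}FD : (h @ F) D; last by apply: filterS FD => z Dz; apply: sUBA; exists D.
have /sB [E sE IED] := BD; rewrite -IED; apply: filter_bigI => W WE.
have := sE _ WE; rewrite inE => -[U [g [V [oU gU oV WEq]]]].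
have Wx : W x by move: Dx; rewrite -IED => /(_ _ WE).
move: Wx; rewrite WEq => -[Ux Vx].
by have := hF U g V oU gU oV Ux Vx.
Qed.

Lemma nbhs_open (T : topologicalType) (x : T) (A : set T) :
  nbhs x A -> exists V, [/\ open V, V x & V `<=` A].
Proof. by rewrite nbhsE => -[V [oV Vx] VA]; exists V. Qed.

Lemma sub_nbhs X (A : set X) (a : sub_space A) (P : set (sub_space A)) :
  nbhs a P -> exists V : set X, [/\ open V, V (set_val a) & forall b, V (set_val b) -> P b].
Proof.
by move=> /nbhs_open[_ [[V oV <-] Va VP]]; exists V; split=> // b Vb; exact: VP.
Qed.

Lemma nbhs_sub X (A : set X) (a : sub_space A) (V : set X) :
  nbhs (set_val a) V -> nbhs a (set_val @^-1` V).
Proof. exact: (@initial_continuous _ _ (set_val : sub_space A -> X) a V). Qed.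

(** The subbase of the analytic topology asks for a regular function on each Zariski open set; a
    regular constant makes every such set analytically open. *)
Definition has_cst X := forall x : X, reg X x (fun=> 0).

Lemma an_near X (x : X) (P : X -> Prop) : has_cst X ->
  (\forall z \near x, P z) -> \forall z \near (x : an X), P z.
Proof.
move=> c0 xP; have [U [oU Ux UP]] := nbhs_open (filterI xP (reg_open (c0 x))).
have FF : Filter (nbhs (x : an X)) by exact: nbhs_filter.
have Uc z : U z -> reg X z (fun=> 0) by move=> /UP[].
by apply: filterS (@an_subbase_nbhs X x U _ setT oU Uc openT Ux I) => z [/UP[]].
Qed.

Lemma reg_an_continuous X (x : X) (g : X -> C) : reg X x g ->
  (g : an X -> C) @ (x : an X) --> g x.
Proof.
move=> gx A /nbhs_open[D [oD Dx DA]].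
have [U [oU Ux Ug]] := nbhs_open (reg_open gx).
have FF : Filter (nbhs (x : an X)) by exact: nbhs_filter.
by apply: filterS (an_subbase_nbhs oU Ug oD Ux Dx) => z [_ Dz]; exact: DA.
Qed.

Lemma cvg_row n (T : Type) (F : set_system T) (FF : Filter F) (f : 'I_n -> T -> C)
    (l : 'I_n -> C) :
  (forall i, f i @ F --> l i) ->
  (fun t => \row_i f i t : 'rV[C]_n) @ F --> (\row_i l i : 'rV[C]_n).
Proof.
move=> fl A /near_rowP[e e0 eA].
have near_fl : \forall t \near F, forall i, `|f i t - l i| < e.
  by apply: filter_forall => i; exact: (@cvgrPdistC_lt _ C _ F FF _ _).1 (fl i) e e0.
by apply: filterS near_fl => t ft; apply: eA => i; rewrite !mxE.
Qed.

(** Regular functions pulled back to [A] extend, near each point, to regular functions on [X]. These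
    extensions give continuity on the subbase, and also regularity, since a holomorphic function
    depends on finitely many regular ones. *)
Lemma an_sub_morphism X Y (A : set X) (g : sub_space A -> Y) : has_cst X ->
  is_morphism g -> @is_morphism R (@sub_space R (an X) A) (an Y) g.
Proof.
move=> c0 [cg rg]; apply/is_morphismP => a.
pose x : X := set_val a.
have ext (k : Y -> C) : reg Y (g a) k -> exists2 K : X -> C, reg X x K &
    \forall b \near (a : @sub_space R (an X) A), k (g b) = K (set_val b).
  move=> /rg[K Kx near_k]; exists K => //.
  have [V [oV Va VK]] := sub_nbhs near_k.
  have Vx : \forall z \near (x : an X), V z by apply: an_near => //; exact: open_nbhs_nbhs.
  have FF : Filter (nbhs (a : @sub_space R (an X) A)) by exact: nbhs_filter.
  by apply: filterS (nbhs_sub Vx) => b Vb; exact: VK.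
have FFa : Filter (nbhs (a : @sub_space R (an X) A)) by exact: nbhs_filter.
have FFx : Filter (nbhs (x : an X)) by exact: nbhs_filter.
have cg' : (g : @sub_space R (an X) A -> an Y) @ a --> (g a : an Y).
  apply: an_cvg => U k D oU kU oD Ua Da.
  have [K Kx kK] := ext k (kU _ Ua).
  have Una : \forall b \near (a : sub_space A), U (g b).
    by apply: (cg a); exact: open_nbhs_nbhs.
  have Unb : \forall b \near (a : @sub_space R (an X) A), U (g b).
    have [V [oV Va VU]] := sub_nbhs Una.
    have Vx : \forall z \near (x : an X), V z by apply: an_near => //; exact: open_nbhs_nbhs.
    have FF : Filter (nbhs (a : @sub_space R (an X) A)) by exact: nbhs_filter.
    by apply: filterS (nbhs_sub Vx) => b Vb; exact: VU.
  have DK : \forall z \near (x : an X), D (K z).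
    apply: (reg_an_continuous Kx); apply: open_nbhs_nbhs; split=> //.
    by rewrite -(nbhs_singleton kK).
  have {}DK : nbhs (a : @sub_space R (an X) A) (set_val @^-1` [set z | D (K z)]) by exact: nbhs_sub.
  near=> b; split; first by near: b.
  by rewrite (near kK b) //; near: b.
split; first exact: cg'.
move=> h /= hreg.
have [m [k [H [kreg Hreg hH]]]] := nbhs_singleton hreg.
have extK i : exists K : X -> C, reg X x K /\
    \forall b \near (a : @sub_space R (an X) A), k i (g b) = K (set_val b).
  by have [K Kx Kk] := ext (k i) (kreg i); exists K.
have [K KP] := choice extK.
have KE : \row_i (K i x) = \row_i (k i (g a)).
  by apply/rowP => i; rewrite !mxE (nbhs_singleton (KP i).2).
exists (fun z : an X => H (\row_i (K i z))); last first.
  have hHb : \forall b \near (a : @sub_space R (an X) A), h (g b) = H (\row_i (k i (g b))).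
    exact: (cg' _ hH).
  have allK : \forall b \near (a : @sub_space R (an X) A), forall i, k i (g b) = K i (set_val b).
    exact: (@filter_forall _ _ _ (nbhs (a : @sub_space R (an X) A)) FFa (fun i => (KP i).2)).
  near=> b; rewrite /= (near hHb b) //.
  by congr (H _); apply/rowP => i; rewrite !mxE; move: i; near: b.
have regK : \forall z \near (x : an X), forall i, reg X z (K i).
  apply: (@filter_forall _ _ _ (nbhs (x : an X)) FFx) => i.
  by apply: an_near => //; apply: reg_open; exact: (KP i).1.
have Hnear : \forall z \near (x : an X), reg (analytic_space R m) (\row_i (K i z)) H.
  have crow : (fun z : an X => \row_i (K i z)) @ (x : an X) --> \row_i (K i x).
    by apply: cvg_row => i; apply: reg_an_continuous; exact: (KP i).1.
  move: (reg_open Hreg); rewrite -KE => HH; exact: crow HH.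
near=> z; exists m, K, H; split.
- by near: z.
- by near: z.
- exact: filterE.
Unshelve. all: by end_near. Qed.

Lemma is_morphism_an X Y (f : X -> Y) : has_cst X -> is_morphism f ->
  is_morphism (an_map f).
Proof.
move=> c0 mf.
have m1 := is_morphism_comp (@set_val_morphism _ X setT) mf.
have m2 := an_sub_morphism c0 m1.
pose i (x : an X) : @sub_space R (an X) setT := to_sub (I : [set: X] x).
have mi : is_morphism i.
  by apply: is_morphism_sub; split=> // x; exact: cvg_id.
exact: is_morphism_comp mi m2.
Qed.

Lemma iso_rel_an X Y (A : set X) (B : set Y) r : has_cst X -> has_cst Y ->
  iso_rel A B r -> @iso_rel R (an X) (an Y) A B r.
Proof.
move=> cX cY [f [mf [g [mg fK gK]]] fr].
exists f => //; split.
  apply: is_morphism_sub; apply: (an_sub_morphism (g := set_val \o f)) => //.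
  exact: is_morphism_comp mf (@set_val_morphism _ _ _).
exists g; split=> //.
apply: is_morphism_sub; apply: (an_sub_morphism (g := set_val \o g)) => //.
exact: is_morphism_comp mg (@set_val_morphism _ _ _).
Qed.

Lemma open_an X (U : set X) : has_cst X -> open U -> @open (an X) U.
Proof.
move=> c0 oU; rewrite openE => x Ux; have := @an_near X x U c0; apply.
exact: open_nbhs_nbhs.
Qed.

(** A local isomorphism for the Zariski topology is one for the analytic topology, so
    analytification can only shrink the exceptional locus. *)
Lemma centre_an X Y (f : X -> Y) : has_cst X -> has_cst Y ->
  centre (an_map f) `<=` centre f.
Proof.
move=> cX cY y [x ex xy]; exists x => // -[V [U [oV Vx oU /restricts_to_isoP VU]]].
apply: ex; exists V, U; split; [exact: open_an|by []|exact: open_an|].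
by apply/restricts_to_isoP; exact: iso_rel_an.
Qed.

Lemma affine_space_cst n : has_cst (affine_space R n).
Proof.
move=> x; apply: filterE => y; exists (mpoly.mpolyC n 0), (mpoly.mpolyC n 1).
rewrite /peval !mpoly.mevalC; split; first exact: oner_neq0.
by apply: filterE => z; rewrite !mpoly.mevalC mul0r.
Qed.

(** Constants are regular on affine space, hence on the affine charts that cover a variety. *)
Lemma variety_cst X : is_variety X -> has_cst X.
Proof.
move=> [_ [k [U [UA UT]] _] x].
have [i _ Ux] : (\bigcup_i U i) x by rewrite UT.
have [oU [n [S [f [clS [[_ rf] _]]]]]] := UA i.
have /rf[H Hx H0] : reg (sub_space S) (f (to_sub Ux)) (fun=> 0).
  by exists (fun=> 0); [exact: affine_space_cst|exact: filterE].
apply: reg_eq_near Hx; have [V [oV Vx VH]] := sub_nbhs H0.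
near=> y; have Uy : U i y by near: y; exact: open_nbhs_nbhs.
have Vy : V y by near: y; exact: open_nbhs_nbhs.
exact: esym (VH (to_sub Uy) Vy).
Unshelve. all: by end_near. Qed.

End AnFunctor.

(** * Weighted blowups *)

Lemma nearI (T : topologicalType) (x : T) (P Q : T -> Prop) :
  nbhs x P -> nbhs x Q -> nbhs x (fun z => P z /\ Q z).
Proof. exact: filterI. Qed.

Lemma nearS (T : topologicalType) (x : T) (P Q : T -> Prop) :
  (forall z, P z -> Q z) -> nbhs x P -> nbhs x Q.
Proof. by move=> PQ; exact: filterS. Qed.

Section WeightedSpace.
Local Open Scope quotient_scope.
Context {R : realType} (n : nat) (w : n.-tuple nat).
Local Notation C := (cplx R).
Local Notation wdom := (@wdomain R n).
Local Notation T := (wspace R w).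

Lemma wproj_eq (p q : wdom) :
  wproj w p = wproj w q <-> exists2 l : C, l != 0 & set_val q = wact w l (set_val p).
Proof.
have E : (wproj w p = wproj w q) <-> worbit w p q.
  split=> [h|h].
    by apply/(@eqquotP _ (worbit_equiv R w) {eq_quot worbit_equiv R w}).
  by apply/(@eqquotP _ (worbit_equiv R w) {eq_quot worbit_equiv R w}).
by rewrite E; split=> [/asboolP|?]; last apply/asboolP.
Qed.

Lemma wproj_surj (A : T) : exists p : wdom, wproj w p = A.
Proof.
exists (repr (A : {eq_quot worbit_equiv R w})).
exact: (@reprK _ {eq_quot worbit_equiv R w}).
Qed.

Definition wpr (p : 'rV[C]_n.+1) (wp : wdom p) : T := wproj w (to_sub wp).

Lemma wact_wdom l (p : 'rV[C]_n.+1) : l != 0 -> wdom p -> wdom (wact w l p).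
Proof.
by move=> l0 [i pi]; exists i; rewrite mxE liftK mulf_neq0 // expf_neq0.
Qed.

Lemma wact_coord l (p : 'rV[C]_n.+1) i :
  wact w l p 0 i = (if unlift ord0 i is Some j then l ^+ tnth w j else l^-1) * p 0 i.
Proof. by rewrite mxE. Qed.

Lemma wact_expands l (p : 'rV[C]_n.+1) i : expands_at p (fun q => wact w l q 0 i).
Proof.
under eq_fun do rewrite wact_coord.
by apply: expands_atM; [exact: expands_at_cst|exact: expands_at_coord].
Qed.

Lemma morph_at_analytic m k (f : 'rV[C]_m -> 'rV[C]_k) (x : 'rV[C]_m) :
  (forall i, expands_at x (fun z => f z 0 i)) ->
  @morph_at R (analytic_space R m) (analytic_space R k) f x.
Proof.
move=> fx; split.
  have -> : f = (fun z => \row_i f z 0 i) by apply/funext => z; apply/rowP => i; rewrite mxE.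
  have FF : Filter (nbhs x) by exact: nbhs_filter.
  by apply: cvg_row => i; exact: expands_at_continuous.
by move=> h /reg_analyticE hx; apply/reg_analyticE; exact: expands_at_comp.
Qed.

Lemma near_comp_analytic m k (f : 'rV[C]_m -> 'rV[C]_k) (x : 'rV[C]_m) (P : 'rV[C]_k -> Prop) :
  (forall i, expands_at x (fun z => f z 0 i)) ->
  (\forall y \near f x, P y) -> \forall z \near x, P (f z).
Proof. by move=> /morph_at_analytic[cf _]; exact: cf. Qed.

(** The projection is open: the saturation [U] of an open set is a union of translates of it.
    Neighbourhoods in the quotient can therefore be tested at any one representative. *)
Lemma wquot_near (p : wdom) (P : T -> Prop) :
  (\forall A \near (wproj w p : T), P A) <->
  (\forall q \near (set_val p : 'rV[C]_n.+1), forall wq : wdom q, P (wpr wq)).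
Proof.
split=> [Pp|Pp].
  have /(_ p) cp : continuous (wproj w : wdom -> wquot R w) by exact: pi_continuous.
  have {}Pp : nbhs p ((wproj w : wdom -> wquot R w) @^-1` P) by exact: cp.
  have [V [oV Vp VP]] := @sub_nbhs R (analytic_space R n.+1) _ _ _ Pp.
  have : nbhs (set_val p : 'rV[C]_n.+1) V by exact: open_nbhs_nbhs.
  by apply: filterS => q Vq wq; exact: (VP (to_sub wq)).
have [V [oV Vp VP]] := nbhs_open Pp.
pose U : set T := [set A | exists q (wq : wdom q), V q /\ wpr wq = A].
have oU : @open (wquot R w) U.
  rewrite /open /= /quotient_open openE => q [q' [wq' [Vq' Eq]]].
  have [l l0 ql] := (wproj_eq _ _).1 Eq.
  have near_V : \forall z \near (set_val q : 'rV[C]_n.+1), V (wact w l^-1 z).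
    apply: near_comp_analytic; first by move=> i; exact: wact_expands.
    apply: open_nbhs_nbhs; split=> //.
    by rewrite ql /= wactM mulVf // wact1.
  have := @nbhs_sub R (analytic_space R n.+1) wdom q _ near_V.
  apply: filterS => z /= Vz; have l0' : l^-1 != 0 by rewrite invr_eq0.
  exists (wact w l^-1 (set_val z)), (wact_wdom l0' (set_val_in z)); split=> //.
  apply/wproj_eq; exists l => //=.
  by rewrite wactM mulfV // wact1.
have : nbhs (wproj w p : wquot R w) U.
  apply: open_nbhs_nbhs; split=> //; exists (set_val p), (set_val_in p); split=> //.
  by congr (wproj w _); apply: val_inj.
by apply: filterS => A [q [wq [Vq <-]]]; exact: VP.
Qed.

Lemma wpr_val (p : wdom) (wp : wdom (set_val p)) : wpr wp = wproj w p.
Proof. by congr (wproj w _); apply: val_inj. Qed.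

(** Regularity on the quotient speaks of all representatives; one suffices, because the action
    carries the extension [H] to the others. *)
Lemma wreg (p : wdom) (k : T -> C) :
  reg T (wproj w p) k <-> exists2 H : 'rV[C]_n.+1 -> C, expands_at (set_val p) H &
    \forall q \near (set_val p : 'rV[C]_n.+1), forall wq : wdom q, k (wpr wq) = H q.
Proof.
split=> [/nbhs_singleton /(_ p erefl) [H Hp near_k]|[H Hp near_k]].
  exists H; first exact/reg_analyticE.
  have [V [oV Vp VP]] := sub_nbhs near_k.
  have : nbhs (set_val p : 'rV[C]_n.+1) V by exact: open_nbhs_nbhs.
  by apply: filterS => q Vq wq; exact: (VP (to_sub wq)).
apply/wquot_near; have := reg_open ((reg_analyticE _ _).2 Hp).
move: (near_join near_k) => nk Hn; near=> q.
have regq : reg (analytic_space R n.+1) q H by near: q.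
have near_q : \forall z \near (q : 'rV[C]_n.+1), forall wz : wdom z, k (wpr wz) = H z by near: q.
move=> wq p' p'q; have [l l0 ql] := (wproj_eq _ _).1 (esym p'q).
have pq : wact w l^-1 (set_val p' : 'rV[C]_n.+1) = q by rewrite ql /= wactM mulVf // wact1.
exists (H \o wact w l^-1).
  apply/reg_analyticE; apply: expands_at_comp.
    by rewrite pq; apply/reg_analyticE.
  by move=> i; exact: wact_expands.
have near_p' : \forall z \near (set_val p' : 'rV[C]_n.+1),
    forall wz : wdom (wact w l^-1 z), k (wpr wz) = H (wact w l^-1 z).
  apply: (@near_comp_analytic _ _ (wact w l^-1) _ (fun z => forall wz : wdom z, k (wpr wz) = H z)).
    by move=> i; exact: wact_expands.
  by rewrite pq.
have := @nbhs_sub R (analytic_space R n.+1) wdom p' _ near_p'.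
apply: filterS => z /= zH; have l0' : l^-1 != 0 by rewrite invr_eq0.
rewrite -(zH (wact_wdom l0' (set_val_in z))); congr k.
by apply/wproj_eq; exists l^-1.
Unshelve. all: by end_near. Qed.

Lemma wdom_near (p : 'rV[C]_n.+1) : wdom p -> \forall q \near p, wdom q.
Proof.
move=> [i pi]; apply/near_rowP; exists `|p 0 (lift ord0 i)|; first by rewrite normr_gt0.
move=> q qp; exists i; apply: contraTneq (qp (lift ord0 i)) => ->.
by rewrite sub0r normrN ltxx.
Qed.

Lemma morph_at_from_wspace m (f : T -> analytic_space R m) (p : wdom)
    (G : 'rV[C]_n.+1 -> 'rV[C]_m) :
  (forall i, expands_at (set_val p) (fun z => G z 0 i)) ->
  (\forall q \near (set_val p : 'rV[C]_n.+1), forall wq : wdom q, f (wpr wq) = G q) ->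
  morph_at f (wproj w p).
Proof.
move=> Gp fG; have fp : f (wproj w p) = G (set_val p).
  by have := nbhs_singleton fG (set_val_in p); rewrite wpr_val.
split.
  move=> P; rewrite fp => Pn; apply/wquot_near.
  have := nearI fG (near_comp_analytic Gp Pn).
  by apply: nearS => q [fq Pq] wq; rewrite /= fq.
move=> h; rewrite fp => /reg_analyticE hG; apply/wreg.
exists (h \o G); first exact: expands_at_comp.
by apply: nearS fG => q fq wq; rewrite /= fq.
Qed.

Lemma morph_at_wspace (f : T -> T) (p : wdom) (G : 'rV[C]_n.+1 -> 'rV[C]_n.+1) :
  (forall i, expands_at (set_val p) (fun z => G z 0 i)) -> wdom (G (set_val p)) ->
  (\forall q \near (set_val p : 'rV[C]_n.+1), forall (wq : wdom q) (wG : wdom (G q)),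
     f (wpr wq) = wpr wG) ->
  morph_at f (wproj w p).
Proof.
move=> Gp wGp fG; have fp : f (wproj w p) = wproj w (to_sub wGp).
  by have := nbhs_singleton fG (set_val_in p) wGp; rewrite wpr_val.
have wGn := near_comp_analytic Gp (wdom_near wGp).
split.
  move=> P; rewrite fp => /wquot_near Pn; apply/wquot_near.
  have := nearI (nearI fG wGn) (near_comp_analytic Gp Pn).
  by apply: nearS => q [[fq wGq] Pq] wq; rewrite /= (fq wq wGq); exact: Pq.
move=> h; rewrite fp => /wreg[H Hp hH]; apply/wreg.
exists (H \o G); first exact: expands_at_comp.
have := nearI (nearI fG wGn) (near_comp_analytic Gp hH).
by apply: nearS => q [[fq wGq] Pq] wq; rewrite /= (fq wq wGq); exact: Pq.
Qed.

Lemma morph_at_to_wspace m (f : analytic_space R m -> T) (x : 'rV[C]_m)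
    (G : 'rV[C]_m -> 'rV[C]_n.+1) :
  (forall i, expands_at x (fun z => G z 0 i)) -> wdom (G x) ->
  (\forall z \near x, forall (wG : wdom (G z)), f z = wpr wG) ->
  morph_at f x.
Proof.
move=> Gx wGx fG; have fx : f x = wproj w (to_sub wGx) by exact: (nbhs_singleton fG wGx).
have wGn := near_comp_analytic Gx (wdom_near wGx).
split.
  move=> P; rewrite fx => /wquot_near Pn.
  have := nearI (nearI fG wGn) (near_comp_analytic Gx Pn).
  by apply: nearS => q [[fq wGq] Pq]; rewrite /= (fq wGq); exact: Pq.
move=> h; rewrite fx => /wreg[H Hx hH]; apply/reg_analyticE.
apply: (@expands_at_eq _ _ _ (H \o G)); last exact: expands_at_comp.
have := nearI (nearI fG wGn) (near_comp_analytic Gx hH).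
by apply: nearS => q [[fq wGq] Pq]; rewrite /= (fq wGq) -Pq.
Qed.

Lemma wpi_wpr (p : 'rV[C]_n.+1) (wp : wdom p) :
  wpi (wpr wp) = wsc w (p 0 ord0) (xpart p).
Proof. by rewrite /wpr wpiE; apply/rowP => i; rewrite !mxE. Qed.

Lemma wpi_morph (A : T) : morph_at (@wpi R n w) A.
Proof.
have [p <-] := wproj_surj A.
apply: (@morph_at_from_wspace _ _ _ (fun q => wsc w (q 0 ord0) (xpart q))).
  move=> i; under eq_fun do rewrite !mxE.
  by apply: expands_atM; [apply: expands_atX|]; exact: expands_at_coord.
by apply: filterE => q wq; rewrite wpi_wpr.
Qed.

(** Away from the fibre over 0 the coordinate u is non-zero, and the quotient [u / v] of the two
    values relates the representatives. *)
Lemma wpi_inj (A B : T) : (forall i, 0 < tnth w i)%N ->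
  wpi A != 0 -> wpi A = wpi B -> A = B.
Proof.
move=> w0; have [p <-] := wproj_surj A; have [q <-] := wproj_surj B.
rewrite -(wpr_val (set_val_in p)) -(wpr_val (set_val_in q)) !wpi_wpr => p0 pq.
have u0 (p' : 'rV[C]_n.+1) : wsc w (p' 0 ord0) (xpart p') != 0 -> p' 0 ord0 != 0.
  apply: contraNneq => u0; apply/eqP/rowP => i.
  by rewrite !mxE u0 expr0n gtn_eqF // mul0r.
have up := u0 _ p0; have uq : (set_val q : 'rV[C]_n.+1) 0 ord0 != 0 by apply: u0; rewrite -pq.
rewrite !wpr_val; apply/wproj_eq.
set u := (set_val p : 'rV[C]_n.+1) 0 ord0 in up pq *.
set v := (set_val q : 'rV[C]_n.+1) 0 ord0 in uq pq *.
exists (u / v); first by rewrite mulf_neq0 ?invr_eq0.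
apply/rowP => i; rewrite wact_coord; case: unliftP => [j ->|->]; last first.
  by rewrite -/u -/v invf_div mulfVK.
have /rowP /(_ j) := pq; rewrite !mxE => E.
rewrite expr_div_n mulrAC E mulrAC mulfV ?mul1r // expf_neq0 //.
Qed.

End WeightedSpace.

(** * The blowup outside the origin and its exceptional fibre *)

Section Blowup.
Context {R : realType} (n : nat) (w : n.-tuple nat) (w0 : forall i, (0 < tnth w i)%N).
Local Notation C := (cplx R).
Local Notation wdom := (@wdomain R n).
Local Notation T := (wspace R w).

Lemma wsc_eq0 (s : C) (x : 'rV[C]_n) : s != 0 -> wsc w s x = 0 -> x = 0.
Proof.
move=> s0 /rowP E; apply/rowP => i; have := E i; rewrite !mxE => /eqP.
by rewrite mulf_eq0 expf_eq0 (negPf s0) andbF /= => /eqP.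
Qed.

Lemma wsc_0l (x : 'rV[C]_n) : wsc w 0 x = 0.
Proof. by apply/rowP => i; rewrite !mxE expr0n gtn_eqF // mul0r. Qed.

Lemma wsc_0r (s : C) : wsc w s (0 : 'rV[C]_n) = 0.
Proof. by apply/rowP => i; rewrite !mxE mulr0. Qed.

Lemma wdom_pcons (u : C) (x : 'rV[C]_n) : x != 0 -> wdom (pcons u x).
Proof.
move=> x0; have /existsP[i xi] : [exists i, x 0 i != 0].
  apply: contraR x0; rewrite negb_exists => /forallP H.
  by apply/eqP/rowP => i; rewrite !mxE; apply/eqP; have := H i; rewrite negbK.
by exists i; rewrite pconsS.
Qed.

Lemma wsc1 (x : 'rV[C]_n) : wsc w 1 x = x.
Proof. by apply/rowP => i; rewrite !mxE expr1n mul1r. Qed.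

Lemma open_neq0 : open [set x : analytic_space R n | x != (0 : 'rV[C]_n)].
Proof.
rewrite openE => x x0; have /near_rowP : \forall z \near (pcons 0 x : 'rV[C]_n.+1), wdom z.
  exact/wdom_near/wdom_pcons.
move=> [e e0 H]; apply/near_rowP; exists e => // z zx; apply/eqP => z0.
have [|i] := H (pcons 0 z).
  move=> i; case: (unliftP ord0 i) => [j ->|->]; rewrite ?pconsS ?pcons0 //.
  by rewrite subrr normr0.
by rewrite pconsS z0 mxE eqxx.
Qed.

Section Strict.
Context (D Z : set (analytic_space R n)) (ZD : Z `<=` D).
Context (b : sub_space (wstrict w D Z) -> sub_space Z) (bw : is_wblowup w D Z b).

Lemma wblowup_in A : wstrict w D Z A -> Z (wpi A).
Proof. by move=> hA; rewrite -(to_subK hA) -bw; exact: set_val_in. Qed.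

Lemma wblowup_morphism : is_morphism b.
Proof.
apply: is_morphism_sub.
have -> : set_val \o b = @wpi R n w \o set_val by apply/funext => y; rewrite /= bw.
by apply: is_morphism_comp; [exact: set_val_morphism|apply/is_morphismP; exact: wpi_morph].
Qed.

(** Away from 0 the blowup is inverted by the section x -> [1, x]; the value [set_val y] outside the
    domain of the section is an arbitrary default. *)
Lemma wblowup_loc_iso y : wpi (set_val y) != 0 -> loc_iso b y.
Proof.
move=> y0; pose B := [set x : analytic_space R n | Z x /\ x != (0 : 'rV[C]_n)].
pose A := [set a : T | wstrict w D Z a /\ wpi a != 0].
pose g (x : analytic_space R n) : T :=
  if pselect (wdom (pcons 1 x)) is left h then wpr w h else set_val y.
have gE (x : 'rV[C]_n) (wx : wdom (pcons 1 x)) : g x = wpr w wx.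
  rewrite /g; case: pselect => [h|] //; congr (wproj w _); exact: val_inj.
have wpig (x : 'rV[C]_n) : x != 0 -> wpi (g x) = x.
  by move=> x0; rewrite (gE _ (wdom_pcons 1 x0)) wpi_wpr pcons0 xpartK wsc1.
have iAB : iso_rel A B (fun a x => A a /\ wpi a = x).
  apply: (@iso_rel_total _ _ _ _ _ _ g).
  - by move=> a _; exact: wpi_morph.
  - move=> x [_ x0]; apply: (morph_at_to_wspace (G := pcons 1)).
    + move=> i; case: (unliftP ord0 i) => [j ->|->].
        by under eq_fun do rewrite pconsS; exact: expands_at_coord.
      by under eq_fun do rewrite pcons0; exact: expands_at_cst.
    + exact: wdom_pcons.
    + by apply: filterE => z wz; exact: gE.
  - move=> a [sa a0]; split; first by split=> //; exact: wblowup_in.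
    by apply: wpi_inj; rewrite ?wpig.
  - move=> x [Zx x0]; split; last exact: wpig.
    split; last by rewrite wpig.
    split; last by rewrite /= wpig //; exact: ZD.
    by apply: subset_closure; rewrite /= wpig //; split=> //; exact/eqP.
have openA : open [set a : T | wpi a != 0].
  have cw : continuous (@wpi R n w) by move=> a; exact: (wpi_morph a).1.
  exact: (open_comp (fun a _ => cw a) open_neq0).
exists (set_val @^-1` A), (set_val @^-1` B); split.
- have -> : set_val @^-1` A = set_val @^-1` [set a : T | wpi a != 0] :> set (sub_space (wstrict w D Z)).
    by apply/seteqP; split=> [z []//|z z0]; split=> //; exact: set_val_in.
  have cs : continuous (set_val : sub_space (wstrict w D Z) -> T) by exact: initial_continuous.
  exact: (open_comp (fun a _ => cs a) openA).
- by split=> //; exact: set_val_in.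
- have -> : set_val @^-1` B = set_val @^-1` [set x : analytic_space R n | x != (0 : 'rV[C]_n)] :> set (sub_space Z).
    by apply/seteqP; split=> [z []//|z z0]; split=> //; exact: set_val_in.
  have cs : continuous (set_val : sub_space Z -> analytic_space R n) by exact: initial_continuous.
  exact: (open_comp (fun a _ => cs a) open_neq0).
apply/restricts_to_isoP.
have := @iso_rel_sub _ _ _ (wstrict w D Z) Z _ _ _ _ _ iAB.
case=> [a []//|x []//|f fi fr]; exists f => // x x'; rewrite -fr.
split=> [[Ax <-]|[Ax E]]; first by split=> //; rewrite bw.
by split=> //; apply: set_valI; rewrite bw.
Qed.

Lemma wblowup_centre z : centre b z -> set_val z = (0 : 'rV[C]_n).
Proof.
move=> [y ey <-]; rewrite bw; apply/eqP/negP => /negP y0.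
exact: (ey (wblowup_loc_iso y0)).
Qed.

(** If other points of the fibre over 0 come arbitrarily close to [y], the map is not injective near
    [y] and so no local isomorphism there. *)
Lemma wblowup_centre0 (z : sub_space Z) (y : sub_space (wstrict w D Z)) :
  set_val z = (0 : 'rV[C]_n) -> wpi (set_val y) = 0 ->
  (forall V : set T, open V -> V (set_val y) ->
     exists2 B, wstrict w D Z B & [/\ V B, B <> set_val y & wpi B = 0]) ->
  centre b z.
Proof.
move=> z0 y0 H; exists y; last by apply: set_valI; rewrite bw y0 z0.
move=> [V [U [oV Vy oU]]] /restricts_to_isoP iVU.
have [W [oW Wy WV]] : exists W : set T, [/\ open W, W (set_val y) & forall y', W (set_val y') -> V y'].
  by apply: sub_nbhs; exact: open_nbhs_nbhs.
have [B sB [WB By B0]] := H W oW Wy.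
have VB : V (to_sub sB) by apply: WV.
have E : to_sub sB = y.
  apply: (iso_rel_inj iVU (y := b y)); split=> //.
  by apply: set_valI; rewrite !bw y0 to_subK.
by apply: By; rewrite -E to_subK.
Qed.

(** The point [0, q] is a limit of the points [s, x], which lie over [Z] minus the origin. *)
Lemma wstrict_limit (q : 'rV[C]_n) (q0 : q != 0) : D (0 : 'rV[C]_n) ->
  (forall e : C, 0 < e -> exists (s : C) x, [/\ s != 0, `|s| < e,
     forall i, `|(x : 'rV[C]_n) 0 i - q 0 i| < e & Z (wsc w s x)]) ->
  wstrict w D Z (wpr w (wdom_pcons 0 q0)).
Proof.
move=> D0 H; split; last by rewrite /= wpi_wpr pcons0 wsc_0l.
move=> P /wquot_near Pq.
have /near_rowP[e e0 He] := nearI Pq (wdom_near (wdom_pcons 0 q0)).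
have [s [x [s0 se xe Zx]]] := H e e0.
have [] := He (pcons s x).
  move=> i; case: (unliftP ord0 i) => [j ->|->]; rewrite ?pconsS ?pcons0 //.
  by rewrite subr0.
move=> Px wx; exists (wpr w wx); split; last exact: Px.
rewrite /= wpi_wpr pcons0 xpartK; split=> // /(wsc_eq0 s0) x0.
by case: wx => i; rewrite pconsS x0 mxE eqxx.
Qed.

End Strict.
End Blowup.

(** * Lifting analytic maps to weighted blowups *)

Section Lifting.
Context {R : realType} (n : nat) (w : n.-tuple nat) (w0 : forall i, (0 < tnth w i)%N).
Local Notation C := (cplx R).
Local Notation wdom := (@wdomain R n).
Local Notation T := (wspace R w).

Definition smap (c : 'I_n -> pwseries R n) (x : 'rV[C]_n) : 'rV[C]_n :=
  \row_i psval (c i) x.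

(** The map (u, x) -> (u, u^(-w_i) c_i(u^w x)), which is analytic across u = 0 when c_i has weight
    at least w_i. *)
Definition liftmap (c : 'I_n -> pwseries R n) (p : 'rV[C]_n.+1) : 'rV[C]_n.+1 :=
  pcons (p 0 ord0) (\row_i liftf w (tnth w i) (c i) p).

Definition admissible (c : 'I_n -> pwseries R n) (r : C) : Prop :=
  forall i, wt_ge w (c i) (tnth w i) /\ cauchy_bound r (c i).

Lemma lift_dom_open (r : C) (p : 'rV[C]_n.+1) :
  lift_dom w r p -> \forall q \near p, lift_dom w r q.
Proof.
move=> rp; have near_i (s : seq 'I_n) : \forall q \near p,
    forall i, i \in s -> `|(q : 'rV[C]_n.+1) 0 ord0| ^+ tnth w i * `|q 0 (lift ord0 i)| < r.
  elim: s => [|i s IH]; first by apply: filterE.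
  have ci : expands_at p (fun q => q 0 ord0 ^+ tnth w i * q 0 (lift ord0 i)).
    by apply: expands_atM; [apply: expands_atX|]; exact: expands_at_coord.
  have FF : Filter (nbhs p) by exact: nbhs_filter.
  have : \forall q \near p, `|(q : 'rV[C]_n.+1) 0 ord0 ^+ tnth w i * q 0 (lift ord0 i)| < r.
    have /cvgrPdist_lt /(_ (r - `|p 0 ord0 ^+ tnth w i * p 0 (lift ord0 i)|)) := expands_at_continuous ci.
    rewrite subr_gt0 normrM normrX => /(_ (rp i)); apply: nearS => q qp.
    rewrite -[X in `|X|](subrK (p 0 ord0 ^+ tnth w i * p 0 (lift ord0 i))).
    apply: le_lt_trans (ler_normD _ _) _.
    by rewrite distrC -ltrBrDr (normrM (p 0 ord0 ^+ _)) normrX.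
  move=> near_h; apply: nearS (nearI near_h IH) => q [qi qs] j.
  by rewrite in_cons => /orP[/eqP ->|/qs //]; rewrite -normrX -normrM.
by apply: nearS (near_i (enum 'I_n)) => q H i; apply: H; rewrite mem_enum.
Qed.

Lemma psval_cb_analytic m (r : C) (c : pwseries R m) (x : 'rV[C]_m) :
  cauchy_bound r c -> polydisc r x -> expands_at x (psval c).
Proof.
move=> [M cM] xr; apply/expands_atP.
apply: (@psval_anaK _ _ (fun=> r) c M) => // a.
by rewrite prodrXr.
Qed.

Lemma polydisc_open m (r : C) (y : 'rV[C]_m) : polydisc r y -> \forall z \near y, polydisc r z.
Proof.
move=> ry; have r_gt0 i : 0 < r - `|y 0 i| by rewrite subr_gt0.
have [e e0 He] := common_pos_fin r_gt0.
apply/near_rowP; exists e => // z zy i.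
rewrite -[z 0 i](subrK (y 0 i)); apply: le_lt_trans (ler_normD _ _) _.
by rewrite -ltrBrDr; exact: lt_le_trans (zy i) (He i).
Qed.

Lemma expands_at_neq0 m (h : 'rV[C]_m -> C) (p : 'rV[C]_m) :
  expands_at p h -> h p != 0 -> \forall q \near p, h q != 0.
Proof.
move=> ph hp; have FF : Filter (nbhs p) by exact: nbhs_filter.
have /cvgrPdist_lt /(_ `|h p|) := expands_at_continuous ph.
rewrite normr_gt0 => /(_ hp); apply: nearS => q; apply: contraTneq => ->.
by rewrite subr0 ltxx.
Qed.

Section One.
Context (r : C) (r0 : 0 < r) (c : 'I_n -> pwseries R n) (cr : admissible c r).

Lemma wsc_liftmap p : lift_dom w r p ->
  wsc w (liftmap c p 0 ord0) (xpart (liftmap c p)) = smap c (wsc w (p 0 ord0) (xpart p)).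
Proof.
move=> rp; rewrite /liftmap pcons0 xpartK; apply/rowP => i; rewrite !mxE.
by have [ci ri] := cr i; rewrite (liftfE ci ri r0 rp).
Qed.

Lemma liftmap_expands p i : lift_dom w r p -> expands_at p (fun q => liftmap c q 0 i).
Proof.
move=> rp; rewrite /liftmap; case: (unliftP ord0 i) => [j ->|->].
  under eq_fun do rewrite pconsS mxE.
  by have [_ rj] := cr j; exact: liftf_expands rj r0 rp.
by under eq_fun do rewrite pcons0; exact: expands_at_coord.
Qed.

Lemma liftmap_wact l p : l != 0 -> lift_dom w r p ->
  liftmap c (wact w l p) = wact w l (liftmap c p).
Proof.
move=> l0 rp; apply/rowP => i; rewrite wact_coord /liftmap.
case: unliftP => [j ->|->]; last by rewrite !pcons0 wact_coord unlift_none.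
rewrite !pconsS !mxE; have [cj rj] := cr j.
exact: liftf_wact cj rj r0 rp.
Qed.

Lemma monomial_at0 m (a : {ffun 'I_m -> nat}) i : a i != 0%N -> monomial a (0 : 'rV[C]_m) = 0.
Proof. by move=> ai; rewrite /monomial (bigD1 i) //= mxE expr0n (negPf ai) mul0r. Qed.

Lemma liftmap_x0 p : xpart p = 0 -> xpart (liftmap c p) = 0.
Proof.
move=> p0; rewrite xpartK; apply/rowP => i; rewrite !mxE.
have [ci ri] := cr i; have rp : lift_dom w r p.
  by apply/lift_domE => j; rewrite p0 wsc_0r mxE normr0.
have := liftf_hsum ci ri r0 rp.
move=> H; apply: (hsum_unique H); rewrite p0.
rewrite (_ : (fun _ => _) = (fun=> 0)); first exact: hsum0.
apply/funext => a; case: (eqVneq (c i a) 0) => [->|/ci wa]; first by rewrite mul0r.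
have [/existsP[j aj]|] := boolP [exists j, a j != 0%N]; first by rewrite (monomial_at0 aj) !mulr0.
rewrite negb_exists => /forallP a0; move: wa (w0 i).
rewrite /mon_wt big1 => [|j _]; first by rewrite leqn0 => /eqP ->.
by have := a0 j; rewrite negbK => /eqP ->; rewrite muln0.
Qed.

Lemma smap0 : smap c 0 = 0.
Proof.
have rp : lift_dom w r (0 : 'rV[C]_n.+1) by move=> i; rewrite !mxE normr0 mulr0.
have E : xpart (0 : 'rV[C]_n.+1) = 0 by apply/rowP => i; rewrite !mxE.
by have := wsc_liftmap rp; rewrite E (liftmap_x0 E) !wsc_0r.
Qed.

End One.

Section Two.
Context (r : C) (r0 : 0 < r) (c c' : 'I_n -> pwseries R n).
Context (cr : admissible c r) (cr' : admissible c' r).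
Context (D D' Z Z' : set (analytic_space R n)) (ZD : Z `<=` D) (ZD' : Z' `<=` D').
Context (FZ : forall x : 'rV[C]_n, polydisc r x -> Z x -> Z' (smap c x) /\ smap c' (smap c x) = x).

(** For u non-zero this is the identity on [Z] divided by powers of u. It extends to u = 0 by
    density: if a coordinate differed at [p], it would differ nearby, also at points over [Z] minus
    the origin, of which [p] is a limit. *)
Lemma liftmapK p : wdom p -> lift_dom w r p -> lift_dom w r (liftmap c p) ->
  (forall wp : wdom p, wstrict w D Z (wpr w wp)) -> liftmap c' (liftmap c p) = p.
Proof.
move=> wp rp rp' sp.
have gen (q : 'rV[C]_n.+1) : q 0 ord0 != 0 -> lift_dom w r q -> lift_dom w r (liftmap c q) ->
    Z (wsc w (q 0 ord0) (xpart q)) -> liftmap c' (liftmap c q) = q.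
  move=> u0 rq rq' Zq; have [_ E] := FZ ((lift_domE _ _ _).1 rq) Zq.
  have := wsc_liftmap r0 cr' rq'; rewrite (wsc_liftmap r0 cr rq) E {1 2}/liftmap !pcons0 => H.
  rewrite -[RHS]pconsK -[LHS]pconsK; congr pcons.
    by rewrite /liftmap !pcons0.
  apply/rowP => i; apply: (mulfI (expf_neq0 (tnth w i) u0)).
  by have /rowP /(_ i) := H; rewrite [LHS]mxE [RHS]mxE.
have [//|i0] := boolP (liftmap c' (liftmap c p) == p); first exact/eqP.
exfalso.
have [i ni] : exists i, liftmap c' (liftmap c p) 0 i != p 0 i.
  apply/existsP; apply: contraR i0; rewrite negb_exists => /forallP H.
  by apply/eqP/rowP => i; have := H i; rewrite negbK => /eqP.
have ei : expands_at p (fun q => liftmap c' (liftmap c q) 0 i - q 0 i).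
  apply: expands_atD; last by apply: expands_atN; exact: expands_at_coord.
  apply: (expands_at_comp (F := fun q => liftmap c' q 0 i)).
    exact: (liftmap_expands r0 cr' i rp').
  by move=> j; exact: (liftmap_expands r0 cr j rp).
have n0 : \forall q \near p, liftmap c' (liftmap c q) 0 i - q 0 i != 0.
  by apply: expands_at_neq0 ei _; rewrite subr_eq0.
have lq := near_comp_analytic (fun i => liftmap_expands r0 cr i rp) (lift_dom_open rp').
have near_p := nearI n0 (nearI (lift_dom_open rp) lq).
have [clp _] := sp wp.
have [] := clp [set A | exists q (wq : wdom q), [/\ wpr w wq = A,
    liftmap c' (liftmap c q) 0 i - q 0 i != 0, lift_dom w r q & lift_dom w r (liftmap c q)]].
  by apply/wquot_near; apply: nearS near_p => q [q1 [q2 q3]] wq; exists q, wq; split.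
move=> A [[/= ZA A0] [q [wq [qA q1 q2 q3]]]].
move: ZA A0; rewrite -qA wpi_wpr => ZA A0.
have u0 : q 0 ord0 != 0 by apply/eqP => u0; apply: A0; rewrite u0 wsc_0l.
by move: q1; rewrite (gen q u0 q2 q3 ZA) subrr eqxx.
Qed.

(** Chosen through some representative, with default [A] where no lift exists; homogeneity makes the
    choice immaterial, see [bliftE]. *)
Definition blift (A : T) : T :=
  xget A [set B | exists p (wp : wdom p) (wl : wdom (liftmap c p)),
                    [/\ lift_dom w r p, wpr w wp = A & wpr w wl = B]].

Lemma bliftE p (wp : wdom p) (wl : wdom (liftmap c p)) : lift_dom w r p ->
  blift (wpr w wp) = wpr w wl.
Proof.
move=> rp; rewrite /blift; case: xgetP => [B _ [q [wq [wl' [rq E <-]]]]|]; last first.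
  by move=> /(_ (wpr w wl)) []; exists p, wp, wl.
have [l l0 pq] := (wproj_eq _ _ _).1 E.
apply/wproj_eq; exists l => //; move: pq; rewrite !to_subK => ->.
by rewrite (liftmap_wact r0 cr).
Qed.

Definition bdom : set T :=
  [set A | [/\ wstrict w D Z A, polydisc r (wpi A) & polydisc r (smap c (wpi A))]].

Context (wZ : forall A, wstrict w D Z A -> Z (wpi A)).

Lemma bdomP A : bdom A -> exists p (wp : wdom p) (wl : wdom (liftmap c p)),
  [/\ lift_dom w r p, lift_dom w r (liftmap c p), A = wpr w wp, blift A = wpr w wl
    & liftmap c' (liftmap c p) = p].
Proof.
move=> [sA rA rA']; have [p pA] := wproj_surj A.
have wp := set_val_in p; rewrite -(wpr_val _ wp) in pA.
move: rA rA'; rewrite -pA wpi_wpr => rA rA'.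
have rp : lift_dom w r (set_val p : 'rV[C]_n.+1) by apply/lift_domE.
have rp' : lift_dom w r (liftmap c (set_val p : 'rV[C]_n.+1)).
  by apply/lift_domE; rewrite (wsc_liftmap r0 cr).
have K : liftmap c' (liftmap c (set_val p : 'rV[C]_n.+1)) = set_val p.
  apply: liftmapK => // wp'.
  by rewrite (_ : wp' = wp) ?pA //; exact: Prop_irrelevance.
(* If the x-part of the lift vanished, so would that of [p], which [liftmap c'] recovers from it. *)
have wl : wdom (liftmap c (set_val p : 'rV[C]_n.+1)).
  rewrite -[X in wdom X]pconsK; apply: wdom_pcons; apply/eqP => l0.
  have := liftmap_x0 r0 cr' l0; rewrite K => x0.
  by case: (wp) => i; have /rowP /(_ i) := x0; rewrite !mxE => ->; rewrite eqxx.
by exists (set_val p), wp, wl; split=> //; rewrite bliftE.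
Qed.

Lemma blift_morph A : bdom A -> morph_at blift A.
Proof.
move=> /bdomP[p [wp [wl [rp rp' -> _ _]]]].
apply: (@morph_at_wspace _ _ _ blift (to_sub wp) (liftmap c)) => //.
  by move=> i; exact: (liftmap_expands r0 cr i rp).
by apply: nearS (lift_dom_open rp) => q rq wq wG; exact: bliftE.
Qed.

Lemma blift_pi A : bdom A -> wpi (blift A) = smap c (wpi A).
Proof.
move=> /bdomP[p [wp [wl [rp rp' EA -> _]]]].
by rewrite wpi_wpr (wsc_liftmap r0 cr) // EA wpi_wpr.
Qed.

(** Closures go to closures once points over [Z] minus 0 go to points over [Z'] minus 0; they do,
    because [smap c'] fixes 0 and inverts [smap c] on [Z]. *)
Lemma blift_strict A : bdom A -> wstrict w D' Z' (blift A).
Proof.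
move=> hA; have [p [wp [wl [rp rp' EA -> K]]]] := bdomP hA.
case: (hA) => sA rA rA'; have [ZA' _] := FZ rA (wZ sA); split; last first.
  by rewrite /= -(bliftE wp wl rp) -EA blift_pi //; exact: ZD'.
move=> P /wquot_near /= Pl.
have near_P := near_comp_analytic (fun i => liftmap_expands r0 cr i rp) Pl.
have near_w := near_comp_analytic (fun i => liftmap_expands r0 cr i rp) (wdom_near wl).
have near_p := nearI (nearI near_P near_w) (lift_dom_open rp).
case: sA => clA _; have [|B] := clA [set B | exists q (wq : wdom q) (wl' : wdom (liftmap c q)),
    [/\ wpr w wq = B, P (wpr w wl') & lift_dom w r q]].
  rewrite EA; apply/wquot_near; apply: nearS near_p => q [[Pq wq'] rq] wq.
  by exists q, wq, wq'; split.
move=> [[/= ZB B0] [q [wq [wl' [EB Pq rq]]]]]; exists (wpr w wl'); split=> //.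
rewrite /= wpi_wpr (wsc_liftmap r0 cr rq); move: ZB B0; rewrite -EB wpi_wpr => ZB B0.
have [Zq Kq] := FZ ((lift_domE _ _ _).1 rq) ZB; split=> // E0.
by apply: B0; rewrite -Kq E0 (smap0 r0 cr').
Qed.

End Two.

Lemma blift_inv (r : C) (r0 : 0 < r) (c c' : 'I_n -> pwseries R n)
    (cr : admissible c r) (cr' : admissible c' r) (D D' Z Z' : set (analytic_space R n)) :
  Z `<=` D -> Z' `<=` D' ->
  (forall x : 'rV[C]_n, polydisc r x -> Z x -> Z' (smap c x) /\ smap c' (smap c x) = x) ->
  (forall A, wstrict w D Z A -> Z (wpi A)) ->
  forall A, bdom r c D Z A ->
    bdom r c' D' Z' (blift r c A) /\ blift r c' (blift r c A) = A.
Proof.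
move=> ZD ZD' FZ wZ A hA; have hB := blift_strict r0 cr cr' ZD' FZ wZ hA.
have [p [wp [wl [rp rp' EA EB K]]]] := bdomP r0 cr cr' FZ hA.
have E : blift r c' (blift r c A) = A.
  have wp' : wdom (liftmap c' (liftmap c p)) by rewrite K.
  rewrite EB (bliftE r0 cr' wl wp' rp') EA; congr (wproj w _); apply: val_inj; exact: K.
case: (hA) => sA rA rA'; have [_ KA] := FZ _ rA (wZ _ sA).
by do !split=> //; rewrite (blift_pi r0 cr cr' FZ hA) ?KA.
Qed.

(** The neighbourhoods [N] and [bdom] consist of the points that stay in the polydisc of convergence
    under the map, so the forward and the backward map exchange them exactly. *)
Theorem wblowup_equivalent (r : C) (r0 : 0 < r) (c c' : 'I_n -> pwseries R n)
    (D D' Z Z' : set (analytic_space R n))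
    (b : sub_space (wstrict w D Z) -> sub_space Z)
    (b' : sub_space (wstrict w D' Z') -> sub_space Z') :
  admissible c r -> admissible c' r -> Z `<=` D -> Z' `<=` D' ->
  (forall x : 'rV[C]_n, polydisc r x -> Z x -> Z' (smap c x) /\ smap c' (smap c x) = x) ->
  (forall x : 'rV[C]_n, polydisc r x -> Z' x -> Z (smap c' x) /\ smap c (smap c' x) = x) ->
  is_wblowup w D Z b -> is_wblowup w D' Z' b' -> locally_equivalent b b'.
Proof.
move=> cr cr' ZD ZD' FZ FZ' bw bw'.
pose N (c : 'I_n -> pwseries R n) (Z : set (analytic_space R n)) : set (analytic_space R n) :=
  [set x : 'rV[C]_n | [/\ Z x, polydisc r x & polydisc r (smap c x)]].
have N0 (d : 'I_n -> pwseries R n) (V : set (analytic_space R n)) : admissible d r -> V (0 : 'rV[C]_n) -> N d V (0 : 'rV[C]_n).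
  by move=> dr V0; split=> //; rewrite ?(smap0 r0 dr) => i; rewrite mxE normr0.
have No (d : 'I_n -> pwseries R n) (V : set (analytic_space R n)) : admissible d r ->
    open (set_val @^-1` N d V : set (sub_space V)).
  move=> dr; rewrite openE => x [Vx rx rdx].
  have dx i : expands_at (set_val x : 'rV[C]_n) (fun z => smap d z 0 i).
    under eq_fun do rewrite mxE.
    by have [_ ri] := dr i; exact: (psval_cb_analytic ri rx).
  have := nearI (polydisc_open rx) (near_comp_analytic dx (polydisc_open rdx)).
  move=> /(@nbhs_sub R (analytic_space R n) V x); apply: nearS => z [rz rdz].
  by split=> //; exact: set_val_in.
have iN : iso_rel (N c Z) (N c' Z') (fun x y => N c Z x /\ smap c x = y).
  have sa (d : 'I_n -> pwseries R n) (x : analytic_space R n) : admissible d r -> polydisc r x ->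
      @morph_at R (analytic_space R n) (analytic_space R n) (smap d) x.
    move=> dr rx; apply: morph_at_analytic => i; under eq_fun do rewrite mxE.
    by have [_ ri] := dr i; exact: (psval_cb_analytic ri rx).
  apply: (@iso_rel_total R (analytic_space R n) (analytic_space R n) _ _ (smap c) (smap c')).
  - by move=> x [_ rx _]; exact: sa.
  - by move=> x [_ rx _]; exact: sa.
  - by move=> x [Zx rx rx']; have [? E] := FZ _ rx Zx; do !split=> //; rewrite E.
  - by move=> x [Zx rx rx']; have [? E] := FZ' _ rx Zx; do !split=> //; rewrite E.
have wZ := wblowup_in bw; have wZ' := wblowup_in bw'.
have iB : iso_rel (bdom r c D Z) (bdom r c' D' Z') (fun A B => bdom r c D Z A /\ blift r c A = B).
  apply: (@iso_rel_total _ _ _ _ _ _ (blift r c')).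
  - by move=> A hA; exact: (blift_morph r0 cr cr' FZ hA).
  - by move=> A hA; exact: (blift_morph r0 cr' cr FZ' hA).
  - by move=> A hA; exact: (blift_inv r0 cr cr' ZD ZD' FZ wZ hA).
  - by move=> A hA; exact: (blift_inv r0 cr' cr ZD' ZD FZ' wZ' hA).
apply/locally_equivalentP.
exists (set_val @^-1` N c Z), (set_val @^-1` N c' Z').
exists (fun x y => N c Z (set_val x) /\ smap c (set_val x) = set_val y).
exists (fun x y => bdom r c D Z (set_val x) /\ blift r c (set_val x) = set_val y).
split.
- split; first exact: No.
  move=> x /(wblowup_centre w0 ZD bw) x0 /=; rewrite x0; apply: N0 => //.
  by rewrite -x0; exact: set_val_in.
- split; first exact: No.
  move=> x /(wblowup_centre w0 ZD' bw') x0 /=; rewrite x0; apply: N0 => //.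
  by rewrite -x0; exact: set_val_in.
- have := @iso_rel_sub _ _ _ Z Z' _ _ _ _ _ iN.
  by apply=> x [].
- have := @iso_rel_sub _ _ _ (wstrict w D Z) (wstrict w D' Z') _ _ _ _ _ iB.
  have -> : b @^-1` (set_val @^-1` N c Z) = set_val @^-1` bdom r c D Z.
    apply/seteqP; split=> y /=; rewrite bw; first by case=> ? ? ?; split=> //; exact: (set_val_in y).
    by case=> h ? ?; split=> //; exact: (wZ _ h).
  have -> : b' @^-1` (set_val @^-1` N c' Z') = set_val @^-1` bdom r c' D' Z'.
    apply/seteqP; split=> y /=; rewrite bw'; first by case=> ? ? ?; split=> //; exact: (set_val_in y).
    by case=> h ? ?; split=> //; exact: (wZ' _ h).
  by apply=> x [].
- move=> y y' [hy Ey]; rewrite bw bw'; rewrite -Ey (blift_pi r0 cr cr' FZ hy).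
  by case: hy => sy ry ry'; split=> //; split=> //; exact: wZ.
Qed.

End Lifting.

(** * Germs of hypersurfaces *)

Section Germs.
Context {R : realType}.
Local Notation C := (cplx R).

Definition analytic0 n m (Phi : 'rV[C]_n -> 'rV[C]_m) : Prop :=
  forall i, expands_at 0 (fun x => Phi x 0 i).

Lemma analytic0_near n m (Phi : 'rV[C]_n -> 'rV[C]_m) (P : 'rV[C]_m -> Prop) :
  analytic0 Phi -> Phi 0 = 0 -> (\forall y \near (0 : 'rV[C]_m), P y) ->
  \forall x \near (0 : 'rV[C]_n), P (Phi x).
Proof. by move=> aP P0; have := @near_comp_analytic R n m Phi 0 P aP; rewrite P0. Qed.

Lemma analytic0_comp n m k (Phi : 'rV[C]_n -> 'rV[C]_m) (h : 'rV[C]_m -> 'rV[C]_k) :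
  analytic0 Phi -> Phi 0 = 0 -> analytic0 h -> analytic0 (h \o Phi).
Proof.
by move=> aP P0 ah i; apply: (expands_at_comp (F := fun y => h y 0 i)) => //; rewrite P0.
Qed.

Definition germ_map n (F F' : 'rV[C]_n -> C) (Phi : 'rV[C]_n -> 'rV[C]_n) : Prop :=
  [/\ analytic0 Phi, Phi 0 = 0 &
      \forall x \near (0 : 'rV[C]_n), F x = 0 -> F' (Phi x) = 0].

(** The two maps are extensions of mutually inverse maps of zero sets to the ambient space, so they
    need to invert each other on the zero sets only. *)
Definition germ_pair n (F F' : 'rV[C]_n -> C) (Phi Psi : 'rV[C]_n -> 'rV[C]_n) : Prop :=
  [/\ germ_map F F' Phi, germ_map F' F Psi,
      \forall x \near (0 : 'rV[C]_n), F x = 0 -> Psi (Phi x) = x &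
      \forall x \near (0 : 'rV[C]_n), F' x = 0 -> Phi (Psi x) = x].

Lemma germ_pair_sym n (F F' : 'rV[C]_n -> C) Phi Psi :
  germ_pair F F' Phi Psi -> germ_pair F' F Psi Phi.
Proof. by case. Qed.

Lemma germ_map_comp n (F F' F'' : 'rV[C]_n -> C) Phi Phi' :
  germ_map F F' Phi -> germ_map F' F'' Phi' -> germ_map F F'' (Phi' \o Phi).
Proof.
move=> [aP P0 FP] [aP' P0' FP']; split; first exact: analytic0_comp.
  by rewrite /= P0.
have := nearI FP (analytic0_near aP P0 FP').
by apply: nearS => x [Fx F'x] /Fx /F'x.
Qed.

Lemma germ_pair_comp n (F F' F'' : 'rV[C]_n -> C) Phi Psi Phi' Psi' :
  germ_pair F F' Phi Psi -> germ_pair F' F'' Phi' Psi' ->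
  germ_pair F F'' (Phi' \o Phi) (Psi \o Psi').
Proof.
move=> [gP gQ PQ QP] [gP' gQ' PQ' QP']; split; [exact: germ_map_comp gP gP'|
  exact: germ_map_comp gQ' gQ| |].
- case: gP => aP P0 FP; have := nearI PQ (nearI FP (analytic0_near aP P0 PQ')).
  by apply: nearS => x [Ex [Fx E'x]] F0 /=; rewrite (E'x (Fx F0)) (Ex F0).
- case: gQ' => aP P0 FP; have := nearI QP' (nearI FP (analytic0_near aP P0 QP)).
  by apply: nearS => x [Ex [Fx E'x]] F0 /=; rewrite (E'x (Fx F0)) (Ex F0).
Qed.

Lemma polydisc_near0 n (e : C) : 0 < e -> \forall x \near (0 : 'rV[C]_n), polydisc e x.
Proof. by move=> e0; apply: polydisc_open => i; rewrite mxE normr0. Qed.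

Section GermMaps.
Context (n : nat) (r r' : C) (F F' : 'rV[C]_n -> C).
Local Notation Z := (@zero_locus R n r F).
Local Notation Z' := (@zero_locus R n r' F').

(** The coordinates of the target, pulled back by the isomorphism, are regular on the source, hence
    locally restrictions of analytic functions of the ambient space. These are the components of
    [Phi]. *)
Lemma germ_map_ex (O : sub_space Z) (O' : sub_space Z') (U : set (sub_space Z))
    (U' : set (sub_space Z')) (s : sub_space Z -> sub_space Z' -> Prop) :
  set_val O = (0 : 'rV[C]_n) -> set_val O' = (0 : 'rV[C]_n) ->
  open U -> open U' -> iso_rel U U' s -> s O O' ->
  exists Phi : 'rV[C]_n -> 'rV[C]_n, [/\ analytic0 Phi, Phi 0 = 0 &
    \forall x \near (0 : 'rV[C]_n), forall zx : Z x,
      exists2 y, s (to_sub zx) y & set_val y = Phi x].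
Proof.
move=> O0 O0' oU oU' iUU; have [f [[cf rf] _] fr] := iUU; move=> sO.
have [v vO fo] := (fr _ _).1 sO.
have rc i : reg (sub_space Z') O' (fun y => (set_val y : 'rV[C]_n) 0 i).
  exists (fun x : 'rV[C]_n => x 0 i); last by apply: filterE.
  by apply/reg_analyticE; exact: expands_at_coord.
have rc2 i : reg (sub_space U') (f v) (fun y => (set_val (set_val y) : 'rV[C]_n) 0 i).
  exists (fun y => (set_val y : 'rV[C]_n) 0 i); last by apply: filterE.
  by rewrite fo; exact: rc.
have ex i : exists H : 'rV[C]_n -> C, expands_at 0 H /\
    \forall x \near (0 : 'rV[C]_n), forall (zx : Z x) (ux : U (to_sub zx)),
      (set_val (set_val (f (to_sub ux))) : 'rV[C]_n) 0 i = H x.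
  have [H Hv near_H] := rf _ _ (rc2 i).
  rewrite vO in Hv; case: Hv => H' H'0 near_H'.
  exists H'; split; first by apply/reg_analyticE; rewrite -O0.
  have [V [oV Vo VH]] := sub_nbhs near_H; rewrite vO in Vo.
  have nV : nbhs O V by exact: open_nbhs_nbhs.
  have [W [oW WO WH]] := sub_nbhs (nearI nV near_H').
  have : nbhs (0 : 'rV[C]_n) W by apply: open_nbhs_nbhs; rewrite -O0.
  apply: nearS => x Wx zx ux; have [Vx E] := WH (to_sub zx) Wx.
  by have := VH (to_sub ux) Vx; rewrite /= E to_subK.
have [H HP] := boolp.choice ex.
have UO : U O by rewrite -vO; exact: set_val_in.
have nU : nbhs O U by exact: open_nbhs_nbhs.
have [W [oW WO WU]] := sub_nbhs nU.
have nW : nbhs (0 : 'rV[C]_n) W by apply: open_nbhs_nbhs; rewrite -O0.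
have nH : \forall x \near (0 : 'rV[C]_n), forall i, forall (zx : Z x) (ux : U (to_sub zx)),
    (set_val (set_val (f (to_sub ux))) : 'rV[C]_n) 0 i = H i x.
  have FF : Filter (nbhs (0 : 'rV[C]_n)) by exact: nbhs_filter.
  exact: (@filter_forall _ _ _ (nbhs (0 : 'rV[C]_n)) FF (fun i => (HP i).2)).
have nE : \forall x \near (0 : 'rV[C]_n), forall zx : Z x,
      exists2 y, s (to_sub zx) y & set_val y = \row_i H i x.
  apply: nearS (nearI nW nH) => x [Wx Hx] zx.
  have ux : U (to_sub zx) by exact: WU.
  exists (set_val (f (to_sub ux))); first by apply/fr; exists (to_sub ux).
  by apply/rowP => i; rewrite mxE; exact: Hx.
exists (fun x => \row_i H i x); split=> //.
- by move=> i; under eq_fun do rewrite mxE; exact: (HP i).1.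
- have Z0 : Z (0 : 'rV[C]_n) by rewrite -O0; exact: set_val_in.
  have [y sy <-] := nbhs_singleton nE Z0; rewrite -O0'; congr set_val.
  have EO : to_sub Z0 = O by apply: set_valI; rewrite to_subK O0.
  by rewrite EO in sy; exact: (iso_rel_fun iUU sy sO).
Qed.

End GermMaps.

Section Pair.
Context (n : nat) (r r' : C) (r_gt0 : 0 < r) (r_gt0' : 0 < r') (F F' : 'rV[C]_n -> C).
Local Notation Z := (@zero_locus R n r F).
Local Notation Z' := (@zero_locus R n r' F').

Lemma germ_iso_pair (O : sub_space Z) (O' : sub_space Z') :
  set_val O = (0 : 'rV[C]_n) -> set_val O' = (0 : 'rV[C]_n) -> germ_iso O O' ->
  exists Phi Psi, germ_pair F F' Phi Psi.
Proof.
move=> O0 O0' /germ_isoP[U [U' [s [oU oU' sUU sO]]]].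
have [Phi [aP P0 sP]] := germ_map_ex O0 O0' oU oU' sUU sO.
have [Psi [aQ Q0 sQ]] := germ_map_ex O0' O0 oU' oU (iso_rel_inv sUU) sO.
exists Phi, Psi.
have gP : \forall x \near (0 : 'rV[C]_n), F x = 0 -> F' (Phi x) = 0.
  apply: nearS (nearI (polydisc_near0 n r_gt0) sP) => x [rx sx] F0.
  have [y _ <-] := sx (conj rx F0); by have [] := set_val_in y.
have gQ : \forall x \near (0 : 'rV[C]_n), F' x = 0 -> F (Psi x) = 0.
  apply: nearS (nearI (polydisc_near0 n r_gt0') sQ) => x [rx sx] F0.
  have [y _ <-] := sx (conj rx F0); by have [] := set_val_in y.
split=> //.
- have := nearI (nearI (polydisc_near0 n r_gt0) sP) (analytic0_near aP P0 sQ).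
  apply: nearS => x [[rx sx] sPx] F0; have [y sy yP] := sx (conj rx F0).
  have zy : Z' (Phi x) by rewrite -yP; exact: set_val_in.
  have [x' sx' <-] := sPx zy.
  have E : to_sub zy = y by apply: set_valI; rewrite to_subK.
  by rewrite E in sx'; rewrite (iso_rel_inj sUU sx' sy).
- have := nearI (nearI (polydisc_near0 n r_gt0') sQ) (analytic0_near aQ Q0 sP).
  apply: nearS => x [[rx sx] sPx] F0; have [y sy yP] := sx (conj rx F0).
  have zy : Z (Psi x) by rewrite -yP; exact: set_val_in.
  have [x' sx' <-] := sPx zy.
  have E : to_sub zy = y by apply: set_valI; rewrite to_subK.
  by rewrite E in sx'; rewrite (iso_rel_fun sUU sx' sy).
Qed.

End Pair.

Lemma polydisc_min n (e e' : C) (x : 'rV[C]_n) : e <= e' -> polydisc e x -> polydisc e' x.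
Proof. by move=> ee xe i; exact: lt_le_trans (xe i) ee. Qed.

Lemma cauchy_bound_min n (e e' : C) (c : pwseries R n) : 0 < e -> e <= e' ->
  cauchy_bound e' c -> cauchy_bound e c.
Proof.
move=> e0 ee [M cM]; exists M => a; apply: le_trans (cM a).
by apply: ler_wpM2l => //; apply: lerXn2r => //; rewrite nnegrE ltW // (lt_le_trans e0).
Qed.

Definition weight_ge n (w : n.-tuple nat) d (h : 'rV[C]_n -> C) : Prop :=
  exists2 c, series_at h c & wt_ge w c d.

(** A common radius has to serve the convergence of both maps, the two polydiscs and the identities
    of the germ pair. *)
Lemma wblowup_equivalent_germ n (w : n.-tuple nat) (r r' : C) (F F' : 'rV[C]_n -> C)
    (Phi Psi : 'rV[C]_n -> 'rV[C]_n)
    (b : sub_space (wstrict w (polydisc r) (zero_locus r F)) -> sub_space (zero_locus r F))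
    (b' : sub_space (wstrict w (polydisc r') (zero_locus r' F')) -> sub_space (zero_locus r' F')) :
  (forall i, 0 < tnth w i)%N -> 0 < r -> 0 < r' ->
  is_wblowup w (polydisc r) (zero_locus r F) b ->
  is_wblowup w (polydisc r') (zero_locus r' F') b' ->
  germ_pair F F' Phi Psi ->
  (forall i, weight_ge w (tnth w i) (fun x => Phi x 0 i)) ->
  (forall i, weight_ge w (tnth w i) (fun x => Psi x 0 i)) ->
  locally_equivalent b b'.
Proof.
move=> w0 r0 r0' bw bw' [gP gQ PQ QP] wP wQ.
have ex (Th : 'rV[C]_n -> 'rV[C]_n) : (forall i, weight_ge w (tnth w i) (fun x => Th x 0 i)) ->
    exists c d, [/\ 0 < d, @admissible R n w c d &
      forall x : 'rV[C]_n, polydisc d x -> Th x = smap c x].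
  move=> wT; have [c cP] := boolp.choice (fun i => (let: ex_intro2 c p q := wT i in ex_intro _ c (conj p q))).
  have cd i : exists d : C, [/\ 0 < d, cauchy_bound d (c i) &
      forall x : 'rV[C]_n, polydisc d x -> Th x 0 i = psval (c i) x].
    have [[[d d0 cd] [e e0 he]] _] := cP i.
    have [f [f0 fd fe]] := pos_min2 d0 e0; exists f; split=> //.
      exact: cauchy_bound_min cd.
    by move=> x fx; apply: he; exact: polydisc_min fx.
  have [d dP] := boolp.choice cd.
  have [e e0 ed] := common_pos_fin (fun i => let: And3 p _ _ := dP i in p).
  exists c, e; split=> // [i|x ex].
    have [_ bi _] := dP i; split; first exact: (cP i).2.
    exact: cauchy_bound_min bi.
  apply/rowP => i; rewrite mxE; have [_ _ ->//] := dP i.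
  exact: polydisc_min ex.
have [c [d [d0 cd Pc]]] := ex _ wP; have [c' [d' [d0' cd' Qc]]] := ex _ wQ.
have [aP P0 FP] := gP; have [aQ Q0 FQ] := gQ.
have near_all := nearI (nearI (nearI FP PQ) (nearI FQ QP))
  (nearI (analytic0_near aP P0 (nearI (polydisc_near0 n r0') (polydisc_near0 n d0')))
         (analytic0_near aQ Q0 (nearI (polydisc_near0 n r0) (polydisc_near0 n d0)))).
have /near_rowP[e e0 He] := near_all.
have [f [f0 fe fd]] := pos_min2 e0 d0; have [k [k0 kf kd']] := pos_min2 f0 d0'.
have ke : k <= e by exact: le_trans fe.
have kd : k <= d by exact: le_trans fd.
apply: (@wblowup_equivalent R n w w0 k k0 c c') bw bw'.
- by move=> i; have [? ?] := cd i; split=> //; exact: cauchy_bound_min kd _.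
- by move=> i; have [? ?] := cd' i; split=> //; exact: cauchy_bound_min kd' _.
- by move=> x [].
- by move=> x [].
- move=> x kx [rx Fx]; have [|[[FPx PQx] _] [[rPx dPx] _]] := He x.
    by move=> i; rewrite mxE subr0; exact: lt_le_trans (kx i) ke.
  rewrite -(Pc x (polydisc_min kd kx)) -(Qc _ dPx).
  by split; [split; [|exact: FPx]|exact: PQx].
- move=> x kx [rx Fx]; have [|[_ [FQx QPx]] [_ [rQx dQx]]] := He x.
    by move=> i; rewrite mxE subr0; exact: lt_le_trans (kx i) ke.
  rewrite -(Qc x (polydisc_min kd' kx)) -(Pc _ dQx).
  by split; [split; [|exact: FQx]|exact: QPx].
Qed.

End Germs.

(** * Leading forms *)

Section Leads.
Context {R : realType} (n : nat).
Local Notation C := (cplx R).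
Implicit Types (w : n.-tuple nat) (h : 'rV[C]_n -> C) (c : pwseries R n).

Lemma series_at_hsum h c : series_at h c ->
  exists2 e : C, 0 < e & forall z : 'rV[C]_n, (forall i, `|z 0 i| < e) ->
    hsum (fun a => c a * monomial a z) (h z).
Proof.
move=> [[r r0 [M cM]] [e e0 he]]; have [f [f0 fr fe]] := pos_min2 r0 e0.
exists f => // z fz; rewrite he => [|i]; last exact: lt_le_trans (fz i) fe.
apply: (psval_hsum (r := fun=> r) (M := M)) => [a|i]; first by rewrite prodrXr.
exact: lt_le_trans (fz i) fr.
Qed.

Lemma series_at_unique h c c' : series_at h c -> series_at h c' -> c = c'.
Proof.
move=> hc hc'; have [e e0 He] := series_at_hsum hc; have [e' e0' He'] := series_at_hsum hc'.
have [f [f0 fe fe']] := pos_min2 e0 e0'.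
have [[r r0 [M cM]] _] := hc; have [[r' r0' [M' cM']] _] := hc'.
have [g [g0 gr gr']] := pos_min2 r0 r0'.
have H := @series0 R n (fun a => c a - c' a).
apply/funext => a; apply/eqP; rewrite -subr_eq0; apply/eqP; apply: H.
  exists g => //; exists (M + M') => b.
  apply: (@le_trans _ _ (`|c b| * g ^+ (\sum_i b i) + `|c' b| * g ^+ (\sum_i b i))).
    by rewrite -mulrDl; apply: ler_wpM2r; [rewrite exprn_ge0 ?ltW|exact: ler_normB].
  apply: lerD.
    apply: le_trans (cM b); apply: ler_wpM2l => //; apply: lerXn2r => //; rewrite nnegrE ltW //.
  apply: le_trans (cM' b); apply: ler_wpM2l => //; apply: lerXn2r => //; rewrite nnegrE ltW //.
exists f => // z fz; apply: hsum_psval.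
have := hsumD (He z (fun i => lt_le_trans (fz i) fe)) (hsumZ (-1) (He' z (fun i => lt_le_trans (fz i) fe'))).
rewrite mulN1r subrr; congr (hsum _ 0); apply/funext => b.
by rewrite mulN1r mulrBl.
Qed.

(** The zero series when [h] has no expansion at 0. *)
Definition taylor h : pwseries R n :=
  if pselect (exists c, series_at h c) is left e then projT1 (cid e) else fun=> 0.

Lemma taylor_at h : expands_at 0 h -> series_at h (taylor h).
Proof.
move=> /expands_at0 e; rewrite /taylor; case: pselect => // e'.
by case: (cid e').
Qed.

Lemma taylorE h c : series_at h c -> taylor h = c.
Proof.
move=> hc; apply: (series_at_unique _ hc); apply: taylor_at.
by apply/expands_at0; exists c.
Qed.

Definition lead w d h : 'rV[C]_n -> C := psval (wt_part w d (taylor h)).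

Definition wge w d h : Prop := wt_ge w (taylor h) d.

Lemma weight_geE w d h : expands_at 0 h -> wge w d h -> weight_ge w d h.
Proof. by move=> h0 hw; exists (taylor h) => //; exact: taylor_at. Qed.

Context (w : n.-tuple nat) (w0 : forall i, (0 < tnth w i)%N).

Lemma wge_wlim d h : expands_at 0 h -> wge w d h -> wlim w d h (lead w d h).
Proof. by move=> h0 hw; apply: series_wlim => //; exact: taylor_at. Qed.

Lemma lead_neq0 d h : expands_at 0 h ->
  (exists2 a, taylor h a != 0 & mon_wt w a = d) -> exists q, lead w d h q != 0.
Proof. by move=> /taylor_at[hc _] [a ha wa]; exact: (wt_part_neq0 hc ha wa). Qed.

Lemma lead0_coef d h a : expands_at 0 h -> (forall q, lead w d h q = 0) ->
  mon_wt w a = d -> taylor h a = 0.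
Proof.
move=> h0 l0 wa; apply/eqP/negPn/negP => ha.
by have [|q] := @lead_neq0 d h h0; [exists a|rewrite l0 eqxx].
Qed.

Lemma wgeN d h : expands_at 0 h -> ~ wge w d h ->
  exists e, [/\ (e < d)%N, wge w e h & exists q, lead w e h q != 0].
Proof.
move=> h0 /wt_geN[e [ed we ha]]; exists e; split=> //.
by apply: lead_neq0 => //; case: ha => a; exists a.
Qed.

(** Were the weight a smaller number [e], the leading form in weight [e] would be non-zero, while a
    limit in weight [d] forces it to be 0. Bounds on weights are thus obtained by computing
    limits. *)
Lemma wlim_wge d h P : expands_at 0 h -> wlim w d h P -> wge w d h.
Proof.
move=> h0 hP; apply: contrapT => /(wgeN h0)[e [ed we [q]]].
by rewrite (wlim_unique (wge_wlim h0 we) (wlim_lower ed hP)) eqxx.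
Qed.

Lemma wlim_lead d h P : expands_at 0 h -> wlim w d h P -> P = lead w d h.
Proof.
by move=> h0 hP; apply: (wlim_unique hP); apply: wge_wlim => //; exact: wlim_wge hP.
Qed.

Lemma wlim0_wge d h : expands_at 0 h -> wlim w d h (fun=> 0) -> wge w d.+1 h.
Proof.
move=> h0 h1 a ha; have da := wlim_wge h0 h1 ha.
rewrite ltn_neqAle da andbT; apply: contra_neq ha => da'.
apply: (lead0_coef h0 _ (esym da')) => q.
by rewrite -(wlim_lead h0 h1).
Qed.

Lemma lead_hsum d h q :
  hsum (fun a => wt_part w d (taylor h) a * monomial a q) (lead w d h q).
Proof.
have H : hsum (fun a => wt_part w d (taylor h) a * monomial a q)
    (\sum_(a <- cube n d.+1) wt_part w d (taylor h) a * monomial a q).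
  apply: hsum_fset => a ad; rewrite /wt_part; case: eqP => [wa|]; last by rewrite mul0r.
  case/negP: ad; apply: mem_cube => i; rewrite ltnS -wa /mon_wt (bigD1 i) //=.
  by apply: leq_trans (leq_addr _ _); rewrite leq_pmull.
by rewrite /lead (hsum_psval H).
Qed.

Definition zero_at i (q : 'rV[C]_n) : 'rV[C]_n := \row_j (if j == i then 0 else q 0 j).

Lemma lead_linear d h i q :
  (forall a, mon_wt w a = d -> taylor h a != 0 -> a i != 0%N -> a = delta i) ->
  lead w d h q = lead w d h (zero_at i q) + wt_part w d (taylor h) (delta i) * q 0 i.
Proof.
move=> H; apply: (hsum_unique (lead_hsum d h q)).
pose f a := if a == delta i then wt_part w d (taylor h) (delta i) * q 0 i else 0.
have /(hsumD (lead_hsum d h (zero_at i q))) : hsum f (f (delta i)).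
  by apply: hsum1 => a ad; rewrite /f (negPf ad).
rewrite /f eqxx; congr (hsum _ _); apply/funext => a.
have [->|ad] := eqVneq a (delta i).
  by rewrite !monomial_delta mxE eqxx mulr0 add0r.
rewrite addr0 /wt_part; case: eqP => [wa|]; last by rewrite !mul0r.
have [->|ha] := eqVneq (taylor h a) 0; first by rewrite !mul0r.
have [ai|ai] := eqVneq (a i) 0%N; last by rewrite (H a wa ha ai) eqxx in ad.
congr (_ * _); apply: eq_bigr => j _; rewrite mxE.
by case: eqP => [->|//]; rewrite ai !expr0.
Qed.

Lemma lead_single d h a q :
  (forall b, mon_wt w b = d -> b != a -> taylor h b * monomial b q = 0) ->
  lead w d h q = wt_part w d (taylor h) a * monomial a q.
Proof.
move=> H; apply: (hsum_unique (lead_hsum d h q)).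
apply: (@hsum1 C _ (fun b => wt_part w d (taylor h) b * monomial b q)) => b ba.
rewrite /wt_part; case: eqP => [wb|]; last by rewrite mul0r.
exact: H.
Qed.

Lemma lead_polyline d h : polyline (lead w d h).
Proof. exact: polyline_wt_part. Qed.

Lemma lead_bound d h (r : C) : 0 < r -> cauchy_bound r (wt_part w d (taylor h)).
Proof.
move=> r0; pose c := wt_part w d (taylor h).
exists (\sum_(a <- cube n d.+1) `|c a| * r ^+ (\sum_i a i)) => a; rewrite -/(c a).
have ge0 b : 0 <= `|c b| * r ^+ (\sum_i b i) by rewrite mulr_ge0 // exprn_ge0 // ltW.
have [ad|ad] := boolP (a \in cube n d.+1); first by rewrite (big_fsetD1 a ad) /= lerDl sumr_ge0.
suff -> : c a = 0 by rewrite normr0 mul0r sumr_ge0.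
rewrite /c /wt_part; case: eqP => // wa; case/negP: ad; apply: mem_cube => i.
rewrite ltnS -wa /mon_wt (bigD1 i) //=.
by apply: leq_trans (leq_addr _ _); rewrite leq_pmull.
Qed.

Lemma lead_expands d h q : expands_at q (lead w d h).
Proof.
have r0 : 0 < 1 + \sum_i `|q 0 i| by rewrite ltr_pwDl // sumr_ge0.
apply: (psval_cb_analytic (lead_bound d h r0)) => i.
rewrite (bigD1 i) //= addrCA ltrDl.
by rewrite ltr_pwDl // sumr_ge0.
Qed.

Lemma lead_wlim d h : wlim w d (lead w d h) (lead w d h).
Proof.
have -> : lead w d h = psval (wt_part w d (wt_part w d (taylor h))).
  by congr psval; apply/funext => a; rewrite /wt_part; case: eqP.
rewrite -[X in wlim _ _ X](_ : lead w d h = _).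
  apply: series_wlim => //; last by move=> a; rewrite /wt_part; case: (mon_wt w a =P d) => [->|_]; rewrite ?eqxx.
  by split; [exists 1 => //; exact: lead_bound|exists 1].
by congr psval; apply/funext => a; rewrite /wt_part; case: eqP.
Qed.

Definition vanishes_on (F h : 'rV[C]_n -> C) : Prop :=
  \forall x \near (0 : 'rV[C]_n), F x = 0 -> h x = 0.

(** In terms of the blowup with weights [w]: for non-zero [q], the point [0, q] is a limit of points
    [s, x] over V(F) with s non-zero. *)
Definition arc_point (F : 'rV[C]_n -> C) (q : 'rV[C]_n) : Prop :=
  forall e : C, 0 < e -> exists (s : C) x, [/\ s != 0, `|s| < e,
    forall i, `|(x : 'rV[C]_n) 0 i - q 0 i| < e & F (wsc w s x) = 0].

(** At the approximating points [h (s^w x) / s^d] is 0, while it tends to [P q]. *)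
Lemma arc_wlim F h d P q : arc_point F q -> vanishes_on F h -> wlim w d h P -> P q = 0.
Proof.
move=> Fq /near_rowP[e e0 He]; rewrite wlimE => /(_ q) hP.
apply/eqP/negPn/negP => Pq; have Pq0 : 0 < `|P q| by rewrite normr_gt0.
move/cvgrPdist_lt : hP => /(_ _ Pq0)[e' e'0 He'].
have [e'' e''0 He''] := near_wsc q w0 e0.
have [f [f0 fe' fe'']] := pos_min2 e'0 e''0.
have [s [x [s0 sf xf Fx]]] := Fq f f0.
have := He' s x s0 (lt_le_trans sf fe') (fun i => lt_le_trans (xf i) fe').
rewrite /= He; first by rewrite mul0r subr0 ltxx.
  move=> i; rewrite [(0 : 'rV[C]_n) 0 i]mxE subr0.
  exact: (He'' s x s0 (lt_le_trans sf fe'') (fun i => lt_le_trans (xf i) fe'')).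
exact: Fx.
Qed.

End Leads.

(** * Divisibility by a coordinate *)

Section Hadamard.
Context {R : realType} (n : nat).
Local Notation C := (cplx R).

Lemma expands_near m (h : 'rV[C]_m -> C) : expands_at 0 h ->
  \forall x \near (0 : 'rV[C]_m), expands_at x h.
Proof. by move=> /expands_atP[r [K [r0 hK]]]; exact: anaK_near hK. Qed.

(** A non-zero value of [h] persists nearby, and points off the coordinate hyperplane are dense. *)
Lemma coord_density (i : 'I_n) (h : 'rV[C]_n -> C) : expands_at 0 h ->
  (\forall x \near (0 : 'rV[C]_n), (x : 'rV[C]_n) 0 i * h x = 0) -> \forall x \near (0 : 'rV[C]_n), h x = 0.
Proof.
move=> h0 xh; have xh' := near_join xh.
apply: nearS (nearI (expands_near h0) xh') => x [hx near_x].
apply/eqP/negPn/negP => hx0.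
have /near_rowP[e e0 He] := nearI near_x (expands_at_neq0 hx hx0).
pose y : 'rV[C]_n := \row_j (if j == i then (if x 0 i == 0 then e / 2 else x 0 i) else x 0 j).
have [|/eqP] := He y.
  move=> j; rewrite mxE; case: eqP => [->|_]; last by rewrite subrr normr0.
  case: eqP => [->|_]; last by rewrite subrr normr0.
  by rewrite subr0 gtr0_norm ?divr_gt0 // ltr_pdivrMr // ltr_pMr // ltr1n.
rewrite mulf_eq0 mxE eqxx => /orP[|/eqP ->]; last by rewrite eqxx.
case: ifP => [_|->//]; first by rewrite mulf_eq0 invr_eq0 pnatr_eq0 orbF gt_eqF.
Qed.

(** By uniqueness of the expansion on the hyperplane, the monomials free of the coordinate have
    coefficient 0; the quotient is the shifted series. *)
Lemma div_coord (i : 'I_n) (h : 'rV[C]_n -> C) : expands_at 0 h ->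
  (\forall x \near (0 : 'rV[C]_n), h (zero_at i x) = 0) ->
  exists2 k, expands_at 0 k & \forall x \near (0 : 'rV[C]_n), h x = (x : 'rV[C]_n) 0 i * k x.
Proof.
move=> /taylor_at hc hz; set c := taylor h in hc.
have [e e0 He] := series_at_hsum hc.
have [[r r0 [M cM]] _] := hc.
have c0 (a : {ffun 'I_n -> nat}) : a i = 0%N -> c a = 0.
  move=> ai; have := @series0 R n (fun a => if a i == 0%N then c a else 0) _ _ a.
  rewrite ai eqxx; apply.
    exists r => //; exists M => b; case: eqP => _ //.
    by rewrite normr0 mul0r (le_trans _ (cM b)) // mulr_ge0 // exprn_ge0 // ltW.
  have /near_rowP[e' e'0 He'] := hz; have [f [f0 fe fe']] := pos_min2 e0 e'0.
  exists f => // z fz.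
  have zz j : `|zero_at i z 0 j| < f.
    by rewrite mxE; case: eqP => // _; rewrite normr0.
  have E : h (zero_at i z) = 0.
    by apply: He' => j; rewrite [(0 : 'rV[C]_n) 0 j]mxE subr0; apply: lt_le_trans (fz j) fe'.
  apply: hsum_psval.
  have := He _ (fun j => lt_le_trans (zz j) fe); rewrite E; congr (hsum _ _); apply/funext => b.
  case: eqP => [bi|/eqP bi].
    congr (_ * _); apply: eq_bigr => j _; rewrite mxE; case: eqP => [->|//].
    by rewrite bi !expr0.
  by rewrite mul0r /monomial (bigD1 i) //= mxE eqxx expr0n (negPf bi) mul0r mulr0.
pose c' : pwseries R n := fun a => c [ffun j => (a j + delta i j)%N].
have c'r : cauchy_bound r c'.
  exists (M / r) => a; rewrite ler_pdivlMr // -mulrA -exprSr.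
  apply: le_trans (cM [ffun j => (a j + delta i j)%N]).
  by have := tdegD a (delta i); rewrite tdeg_delta addn1 /tdeg => ->.
exists (psval c').
  by apply: (psval_cb_analytic c'r) => j; rewrite mxE normr0.
have [f [f0 fe fr]] := pos_min2 e0 r0.
apply/near_rowP; exists f => // z fz.
have fz' j : `|z 0 j| < f by have := fz j; rewrite [(0 : 'rV[C]_n) 0 j]mxE subr0.
have H1 := He z (fun j => lt_le_trans (fz' j) fe).
have H2 : hsum (fun a => c' a * monomial a z) (psval c' z).
  have [M' cM'] := c'r.
  apply: (psval_hsum (r := fun=> r) (M := M')) => [a|j]; first by rewrite prodrXr.
  exact: lt_le_trans (fz' j) fr.
pose phi (a : {ffun 'I_n -> nat}) : {ffun 'I_n -> nat} := [ffun j => (a j + delta i j)%N].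
pose psi (a : {ffun 'I_n -> nat}) : {ffun 'I_n -> nat} := [ffun j => (a j - delta i j)%N].
have H3 := @hsum_reindex C _ _ phi psi _ _ _ _ H1.
apply: (hsum_unique (H3 _ _)).
- by move=> a; apply/ffunP => j; rewrite !ffunE addnK.
- move=> b bb; have [bi|bi] := eqVneq (b i) 0%N; first by rewrite c0 ?mul0r.
  case/eqP: bb; apply/ffunP => j; rewrite !ffunE subnK //.
  by case: eqP => [->|//]; rewrite lt0n.
have := hsumZ (z 0 i) H2; congr (hsum _ _); apply/funext => a /=.
by rewrite monomialD monomial_delta mulrCA; congr (_ * _); exact: mulrC.
Qed.

End Hadamard.

(** * Coordinates, weights and substitutions on C^4 *)

Section Space4.
Context {R : realType}.
Local Notation C := (cplx R).
Implicit Types (q : 'rV[C]_4).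

Definition v4 (x y z t : C) : 'rV[C]_4 := \row_i nth 0 [:: x; y; z; t] i.

Lemma cx_v4 x y z t : cx (v4 x y z t) = x. Proof. by rewrite /cx mxE inordK. Qed.
Lemma cy_v4 x y z t : cy (v4 x y z t) = y. Proof. by rewrite /cy mxE inordK. Qed.
Lemma cz_v4 x y z t : cz (v4 x y z t) = z. Proof. by rewrite /cz mxE inordK. Qed.
Lemma ct_v4 x y z t : ct (v4 x y z t) = t. Proof. by rewrite /ct mxE inordK. Qed.
Definition v4E := (cx_v4, cy_v4, cz_v4, ct_v4).

Lemma ord4P (P : 'I_4 -> Prop) :
  P (inord 0) -> P (inord 1) -> P (inord 2) -> P (inord 3) -> forall i, P i.
Proof.
move=> P0 P1 P2 P3 [[|[|[|[|i]]]] hi] //.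
- by rewrite (_ : Ordinal hi = inord 0) //; apply: val_inj; rewrite /= inordK.
- by rewrite (_ : Ordinal hi = inord 1) //; apply: val_inj; rewrite /= inordK.
- by rewrite (_ : Ordinal hi = inord 2) //; apply: val_inj; rewrite /= inordK.
- by rewrite (_ : Ordinal hi = inord 3) //; apply: val_inj; rewrite /= inordK.
Qed.

Lemma eq4 (p q : 'rV[C]_4) : cx p = cx q -> cy p = cy q -> cz p = cz q -> ct p = ct q -> p = q.
Proof. by move=> ????; apply/rowP; apply: ord4P. Qed.

Lemma v4K q : v4 (cx q) (cy q) (cz q) (ct q) = q.
Proof. by apply: eq4; rewrite v4E. Qed.

Lemma v4_0 : v4 0 0 0 0 = 0.
Proof. by apply: eq4; rewrite v4E /cx /cy /cz /ct mxE. Qed.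

Lemma tnth4 (p1 p2 k l : nat) :
  ((tnth [tuple p1; p2; k; l] (inord 0) = p1) * (tnth [tuple p1; p2; k; l] (inord 1) = p2) *
   (tnth [tuple p1; p2; k; l] (inord 2) = k) * (tnth [tuple p1; p2; k; l] (inord 3) = l))%type.
Proof. by rewrite !(tnth_nth 0%N) !inordK. Qed.

Lemma tuple4_gt0 (p1 p2 k l : nat) : (0 < p1)%N -> (0 < p2)%N -> (0 < k)%N -> (0 < l)%N ->
  forall i, (0 < tnth [tuple p1; p2; k; l] i)%N.
Proof. by move=> ????; apply: ord4P; rewrite tnth4. Qed.

Lemma sum4 (V : nmodType) (f : 'I_4 -> V) :
  \sum_i f i = f (inord 0) + f (inord 1) + f (inord 2) + f (inord 3).
Proof.
rewrite !big_ord_recl big_ord0 addr0 !addrA.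
by congr (f _ + f _ + f _ + f _); apply: val_inj; rewrite /= inordK.
Qed.

Lemma sumn4 (f : 'I_4 -> nat) :
  (\sum_i f i = f (inord 0) + f (inord 1) + f (inord 2) + f (inord 3))%N.
Proof. exact: (@sum4 nat f). Qed.

Lemma mon_wt4 (p1 p2 k l : nat) (a : {ffun 'I_4 -> nat}) :
  mon_wt [tuple p1; p2; k; l] a =
  (p1 * a (inord 0%N) + p2 * a (inord 1%N) + k * a (inord 2%N) + l * a (inord 3%N))%N.
Proof. by rewrite /mon_wt sumn4 !tnth4. Qed.

Lemma wsc4 (p1 p2 k l : nat) (s : C) q : wsc [tuple p1; p2; k; l] s q =
  v4 (s ^+ p1 * cx q) (s ^+ p2 * cy q) (s ^+ k * cz q) (s ^+ l * ct q).
Proof. by apply: eq4; rewrite v4E; rewrite [LHS]mxE tnth4. Qed.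

Lemma mon_wt_delta n (w : n.-tuple nat) i : mon_wt w (delta i) = tnth w i.
Proof.
rewrite /mon_wt (bigD1 i) //= ffunE eqxx muln1 big1 ?addn0 // => j ji.
by rewrite ffunE (negPf ji) muln0.
Qed.

Lemma wt_delta n (w : n.-tuple nat) (a : {ffun 'I_n -> nat}) i :
  (forall j, 0 < tnth w j)%N -> (mon_wt w a <= tnth w i)%N -> a i != 0%N -> a = delta i.
Proof.
move=> w0; rewrite /mon_wt (bigD1 i) //= => H ai.
have ai1 : a i = 1%N.
  apply/eqP; rewrite eqn_leq lt0n ai andbT -(leq_pmul2l (w0 i)) muln1.
  exact: leq_trans (leq_addr _ _) H.
move: H; rewrite ai1 muln1 -{2}[tnth w i]addn0 leq_add2l leqn0 sum_nat_eq0 => /forallP H.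
apply/ffunP => j; rewrite ffunE; case: eqP => [->//|/eqP ji].
by have := H j; rewrite ji muln_eq0 gtn_eqF //= => /eqP.
Qed.

Lemma expands4 n (X Y Z T : 'rV[C]_n -> C) x :
  expands_at x X -> expands_at x Y -> expands_at x Z -> expands_at x T ->
  forall i, expands_at x (fun u => v4 (X u) (Y u) (Z u) (T u) 0 i).
Proof.
move=> hX hY hZ hT; apply: ord4P.
- by rewrite (_ : (fun u => _) = X) //; apply/funext => u; exact: cx_v4.
- by rewrite (_ : (fun u => _) = Y) //; apply/funext => u; exact: cy_v4.
- by rewrite (_ : (fun u => _) = Z) //; apply/funext => u; exact: cz_v4.
- by rewrite (_ : (fun u => _) = T) //; apply/funext => u; exact: ct_v4.
Qed.

Lemma wlim_cx p1 p2 k l : wlim [tuple p1; p2; k; l] p1 (@cx R) (@cx R).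
Proof. by have := @wlim_coord C 4 [tuple p1; p2; k; l] (inord 0); rewrite tnth4. Qed.
Lemma wlim_cy p1 p2 k l : wlim [tuple p1; p2; k; l] p2 (@cy R) (@cy R).
Proof. by have := @wlim_coord C 4 [tuple p1; p2; k; l] (inord 1); rewrite tnth4. Qed.
Lemma wlim_cz p1 p2 k l : wlim [tuple p1; p2; k; l] k (@cz R) (@cz R).
Proof. by have := @wlim_coord C 4 [tuple p1; p2; k; l] (inord 2); rewrite tnth4. Qed.
Lemma wlim_ct p1 p2 k l : wlim [tuple p1; p2; k; l] l (@ct R) (@ct R).
Proof. by have := @wlim_coord C 4 [tuple p1; p2; k; l] (inord 3); rewrite tnth4. Qed.

Lemma wlim_eq n (w : n.-tuple nat) d (h h' P P' : 'rV[C]_n -> C) :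
  (forall u, h u = h' u) -> (forall u, P u = P' u) -> wlim w d h P -> wlim w d h' P'.
Proof. by move=> /funext -> /funext ->. Qed.

Lemma wlim_comp4 n (w : n.-tuple nat) p1 p2 k l d (g G : 'rV[C]_4 -> C)
    (X Y Z T X0 Y0 Z0 T0 : 'rV[C]_n -> C) :
  wlim [tuple p1; p2; k; l] d g G -> wlim w p1 X X0 -> wlim w p2 Y Y0 ->
  wlim w k Z Z0 -> wlim w l T T0 ->
  wlim w d (fun u => g (v4 (X u) (Y u) (Z u) (T u)))
    (fun u => G (v4 (X0 u) (Y0 u) (Z0 u) (T0 u))).
Proof.
move=> hg hX hY hZ hT; apply: (wlim_comp (h := fun u => v4 (X u) (Y u) (Z u) (T u))
  (H := fun u => v4 (X0 u) (Y0 u) (Z0 u) (T0 u)) hg).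
apply: ord4P; rewrite tnth4.
- by apply: (wlim_eq _ _ hX) => u; rewrite -/(cx _) cx_v4.
- by apply: (wlim_eq _ _ hY) => u; rewrite -/(cy _) cy_v4.
- by apply: (wlim_eq _ _ hZ) => u; rewrite -/(cz _) cz_v4.
- by apply: (wlim_eq _ _ hT) => u; rewrite -/(ct _) ct_v4.
Qed.

Lemma wlim0 n (w : n.-tuple nat) d : wlim w d (fun _ : 'rV[C]_n => 0) (fun=> 0).
Proof.
have := wlimZ 0 (wlimX d (wlim_cst w (0 : C))).
case: d => [|d]; first by move=> _; exact: wlim_cst.
move=> _; rewrite wlimE => u.
rewrite (_ : (fun sx : C * 'rV[C]_n => _) = (fun=> 0)); first exact: cvg_cst.
by apply/funext => sx; rewrite mul0r.
Qed.

Lemma polyline_lin n m (F : 'rV[C]_m -> C) (f : 'rV[C]_n -> 'rV[C]_m) : polyline F ->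
  (forall u v l, f (u + l *: v) = f u + l *: f v) -> polyline (F \o f).
Proof. by move=> hF hf u v; have [P hP] := hF (f u) (f v); exists P => l; rewrite /= hf hP. Qed.

Lemma cxD (p q : 'rV[C]_4) l : cx (p + l *: q) = cx p + l * cx q. Proof. by rewrite /cx !mxE. Qed.
Lemma cyD (p q : 'rV[C]_4) l : cy (p + l *: q) = cy p + l * cy q. Proof. by rewrite /cy !mxE. Qed.
Lemma czD (p q : 'rV[C]_4) l : cz (p + l *: q) = cz p + l * cz q. Proof. by rewrite /cz !mxE. Qed.
Lemma ctD (p q : 'rV[C]_4) l : ct (p + l *: q) = ct p + l * ct q. Proof. by rewrite /ct !mxE. Qed.
Definition cD := (cxD, cyD, czD, ctD).

Lemma zero_at0 x y z t : zero_at (inord 0) (v4 x y z t) = v4 0 y z t.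
Proof.
apply: eq4; rewrite /cx /cy /cz /ct mxE -val_eqE /= ?inordK //= ?eqxx //;
  by rewrite -?/(cx _) -?/(cy _) -?/(cz _) -?/(ct _) !v4E.
Qed.
Lemma zero_at1 x y z t : zero_at (inord 1) (v4 x y z t) = v4 x 0 z t.
Proof.
apply: eq4; rewrite /cx /cy /cz /ct mxE -val_eqE /= ?inordK //= ?eqxx //;
  by rewrite -?/(cx _) -?/(cy _) -?/(cz _) -?/(ct _) !v4E.
Qed.
Lemma zero_at2 x y z t : zero_at (inord 2) (v4 x y z t) = v4 x y 0 t.
Proof.
apply: eq4; rewrite /cx /cy /cz /ct mxE -val_eqE /= ?inordK //= ?eqxx //;
  by rewrite -?/(cx _) -?/(cy _) -?/(cz _) -?/(ct _) !v4E.
Qed.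
Lemma zero_at3 x y z t : zero_at (inord 3) (v4 x y z t) = v4 x y z 0.
Proof.
apply: eq4; rewrite /cx /cy /cz /ct mxE -val_eqE /= ?inordK //= ?eqxx //;
  by rewrite -?/(cx _) -?/(cy _) -?/(cz _) -?/(ct _) !v4E.
Qed.

Definition swap q : 'rV[C]_4 := v4 (cy q) (cx q) (cz q) (ct q).

Lemma swapK q : swap (swap q) = q.
Proof. by rewrite /swap !v4E v4K. Qed.

Definition zt_only (g : 'rV[C]_4 -> C) : Prop := forall q, g q = g (v4 0 0 (cz q) (ct q)).

Lemma zt_onlyE g x y z t : zt_only g -> g (v4 x y z t) = g (v4 0 0 z t).
Proof. by move=> hg; rewrite hg !v4E. Qed.

Lemma zt_only_swap g q : zt_only g -> g (swap q) = g q.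
Proof. by move=> hg; rewrite /swap zt_onlyE // -hg. Qed.

Definition hyp (g : 'rV[C]_4 -> C) q : C := cx q * cy q + g q.

Lemma hyp_swap g q : zt_only g -> hyp g (swap q) = hyp g q.
Proof. by move=> hg; rewrite /hyp (zt_only_swap _ hg) cx_v4 cy_v4 mulrC. Qed.

End Space4.

(** * Arc points of xy + g and forms vanishing on them *)

Section Arcs.
Context {R : realType}.
Local Notation C := (cplx R).
Implicit Types (q : 'rV[C]_4) (h X Y : 'rV[C]_4 -> C).

Lemma wlim_zt_only p1 p2 k l d (g G : 'rV[C]_4 -> C) :
  zt_only g -> wlim [tuple p1; p2; k; l] d g G -> zt_only G.
Proof.
move=> hg gG; have := wlim_comp4 gG (wlim0 _ p1) (wlim0 _ p2)
  (wlim_cz p1 p2 k l) (wlim_ct p1 p2 k l).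
rewrite (_ : (fun q => g _) = g) => [H q|]; last by apply/funext => q; rewrite -hg.
by rewrite {1}(wlim_unique gG H).
Qed.

(** For x non-zero the equation is solved for y at each small s: the solution is [g] at [s^w q],
    divided by [- s ^+ (p1 + p2)] and by x, and it tends to -G/x, the y-coordinate of [q]. *)
Lemma arc_hyp_x p1 p2 k l (g G : 'rV[C]_4 -> C) q :
  zt_only g -> wlim [tuple p1; p2; k; l] (p1 + p2) g G ->
  cx q * cy q + G q = 0 -> cx q != 0 -> arc_point [tuple p1; p2; k; l] (hyp g) q.
Proof.
move=> hg; rewrite wlimE => /(_ q) gG Eq x0 e e0.
have ex0 : 0 < e * `|cx q| by rewrite mulr_gt0 // normr_gt0.
move/cvgrPdist_lt : gG => /(_ _ ex0)[e' e'0 He'].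
have [f [f0 fe fe']] := pos_min2 e0 e'0.
have s0 : 0 < f / 2 by rewrite divr_gt0.
have sf : f / 2 < f by rewrite ltr_pdivrMr // ltr_pMr // ltr1n.
have sn0 : f / 2 != 0 by rewrite gt_eqF.
have sN : `|f / 2| = f / 2 by rewrite gtr0_norm.
set s := f / 2 in s0 sf sn0 sN *.
have := He' s q sn0; rewrite sN => /(_ (lt_le_trans sf fe')).
have qq i : `|q 0 i - q 0 i| < e' by rewrite subrr normr0.
move=> /(_ qq) /=; set u := g _; set W := [tuple _; _; _; _] => Hu.
exists s, (v4 (cx q) (- (u / s ^+ (p1 + p2)) / cx q) (cz q) (ct q)); split=> //.
- by rewrite sN (lt_le_trans sf).
- apply: ord4P; rewrite -?/(cx _) -?/(cy _) -?/(cz _) -?/(ct _) !v4E ?subrr ?normr0 //.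
  rewrite (_ : _ - _ = (G q - u / s ^+ (p1 + p2)) / cx q).
    by rewrite normrM normfV ltr_pdivrMr ?normr_gt0.
  have -> : G q = - (cx q * cy q) by apply/eqP; rewrite -addr_eq0 addrC Eq.
  by move: (u / _) => v; field.
- have Eu : u = g (v4 0 0 (s ^+ k * cz q) (s ^+ l * ct q)).
    by rewrite /u wsc4 (zt_onlyE _ _ _ _ hg).
  rewrite /hyp wsc4 !v4E (zt_onlyE _ _ _ _ hg) mulrACA -exprD mulrC.
  rewrite [X in X * _]mulrC divfK // mulNr divfK ?expf_neq0 //.
  by rewrite -Eu addNr.
Qed.

Lemma arc_hyp p1 p2 k l (g G : 'rV[C]_4 -> C) q :
  zt_only g -> wlim [tuple p1; p2; k; l] (p1 + p2) g G ->
  cx q * cy q + G q = 0 -> (cx q != 0) || (cy q != 0) ->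
  arc_point [tuple p1; p2; k; l] (hyp g) q.
Proof.
move=> hg gG Eq /orP[x0|y0]; first exact: arc_hyp_x hg gG Eq x0.
have hG := wlim_zt_only hg gG.
have gG' : wlim [tuple p2; p1; k; l] (p2 + p1) g G.
  have := wlim_comp4 gG (wlim_cy p2 p1 k l) (wlim_cx p2 p1 k l) (wlim_cz p2 p1 k l) (wlim_ct p2 p1 k l).
  by rewrite addnC; apply: wlim_eq => u; exact: zt_only_swap.
have Hq : arc_point [tuple p2; p1; k; l] (hyp g) (swap q).
  apply: (arc_hyp_x hg gG'); rewrite /swap !v4E //.
  by rewrite -/(swap q) zt_only_swap // mulrC.
move=> e e0; have [s [x [s0 se xe Fx]]] := Hq e e0.
exists s, (swap x); split=> //; last first.
  by rewrite -Fx -(hyp_swap _ hg) !wsc4 /swap !v4E.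
have := xe; move=> xe'; apply: ord4P; rewrite -?/(cx _) -?/(cy _) -?/(cz _) -?/(ct _) !v4E.
- by have := xe (inord 1); rewrite -/(cy _) -/(cy _) v4E.
- by have := xe (inord 0); rewrite -/(cx _) -/(cx _) v4E.
- by have := xe (inord 2); rewrite -/(cz _) -/(cz _) v4E.
- by have := xe (inord 3); rewrite -/(ct _) -/(ct _) v4E.
Qed.

Lemma polyline_v4 (F : 'rV[C]_4 -> C) (A B D E : bool) : polyline F ->
  polyline (fun q => F (v4 (cx q *+ A) (cy q *+ B) (cz q *+ D) (ct q *+ E))).
Proof.
move=> hF; apply: (polyline_lin hF) => p q m.
by apply: eq4; rewrite cD !v4E cD; do ?[case: A|case: B|case: D|case: E];
  rewrite ?mulr1n ?mulr0n ?mulr0 ?addr0.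
Qed.

Lemma polyline0_coord n (i : 'I_n) (F : 'rV[C]_n -> C) : polyline F ->
  (forall u : 'rV[C]_n, u 0 i * F u = 0) -> forall u, F u = 0.
Proof.
move=> hF H; have [|//] := polyline_domain (polyline_coord i) hF H.
by move=> /(_ (\row_j 1)) /eqP; rewrite mxE oner_eq0.
Qed.

Lemma polyline0 (F : 'rV[C]_4 -> C) : polyline F ->
  (forall q, cx q * F q = 0) -> forall q, F q = 0.
Proof. exact: polyline0_coord. Qed.

Section Leads.
Context (p1 p2 k l : nat) (p1_gt0 : (0 < p1)%N) (p2_gt0 : (0 < p2)%N)
  (k_gt0 : (0 < k)%N) (l_gt0 : (0 < l)%N).
Local Notation w := [tuple p1; p2; k; l].
Let w0 : forall i, (0 < tnth w i)%N := tuple4_gt0 p1_gt0 p2_gt0 k_gt0 l_gt0.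

Lemma lead_lin_x d h y z t x : (d <= p1)%N ->
  lead w d h (v4 x y z t) = lead w d h (v4 0 y z t) + wt_part w d (taylor h) (delta (inord 0)) * x.
Proof.
move=> dp; rewrite (@lead_linear _ _ _ w0 d h (inord 0)) ?zero_at0 -?/(cx _) ?v4E //.
by move=> a wa _ ai; apply: (wt_delta w0 _ ai); rewrite wa tnth4.
Qed.

Lemma lead_lin_y d h x z t y : (d <= p2)%N ->
  lead w d h (v4 x y z t) = lead w d h (v4 x 0 z t) + wt_part w d (taylor h) (delta (inord 1)) * y.
Proof.
move=> dp; rewrite (@lead_linear _ _ _ w0 d h (inord 1)) ?zero_at1 -?/(cy _) ?v4E //.
by move=> a wa _ ai; apply: (wt_delta w0 _ ai); rewrite wa tnth4.
Qed.

Lemma lead_lin_z d h x y t z : (d <= k)%N ->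
  lead w d h (v4 x y z t) = lead w d h (v4 x y 0 t) + wt_part w d (taylor h) (delta (inord 2)) * z.
Proof.
move=> dp; rewrite (@lead_linear _ _ _ w0 d h (inord 2)) ?zero_at2 -?/(cz _) ?v4E //.
by move=> a wa _ ai; apply: (wt_delta w0 _ ai); rewrite wa tnth4.
Qed.

Lemma lead_lin_t d h x y z t : (d <= l)%N ->
  lead w d h (v4 x y z t) = lead w d h (v4 x y z 0) + wt_part w d (taylor h) (delta (inord 3)) * t.
Proof.
move=> dp; rewrite (@lead_linear _ _ _ w0 d h (inord 3)) ?zero_at3 -?/(ct _) ?v4E //.
by move=> a wa _ ai; apply: (wt_delta w0 _ ai); rewrite wa tnth4.
Qed.

Lemma wt_part_delta d h i : tnth w i = d -> wt_part w d (taylor h) (delta i) = taylor h (delta i).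
Proof. by move=> <-; rewrite /wt_part mon_wt_delta eqxx. Qed.

Lemma wt_part_delta0 d h i : tnth w i != d -> wt_part w d (taylor h) (delta i) = 0.
Proof. by rewrite /wt_part mon_wt_delta => /negPf ->. Qed.

Context (p12 : (p1 <= p2)%N) (G : 'rV[C]_4 -> C) (polyG : polyline G) (ztG : zt_only G)
  (G_neq0 : exists q, G q != 0).

(** The cone xy + G = 0 is parametrized by (x, z, t) through y = -G/x. Both forms are at most linear
    in y, so after multiplication by x they become polynomials [A] and [B], one of which is 0.
    Setting x = 0 shows that the corresponding form has no term in y, as [G] is not 0. *)
Lemma arc_domain d1 d2 X Y : (d1 <= p1)%N -> (d2 <= p2)%N ->
  (forall q, cx q * cy q + G q = 0 -> cx q != 0 -> lead w d1 X q * lead w d2 Y q = 0) ->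
  (forall q, lead w d1 X q = 0) \/ (forall q, lead w d2 Y q = 0).
Proof.
move=> d1p d2p H.
pose a := wt_part w d1 (taylor X) (delta (inord 0)).
pose b := wt_part w d1 (taylor X) (delta (inord 1)).
pose b' := wt_part w d2 (taylor Y) (delta (inord 1)).
have EX x y z t : lead w d1 X (v4 x y z t) = lead w d1 X (v4 0 0 z t) + b * y + a * x.
  by rewrite lead_lin_x // lead_lin_y // (leq_trans d1p).
have EY x y z t : lead w d2 Y (v4 x y z t) = lead w d2 Y (v4 x 0 z t) + b' * y.
  by rewrite lead_lin_y.
pose A q := cx q * (lead w d1 X (v4 (cx q *+ false) (cy q *+ false) (cz q *+ true) (ct q *+ true)) + a * cx q) - b * G q.
pose B q := cx q * lead w d2 Y (v4 (cx q *+ true) (cy q *+ false) (cz q *+ true) (ct q *+ true)) - b' * G q.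
have cxp : polyline (@cx R) by exact: polyline_coord.
have pA : polyline A.
  apply: polylineD; last by apply: polylineN; apply: polylineM => //; exact: polyline_cst.
  apply: polylineM => //; apply: polylineD; last by apply: polylineM => //; exact: polyline_cst.
  by apply: polyline_v4; exact: lead_polyline.
have pB : polyline B.
  apply: polylineD; last by apply: polylineN; apply: polylineM => //; exact: polyline_cst.
  by apply: polylineM => //; apply: polyline_v4; exact: lead_polyline.
have AB q : A q * B q = 0.
  move: q; apply: polyline0; first exact: polylineM.
  move=> q; have [->|x0] := eqVneq (cx q) 0; first by rewrite mul0r.
  have := H (v4 (cx q) (- G q / cx q) (cz q) (ct q)).
  rewrite !v4E (zt_onlyE _ _ _ _ ztG) -ztG mulrC divfK // addNr => /(_ erefl x0).
  rewrite EX EY => E; rewrite /A /B ?mulr1n ?mulr0n.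
  set u := lead w d1 X _ in E *; set v := lead w d2 Y _ in E *.
  have -> : cx q * (u + a * cx q) - b * G q = cx q * (u + b * (- G q / cx q) + a * cx q).
    by field.
  have -> : cx q * v - b' * G q = cx q * (v + b' * (- G q / cx q)) by field.
  by rewrite mulrACA E !mulr0.
have [q0 Gq0] := G_neq0.
have G0 : G (v4 0 0 (cz q0) (ct q0)) != 0 by rewrite -ztG.
have [HA|HB] := polyline_domain pA pB AB; [left|right].
- have b0 : b = 0.
    have := HA (v4 0 0 (cz q0) (ct q0)); rewrite /A !v4E mul0r sub0r => /eqP.
    by rewrite oppr_eq0 mulf_eq0 (negPf G0) orbF => /eqP.
  (* The values at x = 1 and x = -1 separate the part free of x from the linear one. *)
  have Hz z t : lead w d1 X (v4 0 0 z t) = 0 /\ a = 0.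
    have := HA (v4 1 0 z t); have := HA (v4 (-1) 0 z t).
    rewrite /A !v4E b0 !mul0r !mulr1n !mulr0n !subr0 mul1r mulr1 mulrN1 mulN1r.
    move=> /eqP; rewrite oppr_eq0 subr_eq0 => /eqP -> /eqP.
    by rewrite -mulr2n mulrn_eq0 /= => /eqP ->.
  by move=> q; rewrite -(v4K q) EX b0 (Hz _ _).1 (Hz 0 0).2 !mul0r !addr0.
- have b0 : b' = 0.
    have := HB (v4 0 0 (cz q0) (ct q0)); rewrite /B !v4E mul0r sub0r => /eqP.
    by rewrite oppr_eq0 mulf_eq0 (negPf G0) orbF => /eqP.
  have Hz q : lead w d2 Y (v4 (cx q *+ true) (cy q *+ false) (cz q *+ true) (ct q *+ true)) = 0.
    move: q; apply: polyline0; first by apply: polyline_v4; exact: lead_polyline.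
    by move=> q; have := HB q; rewrite /B b0 mul0r subr0.
  by move=> q; rewrite -(v4K q) EY b0 mul0r addr0; have := Hz q; rewrite !mulr1n.
Qed.

(** The argument of [arc_domain] for a single form. *)
Lemma arc_lead_y d2 Y : (d2 <= p2)%N ->
  (forall q, cx q * cy q + G q = 0 -> cx q != 0 -> lead w d2 Y q = 0) ->
  forall q, lead w d2 Y q = 0.
Proof.
move=> d2p H.
pose b' := wt_part w d2 (taylor Y) (delta (inord 1)).
have EY x y z t : lead w d2 Y (v4 x y z t) = lead w d2 Y (v4 x 0 z t) + b' * y.
  by rewrite lead_lin_y.
pose B q := cx q * lead w d2 Y (v4 (cx q *+ true) (cy q *+ false) (cz q *+ true) (ct q *+ true)) - b' * G q.
have cxp : polyline (@cx R) by exact: polyline_coord.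
have pB : polyline B.
  apply: polylineD; last by apply: polylineN; apply: polylineM => //; exact: polyline_cst.
  by apply: polylineM => //; apply: polyline_v4; exact: lead_polyline.
have HB : forall q, B q = 0.
  apply: polyline0 => // q; have [->|x0] := eqVneq (cx q) 0; first by rewrite mul0r.
  have := H (v4 (cx q) (- G q / cx q) (cz q) (ct q)).
  rewrite !v4E (zt_onlyE _ _ _ _ ztG) -ztG mulrC divfK // addNr => /(_ erefl x0).
  rewrite EY => E; rewrite /B ?mulr1n ?mulr0n.
  set v := lead w d2 Y _ in E *.
  have -> : cx q * v - b' * G q = cx q * (v + b' * (- G q / cx q)) by field.
  by rewrite E !mulr0.
have [q0 Gq0] := G_neq0.
have G0 : G (v4 0 0 (cz q0) (ct q0)) != 0 by rewrite -ztG.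
have b0 : b' = 0.
  have := HB (v4 0 0 (cz q0) (ct q0)); rewrite /B !v4E mul0r sub0r => /eqP.
  by rewrite oppr_eq0 mulf_eq0 (negPf G0) orbF => /eqP.
have Hz q : lead w d2 Y (v4 (cx q *+ true) (cy q *+ false) (cz q *+ true) (ct q *+ true)) = 0.
  move: q; apply: polyline0; first by apply: polyline_v4; exact: lead_polyline.
  by move=> q; have := HB q; rewrite /B b0 mul0r subr0.
by move=> q; rewrite -(v4K q) EY b0 mul0r addr0; have := Hz q; rewrite !mulr1n.
Qed.

End Leads.
End Arcs.

(** * Weights and Jacobians of maps between hypersurfaces xy + g *)

Section Hypersurface.
Context {R : realType}.
Local Notation C := (cplx R).
Implicit Types (q : 'rV[C]_4) (h X Y g G : 'rV[C]_4 -> C).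

Section Weights.
Context (p1 p2 k l : nat) (p1_gt0 : (0 < p1)%N) (p2_gt0 : (0 < p2)%N)
  (k_gt0 : (0 < k)%N) (l_gt0 : (0 < l)%N).
Local Notation w := [tuple p1; p2; k; l].
Let w0 : forall i, (0 < tnth w i)%N := tuple4_gt0 p1_gt0 p2_gt0 k_gt0 l_gt0.
Context (p12 : (p1 <= p2)%N) (g G : 'rV[C]_4 -> C) (ztg : zt_only g)
  (gG : wlim w (p1 + p2) g G) (polyG : polyline G) (G_neq0 : exists q, G q != 0).

Let ztG : zt_only G := wlim_zt_only ztg gG.

Lemma wge_delta d h i : taylor h (delta i) != 0 -> wge w d h -> (d <= tnth w i)%N.
Proof. by move=> hi /(_ _ hi); rewrite mon_wt_delta. Qed.

(** If the weights of [X] and [Y] added up to less than [p1 + p2], the leading form of [X * Y + h]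
    would be the product of theirs and vanish at the arc points, against [arc_domain]. The terms x
    in [X] and y in [Y] bound the weights by [p1] and [p2], so a total of at least [p1 + p2] means
    equality. *)
Lemma product_weights X Y h H : expands_at 0 X -> expands_at 0 Y ->
  vanishes_on (hyp g) (fun q => X q * Y q + h q) -> wlim w (p1 + p2) h H ->
  taylor X (delta (inord 0)) != 0 -> taylor Y (delta (inord 1)) != 0 ->
  wge w p1 X /\ wge w p2 Y.
Proof.
move=> X0 Y0 van hH hx hy.
have [d1 [wX [a Xa da]]] := wt_min w (ex_intro (fun a => taylor X a != 0) _ hx).
have [d2 [wY [b Yb db]]] := wt_min w (ex_intro (fun a => taylor Y a != 0) _ hy).
have d1p : (d1 <= p1)%N by have := wge_delta hx wX; rewrite tnth4.
have d2p : (d2 <= p2)%N by have := wge_delta hy wY; rewrite tnth4.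
have [lt_d|ge_d] := ltnP (d1 + d2) (p1 + p2); last first.
  have E1 : d1 = p1 by lia.
  have E2 : d2 = p2 by lia.
  by rewrite E1 in wX; rewrite E2 in wY.
have hl : wlim w (d1 + d2) (fun q => X q * Y q + h q) (fun q => lead w d1 X q * lead w d2 Y q + 0).
  apply: wlimD; last exact: wlim_lower hH.
  by apply: wlimM; apply: wge_wlim.
have [|H1|H2] := arc_domain p1_gt0 p2_gt0 k_gt0 l_gt0 p12 polyG ztG G_neq0 (X := X) (Y := Y) d1p d2p.
- move=> q Eq xq; have := arc_wlim w0 (arc_hyp_x ztg gG Eq xq) van hl.
  by rewrite addr0.
- have [|q] := lead_neq0 X0 (w := w) (d := d1); first by exists a.
  by rewrite H1 eqxx.
- have [|q] := lead_neq0 Y0 (w := w) (d := d2); first by exists b.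
  by rewrite H2 eqxx.
Qed.

(** The leading form of [X] is a multiple of x; if [Y] were too light, its own leading form would
    vanish on the part of the cone where x is non-zero. *)
Lemma cofactor_weight X Y h H (a : C) : expands_at 0 Y ->
  vanishes_on (hyp g) (fun q => X q * Y q + h q) -> wlim w (p1 + p2) h H ->
  wlim w p1 X (fun q => a * cx q) -> a != 0 -> wge w p2 Y.
Proof.
move=> Y0 van hH hX a0; apply: contrapT => /(wgeN Y0)[e [ep we [q Yq]]].
have hl : wlim w (p1 + e) (fun q => X q * Y q + h q) (fun q => a * cx q * lead w e Y q + 0).
  apply: wlimD; last by apply: wlim_lower hH; rewrite ltn_add2l.
  by apply: wlimM => //; apply: wge_wlim.
move/negP: Yq; apply; apply/eqP.
apply: (arc_lead_y p1_gt0 p2_gt0 k_gt0 l_gt0 polyG ztG G_neq0 (ltnW ep)) => {}q Eq xq.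
have := arc_wlim w0 (arc_hyp_x ztg gG Eq xq) van hl.
by rewrite addr0 => /eqP; rewrite !mulf_eq0 (negPf a0) (negPf xq) => /eqP.
Qed.

End Weights.

(** With y = -G/x and after multiplication by x, the relation is quadratic in x over functions of z
    and t, and its coefficients vanish one by one: first [V], then [U * G] and hence [U], and the
    middle one compares [G] with [H]. *)
Lemma lead_identity p k l g G X Y h H :
  (0 < p)%N -> (0 < k)%N -> (0 < l)%N -> let w := [tuple p; p; k; l] in
  zt_only g -> wlim w (p + p) g G -> polyline G -> (exists q, G q != 0) ->
  expands_at 0 X -> expands_at 0 Y -> wge w p X -> wge w p Y ->
  taylor X (delta (inord 0)) != 0 -> taylor Y (delta (inord 1)) != 0 ->
  taylor X (delta (inord 1)) = 0 -> taylor Y (delta (inord 0)) = 0 ->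
  vanishes_on (hyp g) (fun q => X q * Y q + h q) -> wlim w (p + p) h H -> zt_only H ->
  [/\ forall q, lead w p X q = taylor X (delta (inord 0)) * cx q,
      forall q, lead w p Y q = taylor Y (delta (inord 1)) * cy q &
      forall q, taylor X (delta (inord 0)) * taylor Y (delta (inord 1)) * G q = H q].
Proof.
move=> p0 k0 l0 w ztg gG polyG [q0 Gq0] X0 Y0 wX wY a0 b0 a1 b1 van hH ztH.
have w0 : forall i, (0 < tnth w i)%N by exact: tuple4_gt0.
have ztG := wlim_zt_only ztg gG.
set a := taylor X (delta (inord 0)) in a0 *; set b := taylor Y (delta (inord 1)) in b0 *.
have wd (h' : 'rV[C]_4 -> C) : wt_part w p (taylor h') (delta (inord 0)) = taylor h' (delta (inord 0)).
  by rewrite wt_part_delta // tnth4.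
have wd' (h' : 'rV[C]_4 -> C) : wt_part w p (taylor h') (delta (inord 1)) = taylor h' (delta (inord 1)).
  by rewrite wt_part_delta // tnth4.
have EX x y z t : lead w p X (v4 x y z t) = lead w p X (v4 0 0 z t) + a * x.
  by rewrite lead_lin_x // lead_lin_y // wd wd' a1 mul0r addr0.
have EY x y z t : lead w p Y (v4 x y z t) = lead w p Y (v4 0 0 z t) + b * y.
  by rewrite lead_lin_x // lead_lin_y // wd wd' b1 mul0r addr0.
have hl : wlim w (p + p) (fun q => X q * Y q + h q) (fun q => lead w p X q * lead w p Y q + H q).
  by apply: wlimD => //; apply: wlimM; apply: wge_wlim.
pose U z t := lead w p X (v4 0 0 z t); pose V z t := lead w p Y (v4 0 0 z t).
have key x z t : x != 0 -> a * V z t * x ^+ 2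
    + (U z t * V z t - a * b * G (v4 0 0 z t) + H (v4 0 0 z t)) * x - b * U z t * G (v4 0 0 z t) = 0.
  move=> x0; have := @arc_wlim R 4 w w0 (hyp g) _ _ _ (v4 x (- G (v4 0 0 z t) / x) z t) _ van hl.
  have Eq : cx (v4 x (- G (v4 0 0 z t) / x) z t) * cy (v4 x (- G (v4 0 0 z t) / x) z t)
      + G (v4 x (- G (v4 0 0 z t) / x) z t) = 0.
    by rewrite !v4E (zt_onlyE _ _ _ _ ztG) mulrC divfK // addNr.
  have xn : cx (v4 x (- G (v4 0 0 z t) / x) z t) != 0 by rewrite v4E.
  move=> /(_ (arc_hyp_x ztg gG Eq xn)); rewrite EX EY (zt_onlyE _ _ _ _ ztH).
  rewrite -/(U z t) -/(V z t); set Gz := G _; set Hz := H _ => E.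
  rewrite (_ : _ - _ = ((U z t + a * x) * (V z t + b * (- Gz / x)) + Hz) * x).
    by rewrite E mul0r.
  by field.
(* The values at x = 1, -1 and 2 determine a quadratic polynomial, and they avoid the excluded x =
   0. *)
have quad (c2 c1 c0 : C) : (forall x, x != 0 -> c2 * x ^+ 2 + c1 * x - c0 = 0) ->
    [/\ c2 = 0, c1 = 0 & c0 = 0].
  move=> hx; have e1 := hx 1 (oner_neq0 _).
  have e2 : c2 * (-1) ^+ 2 + c1 * (-1) - c0 = 0 by apply: hx; rewrite oppr_eq0 oner_eq0.
  have e3 : c2 * 2%:R ^+ 2 + c1 * 2%:R - c0 = 0 by apply: hx; rewrite pnatr_eq0.
  have h2 : (2%:R : C) != 0 by rewrite pnatr_eq0.
  have h6 : (6%:R : C) != 0 by rewrite pnatr_eq0.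
  have E1 : c1 = 0.
    apply: (mulfI h2); rewrite mulr0.
    rewrite (_ : _ * _ = (c2 * 1 ^+ 2 + c1 * 1 - c0) - (c2 * (-1) ^+ 2 + c1 * (-1) - c0)); first by rewrite e1 e2 subrr.
    by ring.
  have E2 : c2 = 0.
    apply: (mulfI h6); rewrite mulr0.
    rewrite (_ : _ * _ = (c2 * 2%:R ^+ 2 + c1 * 2%:R - c0) *+ 2 - (c2 * 1 ^+ 2 + c1 * 1 - c0) *+ 2 - c1 *+ 2); last by ring.
    by rewrite e1 e3 E1 !mul0rn !subrr.
  split=> //; move: e1; rewrite E1 E2 !mul0r addr0 sub0r => /eqP.
  by rewrite oppr_eq0 => /eqP.
have K z t : [/\ V z t = 0, U z t * G (v4 0 0 z t) = 0 &
    U z t * V z t - a * b * G (v4 0 0 z t) + H (v4 0 0 z t) = 0].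
  have [c2 c1 c0] := quad _ _ _ (fun x x0 => key x z t x0).
  split=> //; first by apply/eqP; move/eqP: c2; rewrite mulf_eq0 (negPf a0).
  by apply/eqP; move/eqP: c0; rewrite -mulrA mulf_eq0 (negPf b0).
have U0 : forall z t, U z t = 0.
  have := @polyline_domain R 4 (fun q => lead w p X (v4 (cx q *+ false) (cy q *+ false) (cz q *+ true) (ct q *+ true))) G.
  case=> //; first by apply: polyline_v4; exact: lead_polyline.
  - move=> q; rewrite !mulr0n !mulr1n ztG; by have [_ ? _] := K (cz q) (ct q).
  - by move=> H1 z t; have := H1 (v4 0 0 z t); rewrite !v4E !mulr0n !mulr1n.
  - by move=> H2; rewrite H2 eqxx in Gq0.
split.
- by move=> q; rewrite -(v4K q) EX -/(U _ _) U0 add0r !v4E.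
- by move=> q; rewrite -(v4K q) EY -/(V _ _); have [-> _ _] := K (cz q) (ct q); rewrite add0r !v4E.
- move=> q; have [-> _] := K (cz q) (ct q); rewrite mulr0 sub0r -ztG -ztH => /eqP.
  by rewrite addrC subr_eq0 => /eqP.
Qed.

Local Notation ones := [tuple 1%N; 1%N; 1%N; 1%N].

Lemma taylor_at0 n (h : 'rV[C]_n -> C) : expands_at 0 h -> taylor h [ffun=> 0%N] = h 0.
Proof.
move=> /taylor_at hc; have [e e0 He] := series_at_hsum hc.
have H0 : hsum (fun a => taylor h a * monomial a 0) (h 0).
  by apply: He => i; rewrite mxE normr0.
have := @hsum1 C _ (fun a => taylor h a * monomial a 0) [ffun=> 0%N].
rewrite monomial0 mulr1 => H1; apply: (hsum_unique (H1 _) H0) => a a0.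
have [/existsP[i ai]|] := boolP [exists i, a i != 0%N].
  by rewrite (monomial_at0 ai) mulr0.
rewrite negb_exists => /forallP a0'; case/eqP: a0; apply/ffunP => i; rewrite ffunE.
by have := a0' i; rewrite negbK => /eqP.
Qed.

Lemma wge1 n (w : n.-tuple nat) (h : 'rV[C]_n -> C) : (forall i, 0 < tnth w i)%N ->
  expands_at 0 h -> h 0 = 0 -> wge w 1 h.
Proof.
move=> w0 h0 h00 a; rewrite lt0n; apply: contra_neq => wa.
rewrite (_ : a = [ffun=> 0%N]) ?taylor_at0 //; apply/ffunP => i; rewrite ffunE.
have /eqP : (\sum_i tnth w i * a i)%N = 0%N := wa.
by rewrite sum_nat_eq0 => /forallP /(_ i); rewrite /= muln_eq0 gtn_eqF //= => /eqP.
Qed.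

Lemma lead_at0 n (w : n.-tuple nat) d (h : 'rV[C]_n -> C) : (forall i, 0 < tnth w i)%N ->
  (0 < d)%N -> lead w d h 0 = 0.
Proof.
move=> w0 d0; apply: (hsum_unique (lead_hsum w0 d h 0)).
rewrite (_ : (fun a => _) = (fun=> 0)); first exact: hsum0.
apply/funext => a; rewrite /wt_part; case: eqP => [wa|]; last by rewrite mul0r.
have [/existsP[i ai]|] := boolP [exists i, a i != 0%N].
  by rewrite (monomial_at0 ai) mulr0.
rewrite negb_exists => /forallP a0; move: d0; rewrite -wa /mon_wt big1 // => i _.
by have := a0 i; rewrite negbK => /eqP ->; rewrite muln0.
Qed.

Lemma ones_gt0 : forall i, (0 < tnth ones i)%N. Proof. exact: tuple4_gt0. Qed.

Lemma lead_ones h q : lead ones 1 h q = \sum_j taylor h (delta j) * q 0 j.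
Proof.
have wp i : wt_part ones 1 (taylor h) (delta i) = taylor h (delta i).
  by apply: wt_part_delta; move: i; apply: ord4P; rewrite tnth4.
rewrite -(v4K q) lead_lin_t // lead_lin_z // lead_lin_y // lead_lin_x //.
rewrite v4_0 lead_at0 //; last exact: ones_gt0.
by rewrite add0r !wp sum4 -!/(cx _) -!/(cy _) -!/(cz _) -!/(ct _) !v4E.
Qed.

(** The Jacobian matrix at the origin. *)
Definition linmx (Phi : 'rV[C]_4 -> 'rV[C]_4) : 'M[C]_4 :=
  \matrix_(i, j) taylor (fun x => Phi x 0 i) (delta j).

Lemma wlim_linmx Phi i : analytic0 Phi -> Phi 0 = 0 ->
  wlim ones 1 (fun x => Phi x 0 i) (fun q => \sum_j linmx Phi i j * q 0 j).
Proof.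
move=> aP P0; have := wge_wlim ones_gt0 (aP i) (wge1 ones_gt0 (aP i) _).
rewrite P0 mxE => /(_ erefl); apply: wlim_eq => // q.
by rewrite lead_ones; apply: eq_bigr => j _; rewrite mxE.
Qed.

(** The tangent cone [xy + G = 0] spans the whole space. *)
Lemma linear_form_arc (G : 'rV[C]_4 -> C) (m : 'I_4 -> C) : zt_only G -> G 0 = 0 ->
  (forall q, cx q * cy q + G q = 0 -> (cx q != 0) || (cy q != 0) -> \sum_j m j * q 0 j = 0) ->
  forall j, m j = 0.
Proof.
move=> ztG G0 H.
have E q : \sum_j m j * q 0 j = m (inord 0) * cx q + m (inord 1) * cy q + m (inord 2) * cz q + m (inord 3) * ct q.
  by rewrite sum4.
have m0 : m (inord 0) = 0.
  have := H (v4 1 0 0 0); rewrite E !v4E zt_onlyE // v4_0 G0 mulr0 addr0 oner_neq0 => /(_ erefl isT).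
  by rewrite mulr1 !mulr0 !addr0.
have m1 : m (inord 1) = 0.
  have := H (v4 0 1 0 0); rewrite E !v4E zt_onlyE // v4_0 G0 mul0r addr0 oner_neq0 orbT => /(_ erefl isT).
  by rewrite mulr1 !mulr0 !addr0 add0r.
apply: ord4P => //.
- have := H (v4 1 (- G (v4 0 0 1 0)) 1 0); rewrite E !v4E zt_onlyE // mul1r addNr oner_neq0 => /(_ erefl isT).
  by rewrite m0 m1 !mul0r !add0r mulr1 mulr0 addr0.
- have := H (v4 1 (- G (v4 0 0 0 1)) 0 1); rewrite E !v4E zt_onlyE // mul1r addNr oner_neq0 => /(_ erefl isT).
  by rewrite m0 m1 !mul0r !add0r mulr1 mulr0 add0r.
Qed.

(** [Psi \o Phi] is the identity on the zero set only, but a linear form that vanishes on the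
    tangent cone is 0, and this applies to each row of the difference of the Jacobians. *)
Lemma linmx_inv g G F' Phi Psi : expands_at 0 g -> zt_only g -> wlim ones 2 g G ->
  germ_pair (hyp g) F' Phi Psi -> linmx Psi *m linmx Phi = 1%:M.
Proof.
move=> g0 ztg gG [[aP P0 _] [aQ Q0 _] PQ _].
have ztG := wlim_zt_only ztg gG.
have G0 : G 0 = 0.
  by rewrite (wlim_lead ones_gt0 g0 gG) lead_at0 //; exact: ones_gt0.
apply/eqP; rewrite -subr_eq0; apply/eqP/matrixP => i j; rewrite mxE [RHS]mxE.
move: j; apply: (linear_form_arc ztG G0) => q Eq qn.
have hl : wlim ones 1 (fun x => Psi (Phi x) 0 i - x 0 i) (fun q =>
    (\sum_k linmx Psi i k * (\row_j \sum_j' linmx Phi j j' * q 0 j') 0 k) + -1 * q 0 i).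
  apply: wlimD.
    apply: (wlim_comp (h := Phi) (g := fun x => Psi x 0 i) (wlim_linmx i aQ Q0)) => k.
    have -> : tnth ones k = 1%N by move: k; apply: ord4P; rewrite tnth4.
    by apply: wlim_eq (wlim_linmx k aP P0) => // q'; rewrite mxE.
  have := @wlim_coord C 4 ones i; rewrite (_ : tnth ones i = 1%N); last by move: i; apply: ord4P; rewrite tnth4.
  by move=> H; apply: (wlim_eq _ _ (wlimZ (-1) H)) => // x; rewrite mulN1r.
have van : vanishes_on (hyp g) (fun x => Psi (Phi x) 0 i - x 0 i).
  by apply: nearS PQ => x Ex /Ex ->; rewrite subrr.
have := arc_wlim ones_gt0 (arc_hyp ztg gG Eq qn) van hl.
move=> E; rewrite -[RHS]E.
transitivity (\sum_j ((linmx Psi *m linmx Phi) i j * q 0 j - (i == j)%:R * q 0 j)).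
  by apply: eq_bigr => j _; rewrite [X in _ + X]mxE [X in - X]mxE mulrDl mulNr.
rewrite big_split /=; congr (_ + _).
  under eq_bigr do rewrite mxE mulr_suml.
  rewrite exchange_big; apply: eq_bigr => k _; rewrite mxE mulr_sumr.
  by apply: eq_bigr => j _; rewrite mulrA.
rewrite (bigD1 i) //= eqxx big1 ?addr0 ?mulN1r ?mul1r // => j ji.
by rewrite eq_sym (negPf ji) mul0r oppr0.
Qed.

Lemma germ_map_vanish g g' Phi : germ_map (hyp g) (hyp g') Phi ->
  vanishes_on (hyp g) (fun q => cx (Phi q) * cy (Phi q) + g' (Phi q)).
Proof. by case. Qed.

Lemma wlim_zt_comp n (w : n.-tuple nat) p1 p2 k l d g G (Phi : 'rV[C]_n -> 'rV[C]_4) Z0 T0 :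
  zt_only g -> wlim [tuple p1; p2; k; l] d g G ->
  wlim w k (fun x => cz (Phi x)) Z0 -> wlim w l (fun x => ct (Phi x)) T0 ->
  wlim w d (fun x => g (Phi x)) (fun x => G (v4 0 0 (Z0 x) (T0 x))).
Proof.
move=> ztg gG hZ hT; have := wlim_comp4 gG (wlim0 w p1) (wlim0 w p2) hZ hT.
by apply: wlim_eq => // x; rewrite -ztg.
Qed.

Lemma germ_pair_swap F g Phi Psi : zt_only g -> germ_pair F (hyp g) Phi Psi ->
  germ_pair F (hyp g) (swap \o Phi) (Psi \o swap).
Proof.
move=> ztg gP; apply: (germ_pair_comp gP).
have sw : germ_map (hyp g) (hyp g) (@swap R).
  split.
  - by apply: expands4; exact: expands_at_coord.
  - by apply: eq4; rewrite v4E /cx /cy /cz /ct !mxE.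
  - by apply: filterE => x Fx; rewrite hyp_swap.
by split=> //; apply: filterE => x _; exact: swapK.
Qed.

Definition normal (Phi : 'rV[C]_4 -> 'rV[C]_4) : Prop :=
  [/\ forall j, j != inord 0 -> linmx Phi (inord 0) j = 0,
      linmx Phi (inord 0) (inord 0) != 0,
      forall j, j != inord 1 -> linmx Phi (inord 1) j = 0 &
      linmx Phi (inord 1) (inord 1) != 0].

Lemma linmx_swap Phi j :
  (linmx (swap \o Phi) (inord 0) j = linmx Phi (inord 1) j) *
  (linmx (swap \o Phi) (inord 1) j = linmx Phi (inord 0) j).
Proof.
split; rewrite !mxE; congr (taylor _ _); apply/funext => x.
  exact: cx_v4.
exact: cy_v4.
Qed.

Lemma row_neq0 (A B : 'M[C]_4) i : A *m B = 1%:M -> ~ (forall j, A i j = 0).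
Proof.
move=> AB Ai; have /matrixP /(_ i i) := AB; rewrite !mxE eqxx big1 => [/esym/eqP|j _].
  by rewrite oner_eq0.
by rewrite Ai mul0r.
Qed.

Lemma normal_inv Phi Psi : linmx Phi *m linmx Psi = 1%:M -> normal Phi -> normal Psi.
Proof.
move=> E [x0 xx y0 yy].
have row i j : (forall j', j' != i -> linmx Phi i j' = 0) ->
    linmx Phi i i * linmx Psi i j = (i == j)%:R.
  move=> H; have /matrixP /(_ i j) := E; rewrite [in LHS]mxE [in RHS]mxE => <-.
  by rewrite (bigD1 i) //= big1 ?addr0 // => j' /H ->; rewrite mul0r.
split.
- move=> j j0; have /eqP := row _ j x0.
  by rewrite [_ == j]eq_sym (negPf j0) mulf_eq0 (negPf xx) => /eqP.
- apply/eqP => H; have /eqP := row _ (inord 0) x0.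
  by rewrite H mulr0 eqxx eq_sym oner_eq0.
- move=> j j0; have /eqP := row _ j y0.
  by rewrite [_ == j]eq_sym (negPf j0) mulf_eq0 (negPf yy) => /eqP.
- apply/eqP => H; have /eqP := row _ (inord 1) y0.
  by rewrite H mulr0 eqxx eq_sym oner_eq0.
Qed.

Lemma ord4_neq : ((inord 0 != inord 1 :> 'I_4) * (inord 0 != inord 2 :> 'I_4) *
  (inord 0 != inord 3 :> 'I_4) * (inord 1 != inord 0 :> 'I_4) * (inord 1 != inord 2 :> 'I_4) *
  (inord 1 != inord 3 :> 'I_4) * (inord 2 != inord 0 :> 'I_4) * (inord 2 != inord 1 :> 'I_4) *
  (inord 2 != inord 3 :> 'I_4) * (inord 3 != inord 0 :> 'I_4) * (inord 3 != inord 1 :> 'I_4) *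
  (inord 3 != inord 2 :> 'I_4))%type.
Proof. by do !split; rewrite -val_eqE /= !inordK. Qed.

Definition multiplicity_ge3 g : Prop :=
  [/\ expands_at 0 g, zt_only g & wlim ones 2 g (fun=> 0)].

Lemma linmx_inv3 g F' Phi Psi : multiplicity_ge3 g ->
  germ_pair (hyp g) F' Phi Psi -> linmx Psi *m linmx Phi = 1%:M.
Proof. by case=> g0 ztg gG; exact: linmx_inv g0 ztg gG. Qed.

(** The quadratic parts are xy, so the product of the linear parts of the first two components
    vanishes on xy = 0. On each of the hyperplanes x = 0 and y = 0 one of the two linear forms is 0,
    and not the same one twice since the Jacobian is invertible. *)
Lemma normal_or_swap g g' Phi Psi : multiplicity_ge3 g -> multiplicity_ge3 g' ->
  germ_pair (hyp g) (hyp g') Phi Psi -> normal Phi \/ normal (swap \o Phi).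
Proof.
move=> mg mg' gP; have [g0 ztg gG] := mg; have [g0' ztg' gG'] := mg'.
have JJ := mulmx1C (linmx_inv3 mg gP).
have [[aP P0 FP] _ _ _] := gP.
have hl : wlim ones 2 (fun q => cx (Phi q) * cy (Phi q) + g' (Phi q))
    (fun q => (\sum_j linmx Phi (inord 0) j * q 0 j) * (\sum_j linmx Phi (inord 1) j * q 0 j) + 0).
  apply: wlimD; first exact: (wlimM (wlim_linmx (inord 0) aP P0) (wlim_linmx (inord 1) aP P0)).
  exact: (wlim_zt_comp ztg' gG' (wlim_linmx (inord 2) aP P0) (wlim_linmx (inord 3) aP P0)).
have H q : cx q * cy q = 0 -> (cx q != 0) || (cy q != 0) ->
    (\sum_j linmx Phi (inord 0) j * q 0 j) * (\sum_j linmx Phi (inord 1) j * q 0 j) = 0.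
  move=> q0 qn; have Eq : cx q * cy q + 0 = 0 by rewrite addr0.
  have := arc_wlim ones_gt0 (arc_hyp (G := fun=> 0) ztg gG Eq qn) (germ_map_vanish (And3 aP P0 FP)) hl.
  by rewrite addr0.
have pl i (a b : bool) : polyline (fun q => \sum_j linmx Phi i j * v4 (cx q *+ a) (cy q *+ b) (cz q *+ true) (ct q *+ true) 0 j).
  apply: (polyline_v4 (F := fun q => \sum_j linmx Phi i j * q 0 j)).
  move=> p q; exists ((\sum_j linmx Phi i j * p 0 j)%:P + 'X * (\sum_j linmx Phi i j * q 0 j)%:P) => m.
  rewrite !hornerE mulr_sumr -big_split /=; apply: eq_bigr => j _; rewrite !mxE; ring.
have S i q (a b : bool) : \sum_j linmx Phi i j * v4 (cx q *+ a) (cy q *+ b) (cz q *+ true) (ct q *+ true) 0 j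
   = linmx Phi i (inord 0) * (cx q *+ a) + linmx Phi i (inord 1) * (cy q *+ b)
     + linmx Phi i (inord 2) * cz q + linmx Phi i (inord 3) * ct q.
  by rewrite sum4 -/(cx _) -/(cy _) -/(cz _) -/(ct _) !v4E.
have coef i (a b : bool) : (forall q, \sum_j linmx Phi i j * v4 (cx q *+ a) (cy q *+ b) (cz q *+ true) (ct q *+ true) 0 j = 0) ->
    [/\ (a -> linmx Phi i (inord 0) = 0), (b -> linmx Phi i (inord 1) = 0),
        linmx Phi i (inord 2) = 0 & linmx Phi i (inord 3) = 0].
  move=> E; split.
  - by move=> a1; have := E (v4 1 0 0 0); rewrite S !v4E a1 !mul0rn !mulr0 !addr0 mulr1n mulr1.
  - by move=> b1; have := E (v4 0 1 0 0); rewrite S !v4E b1 !mul0rn !mulr0 !addr0 add0r mulr1n mulr1.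
  - by have := E (v4 0 0 1 0); rewrite S !v4E !mul0rn !mulr0 !addr0 !add0r mulr1.
  - by have := E (v4 0 0 0 1); rewrite S !v4E !mul0rn !mulr0 !add0r mulr1.
have split_x : (forall q, \sum_j linmx Phi (inord 0) j * v4 (cx q *+ true) (cy q *+ false) (cz q *+ true) (ct q *+ true) 0 j = 0) \/
   (forall q, \sum_j linmx Phi (inord 1) j * v4 (cx q *+ true) (cy q *+ false) (cz q *+ true) (ct q *+ true) 0 j = 0).
  apply: polyline_domain; [exact: pl|exact: pl|].
  apply: polyline0; first by apply: polylineM; exact: pl.
  move=> q; have [->|x0] := eqVneq (cx q) 0; first by rewrite mul0r.
  by rewrite H ?mulr0 // !v4E ?mulr1n ?mulr0n ?mulr0 ?x0.
have split_y : (forall q, \sum_j linmx Phi (inord 0) j * v4 (cx q *+ false) (cy q *+ true) (cz q *+ true) (ct q *+ true) 0 j = 0) \/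
   (forall q, \sum_j linmx Phi (inord 1) j * v4 (cx q *+ false) (cy q *+ true) (cz q *+ true) (ct q *+ true) 0 j = 0).
  apply: polyline_domain; [exact: pl|exact: pl|] => q.
  move: q; apply: (polyline0_coord (i := inord 1)); first by apply: polylineM; exact: pl.
  move=> q; rewrite -/(cy q).
  have [->|y0] := eqVneq (cy q) 0; first by rewrite mul0r.
  by rewrite H ?mulr0 // !v4E ?mulr1n ?mulr0n ?mul0r ?y0 ?orbT.
have nz i : ~ (forall j, linmx Phi i j = 0) := row_neq0 JJ.
case: split_x => /coef[/(_ isT) x0 _ x2 x3]; case: split_y => /coef[_ /(_ isT) y1 y2 y3].
- by case: (nz (inord 0)); apply: ord4P.
- right; split.
  + by apply: ord4P; rewrite ?eqxx // !linmx_swap.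
  + by rewrite linmx_swap; apply/eqP => y0; case: (nz (inord 1)); apply: ord4P.
  + by apply: ord4P; rewrite ?eqxx // !linmx_swap.
  + by rewrite linmx_swap; apply/eqP => y0; case: (nz (inord 0)); apply: ord4P.
- left; split.
  + by apply: ord4P; rewrite ?eqxx.
  + by apply/eqP => y0; case: (nz (inord 0)); apply: ord4P.
  + by apply: ord4P; rewrite ?eqxx.
  + by apply/eqP => y0; case: (nz (inord 1)); apply: ord4P.
- by case: (nz (inord 1)); apply: ord4P.
Qed.

End Hypersurface.

(** * Power series in z and t as functions on C^4 *)

Section TwoVariables.
Context {R : realType}.
Local Notation C := (cplx R).
Implicit Types (q : 'rV[C]_4) (c g : pwseries R 2).

Definition o1 : 'I_2 := lift ord0 ord0.

Lemma ord2P (P : 'I_2 -> Prop) : P ord0 -> P o1 -> forall i, P i.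
Proof.
move=> P0 P1 [[|[|i]] hi] //.
- by rewrite (_ : Ordinal hi = ord0) //; exact: val_inj.
- by rewrite (_ : Ordinal hi = o1) //; exact: val_inj.
Qed.

Lemma mon_wt2 (k l : nat) (a : {ffun 'I_2 -> nat}) :
  mon_wt [tuple k; l] a = (k * a ord0 + l * a o1)%N.
Proof. by rewrite /mon_wt !big_ord_recl big_ord0 addn0 !(tnth_nth 0%N). Qed.

Lemma zt_expK (a : {ffun 'I_2 -> nat}) : a = zt_exp (a ord0) (a o1).
Proof. by apply/ffunP; apply: ord2P; rewrite ffunE. Qed.

Lemma zt_expE i j : (zt_exp i j ord0 = i) * (zt_exp i j o1 = j).
Proof. by rewrite !ffunE. Qed.

Lemma mult_geE g d : wt_ge [tuple of nseq 2 1%N] g d <-> wt_ge [tuple 1%N; 1%N] g d.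
Proof.
have E a : mon_wt [tuple of nseq 2 1%N] a = mon_wt [tuple 1%N; 1%N] a.
  by apply: eq_bigr => i _; rewrite tnth_nseq; congr (_ * _)%N; move: i; apply: ord2P.
by split=> H a /H; rewrite E.
Qed.

Lemma czt_v4 x y z t : czt (v4 x y z t) = czt (v4 0 0 z t) :> 'rV[C]_2.
Proof. by apply/rowP; apply: ord2P; rewrite !mxE !v4E. Qed.

Lemma czt0 q : czt q 0 ord0 = cz q. Proof. by rewrite mxE. Qed.
Lemma czt1 q : czt q 0 o1 = ct q. Proof. by rewrite mxE. Qed.

Lemma monomial2 (a : {ffun 'I_2 -> nat}) (x : 'rV[C]_2) :
  monomial a x = x 0 ord0 ^+ a ord0 * x 0 o1 ^+ a o1.
Proof. by rewrite /monomial !big_ord_recl big_ord0 mulr1. Qed.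

Definition ztf g q : C := psval g (czt q).

Lemma ztf_only g : zt_only (ztf g).
Proof. by move=> q; rewrite /ztf -[in LHS](v4K q) czt_v4. Qed.

Lemma czt_D : forall (p q : 'rV[C]_4) m, czt (p + m *: q) = czt p + m *: czt q.
Proof.
move=> p q m; apply/rowP; apply: ord2P.
  by rewrite czt0 czD -(czt0 p) -(czt0 q) [RHS]mxE; congr (_ + _); rewrite [RHS]mxE.
by rewrite czt1 ctD -(czt1 p) -(czt1 q) [RHS]mxE; congr (_ + _); rewrite [RHS]mxE.
Qed.

Lemma czt_expands q i : expands_at q (fun x => czt x 0 i).
Proof.
move: i; apply: ord2P.
- by under eq_fun do rewrite czt0; exact: expands_at_coord.
- by under eq_fun do rewrite czt1; exact: expands_at_coord.
Qed.

Lemma ztf_expands g : convergent g -> expands_at 0 (ztf g).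
Proof.
move=> [r r0 gr]; apply: expands_at_comp; last exact: czt_expands.
apply: (psval_cb_analytic gr) => i; rewrite (_ : czt 0 = 0) ?mxE ?normr0 //.
by apply/rowP; apply: ord2P; rewrite !mxE /cz /ct !mxE.
Qed.

Lemma wlim_czt p1 p2 k l i :
  wlim [tuple p1; p2; k; l] (tnth [tuple k; l] i) (fun q => czt q 0 i) (fun q => czt q 0 i).
Proof.
move: i; apply: ord2P; rewrite (tnth_nth 0%N) /=.
- by apply: wlim_eq (wlim_cz p1 p2 k l) => q; rewrite czt0.
- by apply: wlim_eq (wlim_ct p1 p2 k l) => q; rewrite czt1.
Qed.

Lemma ztf_wlim p1 p2 k l d g : (0 < k)%N -> (0 < l)%N -> convergent g ->
  wt_ge [tuple k; l] g d ->
  wlim [tuple p1; p2; k; l] d (ztf g) (psval (wt_part [tuple k; l] d g) \o @czt R).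
Proof.
move=> k0 l0 [r r0 gr] gd; apply: (wlim_comp (v := [tuple k; l])); last exact: wlim_czt.
apply: (wlim_series _ r0 gr gd).
by apply: ord2P; rewrite (tnth_nth 0%N).
Qed.

Lemma ztf_polyline k l d g : (0 < k)%N -> (0 < l)%N ->
  polyline (psval (wt_part [tuple k; l] d g) \o @czt R).
Proof.
move=> k0 l0; apply: polyline_lin; last exact: czt_D.
by apply: polyline_wt_part; apply: ord2P; rewrite (tnth_nth 0%N).
Qed.

Lemma ztf_neq0 k l d g a : convergent g -> g a != 0 -> mon_wt [tuple k; l] a = d ->
  exists q, (psval (wt_part [tuple k; l] d g) \o @czt R) q != 0.
Proof.
move=> gc ga wa; have [x gx] := wt_part_neq0 gc ga wa.
exists (v4 0 0 (x 0 ord0) (x 0 o1)) => /=.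
rewrite (_ : czt _ = x) //; apply/rowP; apply: ord2P; rewrite ?czt0 ?czt1 v4E //.
Qed.

Lemma psval_single n (c : pwseries R n) a x : (forall b, b != a -> c b * monomial b x = 0) ->
  psval c x = c a * monomial a x.
Proof.
move=> H; apply: hsum_psval.
exact: (@hsum1 C _ (fun b => c b * monomial b x)).
Qed.

Lemma ztf_wlim0 p1 p2 k l d g : (0 < k)%N -> (0 < l)%N -> convergent g ->
  wt_ge [tuple k; l] g d.+1 -> wlim [tuple p1; p2; k; l] d (ztf g) (fun=> 0).
Proof. by move=> k0 l0 gc gd; exact: wlim_lower (ltnSn d) (ztf_wlim p1 p2 k0 l0 gc gd). Qed.

Lemma multiplicity_ge3_ztf g : convergent g -> wt_ge [tuple 1%N; 1%N] g 3 ->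
  multiplicity_ge3 (ztf g).
Proof. by move=> gc g3; split; [exact: ztf_expands|exact: ztf_only|exact: ztf_wlim0]. Qed.

End TwoVariables.

(** * Comparison of multiplicities; pure powers of t *)

Section Multiplicity.
Context {R : realType}.
Local Notation C := (cplx R).
Implicit Types (q : 'rV[C]_4) (h g G : 'rV[C]_4 -> C).

Lemma wge_min n (w : n.-tuple nat) d (h : 'rV[C]_n -> C) : (forall i, d <= tnth w i)%N ->
  expands_at 0 h -> h 0 = 0 -> wge w d h.
Proof.
move=> wd h0 h00 a ha.
have [i ai] : exists i, a i != 0%N.
  apply/existsP; apply: contraNT ha; rewrite negb_exists => /forallP a0.
  rewrite (_ : a = [ffun=> 0%N]) ?taylor_at0 ?h00 //; apply/ffunP => i; rewrite ffunE.
  by have := a0 i; rewrite negbK => /eqP.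
rewrite /mon_wt (bigD1 i) //=; apply: leq_trans (leq_addr _ _).
by apply: leq_trans (wd i) _; rewrite leq_pmulr // lt0n.
Qed.

Lemma germ_map_comp_expands F F' (Phi : 'rV[C]_4 -> 'rV[C]_4) : germ_map F F' Phi ->
  [/\ expands_at 0 (fun x => cx (Phi x)), expands_at 0 (fun x => cy (Phi x)),
      expands_at 0 (fun x => cz (Phi x)) & expands_at 0 (fun x => ct (Phi x))].
Proof. by case=> aP _ _; split; [exact: (aP (inord 0))|exact: (aP (inord 1))|exact: (aP (inord 2))|exact: (aP (inord 3))]. Qed.

Lemma germ_map_comp0 F F' (Phi : 'rV[C]_4 -> 'rV[C]_4) : germ_map F F' Phi ->
  [/\ cx (Phi 0) = 0, cy (Phi 0) = 0, cz (Phi 0) = 0 & ct (Phi 0) = 0].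
Proof. by case=> _ -> _; rewrite /cx /cy /cz /ct !mxE. Qed.

(** The tangent cone xy = 0 of the target is a product of linear forms. Pulled back, this product
    vanishes on xy + G = 0, so by [arc_domain] one row of an invertible Jacobian would be 0. *)
Lemma quadric_not_cubic g G g' Phi Psi : expands_at 0 g -> zt_only g ->
  wlim [tuple 1%N; 1%N; 1%N; 1%N] 2 g G -> polyline G -> (exists q, G q != 0) ->
  multiplicity_ge3 g' -> germ_pair (hyp g) (hyp g') Phi Psi -> False.
Proof.
move=> g0 ztg gG polyG Gn [g0' ztg' gG'] gP.
have JJ := mulmx1C (linmx_inv g0 ztg gG gP).
have [gm _ _ _] := gP; have [aP P0 _] := gm.
have ztG := wlim_zt_only ztg gG.
have wlc i := wge_wlim ones_gt0 (aP i) (wge1 ones_gt0 (aP i) _).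
have P0i i : Phi 0 0 i = 0 by rewrite P0 mxE.
have hl : wlim [tuple 1%N; 1%N; 1%N; 1%N] 2 (fun q => cx (Phi q) * cy (Phi q) + g' (Phi q))
    (fun q => lead [tuple 1%N; 1%N; 1%N; 1%N] 1 (fun x => cx (Phi x)) q *
              lead [tuple 1%N; 1%N; 1%N; 1%N] 1 (fun x => cy (Phi x)) q + 0).
  apply: wlimD; first exact: (wlimM (wlc P0i (inord 0)) (wlc P0i (inord 1))).
  exact: (wlim_zt_comp ztg' gG' (wlim_linmx (inord 2) aP P0) (wlim_linmx (inord 3) aP P0)).
have [q Eq xq|H|H] := @arc_domain R 1 1 1 1 isT isT isT isT isT G polyG ztG Gn 1 1
  (fun x => cx (Phi x)) (fun x => cy (Phi x)) isT isT.
- have := arc_wlim ones_gt0 (arc_hyp_x ztg gG Eq xq) (germ_map_vanish gm) hl.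
  by rewrite addr0.
- apply: (row_neq0 JJ (i := inord 0)) => j; rewrite mxE.
  by apply: (lead0_coef (aP (inord 0)) H); rewrite mon_wt_delta; move: j; apply: ord4P; rewrite tnth4.
- apply: (row_neq0 JJ (i := inord 1)) => j; rewrite mxE.
  by apply: (lead0_coef (aP (inord 1)) H); rewrite mon_wt_delta; move: j; apply: ord4P; rewrite tnth4.
Qed.

(** In the weights (m, m, 2, 2) the form [G] is the part of [g] of degree [m] in z and t, while [g']
    has no part of that weight. So the product of the leading forms of the first two components
    vanishes on the cone, against their terms x and y. *)
Lemma multiplicity_le m g G g' Phi Psi : (2 < m)%N -> let w := [tuple m; m; 2%N; 2%N] in
  multiplicity_ge3 g -> wlim w (m + m) g G -> polyline G -> (exists q, G q != 0) ->
  multiplicity_ge3 g' -> wlim w (m + m) g' (fun=> 0) ->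
  germ_pair (hyp g) (hyp g') Phi Psi -> False.
Proof.
move=> m3 w mg gG polyG Gn mg' gG'; have [_ ztg _] := mg; have [_ ztg' _] := mg'.
have m0 : (0 < m)%N by exact: leq_trans m3.
have m2 : (2 <= m)%N by exact: ltnW.
have w0 : forall i, (0 < tnth w i)%N by exact: tuple4_gt0.
have w2 : forall i, (2 <= tnth w i)%N by apply: ord4P; rewrite tnth4.
have ztG := wlim_zt_only ztg gG.
wlog nP : Phi Psi / normal Phi.
  move=> H gP; case: (normal_or_swap mg mg' gP) => nP; first exact: (H _ _ nP gP).
  exact: (H _ _ nP (germ_pair_swap ztg' gP)).
move=> [gm _ _ _]; have [hX hY hZ hT] := germ_map_comp_expands gm.
have [X0 Y0 Z0 T0] := germ_map_comp0 gm.
have hl : wlim w (m + m) (fun q => g' (Phi q)) (fun=> 0).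
  apply: (wlim_zt_comp ztg' gG'); apply: (wge_wlim w0) => //; exact: wge_min.
case: nP => x0 xx y0 yy; rewrite !mxE in xx yy.
have [wX wY] := product_weights m0 m0 (isT : (0 < 2)%N) (isT : (0 < 2)%N) (leqnn m) ztg gG polyG Gn
   hX hY (germ_map_vanish gm) hl xx yy.
have hl2 : wlim w (m + m) (fun q => cx (Phi q) * cy (Phi q) + g' (Phi q))
    (fun q => lead w m (fun x => cx (Phi x)) q * lead w m (fun x => cy (Phi x)) q + 0).
  by apply: wlimD => //; exact: (wlimM (wge_wlim w0 hX wX) (wge_wlim w0 hY wY)).
have [q Eq xq|H|H] := @arc_domain R m m 2 2 m0 m0 isT isT (leqnn m) G polyG ztG Gn m m
  (fun x => cx (Phi x)) (fun x => cy (Phi x)) (leqnn m) (leqnn m).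
- have := arc_wlim w0 (arc_hyp_x ztg gG Eq xq) (germ_map_vanish gm) hl2.
  by rewrite addr0.
- move/eqP: xx; apply; apply: (lead0_coef hX H).
  by rewrite mon_wt_delta tnth4.
- move/eqP: yy; apply; apply: (lead0_coef hY H).
  by rewrite mon_wt_delta tnth4.
Qed.

Definition texp (e : nat) : {ffun 'I_4 -> nat} := [ffun i => if i == inord 3 then e else 0%N].

Lemma texpE e : ((texp e (inord 0%N) = 0%N) * (texp e (inord 1%N) = 0%N) *
  (texp e (inord 2%N) = 0%N) * (texp e (inord 3%N) = e))%type.
Proof.
rewrite !ffunE eqxx (negPf ord4_neq.1.1.1.1.1.1.1.1.1.2) //.
by rewrite -!val_eqE /= !inordK.
Qed.

Lemma lead_texp p1 p2 k l d e h : (0 < p1)%N -> (0 < p2)%N -> (0 < k)%N -> (0 < l)%N ->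
  (l * e = d)%N -> forall t, lead [tuple p1; p2; k; l] d h (v4 0 0 0 t) = taylor h (texp e) * t ^+ e.
Proof.
move=> p10 p20 k0 l0 led t; have w0 := tuple4_gt0 p10 p20 k0 l0.
have mt b : monomial b (v4 0 0 0 t : 'rV[C]_4) =
    0 ^+ b (inord 0) * 0 ^+ b (inord 1) * 0 ^+ b (inord 2) * t ^+ b (inord 3).
  rewrite /monomial !big_ord_recl big_ord0 !mxE /= !mulr1 !mulrA.
  by congr (_ ^+ b _ * _ ^+ b _ * _ ^+ b _ * _ ^+ b _); apply: val_inj; rewrite /= inordK.
rewrite (lead_single w0 (a := texp e)).
  by rewrite mt !texpE !mul1r /wt_part mon_wt4 !texpE !muln0 !add0n led eqxx.
move=> b; rewrite mon_wt4 mt => wb bt.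
have [b0|b0] := eqVneq (b (inord 0)) 0%N; last by rewrite expr0n (negPf b0) !mul0r mulr0.
have [b1|b1] := eqVneq (b (inord 1)) 0%N; last by rewrite [0 ^+ b (inord 1)]expr0n (negPf b1) mulr0 !mul0r mulr0.
have [b2|b2] := eqVneq (b (inord 2)) 0%N; last by rewrite [0 ^+ b (inord 2)]expr0n (negPf b2) mulr0 mul0r mulr0.
case/eqP: bt; apply/ffunP; apply: ord4P; rewrite texpE //.
apply/eqP; rewrite -(eqn_pmul2l l0) led -wb b0 b1 b2 !muln0 !add0n //.
Qed.

(** When x, y and z weigh at least [d], only pure powers of t can be too light. *)
Lemma wge_texp p1 p2 k l d h : (d <= p1)%N -> (d <= p2)%N -> (d <= k)%N ->
  (forall e, taylor h (texp e) != 0 -> (d <= l * e)%N) -> wge [tuple p1; p2; k; l] d h.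
Proof.
move=> dp1 dp2 dk H a ha; rewrite mon_wt4.
have [a0|a0] := posnP (a (inord 0)); last first.
  by rewrite -!addnA (leq_trans _ (leq_addr _ _)) // (leq_trans dp1) // leq_pmulr.
have [a1|a1] := posnP (a (inord 1)); last first.
  by rewrite -!addnA addnCA (leq_trans _ (leq_addr _ _)) // (leq_trans dp2) // leq_pmulr.
have [a2|a2] := posnP (a (inord 2)); last first.
  by rewrite addnAC addnC (leq_trans _ (leq_addr _ _)) // (leq_trans dk) // leq_pmulr.
rewrite a0 a1 a2 !muln0 !add0n; apply: H.
rewrite (_ : texp _ = a) //; apply/ffunP; apply: ord4P; rewrite texpE //.
Qed.

Lemma wge_texp0 p1 p2 k l d h e : wge [tuple p1; p2; k; l] d h -> (l * e < d)%N ->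
  taylor h (texp e) = 0.
Proof.
move=> hd led; apply/eqP/negPn/negP => /hd; rewrite mon_wt4 !texpE !muln0 !add0n.
by rewrite leqNgt led.
Qed.

Lemma lead_zt_only p1 p2 k l d h : (0 < p1)%N -> (0 < p2)%N -> (0 < k)%N -> (0 < l)%N ->
  (d < p1)%N -> (d < p2)%N -> zt_only (lead [tuple p1; p2; k; l] d h).
Proof.
move=> p10 p20 k0 l0 d1 d2 q; rewrite -{1}(v4K q).
rewrite lead_lin_x ?(ltnW d1) // lead_lin_y ?(ltnW d2) //.
by rewrite !wt_part_delta0 ?tnth4 ?gtn_eqF // !mul0r !addr0.
Qed.

(** By [lead_identity] the [m]-th power of the leading form of the z-component is proportional to
    z^m, so it vanishes at z = 0. *)
Lemma lead_z_pure p k l m (a a' : C) g g' Phi : (0 < m)%N -> (0 < k)%N -> (0 < l)%N -> (k < p)%N ->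
  let w := [tuple p; p; k; l] in
  zt_only g -> wlim w (p + p) g (fun q => a * cz q ^+ m) -> a != 0 ->
  zt_only g' -> wlim w (p + p) g' (fun q => a' * cz q ^+ m) -> a' != 0 ->
  germ_map (hyp g) (hyp g') Phi -> normal Phi ->
  wge w k (fun x => cz (Phi x)) -> wge w l (fun x => ct (Phi x)) ->
  lead w k (fun x => cz (Phi x)) (v4 0 0 0 1) = 0.
Proof.
move=> m0 k0 l0 kp w ztg gG a0 ztg' gG' a0' gm nP wZ wT.
have p0 : (0 < p)%N by exact: leq_trans kp.
have w0 : forall i, (0 < tnth w i)%N by exact: tuple4_gt0.
have [hX hY hZ hT] := germ_map_comp_expands gm.
have polyG : polyline (fun q => a * cz q ^+ m).
  apply: polylineM; first exact: polyline_cst.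
  by apply: polylineX; exact: polyline_coord.
have Gn : exists q, a * cz q ^+ m != 0.
  by exists (v4 0 0 1 0); rewrite v4E expr1n mulr1.
have [x0 xx y0 yy] := nP.
have x1 := x0 _ ord4_neq.1.1.1.1.1.1.1.1.2; have y1 := y0 _ ord4_neq.1.1.1.1.1.1.1.1.1.1.1.
rewrite !mxE in xx yy x1 y1.
have hl : wlim w (p + p) (fun q => g' (Phi q)) (fun q => a' * lead w k (fun x => cz (Phi x)) q ^+ m).
  have := wlim_zt_comp ztg' gG' (wge_wlim w0 hZ wZ) (wge_wlim w0 hT wT).
  by apply: wlim_eq => // q; rewrite v4E.
have [wX wY] := product_weights p0 p0 k0 l0 (leqnn p) ztg gG polyG Gn
   hX hY (germ_map_vanish gm) hl xx yy.
have ztH : zt_only (fun q => a' * lead w k (fun x => cz (Phi x)) q ^+ m).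
  by move=> q; rewrite (lead_zt_only _ p0 p0 k0 l0 kp kp q).
have [_ _ /(_ (v4 0 0 0 1))] := lead_identity p0 k0 l0 ztg gG polyG Gn hX hY wX wY xx yy x1 y1
  (germ_map_vanish gm) hl ztH.
rewrite v4E expr0n gtn_eqF // mulr0 mulr0 => /esym/eqP.
by rewrite mulf_eq0 (negPf a0') expf_eq0 m0 => /eqP.
Qed.

End Multiplicity.

(** * Type (1) *)

Section PureOrder.
Context {R : realType}.
Local Notation C := (cplx R).
Implicit Types (q : 'rV[C]_4) (h : 'rV[C]_4 -> C) (g : pwseries R 2).

(** The condition on z^(n+1) is deduced from the cA_n-point in [type1_series_of_germ]. *)
Definition type1_series a n g : Prop :=
  [/\ convergent g, wt_eq [tuple a; 1%N] g (a * n.+1) & (1 < a)%N -> g (zt_exp n.+1 0) != 0].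

Lemma mon_wt2_scale s j (b : {ffun 'I_2 -> nat}) :
  mon_wt [tuple (s * j)%N; s] b = (s * mon_wt [tuple j; 1%N] b)%N.
Proof. by rewrite !mon_wt2 mul1n mulnDr mulnA. Qed.

(** Turning the supporting line about the vertex z^(n+1) of the Newton polygon, from slope [a] to a
    smaller slope [j], keeps all monomials on the same side. *)
Lemma wt_ge_scale a n g s j : (j <= a)%N -> wt_ge [tuple a; 1%N] g (a * n.+1) ->
  wt_ge [tuple (s * j)%N; s] g (s * (j * n.+1)).
Proof.
move=> ja H b /H; rewrite mon_wt2_scale leq_mul2l !mon_wt2 !mul1n => hb.
apply/orP; right; have [le|lt] := leqP n.+1 (b ord0).
  by rewrite (leq_trans _ (leq_addr _ _)) // leq_mul2l le orbT.
rewrite -(subnK (ltnW lt)) mulnDr addnC leq_add2l.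
apply: (@leq_trans (a * (n.+1 - b ord0))); first by rewrite leq_mul2r ja orbT.
by rewrite mulnBr leq_subLR.
Qed.

(** For [j < a] the turned line can meet the Newton polygon in the vertex z^(n+1) only. *)
Lemma wt_part_scale a n g s j b : (0 < s)%N -> (0 < j)%N -> (j < a)%N ->
  wt_ge [tuple a; 1%N] g (a * n.+1) ->
  wt_part [tuple (s * j)%N; s] (s * (j * n.+1)) g b != 0 -> b = zt_exp n.+1 0.
Proof.
move=> s0 j0 ja H; rewrite /wt_part mon_wt2_scale eqn_pmul2l // !mon_wt2 mul1n.
case: ifP => [/eqP E|_]; last by rewrite eqxx.
move=> /H; rewrite mon_wt2 mul1n => hb.
have b0 : b ord0 = n.+1.
  apply/eqP; rewrite eqn_leq -(leq_pmul2l j0) -E leq_addr /= leqNgt; apply/negP => lt.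
  have : (j * (n.+1 - b ord0) < a * (n.+1 - b ord0))%N by rewrite ltn_mul2r ja subn_gt0 lt.
  by rewrite !mulnBr -E; lia.
by rewrite (zt_expK b) b0; congr zt_exp; move: E; rewrite b0; lia.
Qed.

Lemma ztf_lead_z a n g s j p1 p2 : (0 < s)%N -> (0 < j)%N -> (j < a)%N ->
  convergent g -> wt_ge [tuple a; 1%N] g (a * n.+1) ->
  wlim [tuple p1; p2; (s * j)%N; s] (s * (j * n.+1)) (ztf g)
    (fun q => g (zt_exp n.+1 0) * cz q ^+ n.+1).
Proof.
move=> s0 j0 ja gc gw; have sj0 : (0 < s * j)%N by rewrite muln_gt0 s0.
have := ztf_wlim p1 p2 sj0 s0 gc (wt_ge_scale s (ltnW ja) gw).
apply: wlim_eq => // q /=; rewrite (@psval_single _ _ _ (zt_exp n.+1 0)).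
  by rewrite /wt_part mon_wt2 !zt_expE muln0 addn0 mulnA eqxx monomial2 !zt_expE czt0 expr0 mulr1.
move=> b bn; apply/eqP; rewrite mulf_eq0; apply/orP; left; apply: contraR bn.
by move/(wt_part_scale s0 j0 ja gw) ->.
Qed.

Lemma type1_ones a n g : (0 < a)%N -> wt_ge [tuple a; 1%N] g (a * n.+1) ->
  wt_ge [tuple 1%N; 1%N] g n.+1.
Proof. by move=> a0 gw; have := @wt_ge_scale a n g 1 1 a0 gw; rewrite !mul1n. Qed.

Lemma type1_multiplicity a n g : (0 < a)%N -> (1 < n)%N -> type1_series a n g ->
  multiplicity_ge3 (ztf g).
Proof.
move=> a0 n1 [gc [gw _] _]; apply: multiplicity_ge3_ztf => // b /(type1_ones a0 gw).
exact: leq_trans.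
Qed.

Lemma texp_delta : texp 1 = delta (inord 3).
Proof. by apply/ffunP => i; rewrite !ffunE; case: eqP. Qed.

Lemma taylor_texp0 h : expands_at 0 h -> taylor h (texp 0) = h 0.
Proof.
move=> h0; rewrite -taylor_at0 //; congr taylor.
by apply/ffunP => i; rewrite !ffunE; case: eqP.
Qed.

(** The restriction of [h] to the t-axis vanishes to order at least [a]. *)
Definition pure_order a h : Prop := forall e, (e < a)%N -> taylor h (texp e) = 0.

Definition pure_orders a (Phi : 'rV[C]_4 -> 'rV[C]_4) : Prop :=
  [/\ pure_order a (fun x => cx (Phi x)), pure_order a (fun x => cy (Phi x)) &
      pure_order a (fun x => cz (Phi x))].

Lemma pure_orders_swap a Phi : pure_orders a (swap \o Phi) -> pure_orders a Phi.
Proof.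
have Ex : (fun x => cx (swap (Phi x))) = (fun x => cy (Phi x)) by apply/funext => x; exact: cx_v4.
have Ey : (fun x => cy (swap (Phi x))) = (fun x => cx (Phi x)) by apply/funext => x; exact: cy_v4.
have Ez : (fun x => cz (swap (Phi x))) = (fun x => cz (Phi x)) by apply/funext => x; exact: cz_v4.
by rewrite /pure_orders /= Ex Ey Ez; case.
Qed.

(** Induction on the exponent [e] of t, with the weights [(n+1)e, (n+1)e, 2e, 2], for which
    the leading form of [g] is a multiple of [z^(n+1)]. *)
Lemma pure_orders_normal a n g g' Phi Psi : (0 < a)%N -> (1 < n)%N ->
  type1_series a n g -> type1_series a n g' ->
  germ_pair (hyp (ztf g)) (hyp (ztf g')) Phi Psi -> normal Phi -> pure_orders a Phi.
Proof.
move=> a0 n1 tg tg' [gm _ _ _] nP.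
have [gc [gw [b gb wb]] gz] := tg; have [gc' [gw' _] gz'] := tg'.
have [hX hY hZ hT] := germ_map_comp_expands gm.
have [X0 Y0 Z0 T0] := germ_map_comp0 gm.
have pZ : pure_order a (fun x => cz (Phi x)).
  elim/ltn_ind => e IH ea; have [->|e0] := posnP e; first by rewrite taylor_texp0.
  have a1 : (1 < a)%N by exact: leq_ltn_trans ea.
  have e2 : (0 < 2 * e)%N by rewrite muln_gt0.
  have E : ((n.+1 * e) + (n.+1 * e) = 2 * (e * n.+1))%N by lia.
  have kp : (2 * e < n.+1 * e)%N by rewrite ltn_pmul2r.
  have lz := ztf_lead_z (n.+1 * e) (n.+1 * e) (isT : (0 < 2)%N) e0 ea gc gw.
  have lz' := ztf_lead_z (n.+1 * e) (n.+1 * e) (isT : (0 < 2)%N) e0 ea gc' gw'.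
  rewrite -E in lz lz'.
  have := lead_z_pure (ltn0Sn n) e2 (isT : (0 < 2)%N) kp (@ztf_only R g) lz (gz a1) (@ztf_only R g') lz' (gz' a1) gm nP.
  rewrite (lead_texp _ _ _ _ _ (erefl (2 * e)%N)) ?muln_gt0 //= expr1n mulr1; apply.
    apply: wge_texp; rewrite ?(ltnW kp) // => e' e'n; rewrite leq_mul2l /= leqNgt; apply/negP => e'e.
    by rewrite IH ?eqxx // in e'n; exact: ltn_trans ea.
  by apply: wge_min => //; apply: ord4P; rewrite tnth4 //; lia.
have a2 : (0 < 2 * a)%N by rewrite muln_gt0.
have p0 : (0 < n.+1 * a)%N by rewrite muln_gt0.
have E : ((n.+1 * a) + (n.+1 * a) = 2 * (a * n.+1))%N by lia.
have kp : (2 * a < n.+1 * a)%N by rewrite ltn_pmul2r.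
pose w := [tuple (n.+1 * a)%N; (n.+1 * a)%N; (2 * a)%N; 2%N].
have w0 : forall i, (0 < tnth w i)%N by exact: tuple4_gt0.
have lg := ztf_wlim (n.+1 * a) (n.+1 * a) a2 (isT : (0 < 2)%N) gc (wt_ge_scale 2 (leqnn a) gw).
have lg' := ztf_wlim (n.+1 * a) (n.+1 * a) a2 (isT : (0 < 2)%N) gc' (wt_ge_scale 2 (leqnn a) gw').
rewrite -E in lg lg'.
have wZ : wge w (2 * a) (fun x => cz (Phi x)).
  apply: wge_texp; rewrite ?(ltnW kp) // => e en; rewrite leq_mul2l /= leqNgt; apply/negP => ea.
  by rewrite pZ ?eqxx // in en.
have wT : wge w 2 (fun x => ct (Phi x)).
  by apply: wge_min => //; apply: ord4P; rewrite tnth4 //; lia.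
have hl := wlim_zt_comp (@ztf_only R g') lg' (wge_wlim w0 hZ wZ) (wge_wlim w0 hT wT).
have [_ xx _ yy] := nP; rewrite !mxE in xx yy.
have Gn : exists q, (psval (wt_part [tuple (2 * a)%N; 2%N] (n.+1 * a + n.+1 * a) g) \o @czt R) q != 0.
  by apply: ztf_neq0 gc gb _; rewrite mon_wt2_scale wb E.
have [wX wY] := product_weights p0 p0 a2 (isT : (0 < 2)%N) (leqnn _) (@ztf_only R g) lg
  (ztf_polyline _ _ a2 (isT : (0 < 2)%N)) Gn hX hY (germ_map_vanish gm) hl xx yy.
(* The first two components have weight at least [n.+1 * a], which exceeds the weight [2 * e] of
   t^e. *)
have lt_e e : (e < a)%N -> (2 * e < n.+1 * a)%N.
  by move=> ea; apply: leq_trans (ltnW kp); rewrite ltn_pmul2l.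
by split=> // e ea; [exact: (wge_texp0 wX (lt_e _ ea))|exact: (wge_texp0 wY (lt_e _ ea))].
Qed.

Lemma mult_inv0 (r : 'rV[C]_4) (A B : 'M[C]_4) : A *m B = 1%:M -> r *m A = 0 -> r = 0.
Proof. by move=> AB rA; rewrite -(mulmx1 r) -AB mulmxA rA mul0mx. Qed.

(** The tangent cone xy + c z^2 does not separate x, y and z, so their coefficients of t^e are
    treated together. Comparing powers of t on the cone shows that the vector of these coefficients
    is orthogonal, for the polar form of xy + c' z^2, to the image of the Jacobian. The Jacobian is
    invertible and the form non-degenerate in x, y, z, so the vector is 0. *)
Lemma pure_orders_quadric a g g' Phi Psi : (1 < a)%N ->
  type1_series a 1 g -> type1_series a 1 g' ->
  germ_pair (hyp (ztf g)) (hyp (ztf g')) Phi Psi -> pure_orders a Phi.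
Proof.
move=> a1 tg tg' gP; have [gm _ _ _] := gP.
have [gc [gw _] /(_ a1) gz] := tg; have [gc' [gw' _] /(_ a1) gz'] := tg'.
set c := g _ in gz; set c' := g' _ in gz'.
have [hX hY hZ hT] := germ_map_comp_expands gm.
have [X0 Y0 Z0 T0] := germ_map_comp0 gm.
have one_a : (0 < 1)%N /\ (0 < a)%N by split=> //; exact: ltnW.
have lz1 := ztf_lead_z 1 1 (isT : (0 < 1)%N) (isT : (0 < 1)%N) a1 gc gw.
have JJ := mulmx1C (linmx_inv (ztf_expands gc) (@ztf_only R g) lz1 gP).
suff all e : (e < a)%N -> [/\ taylor (fun x => cx (Phi x)) (texp e) = 0,
    taylor (fun x => cy (Phi x)) (texp e) = 0 & taylor (fun x => cz (Phi x)) (texp e) = 0].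
  by split=> e /all [].
elim/ltn_ind: e => e IH ea; have [->|e0] := posnP e; first by rewrite !taylor_texp0.
pose w := [tuple e; e; e; 1%N].
have w0 : forall i, (0 < tnth w i)%N by exact: tuple4_gt0.
have lz := ztf_lead_z e e (isT : (0 < 1)%N) e0 ea gc gw.
have lz' := ztf_lead_z e e (isT : (0 < 1)%N) e0 ea gc' gw'.
rewrite !mul1n muln2 -addnn -/c in lz; rewrite !mul1n muln2 -addnn -/c' in lz'.
have wh h : (forall e', (e' < e)%N -> taylor h (texp e') = 0) -> wge w e h.
  move=> H; apply: wge_texp => // e' e'n; rewrite mul1n leqNgt; apply/negP => e'e.
  by rewrite H ?eqxx // in e'n.
have wX : wge w e (fun x => cx (Phi x)) by apply: wh => e' e'e; have [] := IH e' e'e (ltn_trans e'e ea).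
have wY : wge w e (fun x => cy (Phi x)) by apply: wh => e' e'e; have [] := IH e' e'e (ltn_trans e'e ea).
have wZ : wge w e (fun x => cz (Phi x)) by apply: wh => e' e'e; have [] := IH e' e'e (ltn_trans e'e ea).
have wT := wge1 w0 hT T0.
have hl : wlim w (e + e) (fun x => cx (Phi x) * cy (Phi x) + ztf g' (Phi x))
    (fun q => lead w e (fun x => cx (Phi x)) q * lead w e (fun x => cy (Phi x)) q
              + c' * lead w e (fun x => cz (Phi x)) q ^+ 2).
  apply: wlimD; first exact: (wlimM (wge_wlim w0 hX wX) (wge_wlim w0 hY wY)).
  have := wlim_zt_comp (@ztf_only R g') lz' (wge_wlim w0 hZ wZ) (wge_wlim w0 hT wT).
  by apply: wlim_eq => // q; rewrite v4E.
have ld h x y z t : lead w e h (v4 x y z t) = taylor h (texp e) * t ^+ e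
    + taylor h (delta (inord 0)) * x + taylor h (delta (inord 1)) * y + taylor h (delta (inord 2)) * z.
  rewrite lead_lin_z // lead_lin_y // lead_lin_x // (lead_texp _ _ _ _ _ (mul1n e)) //.
  by rewrite !wt_part_delta ?tnth4.
have key q : cx q * cy q + c * cz q ^+ 2 = 0 -> (cx q != 0) || (cy q != 0) ->
    lead w e (fun x => cx (Phi x)) q * lead w e (fun x => cy (Phi x)) q
              + c' * lead w e (fun x => cz (Phi x)) q ^+ 2 = 0.
  move=> Eq qn; have Hq := arc_hyp (G := fun q => c * cz q ^+ 2) (@ztf_only R g) lz Eq qn.
  exact: (arc_wlim w0 Hq (germ_map_vanish gm) hl).
set X := fun x => cx (Phi x) in ld key *; set Y := fun x => cy (Phi x) in ld key *; set Z := fun x => cz (Phi x) in ld key *.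
set a_ := taylor X (texp e); set b_ := taylor Y (texp e); set d_ := taylor Z (texp e).
pose L h q := taylor h (delta (inord 0)) * cx q + taylor h (delta (inord 1)) * cy q
  + taylor h (delta (inord 2)) * cz q.
have keyt q (t : C) : cx q * cy q + c * cz q ^+ 2 = 0 -> (cx q != 0) || (cy q != 0) ->
   (L X q + a_ * t ^+ e) * (L Y q + b_ * t ^+ e) + c' * (L Z q + d_ * t ^+ e) ^+ 2 = 0.
  move=> Eq qn; have := key (v4 (cx q) (cy q) (cz q) t); rewrite !v4E => /(_ Eq qn).
  rewrite !ld -/a_ -/b_ -/d_ /L => <-; ring.
have keyL q : cx q * cy q + c * cz q ^+ 2 = 0 -> (cx q != 0) || (cy q != 0) ->
    L X q * L Y q + c' * L Z q ^+ 2 = 0.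
  move=> Eq qn; have := keyt q 0 Eq qn; rewrite expr0n gtn_eqF // !mulr0 !addr0 //.
have Ln h q : L h (- q) = - L h q.
  by rewrite /L /cx /cy /cz !mxE; ring.
(* Passing from q to -q changes the sign of the linear parts but not of the coefficients of t^e; the
   difference of [keyt] and [keyn] is twice the bilinear term. *)
have keyn q : cx q * cy q + c * cz q ^+ 2 = 0 -> (cx q != 0) || (cy q != 0) ->
   (- L X q + a_) * (- L Y q + b_) + c' * (- L Z q + d_) ^+ 2 = 0.
  move=> Eq qn; have := keyt (- q) 1; rewrite !Ln expr1n !mulr1; apply.
    by rewrite -Eq /cx /cy /cz !mxE; ring.
  by move: qn; rewrite /cx /cy !mxE !oppr_eq0.
have two : (2%:R : C) != 0 by rewrite pnatr_eq0.
have bil q : cx q * cy q + c * cz q ^+ 2 = 0 -> (cx q != 0) || (cy q != 0) ->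
    b_ * L X q + a_ * L Y q + 2%:R * c' * d_ * L Z q = 0.
  move=> Eq qn; apply: (mulfI two); rewrite mulr0.
  have k1 := keyt q 1 Eq qn; have k2 := keyn q Eq qn; rewrite expr1n !mulr1 in k1.
  rewrite -[RHS](subrr 0) -{1}k1 -k2; ring.
have quad : a_ * b_ + c' * d_ ^+ 2 = 0.
  have Eq : cx (v4 1 0 0 0) * cy (v4 1 0 0 0) + c * cz (v4 1 0 0 0) ^+ 2 = 0 :> C.
    by rewrite !v4E mulr0 expr0n mulr0 addr0.
  have qn : (cx (v4 1 0 0 0 : 'rV[C]_4) != 0) || (cy (v4 1 0 0 0 : 'rV[C]_4) != 0) by rewrite v4E oner_neq0.
  have k1 := keyt _ 1 Eq qn; have k2 := keyn _ Eq qn; have k3 := keyL _ Eq qn; rewrite expr1n !mulr1 in k1.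
  apply: (mulfI two); rewrite mulr0.
  move: k1 k2 k3; move: (L X _) (L Y _) (L Z _) => lx ly lz_ k1 k2 k3.
  transitivity (((lx + a_) * (ly + b_) + c' * (lz_ + d_) ^+ 2)
    + ((- lx + a_) * (- ly + b_) + c' * (- lz_ + d_) ^+ 2) - 2%:R * (lx * ly + c' * lz_ ^+ 2)).
    by ring.
  by rewrite k1 k2 k3 mulr0 subr0 addr0.
pose m j := if j == inord 3 then 0 else
  b_ * linmx Phi (inord 0) j + a_ * linmx Phi (inord 1) j + 2%:R * c' * d_ * linmx Phi (inord 2) j.
have m0 : forall j, m j = 0.
  apply: (@linear_form_arc R (fun q => c * cz q ^+ 2)).
  - by move=> q; rewrite v4E.
  - by rewrite /cz mxE expr0n mulr0.
  - move=> q Eq qn; rewrite -[RHS](bil q Eq qn) sum4 /m eqxx !(negPf ord4_neq.1.1.1.1.1.1.1.1.1.2).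
    rewrite -!val_eqE /= !inordK //= !mxE /L -/(cx q) -/(cy q) -/(cz q); ring.
have r0 : v4 b_ a_ (2%:R * c' * d_) 0 *m linmx Phi = 0.
  apply/rowP => j; rewrite [LHS]mxE [RHS]mxE sum4 -/(cx _) -/(cy _) -/(cz _) -/(ct _) !v4E mul0r addr0.
  have := m0 j; rewrite /m; case: eqP => [-> _|//].
  rewrite !mxE -texp_delta.
  (* The t-column of the Jacobian consists of the unknown coefficients when [e = 1], and [quad]
     settles it; for larger [e] its first three entries are 0 by induction. *)
  have [e1|e1] := eqVneq e 1%N.
    have Ea : taylor (fun x => Phi x 0 (inord 0)) (texp 1) = a_ by rewrite /a_ e1.
    have Eb : taylor (fun x => Phi x 0 (inord 1)) (texp 1) = b_ by rewrite /b_ e1.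
    have Ed : taylor (fun x => Phi x 0 (inord 2)) (texp 1) = d_ by rewrite /d_ e1.
    by rewrite Ea Eb Ed -[RHS](mulr0 2%:R) -quad; ring.
  have [|-> -> ->] := IH 1%N _ a1; first by rewrite ltn_neqAle eq_sym e1.
  by rewrite !mulr0 !addr0.
have := mult_inv0 JJ r0 => r00.
have b0 : b_ = 0 by have := cx_v4 b_ a_ (2%:R * c' * d_) 0; rewrite r00 /cx mxE => <-.
have a0 : a_ = 0 by have := cy_v4 b_ a_ (2%:R * c' * d_) 0; rewrite r00 /cy mxE => <-.
have d0 : 2%:R * c' * d_ = 0 by have := cz_v4 b_ a_ (2%:R * c' * d_) 0; rewrite r00 /cz mxE => <-.
split=> //; apply/eqP; move/eqP: d0; rewrite !mulf_eq0 (negPf two) (negPf gz') //.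
Qed.

Lemma pure_ordersP a n g g' Phi Psi : (0 < a)%N -> (0 < n)%N ->
  type1_series a n g -> type1_series a n g' ->
  germ_pair (hyp (ztf g)) (hyp (ztf g')) Phi Psi -> pure_orders a Phi.
Proof.
move=> a0 n0 tg tg' gP; have [gm _ _ _] := gP.
have [hX hY hZ hT] := germ_map_comp_expands gm.
have [X0 Y0 Z0 T0] := germ_map_comp0 gm.
have [a1|a1] := leqP a 1.
  have e0 e : (e < a)%N -> e = 0%N by lia.
  by split=> e /e0 ->; rewrite taylor_texp0.
have [n1|n1] := leqP n 1.
  have n1' : n = 1%N by lia.
  by rewrite n1' in tg tg'; exact: pure_orders_quadric gP.
have mg := type1_multiplicity a0 n1 tg; have mg' := type1_multiplicity a0 n1 tg'.
have [nP|nP] := normal_or_swap mg mg' gP; first exact: (pure_orders_normal a0 n1 tg tg' gP nP).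
apply: pure_orders_swap; exact: (pure_orders_normal a0 n1 tg tg' (germ_pair_swap (@ztf_only R g') gP) nP).
Qed.

End PureOrder.

(** * Automorphisms of xy + g that shift z by multiples of x *)

Section Danielewski.
Context {R : realType}.
Local Notation C := (cplx R).
Implicit Types (q : 'rV[C]_4) (h g u : 'rV[C]_4 -> C).

Lemma lead_wt0 h q : expands_at 0 h -> lead [tuple 1%N; 1%N; 1%N; 1%N] 0 h q = h 0.
Proof.
move=> h0; rewrite (lead_single ones_gt0 (a := [ffun=> 0%N])).
  by rewrite /wt_part /mon_wt big1 ?eqxx ?monomial0 ?mulr1 ?taylor_at0 // => i _; rewrite ffunE muln0.
move=> b wb; case/eqP; apply/ffunP => i; rewrite ffunE.
have /eqP : mon_wt [tuple 1%N; 1%N; 1%N; 1%N] b = 0%N := wb.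
by rewrite /mon_wt sum_nat_eq0 => /forallP /(_ i); rewrite /= muln_eq0 gtn_eqF ?ones_gt0 //= => /eqP.
Qed.

Lemma wlim_wt0 h : expands_at 0 h -> wlim [tuple 1%N; 1%N; 1%N; 1%N] 0 h (fun=> h 0).
Proof.
move=> h0; have := wge_wlim ones_gt0 h0 (fun a _ => leq0n _ : (0 <= _)%N).
by apply: wlim_eq => // q; exact: lead_wt0.
Qed.

Lemma v4_analytic (X Y Z T : 'rV[C]_4 -> C) : expands_at 0 X -> expands_at 0 Y ->
  expands_at 0 Z -> expands_at 0 T -> analytic0 (fun q => v4 (X q) (Y q) (Z q) (T q)).
Proof. exact: expands4. Qed.

Lemma expands_comp0 n m (F : 'rV[C]_m -> C) (Phi : 'rV[C]_n -> 'rV[C]_m) :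
  analytic0 Phi -> Phi 0 = 0 -> expands_at 0 F -> expands_at 0 (fun x => F (Phi x)).
Proof. by move=> aP P0 F0; have := @expands_at_comp R n m F Phi 0; rewrite P0; apply. Qed.

Definition shear u k q : 'rV[C]_4 := v4 (cx q) (cy q + k q) (cz q - u q) (ct q).

Definition xt_only u : Prop := forall q, u q = u (v4 (cx q) 0 0 (ct q)).

Context (g G : 'rV[C]_4 -> C) (g0 : expands_at 0 g) (ztg : zt_only g)
  (gG : wlim [tuple 1%N; 1%N; 1%N; 1%N] 2 g G).

(** [k = (g(z, t) - g(z - u, t)) / x], so that [shear u k] preserves [xy + g]. *)
Lemma shear_ex u : expands_at 0 u -> (forall t, u (v4 0 0 0 t) = 0) -> xt_only u ->
  exists k, [/\ expands_at 0 k, k 0 = 0 &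
    \forall q \near (0 : 'rV[C]_4), cx q * k q = g q - g (v4 0 0 (cz q - u q) (ct q))].
Proof.
move=> hu u0 xu.
have u00 : u 0 = 0 by rewrite -v4_0.
pose h q := g q - g (v4 0 0 (cz q - u q) (ct q)).
have az : expands_at 0 (fun q => cz q - u q).
  by apply: expands_atD; [exact: expands_at_coord|exact: expands_atN].
have av : analytic0 (fun q => v4 0 0 (cz q - u q) (ct q)).
  by apply: v4_analytic => //; [exact: expands_at_cst|exact: expands_at_cst|exact: expands_at_coord].
have v00 : v4 0 0 (cz (0 : 'rV[C]_4) - u 0) (ct (0 : 'rV[C]_4)) = 0.
  by rewrite u00 subr0 -[RHS]v4_0 /cz /ct !mxE.
have hh : expands_at 0 h.
  apply: expands_atD => //; apply: expands_atN.
  exact: (expands_comp0 av v00 g0).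
have hz : \forall q \near (0 : 'rV[C]_4), h (zero_at (inord 0) q) = 0.
  apply: filterE => q; rewrite -[q](v4K q) zero_at0 /h (xu (v4 _ _ _ _)) !v4E u0 subr0.
  by rewrite ztg !v4E subrr.
have [k hk kh] := div_coord hh hz; exists k; split=> //; last by apply: nearS kh => q E; rewrite -/(h q) E.
(* The function [h], which is x times [k], has weight at least 2; its weight 1 part is [k 0] times
   x, so [k 0] is 0. *)
have o1' : wlim [tuple 1%N; 1%N; 1%N; 1%N] 1 u (lead [tuple 1%N; 1%N; 1%N; 1%N] 1 u).
  by apply: (wge_wlim ones_gt0) => //; apply: wge1 => //; exact: ones_gt0.
have hl : wlim [tuple 1%N; 1%N; 1%N; 1%N] 2 h (fun q => G q + -1 * G (v4 0 0 (cz q + -1 * lead [tuple 1%N; 1%N; 1%N; 1%N] 1 u q) (ct q))).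
  have /(wlimZ (-1)) h2 := wlim_comp4 gG (wlim0 _ 1) (wlim0 _ 1)
    (wlimD (wlim_cz 1 1 1 1) (wlimZ (-1) o1')) (wlim_ct 1 1 1 1).
  by apply: (wlim_eq _ _ (wlimD gG h2)) => // q; rewrite /h !mulN1r.
have kl := wlimM (wlim_cx 1 1 1 1) (wlim_wt0 hk).
have kl' : wlim [tuple 1%N; 1%N; 1%N; 1%N] (1 + 0) h (fun q => cx q * k 0).
  apply: (wlim_near ones_gt0) kl.
  have /near_rowP[e e0 He] := kh; exists e => // z ze.
  by apply/esym/He => i; rewrite [(0 : 'rV[C]_4) 0 i]mxE subr0.
have E := wlim_unique kl' (wlim_lower (isT : (1 + 0 < 2)%N) hl).
have := congr1 (fun f => f (v4 1 0 0 0)) E.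
by rewrite /= v4E mul1r.
Qed.

Lemma shear_analytic u k : expands_at 0 u -> expands_at 0 k -> u 0 = 0 -> k 0 = 0 ->
  analytic0 (shear u k) /\ shear u k 0 = 0.
Proof.
move=> hu hk u0 k0; split.
  apply: v4_analytic; rewrite ?/cx ?/cy ?/cz ?/ct; try exact: expands_at_coord.
    by apply: expands_atD => //; exact: expands_at_coord.
  by apply: expands_atD; [exact: expands_at_coord|exact: expands_atN].
by rewrite /shear u0 k0 subr0 addr0 v4K.
Qed.

Lemma shear_map u k : expands_at 0 u -> expands_at 0 k -> u 0 = 0 -> k 0 = 0 ->
  (\forall q \near (0 : 'rV[C]_4), cx q * k q = g q - g (v4 0 0 (cz q - u q) (ct q))) ->
  germ_map (hyp g) (hyp g) (shear u k).
Proof.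
move=> hu hk u0 k0 near_k; have [aS S0] := shear_analytic hu hk u0 k0; split=> //.
apply: nearS near_k => q E; rewrite /hyp => Fq.
by rewrite /shear !v4E mulrDr E (zt_onlyE _ _ _ _ ztg) addrA subrK.
Qed.

(** [u] depends on x and t only and is unchanged by the shear. The two corrections of y cancel after
    multiplication by x, and x can be removed by density. *)
Lemma shearK u u' k k' : (forall q, u' q = - u q) -> expands_at 0 u -> expands_at 0 k -> expands_at 0 k' -> u 0 = 0 -> k 0 = 0 ->
  xt_only u ->
  (\forall q \near (0 : 'rV[C]_4), cx q * k q = g q - g (v4 0 0 (cz q - u q) (ct q))) ->
  (\forall q \near (0 : 'rV[C]_4), cx q * k' q = g q - g (v4 0 0 (cz q - - u q) (ct q))) ->
  \forall q \near (0 : 'rV[C]_4), shear u' k' (shear u k q) = q.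
Proof.
move=> Eu hu hk hk' u0 k0 xu nk nk'; have [aS S0] := shear_analytic hu hk u0 k0.
have uS q : u (shear u k q) = u q by rewrite xu [RHS]xu /shear !v4E.
have nK : \forall q \near (0 : 'rV[C]_4), k q + k' (shear u k q) = 0.
  apply: (@coord_density _ _ (inord 0)).
    by apply: expands_atD => //; exact: (expands_comp0 aS S0 hk').
  apply: nearS (nearI nk (analytic0_near aS S0 nk')) => q [E E'].
  rewrite -/(cx q) mulrDr E; have := E'; rewrite uS /shear !v4E opprK => ->.
  by rewrite subrK (zt_onlyE _ _ _ _ ztg) -ztg addrA subrK subrr.
apply: nearS nK => q E; apply: eq4; rewrite /shear v4E.
- by rewrite v4E.
- by rewrite v4E -addrA; have := E; rewrite /shear => ->; rewrite addr0.
- by rewrite -/(shear u k q) Eu uS !v4E opprK subrK.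
- by rewrite v4E.
Qed.

(** As [u] vanishes on x = 0, the change of g under z -> z - u is divisible by x and can be absorbed
    into y. The shear for -u is the inverse. *)
Lemma danielewski u : expands_at 0 u -> (forall t, u (v4 0 0 0 t) = 0) -> xt_only u ->
  exists d d', germ_pair (hyp g) (hyp g) d d' /\
    forall q, [/\ cx (d q) = cx q, cz (d q) = cz q - u q & ct (d q) = ct q].
Proof.
move=> hu u0 xu; have u00 : u 0 = 0 by rewrite -v4_0.
have hu' : expands_at 0 (fun q => - u q) by exact: expands_atN.
have [k [hk k0 nk]] := shear_ex hu u0 xu.
have [||k' [hk' k0' nk']] := shear_ex hu'.
- by move=> t; rewrite u0 oppr0.
- by move=> q; rewrite xu.
have u00' : - u 0 = 0 by rewrite u00 oppr0.
exists (shear u k), (shear (fun q => - u q) k'); split; last by move=> q; rewrite /shear !v4E.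
split; [exact: shear_map|exact: shear_map| |].
- by apply: nearS (shearK (fun q => erefl) hu hk hk' u00 k0 xu nk nk') => q -> _.
- have xu' : xt_only (fun q => - u q) by move=> q; rewrite xu.
  have nk2 : \forall q \near (0 : 'rV[C]_4), cx q * k q = g q - g (v4 0 0 (cz q - - - u q) (ct q)).
    by apply: nearS nk => q; rewrite opprK.
  by apply: nearS (shearK (fun q => esym (opprK _)) hu' hk' hk u00' k0' xu' nk' nk2) => q ->.
Qed.

End Danielewski.

(** * Maps respecting the weights in type (1) *)

Section Type1.
Context {R : realType}.
Local Notation C := (cplx R).
Implicit Types (q : 'rV[C]_4) (h : 'rV[C]_4 -> C) (g : pwseries R 2).

Context (n a r1 r2 : nat) (n0 : (0 < n)%N) (r1_gt0 : (0 < r1)%N) (r2_gt0 : (0 < r2)%N)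
  (a0 : (0 < a)%N) (r12 : (r1 <= r2)%N) (ar : (a * n.+1 = r1 + r2)%N).
Local Notation w := [tuple r1; r2; a; 1%N].
Let w0 : forall i, (0 < tnth w i)%N := tuple4_gt0 r1_gt0 r2_gt0 a0 (isT : (0 < 1)%N).

Definition map_weights (v : 4.-tuple nat) (Phi : 'rV[C]_4 -> 'rV[C]_4) : Prop :=
  forall i, wge v (tnth v i) (fun x => Phi x 0 i).

Lemma map_weights4 p1 p2 k l (Phi : 'rV[C]_4 -> 'rV[C]_4) :
  wge [tuple p1; p2; k; l] p1 (fun x => cx (Phi x)) -> wge [tuple p1; p2; k; l] p2 (fun x => cy (Phi x)) ->
  wge [tuple p1; p2; k; l] k (fun x => cz (Phi x)) -> wge [tuple p1; p2; k; l] l (fun x => ct (Phi x)) ->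
  map_weights [tuple p1; p2; k; l] Phi.
Proof. by move=> ????; apply: ord4P; rewrite tnth4. Qed.

Definition lead_g g := psval (wt_part [tuple a; 1%N] (r1 + r2) g) \o @czt R.

Lemma type1_wlim g : type1_series a n g -> wlim w (r1 + r2) (ztf g) (lead_g g).
Proof. by move=> [gc [gw _] _]; apply: ztf_wlim => //; rewrite -ar. Qed.

Lemma type1_neq0 g : type1_series a n g -> exists q, lead_g g q != 0.
Proof. by move=> [gc [_ [b gb wb]] _]; apply: ztf_neq0 gc gb _; rewrite wb ar. Qed.

Lemma lead_g_polyline g : polyline (lead_g g).
Proof. exact: ztf_polyline. Qed.

Lemma pure_order_wge h d : pure_order a h -> (d <= r1)%N -> (d <= a)%N -> wge w d h.
Proof.
move=> ph dr da; apply: wge_texp => //; first exact: leq_trans r12.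
move=> e en; rewrite mul1n (leq_trans da) // leqNgt; apply/negP => ea.
by rewrite ph ?eqxx in en.
Qed.

(** For [a <= r1] the variables x, y and z all weigh at least [a], so the pure order settles the
    z-component, and [product_weights] settles x and y. *)
Lemma type1_normal g g' Phi Psi : (a <= r1)%N -> type1_series a n g -> type1_series a n g' ->
  germ_pair (hyp (ztf g)) (hyp (ztf g')) Phi Psi -> normal Phi -> map_weights w Phi.
Proof.
move=> ar1 tg tg' gP nP; have [gm _ _ _] := gP.
have [_ _ pZ] := pure_ordersP a0 n0 tg tg' gP.
have [hX hY hZ hT] := germ_map_comp_expands gm; have [_ _ _ T0] := germ_map_comp0 gm.
have wZ := pure_order_wge pZ ar1 (leqnn a); have wT := wge1 w0 hT T0.
have hl := wlim_zt_comp (@ztf_only R g') (type1_wlim tg') (wge_wlim w0 hZ wZ) (wge_wlim w0 hT wT).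
have [_ xx _ yy] := nP; rewrite !mxE in xx yy.
have [wX wY] := product_weights r1_gt0 r2_gt0 a0 (isT : (0 < 1)%N) r12 (@ztf_only R g) (type1_wlim tg)
  (lead_g_polyline g) (type1_neq0 tg) hX hY (germ_map_vanish gm) hl xx yy.
exact: map_weights4.
Qed.

(** * The case r1 < a: raising the weight of the z-component *)

Section Small.
Context (r1a : (r1 < a)%N) (g g' : pwseries R 2) (tg : type1_series a n g) (tg' : type1_series a n g').

Let a1 : (1 < a)%N. Proof. exact: leq_ltn_trans r1a. Qed.
Let ar2 : (a < r2)%N.
Proof.
have : (a * 2 <= r1 + r2)%N by rewrite -ar leq_mul2l ltnS n0 orbT.
by lia.
Qed.

Lemma type1_linmx_inv Phi Psi : germ_pair (hyp (ztf g)) (hyp (ztf g')) Phi Psi ->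
  linmx Psi *m linmx Phi = 1%:M.
Proof.
move=> gP; have [gc [gw _] _] := tg.
have H : wt_ge [tuple 1%N; 1%N] g 2.
  by move=> b /(type1_ones a0 gw); apply: leq_trans.
exact: (linmx_inv (ztf_expands gc) (@ztf_only R g) (ztf_wlim 1 1 _ _ gc H) gP).
Qed.

(** Both y and z weigh more than [r1], and t^r1 is excluded by the pure order since [r1 < a]; only x
    is left. *)
Lemma lead_x Phi Psi : germ_pair (hyp (ztf g)) (hyp (ztf g')) Phi Psi ->
  wlim w r1 (fun x => cx (Phi x)) (fun q => linmx Phi (inord 0) (inord 0) * cx q).
Proof.
move=> gP; have [gm _ _ _] := gP; have [pX _ _] := pure_ordersP a0 n0 tg tg' gP.
have [hX _ _ _] := germ_map_comp_expands gm.
have := wge_wlim w0 hX (pure_order_wge pX (leqnn r1) (ltnW r1a)).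
apply: wlim_eq => // q; rewrite -(v4K q).
rewrite lead_lin_z // ?(ltnW r1a) // lead_lin_y // lead_lin_x // (lead_texp _ _ _ _ _ (mul1n r1)) //.
rewrite pX // mul0r add0r [X in _ + X * _ + _]wt_part_delta0 ?tnth4; last by rewrite gtn_eqF // (ltn_trans r1a).
rewrite [X in _ + X * _]wt_part_delta0 ?tnth4; last by rewrite gtn_eqF.
by rewrite !mul0r !addr0 wt_part_delta ?tnth4 // !v4E mxE.
Qed.

(** The pure orders make the first three entries of the t-column of the Jacobian 0, so the last one
    is not. A term in x has weight 1 only for [r1 = 1]. *)
Lemma lead_t Phi Psi : germ_pair (hyp (ztf g)) (hyp (ztf g')) Phi Psi -> exists rho,
  [/\ (r1 == 1%N) || (rho == 0), linmx Phi (inord 3) (inord 3) != 0 &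
   wlim w 1 (fun x => ct (Phi x)) (fun q => rho * cx q + linmx Phi (inord 3) (inord 3) * ct q)].
Proof.
move=> gP; have [gm _ _ _] := gP; have [pX pY pZ] := pure_ordersP a0 n0 tg tg' gP.
have [_ _ _ hT] := germ_map_comp_expands gm; have [_ _ _ T0] := germ_map_comp0 gm.
exists (wt_part w 1 (taylor (fun x => ct (Phi x))) (delta (inord 0))); split.
- by have [//|r1n] := eqVneq r1 1%N; rewrite wt_part_delta0 ?tnth4 // eqxx.
- apply/eqP => t0; have /matrixP /(_ (inord 3) (inord 3)) := type1_linmx_inv gP.
  rewrite [LHS]mxE [RHS]mxE sum4 eqxx t0 mulr0 addr0.
  rewrite [linmx Phi (inord 0) _]mxE [linmx Phi (inord 1) _]mxE [linmx Phi (inord 2) _]mxE -texp_delta.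
  by rewrite pX // pY // pZ // !mulr0 !addr0 => /esym/eqP; rewrite oner_eq0.
have := wge_wlim w0 hT (wge1 w0 hT T0); apply: wlim_eq => // q; rewrite -(v4K q).
rewrite lead_lin_t // lead_lin_z // lead_lin_y // lead_lin_x // v4_0 lead_at0 // add0r !v4E.
rewrite [X in _ + X * _ + _ + _]wt_part_delta0 ?tnth4; last by rewrite gtn_eqF // (ltn_trans a1).
rewrite [X in _ + X * _ + _]wt_part_delta0 ?tnth4; last by rewrite gtn_eqF.
have -> : linmx Phi (inord 3) (inord 3) = wt_part w 1 (taylor (fun x => ct (Phi x))) (delta (inord 3)).
  by rewrite mxE wt_part_delta // tnth4.
by rewrite !mul0r !addr0.
Qed.

Lemma lead_z_xt Phi Psi e : germ_pair (hyp (ztf g)) (hyp (ztf g')) Phi Psi -> (0 < e < a)%N ->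
  xt_only (lead w e (fun x => cz (Phi x))) /\
  forall t, lead w e (fun x => cz (Phi x)) (v4 0 0 0 t) = 0.
Proof.
move=> gP /andP[e0 ea]; have [_ _ pZ] := pure_ordersP a0 n0 tg tg' gP; split.
  move=> q; rewrite -{1}(v4K q) lead_lin_z ?(ltnW ea) // lead_lin_y // ?(ltnW (ltn_trans ea ar2)) //.
  rewrite [X in _ + X * _ + _]wt_part_delta0 ?tnth4; last by rewrite gtn_eqF // (ltn_trans ea).
  rewrite [X in _ + X * _]wt_part_delta0 ?tnth4; last by rewrite gtn_eqF.
  by rewrite !mul0r !addr0.
by move=> t; rewrite (lead_texp _ _ _ _ _ (mul1n e)) // pZ // mul0r.
Qed.

(** The part of weight [e] of the z-component depends on x and t only and vanishes
    at [x = 0], hence is removed by a shear of the target. *)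
Lemma raise_weight Phi Psi e : germ_pair (hyp (ztf g)) (hyp (ztf g')) Phi Psi ->
  linmx Phi (inord 0) (inord 0) != 0 -> (0 < e < a)%N -> wge w e (fun x => cz (Phi x)) ->
  exists Phi' Psi', [/\ germ_pair (hyp (ztf g)) (hyp (ztf g')) Phi' Psi',
    linmx Phi' (inord 0) (inord 0) != 0 & wge w e.+1 (fun x => cz (Phi' x))].
Proof.
move=> gP al0 ea wZ; have [gm _ _ _] := gP; have [hX _ hZ hT] := germ_map_comp_expands gm.
set al := linmx Phi _ _ in al0.
have [rho [rh tau0 hTl]] := lead_t gP; set tau := linmx Phi _ _ in tau0 hTl.
have [xtZ Z00] := lead_z_xt gP ea; set Z0 := lead w e (fun x => cz (Phi x)) in xtZ Z00.
(* [Z0] in the coordinates of the target: the leading forms al x and rho x + tau t of the x- and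
   t-components are inverted, and [Z0] does not depend on y and z. *)
pose u q := Z0 (v4 (al^-1 * cx q) 0 0 (tau^-1 * (ct q + - (rho * al^-1) * cx q))).
have hu : expands_at 0 u.
  apply: (expands_at_comp (F := Z0)); first exact: lead_expands.
  apply: expands4; try exact: expands_at_cst.
    by apply: expands_atM; [exact: expands_at_cst|exact: expands_at_coord].
  apply: expands_atM; first exact: expands_at_cst.
  apply: expands_atD; first exact: expands_at_coord.
  by apply: expands_atM; [exact: expands_at_cst|exact: expands_at_coord].
have u0 t : u (v4 0 0 0 t) = 0 by rewrite /u !v4E !mulr0 addr0 Z00.
have xu : xt_only u by move=> q; rewrite /u !v4E.
have [gc' [gw' _] _] := tg'.
have g2 : wt_ge [tuple 1%N; 1%N] g' 2.
  by move=> b /(type1_ones a0 gw'); apply: leq_trans.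
have [d [d' [dP dE]]] := danielewski (ztf_expands gc') (@ztf_only R g') (ztf_wlim 1 1 (isT : (0 < 1)%N) (isT : (0 < 1)%N) gc' g2) hu u0 xu.
have gP' := germ_pair_comp gP dP; exists (d \o Phi), (Psi \o d'); split=> //.
  rewrite (_ : linmx (d \o Phi) _ _ = al) // /al !mxE; congr (taylor _ _).
  by apply/funext => x /=; have [] := dE (Phi x).
have [gm' _ _ _] := gP'; have [_ _ hZ' _] := germ_map_comp_expands gm'.
apply: (wlim0_wge w0) => //.
have hx : wlim w r1 (fun x => al^-1 * cx (Phi x)) (fun q => al^-1 * (al * cx q)).
  exact: wlimZ (lead_x gP).
have hr : wlim w 1 (fun x => - (rho * al^-1) * cx (Phi x)) (fun q => - (rho * al^-1) * (al * cx q)).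
  (* The correction by x has weight 1 when [r1 = 1], and is absent otherwise. *)
  case/orP: rh => [/eqP r11|/eqP ->]; last first.
    by apply: (wlim_eq _ _ (wlim0 w 1)) => q; rewrite mul0r oppr0 mul0r.
  exact: wlimZ (eq_ind r1 (fun d => wlim w d _ _) (lead_x gP) _ r11).
have hul := wlim_comp4 (lead_wlim w0 e (fun x => cz (Phi x))) hx (wlim0 w r2) (wlim0 w a)
  (wlimZ tau^-1 (wlimD hTl hr)).
apply: (wlim_eq _ _ (wlimD (wge_wlim w0 hZ wZ) (wlimZ (-1) hul))) => q.
  by rewrite mulN1r /=; have [_ -> _] := dE (Phi q).
have E1 : al^-1 * (al * cx q) = cx q by rewrite mulKf.
have E2 : tau^-1 * (rho * cx q + tau * ct q + - (rho / al) * (al * cx q)) = ct q.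
  by rewrite mulNr mulrA divfK // addrAC subrr add0r mulKf.
by rewrite E1 E2 -/Z0 -xtZ mulN1r subrr.
Qed.

Lemma raise_to Phi Psi : germ_pair (hyp (ztf g)) (hyp (ztf g')) Phi Psi ->
  linmx Phi (inord 0) (inord 0) != 0 ->
  exists Phi' Psi', [/\ germ_pair (hyp (ztf g)) (hyp (ztf g')) Phi' Psi',
    linmx Phi' (inord 0) (inord 0) != 0 & wge w a (fun x => cz (Phi' x))].
Proof.
move=> gP al0.
suff H e : (e < a)%N -> exists Phi' Psi', [/\ germ_pair (hyp (ztf g)) (hyp (ztf g')) Phi' Psi',
    linmx Phi' (inord 0) (inord 0) != 0 & wge w e.+1 (fun x => cz (Phi' x))].
  by have := H a.-1; rewrite prednK //; apply.
elim: e => [_|e IH ea].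
  exists Phi, Psi; split=> //; have [gm _ _ _] := gP.
  have [_ _ hZ _] := germ_map_comp_expands gm; have [_ _ Z0 _] := germ_map_comp0 gm.
  exact: wge1.
have [Phi' [Psi' [gP' al0' wZ]]] := IH (ltnW ea).
by apply: (raise_weight gP' al0' _ wZ); rewrite ea.
Qed.

Lemma small_weights_fwd Phi Psi : germ_pair (hyp (ztf g)) (hyp (ztf g')) Phi Psi ->
  linmx Phi (inord 0) (inord 0) != 0 -> wge w a (fun x => cz (Phi x)) -> map_weights w Phi.
Proof.
move=> gP al0 wZ; have [gm _ _ _] := gP.
have [hX hY hZ hT] := germ_map_comp_expands gm; have [_ _ _ T0] := germ_map_comp0 gm.
have wT := wge1 w0 hT T0.
have hl := wlim_zt_comp (@ztf_only R g') (type1_wlim tg') (wge_wlim w0 hZ wZ) (wge_wlim w0 hT wT).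
apply: map_weights4 => //; first exact: wlim_wge w0 _ _ _ hX (lead_x gP).
exact: (cofactor_weight r1_gt0 r2_gt0 a0 (isT : (0 < 1)%N) (@ztf_only R g) (type1_wlim tg)
  (lead_g_polyline g) (type1_neq0 tg) hY (germ_map_vanish gm) hl (lead_x gP) al0).
Qed.

End Small.

Section SmallPair.
Context (r1a : (r1 < a)%N) (g g' : pwseries R 2) (tg : type1_series a n g) (tg' : type1_series a n g').

Let a1 : (1 < a)%N. Proof. exact: leq_ltn_trans r1a. Qed.

(** Shearing [Psi] as well would change [Phi], but [Psi] inherits its weights. A leading form [P] of
    its z-component in weight [e < a] depends on x and t only, and [Psi \o Phi = id] makes P(al x,
    rho x + tau t) vanish on the cone, whose points realize every (x, t) with x non-zero. *)
Lemma small_weights_bwd Phi Psi : germ_pair (hyp (ztf g)) (hyp (ztf g')) Phi Psi ->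
  map_weights w Phi -> linmx Phi (inord 0) (inord 0) != 0 ->
  wge w a (fun x => cz (Psi x)) /\ linmx Psi (inord 0) (inord 0) != 0.
Proof.
move=> gP mw al0; have gP' := germ_pair_sym gP.
have [[aP P0 _] gm' PQ _] := gP.
have [hX' hY' hZ' hT'] := germ_map_comp_expands gm'.
have [rho [_ tau0 hT]] := lead_t r1a tg tg' gP.
have ztG := wlim_zt_only (@ztf_only R g) (type1_wlim tg).
have wP i := wge_wlim w0 (aP i) (mw i).
have cone x t : x != 0 -> exists q, [/\ cx q = x, ct q = t, cx q * cy q + lead_g g q = 0 & cx q != 0].
  move=> x0; exists (v4 x (- lead_g g (v4 0 0 0 t) / x) 0 t).
  by rewrite !v4E (zt_onlyE _ _ _ _ ztG) mulrC divfK // addNr.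
have lim_comp h d P : wlim w d h P ->
    wlim w d (fun x => h (Phi x)) (fun q => P (v4 (linmx Phi (inord 0) (inord 0) * cx q)
      (lead w r2 (fun x => cy (Phi x)) q) (lead w a (fun x => cz (Phi x)) q)
      (rho * cx q + linmx Phi (inord 3) (inord 3) * ct q))).
  move=> hP; have hy := wP (inord 1); have hz := wP (inord 2); rewrite !tnth4 in hy hz.
  have := wlim_comp4 hP (lead_x r1a tg tg' gP) hy hz hT.
  by apply: wlim_eq => // x; rewrite v4K.
split.
- apply: contrapT => /(wgeN hZ')[e [ea we [q0 Zq0]]].
  have e0 : (0 < e)%N.
    rewrite lt0n; apply: contra_neq Zq0 => ->.
    have [_ _ Z0' _] := germ_map_comp0 gm'.
    by rewrite -(wlim_lead w0 hZ' (wlim_lower (isT : (0 < 1)%N) (wge_wlim w0 hZ' (wge1 w0 hZ' Z0')))).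
  have e0a : (0 < e < a)%N by rewrite e0.
  have [xtZ _] := lead_z_xt r1a tg' tg gP' e0a.
  set P := lead w e (fun x => cz (Psi x)) in xtZ Zq0.
  have hl : wlim w e (fun x => cz (Psi (Phi x)) + -1 * cz x) (fun q => P (v4 (linmx Phi (inord 0) (inord 0) * cx q)
      (lead w r2 (fun x => cy (Phi x)) q) (lead w a (fun x => cz (Phi x)) q)
      (rho * cx q + linmx Phi (inord 3) (inord 3) * ct q)) + -1 * 0).
    apply: wlimD; first exact: lim_comp (wge_wlim w0 hZ' we).
    by apply: wlimZ; exact: wlim_lower ea (wlim_cz r1 r2 a 1).
  have van : vanishes_on (hyp (ztf g)) (fun x => cz (Psi (Phi x)) + -1 * cz x).
    by apply: nearS PQ => x Ex /Ex ->; rewrite mulN1r subrr.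
  have P0x x t : x != 0 -> P (v4 x 0 0 t) = 0.
    move=> x0; have [|q [qx qt Eq xq]] := cone (x / linmx Phi (inord 0) (inord 0)) ((t - rho * (x / linmx Phi (inord 0) (inord 0))) / linmx Phi (inord 3) (inord 3)).
      by rewrite mulf_neq0 // invr_eq0.
    have := arc_wlim w0 (arc_hyp_x (@ztf_only R g) (type1_wlim tg) Eq xq) van hl.
    have E1 : linmx Phi (inord 0) (inord 0) * cx q = x by rewrite qx mulrC divfK.
    have E2 : rho * cx q + linmx Phi (inord 3) (inord 3) * ct q = t.
      by rewrite qx qt [X in _ + X]mulrCA mulfV // mulr1 addrC subrK.
    rewrite mulr0 addr0 E1 E2 => H; have := xtZ (v4 x (lead w r2 (fun x => cy (Phi x)) q) (lead w a (fun x => cz (Phi x)) q) t).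
    by rewrite cx_v4 ct_v4 => <-.
  have Pall : forall q, P (v4 (cx q *+ true) (cy q *+ false) (cz q *+ false) (ct q *+ true)) = 0.
    apply: polyline0; first by apply: polyline_v4; exact: lead_polyline.
    move=> q; have [->|x0] := eqVneq (cx q) 0; first by rewrite mul0r.
    by rewrite !mulr1n !mulr0n P0x // mulr0.
  by move: Zq0; rewrite xtZ; have := Pall q0; rewrite !mulr1n !mulr0n => ->; rewrite eqxx.
- have hl : wlim w r1 (fun x => cx (Psi (Phi x)) + -1 * cx x)
      (fun q => linmx Psi (inord 0) (inord 0) * (linmx Phi (inord 0) (inord 0) * cx q) + -1 * cx q).
    apply: wlimD; last exact: wlimZ (wlim_cx r1 r2 a 1).
    by apply: (wlim_eq _ _ (lim_comp _ _ _ (lead_x r1a tg' tg gP'))) => // q; rewrite v4E.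
  have van : vanishes_on (hyp (ztf g)) (fun x => cx (Psi (Phi x)) + -1 * cx x).
    by apply: nearS PQ => x Ex /Ex ->; rewrite mulN1r subrr.
  have [|q [qx qt Eq xq]] := cone 1 0; first exact: oner_neq0.
  have := arc_wlim w0 (arc_hyp_x (@ztf_only R g) (type1_wlim tg) Eq xq) van hl.
  rewrite qx !mulr1 => E; apply/eqP => p0; move/eqP: E.
  by rewrite p0 mul0r add0r oppr_eq0 oner_eq0.
Qed.

(** For [n > 1] this is part of [normal]. For [n = 1], if the first column of the Jacobian were 0 in
    the rows of x and y, it would be so in that of z, because the image of (1, 0, 0, 0) lies on the
    tangent cone of the target. The first and the t-column would then both be supported in the last
    row. *)
Lemma small_first Phi Psi : germ_pair (hyp (ztf g)) (hyp (ztf g')) Phi Psi ->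
  linmx Phi (inord 0) (inord 0) != 0 \/ linmx (swap \o Phi) (inord 0) (inord 0) != 0.
Proof.
move=> gP; have [gm _ _ _] := gP.
have [n1|n1] := leqP n 1; last first.
  by have [[]|[]] := normal_or_swap (type1_multiplicity a0 n1 tg) (type1_multiplicity a0 n1 tg') gP; [left|right].
have n1' : n = 1%N by lia.
rewrite linmx_swap; apply: contrapT => /not_orP[/negP /negPn /eqP x0 /negP /negPn /eqP y0].
have JJ := type1_linmx_inv tg gP.
have [pX pY pZ] := pure_ordersP a0 n0 tg tg' gP.
have [gc [gw _] /(_ a1) gz] := tg; have [gc' [gw' _] /(_ a1) gz'] := tg'; rewrite n1' in gw gw' gz gz'.
have lz := ztf_lead_z 1 1 (isT : (0 < 1)%N) (isT : (0 < 1)%N) a1 gc gw.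
have lz' := ztf_lead_z 1 1 (isT : (0 < 1)%N) (isT : (0 < 1)%N) a1 gc' gw'.
have [aP P0 _] := gm.
have z0 : linmx Phi (inord 2) (inord 0) = 0.
  have hl : wlim [tuple 1%N; 1%N; 1%N; 1%N] (1 + 1) (fun x => cx (Phi x) * cy (Phi x) + ztf g' (Phi x))
     (fun q => (\sum_j linmx Phi (inord 0) j * q 0 j) * (\sum_j linmx Phi (inord 1) j * q 0 j)
        + g' (zt_exp 2 0) * (\sum_j linmx Phi (inord 2) j * q 0 j) ^+ 2).
    apply: wlimD; first exact: (wlimM (wlim_linmx (inord 0) aP P0) (wlim_linmx (inord 1) aP P0)).
    have := wlim_zt_comp (@ztf_only R g') lz' (wlim_linmx (inord 2) aP P0) (wlim_linmx (inord 3) aP P0).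
    by apply: wlim_eq => // q; rewrite v4E.
  have Eq : cx (v4 1 0 0 0) * cy (v4 1 0 0 0) + g (zt_exp 2 0) * cz (v4 1 0 0 0) ^+ 2 = 0.
    by rewrite !v4E mulr0 expr0n mulr0 addr0.
  have xq : cx (v4 1 0 0 0 : 'rV[C]_4) != 0 by rewrite v4E oner_neq0.
  have Hq := arc_hyp_x (G := fun q => g (zt_exp 2 0) * cz q ^+ 2) (@ztf_only R g) lz Eq xq.
  have := arc_wlim ones_gt0 Hq (germ_map_vanish gm) hl.
  rewrite !sum4 -/(cx _) -/(cy _) -/(cz _) -/(ct _) !v4E !mulr0 !addr0 !mulr1 x0 mul0r add0r => /eqP.
  by rewrite mulf_eq0 (negPf gz') expf_eq0 => /eqP.
have c3 i : i != inord 3 -> linmx Phi i (inord 3) = 0.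
  rewrite mxE -texp_delta; move: i; apply: ord4P; rewrite ?eqxx // => _; [exact: pX|exact: pY|exact: pZ].
have E i j : linmx Psi i (inord 3) * linmx Phi (inord 3) j
    + (linmx Psi i (inord 0) * linmx Phi (inord 0) j + linmx Psi i (inord 1) * linmx Phi (inord 1) j
    + linmx Psi i (inord 2) * linmx Phi (inord 2) j) = (i == j)%:R.
  by have /matrixP /(_ i j) := JJ; rewrite [LHS]mxE [RHS]mxE sum4 addrC.
have e1 := E (inord 0) (inord 0); have e2 := E (inord 3) (inord 0); have e3 := E (inord 3) (inord 3).
rewrite x0 y0 z0 !mulr0 !addr0 eqxx in e1.
rewrite x0 y0 z0 !mulr0 !addr0 eq_sym (negPf ord4_neq.1.1.1.1.1.1.1.1.1.2) in e2.
have c0 : linmx Phi (inord 0) (inord 3) = 0 by apply: c3; rewrite ord4_neq.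
have c1 : linmx Phi (inord 1) (inord 3) = 0 by apply: c3; rewrite ord4_neq.
have c2 : linmx Phi (inord 2) (inord 3) = 0 by apply: c3; rewrite ord4_neq.
rewrite c0 c1 c2 !mulr0 !addr0 eqxx in e3.
move/eqP: e2; rewrite mulf_eq0 => /orP[/eqP s0|/eqP s0].
  by move: e3; rewrite s0 mul0r => /esym/eqP; rewrite oner_eq0.
by move: e1; rewrite s0 mulr0 => /esym/eqP; rewrite oner_eq0.
Qed.

Lemma type1_small Phi0 Psi0 : germ_pair (hyp (ztf g)) (hyp (ztf g')) Phi0 Psi0 ->
  exists Phi' Psi', [/\ germ_pair (hyp (ztf g)) (hyp (ztf g')) Phi' Psi',
    map_weights w Phi' & map_weights w Psi'].
Proof.
move=> gP0.
have [Phi [Psi [gP al0]]] : exists Phi Psi, germ_pair (hyp (ztf g)) (hyp (ztf g')) Phi Psi /\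
    linmx Phi (inord 0) (inord 0) != 0.
  case: (small_first gP0) => al0; first by exists Phi0, Psi0.
  by exists (swap \o Phi0), (Psi0 \o swap); split=> //; exact: germ_pair_swap (@ztf_only R g') gP0.
have [Phi' [Psi' [gP' al0' wZ]]] := raise_to r1a tg tg' gP al0.
have mP := small_weights_fwd r1a tg tg' gP' al0' wZ.
have [wZ' be0] := small_weights_bwd gP' mP al0'.
exists Phi', Psi'; split=> //.
exact: (small_weights_fwd r1a tg' tg (germ_pair_sym gP') be0 wZ').
Qed.

End SmallPair.

Lemma map_weights_ones (Phi : 'rV[C]_4 -> 'rV[C]_4) : analytic0 Phi -> Phi 0 = 0 ->
  map_weights [tuple 1%N; 1%N; 1%N; 1%N] Phi.
Proof.
move=> aP P0 i; rewrite (_ : tnth _ i = 1%N); last by move: i; apply: ord4P; rewrite tnth4.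
by apply: wge1; [exact: ones_gt0|exact: aP|rewrite P0 mxE].
Qed.

(** If [a <= r1] and [n = 1], then 2a = r1 + r2 gives r1 = r2 = a, and coprimality gives a = 1: all
    weights are 1 and every analytic map fixing 0 respects them. *)
Lemma type1_weights g g' Phi Psi : coprime a r1 -> type1_series a n g -> type1_series a n g' ->
  germ_pair (hyp (ztf g)) (hyp (ztf g')) Phi Psi ->
  exists Phi' Psi', [/\ germ_pair (hyp (ztf g)) (hyp (ztf g')) Phi' Psi',
    map_weights w Phi' & map_weights w Psi'].
Proof.
move=> co tg tg' gP; have [r1a|ar1] := ltnP r1 a; first exact: (type1_small r1a tg tg' gP).
have [n1|n1] := leqP n 1.
  have En : n = 1%N by lia.
  have ar' := ar; rewrite En in ar'.
  have E1 : r1 = a by lia.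
  have E2 : a = 1%N by move: co; rewrite E1 /coprime gcdnn => /eqP.
  have E3 : r2 = 1%N by lia.
  exists Phi, Psi; rewrite E1 E3 E2.
  have [[aP P0 _] [aQ Q0 _] _ _] := gP.
  by split=> //; exact: map_weights_ones.
have mg := type1_multiplicity a0 n1 tg; have mg' := type1_multiplicity a0 n1 tg'.
have [Phi' [Psi' [gP' nP]]] : exists Phi' Psi', germ_pair (hyp (ztf g)) (hyp (ztf g')) Phi' Psi' /\ normal Phi'.
  have [nP|nP] := normal_or_swap mg mg' gP; first by exists Phi, Psi.
  by exists (swap \o Phi), (Psi \o swap); split=> //; exact: germ_pair_swap (@ztf_only R g') gP.
have nQ := normal_inv (mulmx1C (linmx_inv3 mg gP')) nP.
exists Phi', Psi'; split=> //; first exact: (type1_normal ar1 tg tg' gP' nP).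
exact: (type1_normal ar1 tg' tg (germ_pair_sym gP') nQ).
Qed.

End Type1.

(** * Type (3) *)

Section Type3Form.
Context {R : realType}.
Local Notation C := (cplx R).
Implicit Types (q : 'rV[C]_4) (h : 'rV[C]_4 -> C).

(** For the weights (2, 1), only z and t^2 have weight 2, and only zt and t^3 have weight 3. *)
Lemma psval4 (p : pwseries R 2) (x : 'rV[C]_2) :
  (forall e, p e != 0 -> mon_wt [tuple 2%N; 1%N] e = 2%N \/ mon_wt [tuple 2%N; 1%N] e = 3%N) ->
  psval p x = p (zt_exp 1 0) * x 0 ord0 + p (zt_exp 0 2) * x 0 o1 ^+ 2
    + p (zt_exp 1 1) * (x 0 ord0 * x 0 o1) + p (zt_exp 0 3) * x 0 o1 ^+ 3.
Proof.
move=> hp; apply: hsum_psval.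
pose f e b := if b == e then p e * monomial e x else 0.
have hf e : hsum (f e) (p e * monomial e x).
  have := @hsum1 C _ (f e) e; rewrite /f eqxx; apply => b /negPf -> //.
have := hsumD (hsumD (hsumD (hf (zt_exp 1 0)) (hf (zt_exp 0 2))) (hf (zt_exp 1 1))) (hf (zt_exp 0 3)).
rewrite !monomial2 !zt_expE !expr1 !expr0 !mul1r !mulr1; congr (hsum _ _); apply/funext => b.
rewrite /f; have zt_neq i j i' j' : (i != i') || (j != j') -> (zt_exp i j == zt_exp i' j') = false.
  move=> n; apply/eqP => E; move: n.
  have := congr1 (fun h : {ffun 'I_2 -> nat} => h ord0) E; rewrite /= !zt_expE => ->.
  have := congr1 (fun h : {ffun 'I_2 -> nat} => h o1) E; rewrite /= !zt_expE => ->.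
  by rewrite !eqxx.
have [->|n1] := eqVneq b (zt_exp 1 0); first by rewrite !zt_neq // !addr0.
have [->|n2] := eqVneq b (zt_exp 0 2); first by rewrite !zt_neq // !addr0 add0r.
have [->|n3] := eqVneq b (zt_exp 1 1); first by rewrite !zt_neq // !addr0 !add0r.
have [->|n4] := eqVneq b (zt_exp 0 3); first by rewrite !add0r.
rewrite !addr0; have [->|pb] := eqVneq (p b) 0; first by rewrite mul0r.
exfalso; move: (hp b pb); rewrite mon_wt2 mul1n => H.
have : [\/ b = zt_exp 1 0, b = zt_exp 0 2, b = zt_exp 1 1 | b = zt_exp 0 3].
  rewrite (zt_expK b); move: (b ord0) (b o1) H => i j H.
  have : ((i == 1) && (j == 0) || (i == 0) && (j == 2) || ((i == 1) && (j == 1)) || ((i == 0) && (j == 3)))%N by lia.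
  by case/orP => [/orP[/orP[]|]|] /andP[/eqP -> /eqP ->]; [constructor 1|constructor 2|constructor 3|constructor 4].
by case=> E; [move: n1|move: n2|move: n3|move: n4]; rewrite E eqxx.
Qed.

Lemma psval4_part (p : pwseries R 2) (x : 'rV[C]_2) :
  (forall e, p e != 0 -> mon_wt [tuple 2%N; 1%N] e = 2%N \/ mon_wt [tuple 2%N; 1%N] e = 3%N) ->
  psval (wt_part [tuple 2%N; 1%N] 3 p) x =
    p (zt_exp 1 1) * (x 0 ord0 * x 0 o1) + p (zt_exp 0 3) * x 0 o1 ^+ 3.
Proof.
move=> hp; rewrite psval4; last by move=> e; rewrite /wt_part; case: ifP => [/eqP ?|_]; [right|rewrite eqxx].
by rewrite /wt_part !mon_wt2 !zt_expE /= !mul0r !add0r.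
Qed.

Section Params.
Context (c m pi_ be a b : C) (g : pwseries R 2).

Definition p3f q : C := a * (cz q * ct q) + b * ct q ^+ 3.
(** Let p = pi_ z + be t^2 + p3f. When [m ^+ 2 = 1 - c ^+ 2], the function [m * pf] is
    [p - c ^+ 2 * p3f], the coefficient of 2x that remains after completing the square in y. *)
Definition pf q : C := m^-1 * (pi_ * cz q + be * ct q ^+ 2) + m * p3f q.
Definition ef q : C := cz q ^+ 3 + ztf g q - c ^+ 2 * p3f q ^+ 2.
Definition type3_zt q : C := ef q - pf q ^+ 2.
Definition type3_fun q : C := cx q ^+ 2 + cy q ^+ 2 + 2%:R * c * cx q * cy q
  + 2%:R * cx q * (pi_ * cz q + be * ct q ^+ 2 + p3f q) + 2%:R * c * cy q * p3f q
  + cz q ^+ 3 + ztf g q.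

(** As [m ^+ 2 = 1 - c ^+ 2], completing the square in y and then in x gives
    [type3_fun = s1 ^+ 2 + y1 ^+ 2 + type3_zt]. *)
Definition y1 q : C := cy q + c * cx q + c * p3f q.
Definition s1 q : C := m * cx q + pf q.
(** The sum of squares [s1 ^+ 2 + y1 ^+ 2] is split into conjugate factors, which become the new x
    and y. *)
Definition theta q : 'rV[C]_4 := v4 (s1 q + 'i * y1 q) (s1 q - 'i * y1 q) (cz q) (ct q).
Definition xback q : C := m^-1 * (2%:R^-1 * (cx q + cy q) - pf q).
Definition yback q : C := (2%:R * 'i)^-1 * (cx q - cy q) - c * xback q - c * p3f q.
Definition theta' q : 'rV[C]_4 := v4 (xback q) (yback q) (cz q) (ct q).

Context (m0 : m != 0) (mc : m ^+ 2 = 1 - c ^+ 2).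

Lemma i_neq0 : 'i != 0 :> C. Proof. exact: neq0Ci. Qed.

Lemma ii_prod (x y : C) : (x + 'i * y) * (x - 'i * y) = x ^+ 2 + y ^+ 2.
Proof. by rewrite mulrC -subr_sqr exprMn sqrCi mulN1r opprK. Qed.

Lemma f3E q : type3_fun q = hyp type3_zt (theta q).
Proof.
rewrite /hyp /theta !v4E ii_prod /type3_zt /ef /pf /p3f /ztf czt_v4 !v4E.
rewrite [czt (v4 0 0 _ _)](_ : _ = czt q); last by rewrite -[in RHS](v4K q) [RHS]czt_v4.
rewrite /type3_fun /s1 /y1 /pf /ztf -/(p3f q).
have -> : (m * cx q + (m^-1 * (pi_ * cz q + be * ct q ^+ 2) + m * p3f q)) ^+ 2 =
   (1 - c ^+ 2) * cx q ^+ 2 + 2%:R * cx q * (pi_ * cz q + be * ct q ^+ 2) + 2%:R * (1 - c ^+ 2) * cx q * p3f q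
   + (m^-1 * (pi_ * cz q + be * ct q ^+ 2) + m * p3f q) ^+ 2.
  by rewrite -mc; field.
ring.
Qed.

Lemma p3f_v4 x y q : p3f (v4 x y (cz q) (ct q)) = p3f q.
Proof. by rewrite /p3f !v4E. Qed.

Lemma pf_v4 x y q : pf (v4 x y (cz q) (ct q)) = pf q.
Proof. by rewrite /pf p3f_v4 !v4E. Qed.

Lemma thetaK q : theta' (theta q) = q.
Proof.
have X : xback (theta q) = cx q.
  by rewrite /xback /theta pf_v4 !v4E /s1; field.
rewrite /theta' /yback X {1 2}/theta p3f_v4 !v4E.
apply: eq4; rewrite v4E ?v4E //.
rewrite (_ : (2%:R * 'i)^-1 * _ = y1 q); first by rewrite /y1; ring.
by field; exact: i_neq0.
Qed.

Lemma theta'K q : theta (theta' q) = q.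
Proof.
have S : s1 (theta' q) = 2%:R^-1 * (cx q + cy q).
  by rewrite /s1 /theta' pf_v4 v4E /xback mulVKf // subrK.
have Y : y1 (theta' q) = (2%:R * 'i)^-1 * (cx q - cy q).
  by rewrite /y1 /theta' p3f_v4 !v4E /yback; ring.
rewrite /theta S Y {1 2}/theta' !v4E.
have E : 'i * ((2%:R * 'i)^-1 * (cx q - cy q)) = 2%:R^-1 * (cx q - cy q).
  by field; exact: i_neq0.
apply: eq4; rewrite v4E ?E //.
- by field.
- by field.
Qed.

Lemma zt_only_g3 : zt_only type3_zt.
Proof.
move=> q; rewrite /type3_zt /ef pf_v4 p3f_v4 !v4E; congr (_ + _ - _ - _).
exact: ztf_only.
Qed.

Lemma p3f_expands x : expands_at x p3f.
Proof.
apply: expands_atD; apply: expands_atM; try exact: expands_at_cst.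
  by apply: expands_atM; exact: expands_at_coord.
by apply: expands_atX; exact: expands_at_coord.
Qed.

Lemma pf_expands x : expands_at x pf.
Proof.
apply: expands_atD; apply: expands_atM; try exact: expands_at_cst; last exact: p3f_expands.
apply: expands_atD; apply: expands_atM; try exact: expands_at_cst; first exact: expands_at_coord.
by apply: expands_atX; exact: expands_at_coord.
Qed.

Lemma ef_expands : convergent g -> expands_at 0 ef.
Proof.
move=> gc; apply: expands_atD.
  by apply: expands_atD; [apply: expands_atX; exact: expands_at_coord|exact: ztf_expands].
by apply: expands_atN; apply: expands_atM; [exact: expands_at_cst|apply: expands_atX; exact: p3f_expands].
Qed.

Lemma g3_expands : convergent g -> expands_at 0 type3_zt.
Proof.
move=> gc; apply: expands_atD; first exact: ef_expands.
by apply: expands_atN; apply: expands_atX; exact: pf_expands.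
Qed.

Lemma p3f0 : p3f 0 = 0. Proof. by rewrite /p3f /cz /ct !mxE expr0n !mulr0 addr0. Qed.
Lemma pf0 : pf 0 = 0. Proof. by rewrite /pf p3f0 /cz /ct !mxE expr0n !mulr0 !addr0 mulr0. Qed.

Lemma y1_expands x : expands_at x y1.
Proof.
apply: expands_atD; last by apply: expands_atM; [exact: expands_at_cst|exact: p3f_expands].
apply: expands_atD; first exact: expands_at_coord.
by apply: expands_atM; [exact: expands_at_cst|exact: expands_at_coord].
Qed.

Lemma s1_expands x : expands_at x s1.
Proof.
apply: expands_atD; last exact: pf_expands.
by apply: expands_atM; [exact: expands_at_cst|exact: expands_at_coord].
Qed.

Lemma xback_expands x : expands_at x xback.
Proof.
apply: expands_atM; first exact: expands_at_cst.
apply: expands_atD; last by apply: expands_atN; exact: pf_expands.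
apply: expands_atM; first exact: expands_at_cst.
by apply: expands_atD; exact: expands_at_coord.
Qed.

Lemma yback_expands x : expands_at x yback.
Proof.
apply: expands_atD; last by apply: expands_atN; apply: expands_atM; [exact: expands_at_cst|exact: p3f_expands].
apply: expands_atD; last by apply: expands_atN; apply: expands_atM; [exact: expands_at_cst|exact: xback_expands].
apply: expands_atM; first exact: expands_at_cst.
by apply: expands_atD; [exact: expands_at_coord|apply: expands_atN; exact: expands_at_coord].
Qed.

Lemma theta_pair : germ_pair type3_fun (hyp type3_zt) theta theta'.
Proof.
have aT : analytic0 theta.
  have ey : expands_at 0 (fun q => 'i * y1 q) by apply: expands_atM; [exact: expands_at_cst|exact: y1_expands].
  apply: v4_analytic; [| |exact: expands_at_coord|exact: expands_at_coord].
    by apply: expands_atD; [exact: s1_expands|].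
  by apply: expands_atD; [exact: s1_expands|exact: expands_atN].
have T0 : theta 0 = 0.
  have x0 : cx (0 : 'rV[C]_4) = 0 by rewrite /cx mxE.
  have y0 : cy (0 : 'rV[C]_4) = 0 by rewrite /cy mxE.
  have z0 : cz (0 : 'rV[C]_4) = 0 by rewrite /cz mxE.
  have t0 : ct (0 : 'rV[C]_4) = 0 by rewrite /ct mxE.
  by rewrite /theta /s1 /y1 pf0 p3f0 x0 y0 z0 t0 !mulr0 !addr0 mulr0 ?oppr0 ?subr0 ?addr0 v4_0.
split.
- by split=> //; apply: filterE => x; rewrite f3E.
- split; last by apply: filterE => x; rewrite f3E theta'K.
    by apply: v4_analytic; [exact: xback_expands|exact: yback_expands|exact: expands_at_coord|exact: expands_at_coord].
  by rewrite -[in LHS]T0 thetaK.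
- by apply: filterE => x _; exact: thetaK.
- by apply: filterE => x _; exact: theta'K.
Qed.

End Params.

Lemma eq_type3E c (p g : pwseries R 2) :
  (forall e, p e != 0 -> mon_wt [tuple 2%N; 1%N] e = 2%N \/ mon_wt [tuple 2%N; 1%N] e = 3%N) ->
  eq_type3 c p g = type3_fun c (p (zt_exp 1 0)) (p (zt_exp 0 2)) (p (zt_exp 1 1)) (p (zt_exp 0 3)) g.
Proof.
move=> hp; apply/funext => q; rewrite /eq_type3 /type3_fun psval4 // psval4_part // !czt0 !czt1.
by rewrite /p3f; congr (_ + _ + _ + _ + _ + _ + _); rewrite !addrA.
Qed.

End Type3Form.

(** * Leading forms in type (3) for the auxiliary weights *)

Section Type3Weights.
Context {R : realType}.
Local Notation C := (cplx R).
Implicit Types (q : 'rV[C]_4) (h : 'rV[C]_4 -> C).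

Definition type3_params (c m be : C) (g : pwseries R 2) : Prop :=
  [/\ m != 0, m ^+ 2 = 1 - c ^+ 2, be != 0, convergent g & wt_ge [tuple 2%N; 1%N] g 6 /\
    forall i j, g (zt_exp i j) != 0 -> (i <= 2)%N].

(** The bound on the z-degree keeps z^3 out of [g]; otherwise it would add to the explicit term z^3
    in the leading forms below. *)
Lemma type3_series_weight (g : pwseries R 2) k l N : wt_ge [tuple 2%N; 1%N] g 6 ->
  (forall i j, g (zt_exp i j) != 0 -> (i <= 2)%N) ->
  (forall i j, (i <= 2)%N -> (6 <= 2 * i + j)%N -> (N <= k * i + l * j)%N) ->
  wt_ge [tuple k; l] g N.
Proof.
move=> gw gd H e ge; rewrite mon_wt2; apply: H.
  by apply: (gd _ (e o1)); rewrite -zt_expK.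
by have := gw e ge; rewrite mon_wt2 mul1n.
Qed.

Lemma wlimN n (w : n.-tuple nat) d (h P : 'rV[C]_n -> C) :
  wlim w d h P -> wlim w d (fun x => - h x) (fun x => - P x).
Proof. by move=> /(wlimZ (-1)); apply: wlim_eq => x; rewrite mulN1r. Qed.

Lemma wlim_p3f0 (a b : C) p1 p2 k l d : (d < k + l)%N -> (d < l * 3)%N ->
  wlim [tuple p1; p2; k; l] d (p3f a b) (fun=> 0).
Proof.
move=> dk dl.
have h1 := wlim_lower dk (wlimZ a (wlimM (wlim_cz p1 p2 k l) (wlim_ct p1 p2 k l))).
have h2 := wlim_lower dl (wlimZ b (wlimX 3 (wlim_ct p1 p2 k l))).
by apply: (wlim_eq _ _ (wlimD h1 h2)) => // x; rewrite addr0.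
Qed.

Lemma wlim_p3f (a b : C) p1 p2 : wlim [tuple p1; p2; 2%N; 1%N] 3 (p3f a b) (p3f a b).
Proof.
have h1 := wlimZ a (wlimM (wlim_cz p1 p2 2 1) (wlim_ct p1 p2 2 1)).
have h2 := wlimZ b (wlimX 3 (wlim_ct p1 p2 2 1)).
exact: wlimD h1 h2.
Qed.

Lemma wlim_pf0 (m be a b : C) p1 p2 k l d : (d < l * 2)%N -> (d < k + l)%N -> (d < l * 3)%N ->
  wlim [tuple p1; p2; k; l] d (pf m 0 be a b) (fun=> 0).
Proof.
move=> d2 dk dl.
have h1 := wlim_lower d2 (wlimZ (m^-1 * be) (wlimX 2 (wlim_ct p1 p2 k l))).
have h2 := wlimZ m (wlim_p3f0 a b p1 p2 dk dl).
apply: (wlim_eq _ _ (wlimD h1 h2)) => x; first by rewrite /pf; ring.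
by rewrite mulr0 addr0.
Qed.

Lemma wlim_pf (m be a b : C) p1 p2 k l : (0 < l)%N -> (l < k)%N ->
  wlim [tuple p1; p2; k; l] (l * 2) (pf m 0 be a b) (fun q => m^-1 * be * ct q ^+ 2).
Proof.
move=> l0 lk.
have dk : (l * 2 < k + l)%N by rewrite muln2 -addnn ltn_add2r.
have dl : (l * 2 < l * 3)%N by rewrite ltn_pmul2l.
have h1 := wlimZ (m^-1 * be) (wlimX 2 (wlim_ct p1 p2 k l)).
have h2 := wlimZ m (wlim_p3f0 a b p1 p2 dk dl).
apply: (wlim_eq _ _ (wlimD h1 h2)) => x; first by rewrite /pf; ring.
by rewrite mulr0 addr0.
Qed.

Lemma wlim_g3 (c m be a b : C) (g : pwseries R 2) p1 p2 k l N L1 L2 : (0 < k)%N -> (0 < l)%N -> type3_params c m be g ->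
  (forall i j, (i <= 2)%N -> (6 <= 2 * i + j)%N -> (N < k * i + l * j)%N) ->
  wlim [tuple p1; p2; k; l] N (fun q => cz q ^+ 3) L1 ->
  wlim [tuple p1; p2; k; l] N (fun q => p3f a b q ^+ 2) (fun=> 0) ->
  wlim [tuple p1; p2; k; l] N (fun q => pf m 0 be a b q ^+ 2) L2 ->
  wlim [tuple p1; p2; k; l] N (type3_zt c m 0 be a b g) (fun q => L1 q - L2 q).
Proof.
move=> k0 l0 [_ _ _ gc [gw gd]] H hz hp hf.
have hg := ztf_wlim0 p1 p2 k0 l0 gc (type3_series_weight gw gd H).
apply: (wlim_eq _ _ (wlimD (wlimD (wlimD hz hg) (wlimN (wlimZ (c ^+ 2) hp))) (wlimN hf))) => // x.
by rewrite mulr0 oppr0 !addr0.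
Qed.

Lemma wlim_g3_ones (c m be a b : C) (g : pwseries R 2) : type3_params c m be g ->
  wlim [tuple 1%N; 1%N; 1%N; 1%N] 2 (type3_zt c m 0 be a b g) (fun=> 0).
Proof.
move=> tp; have hp := wlimX 2 (@wlim_p3f0 a b 1 1 1 1 1 isT isT).
have hf := wlimX 2 (@wlim_pf0 m be a b 1 1 1 1 1 isT isT isT).
have hz := wlim_lower (isT : (2 < 3)%N) (wlimX 3 (@wlim_cz R 1 1 1 1)).
have hp' : wlim [tuple 1%N; 1%N; 1%N; 1%N] 2 (fun q => p3f a b q ^+ 2) (fun=> 0).
  by apply: wlim_eq hp => // x; rewrite expr0n.
have := wlim_g3 (isT : (0 < 1)%N) (isT : (0 < 1)%N) tp _ hz hp' hf.
move=> H; apply: (wlim_eq _ _ (H _)) => // [x|i j]; last by lia.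
by rewrite expr0n subr0.
Qed.

Lemma type3_mult (c m be a b : C) (g : pwseries R 2) : type3_params c m be g -> multiplicity_ge3 (type3_zt c m 0 be a b g).
Proof.
move=> tp; split; [|exact: zt_only_g3|exact: wlim_g3_ones].
by apply: g3_expands; case: tp.
Qed.

Lemma wlim_g3_3322 (c m be a b : C) (g : pwseries R 2) : type3_params c m be g ->
  wlim [tuple 3%N; 3%N; 2%N; 2%N] 6 (type3_zt c m 0 be a b g) (fun q => 1 * cz q ^+ 3).
Proof.
move=> tp; have hp := wlimX 2 (@wlim_p3f0 a b 3 3 2 2 3 isT isT).
have hf := wlimX 2 (@wlim_pf0 m be a b 3 3 2 2 3 isT isT isT).
have hz := wlimX 3 (@wlim_cz R 3 3 2 2).
have hp' : wlim [tuple 3%N; 3%N; 2%N; 2%N] 6 (fun q => p3f a b q ^+ 2) (fun=> 0).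
  by apply: wlim_eq hp => // x; rewrite expr0n.
have := wlim_g3 (isT : (0 < 2)%N) (isT : (0 < 2)%N) tp _ hz hp' hf.
move=> H; apply: (wlim_eq _ _ (H _)) => // [x|i j]; last by lia.
by rewrite expr0n subr0 mul1r.
Qed.

(** For [b0] non-zero, xy + e6 is the equation of an E_6 singularity, quasihomogeneous of weight 12
    for (6, 6, 4, 3). *)
Definition e6 (b0 : C) q := cz q ^+ 3 - b0 ^+ 2 * ct q ^+ 4.

Lemma wlim_g3_6643 (c m be a b : C) (g : pwseries R 2) : type3_params c m be g ->
  wlim [tuple 6%N; 6%N; 4%N; 3%N] 12 (type3_zt c m 0 be a b g) (e6 (m^-1 * be)).
Proof.
move=> tp; have hp := wlimX 2 (@wlim_p3f0 a b 6 6 4 3 6 isT isT).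
have hf := wlimX 2 (@wlim_pf m be a b 6 6 4 3 isT isT).
have hz := wlimX 3 (@wlim_cz R 6 6 4 3).
have hp' : wlim [tuple 6%N; 6%N; 4%N; 3%N] 12 (fun q => p3f a b q ^+ 2) (fun=> 0).
  by apply: wlim_eq hp => // x; rewrite expr0n.
have := wlim_g3 (isT : (0 < 4)%N) (isT : (0 < 3)%N) tp _ hz hp' hf.
move=> H; apply: (wlim_eq _ _ (H _)) => // [x|i j]; last by lia.
by rewrite /e6; ring.
Qed.

Lemma e6_polyline (b0 : C) : polyline (e6 b0).
Proof.
apply: polylineD; first by apply: polylineX; exact: polyline_coord.
apply: polylineN; apply: polylineM; first exact: polyline_cst.
by apply: polylineX; exact: polyline_coord.
Qed.

Lemma quadric_g3 (c m pi_ be a b : C) (g : pwseries R 2) : type3_params c m be g -> pi_ != 0 ->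
  wlim [tuple 1%N; 1%N; 1%N; 1%N] 2 (type3_zt c m pi_ be a b g) (fun q => - (m^-1 * pi_ * cz q) ^+ 2).
Proof.
move=> tp pi0; have [m0 _ _ gc [gw gd]] := tp.
have hp := wlimX 2 (@wlim_p3f0 a b 1 1 1 1 1 isT isT).
have hz := wlim_lower (isT : (2 < 3)%N) (wlimX 3 (@wlim_cz R 1 1 1 1)).
have hg : wlim [tuple 1%N; 1%N; 1%N; 1%N] 2 (ztf g) (fun=> 0).
  apply: ztf_wlim0 => //; apply: (type3_series_weight gw gd) => i j; lia.
have hf : wlim [tuple 1%N; 1%N; 1%N; 1%N] 1 (pf m pi_ be a b) (fun q => m^-1 * pi_ * cz q).
  have h1 := wlim_lower (isT : (1 < 1 * 2)%N) (wlimZ (m^-1 * be) (wlimX 2 (wlim_ct 1 1 1 1))).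
  have h2 := wlimZ m (@wlim_p3f0 a b 1 1 1 1 1 isT isT).
  have h3 := wlimZ (m^-1 * pi_) (@wlim_cz R 1 1 1 1).
  apply: (wlim_eq _ _ (wlimD h3 (wlimD h1 h2))) => x; first by rewrite /pf; ring.
  by rewrite mulr0 !addr0.
apply: (wlim_eq _ _ (wlimD (wlimD (wlimD hz hg) (wlimN (wlimZ (c ^+ 2) hp))) (wlimN (wlimX 2 hf)))) => // x.
by rewrite expr0n mulr0 oppr0 !add0r.
Qed.

(** A term z in p would give [type3_zt] the non-zero quadratic part - (m^-1 pi_ z)^2, whereas the
    other germ has multiplicity at least 3 in z and t. *)
Lemma type3_pi0 (c m pi_ be a b : C) (g : pwseries R 2) g' Phi Psi : type3_params c m be g -> multiplicity_ge3 g' ->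
  germ_pair (hyp (type3_zt c m pi_ be a b g)) (hyp g') Phi Psi -> pi_ = 0.
Proof.
move=> tp mg gP; apply/eqP/negPn/negP => pi0; have [m0 _ _ gc _] := tp.
apply: (quadric_not_cubic (g3_expands c m pi_ be a b gc) (@zt_only_g3 _ c m pi_ be a b g) (quadric_g3 a b tp pi0) _ _ mg gP).
  apply: polylineN; apply: polylineX; apply: polylineM; first exact: polyline_cst.
  exact: polyline_coord.
exists (v4 0 0 1 0); rewrite v4E mulr1 oppr_eq0 expf_eq0 /=.
by rewrite mulf_neq0 // invr_eq0.
Qed.

Lemma lead_texp_none p1 p2 k l d h (t : C) : (0 < p1)%N -> (0 < p2)%N -> (0 < k)%N -> (0 < l)%N ->
  (forall e, l * e != d)%N -> lead [tuple p1; p2; k; l] d h (v4 0 0 0 t) = 0.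
Proof.
move=> p10 p20 k0 l0 led; have w0 := tuple4_gt0 p10 p20 k0 l0.
apply: (hsum_unique (lead_hsum w0 d h _)).
rewrite (_ : (fun _ => _) = (fun=> 0)); first exact: hsum0.
apply/funext => e; rewrite /wt_part; case: eqP => [we|]; last by rewrite mul0r.
suff -> : monomial e (v4 0 0 0 t : 'rV[C]_4) = 0 by rewrite mulr0.
have mt : monomial e (v4 0 0 0 t : 'rV[C]_4) =
    0 ^+ e (inord 0) * 0 ^+ e (inord 1) * 0 ^+ e (inord 2) * t ^+ e (inord 3).
  rewrite /monomial !big_ord_recl big_ord0 !mxE /= !mulr1 !mulrA.
  by congr (_ ^+ e _ * _ ^+ e _ * _ ^+ e _ * _ ^+ e _); apply: val_inj; rewrite /= inordK.
rewrite mt; have [b0|b0] := eqVneq (e (inord 0)) 0%N; last by rewrite expr0n (negPf b0) !mul0r.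
have [b1|b1] := eqVneq (e (inord 1)) 0%N; last by rewrite [0 ^+ e (inord 1)]expr0n (negPf b1) mulr0 !mul0r.
have [b2|b2] := eqVneq (e (inord 2)) 0%N; last by rewrite [0 ^+ e (inord 2)]expr0n (negPf b2) mulr0 mul0r.
have /eqP := led (e (inord 3)); case; rewrite -we mon_wt4 b0 b1 b2 !muln0 !add0n //.
Qed.

Section Pair.
Context (c m be a b : C) (g : pwseries R 2) (tp : type3_params c m be g).
Context (c' m' be' a' b' : C) (g' : pwseries R 2) (tp' : type3_params c' m' be' g').
Local Notation G := (type3_zt c m 0 be a b g).
Local Notation G' := (type3_zt c' m' 0 be' a' b' g').

(** In the weights (3, 3, 2, 2) both leading forms are z^3, so [lead_z_pure] applies. *)
Lemma type3_no_t Phi Psi : germ_pair (hyp G) (hyp G') Phi Psi -> normal Phi ->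
  taylor (fun x => cz (Phi x)) (texp 1) = 0.
Proof.
move=> [gm _ _ _] nP.
have [hX hY hZ hT] := germ_map_comp_expands gm; have [_ _ Z0 T0] := germ_map_comp0 gm.
have wm (h : 'rV[C]_4 -> C) : expands_at 0 h -> h 0 = 0 -> wge [tuple 3%N; 3%N; 2%N; 2%N] 2 h.
  by apply: wge_min; apply: ord4P; rewrite tnth4.
have := lead_z_pure (isT : (0 < 3)%N) (isT : (0 < 2)%N) (isT : (0 < 2)%N) (isT : (2 < 3)%N)
  (@zt_only_g3 _ c m 0 be a b g) (wlim_g3_3322 a b tp) (oner_neq0 C)
  (@zt_only_g3 _ c' m' 0 be' a' b' g') (wlim_g3_3322 a' b' tp') (oner_neq0 C) gm nP (wm _ hZ Z0) (wm _ hT T0).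
by rewrite (@lead_texp R 3 3 2 2 2 1) // expr1n mulr1.
Qed.

(** This is [lead_identity] in the weights (6, 6, 4, 3). The coefficients of t^4 in the forms [e6]
    give the relation, and t^2, of weight 6, cannot occur beside the leading forms of the x- and
    y-components, which are multiples of x and of y. *)
Lemma type3_leads Phi Psi : germ_pair (hyp G) (hyp G') Phi Psi -> normal Phi ->
  [/\ linmx Phi (inord 0) (inord 0) * linmx Phi (inord 1) (inord 1) * (m^-1 * be) ^+ 2 =
        (m'^-1 * be') ^+ 2 * linmx Phi (inord 3) (inord 3) ^+ 4,
      linmx Phi (inord 3) (inord 3) != 0,
      taylor (fun x => cx (Phi x)) (texp 2) = 0 & taylor (fun x => cy (Phi x)) (texp 2) = 0].
Proof.
move=> gP nP; have [gm _ _ _] := gP; have z1 := type3_no_t gP nP.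
have [hX hY hZ hT] := germ_map_comp_expands gm; have [X0 Y0 Z0 T0] := germ_map_comp0 gm.
pose w := [tuple 6%N; 6%N; 4%N; 3%N]; have w0 : forall i, (0 < tnth w i)%N by exact: tuple4_gt0.
have wZ : wge w 4 (fun x => cz (Phi x)).
  apply: wge_texp => // -[|[|e]]; [|by rewrite z1 eqxx|by lia].
  by rewrite taylor_texp0 // Z0 eqxx.
have wT : wge w 3 (fun x => ct (Phi x)) by apply: wge_min => //; apply: ord4P; rewrite tnth4.
have Gn : exists q, e6 (m^-1 * be) q != 0.
  by exists (v4 0 0 1 0); rewrite /e6 !v4E expr1n expr0n mulr0 subr0 oner_neq0.
have [x0 xx y0 yy] := nP.
have x1 : linmx Phi (inord 0) (inord 1) = 0 by apply: x0; rewrite ord4_neq.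
have y1 : linmx Phi (inord 1) (inord 0) = 0 by apply: y0; rewrite ord4_neq.
rewrite !mxE in xx yy x1 y1.
have hl := wlim_zt_comp (@zt_only_g3 _ c' m' 0 be' a' b' g') (wlim_g3_6643 a' b' tp') (wge_wlim w0 hZ wZ) (wge_wlim w0 hT wT).
have [wX wY] := product_weights (isT : (0 < 6)%N) (isT : (0 < 6)%N) (isT : (0 < 4)%N) (isT : (0 < 3)%N) (leqnn 6)
   (@zt_only_g3 _ c m 0 be a b g) (wlim_g3_6643 a b tp) (e6_polyline _) Gn
   hX hY (germ_map_vanish gm) hl xx yy.
have ztH : zt_only (fun q => e6 (m'^-1 * be') (v4 0 0 (lead w 4 (fun x => cz (Phi x)) q) (lead w 3 (fun x => ct (Phi x)) q))).
  by move=> q; rewrite -!(lead_zt_only _ (isT : (0 < 6)%N) (isT : (0 < 6)%N) (isT : (0 < 4)%N) (isT : (0 < 3)%N) _ _ q).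
have [LX LY LH] := lead_identity (isT : (0 < 6)%N) (isT : (0 < 4)%N) (isT : (0 < 3)%N)
   (@zt_only_g3 _ c m 0 be a b g) (wlim_g3_6643 a b tp) (e6_polyline _) Gn hX hY wX wY xx yy x1 y1
   (germ_map_vanish gm) hl ztH.
split.
- have := LH (v4 0 0 0 1); rewrite /e6 !v4E expr0n /= sub0r expr1n mulr1 lead_texp_none //; last by move=> e; lia.
  rewrite (@lead_texp R 6 6 4 3 3 1) // expr1n mulr1 expr0n /= sub0r => /eqP.
  by rewrite mulrN eqr_opp => /eqP; rewrite !mxE texp_delta.
- have JJ := linmx_inv3 (type3_mult a b tp) gP.
  apply/eqP => t0; have /matrixP /(_ (inord 3) (inord 3)) := JJ.
  rewrite [LHS]mxE [RHS]mxE sum4 eqxx t0 mulr0 addr0.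
  rewrite x0 ?ord4_neq // y0 ?ord4_neq //.
  rewrite [linmx Phi (inord 2) _]mxE -texp_delta z1 !mulr0 !addr0 => /esym/eqP.
  by rewrite oner_eq0.
- have := LX (v4 0 0 0 1); rewrite (@lead_texp R 6 6 4 3 6 2) // expr1n mulr1 v4E mulr0 //.
- have := LY (v4 0 0 0 1); rewrite (@lead_texp R 6 6 4 3 6 2) // expr1n mulr1 v4E mulr0 //.
Qed.

(** Can be achieved by multiplying x and y by inverse constants; the last condition matches the
    coefficients of [t ^+ 2] in the two factors. *)
Definition balanced (Phi : 'rV[C]_4 -> 'rV[C]_4) : Prop :=
  [/\ normal Phi, linmx Phi (inord 0) (inord 0) = linmx Phi (inord 1) (inord 1) &
      linmx Phi (inord 0) (inord 0) * (m^-1 * be) = m'^-1 * be' * linmx Phi (inord 3) (inord 3) ^+ 2].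

Definition torus (l : C) q : 'rV[C]_4 := v4 (l * cx q) (l^-1 * cy q) (cz q) (ct q).

Lemma torusK (l : C) q : l != 0 -> torus l^-1 (torus l q) = q.
Proof. by move=> l0; apply: eq4; rewrite /torus !v4E // mulKf // invr_eq0. Qed.

Lemma torus_map (l : C) (h : 'rV[C]_4 -> C) : l != 0 -> zt_only h -> germ_map (hyp h) (hyp h) (torus l).
Proof.
move=> l0 zth; split.
- apply: v4_analytic; try exact: expands_at_coord.
    by apply: expands_atM; [exact: expands_at_cst|exact: expands_at_coord].
  by apply: expands_atM; [exact: expands_at_cst|exact: expands_at_coord].
- by apply: eq4; rewrite /torus v4E /cx /cy /cz /ct !mxE ?mulr0.
- apply: filterE => x; rewrite /hyp /torus !v4E (zt_onlyE _ _ _ _ zth) -zth mulrACA mulfV // mul1r //.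
Qed.

Lemma torus_pair (l : C) (h : 'rV[C]_4 -> C) : l != 0 -> zt_only h ->
  germ_pair (hyp h) (hyp h) (torus l) (torus l^-1).
Proof.
move=> l0 zth; have l0' : l^-1 != 0 by rewrite invr_eq0.
split; [exact: torus_map|exact: torus_map| |].
- by apply: filterE => x _; exact: torusK.
- by apply: filterE => x _; rewrite -{1}(invrK l); exact: torusK.
Qed.

Lemma taylorZ (l : C) (h : 'rV[C]_4 -> C) e : expands_at 0 h -> taylor (fun x => l * h x) e = l * taylor h e.
Proof.
move=> h0; have hc := taylor_at h0; have [[r r0 [M cM]] [f f0 hf]] := hc.
rewrite (_ : taylor (fun x => l * h x) = (fun a => l * taylor h a)) //.
apply: taylorE; split.
  exists r => //; exists (`|l| * M) => d.
  by rewrite normrM -mulrA; apply: ler_wpM2l.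
have [f' [f'0 H]] := series_at_hsum hc.
exists f' => // z zf; apply/esym/hsum_psval.
by have := hsumZ l (H z zf); congr (hsum _ _); apply/funext => d; rewrite mulrA.
Qed.

Lemma balance_scalar (al bt u u' tau : C) : al != 0 -> u != 0 -> u' != 0 -> tau != 0 ->
  al * bt * u ^+ 2 = u' ^+ 2 * tau ^+ 4 ->
  u' * tau ^+ 2 / u / al * al = (u' * tau ^+ 2 / u / al)^-1 * bt.
Proof.
move=> al0 u0 u0' tau0 E.
have -> : bt = u' ^+ 2 * tau ^+ 4 / (al * u ^+ 2) by rewrite -E; field; rewrite al0 u0.
by field; rewrite al0 u0 u0' tau0.
Qed.

Lemma balance Phi Psi : germ_pair (hyp G) (hyp G') Phi Psi ->
  exists Phi' Psi', germ_pair (hyp G) (hyp G') Phi' Psi' /\ balanced Phi'.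
Proof.
move=> gP0.
have [Phi1 [Psi1 [gP nP]]] : exists Phi' Psi', germ_pair (hyp G) (hyp G') Phi' Psi' /\ normal Phi'.
  have [nP|nP] := normal_or_swap (type3_mult a b tp) (type3_mult a' b' tp') gP0; first by exists Phi, Psi.
  by exists (swap \o Phi), (Psi \o swap); split=> //; exact: germ_pair_swap (@zt_only_g3 _ c' m' 0 be' a' b' g') gP0.
have [E tau0 _ _] := type3_leads gP nP; have [x0 xx y0 yy] := nP.
have [m0 _ be0 _ _] := tp; have [m0' _ be0' _ _] := tp'.
set al := linmx Phi1 (inord 0) (inord 0) in E xx; set bt := linmx Phi1 (inord 1) (inord 1) in E yy.
set tau := linmx Phi1 (inord 3) (inord 3) in E tau0.
set u := m^-1 * be in E; set u' := m'^-1 * be' in E.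
have u0 : u != 0 by rewrite mulf_neq0 // invr_eq0.
have u0' : u' != 0 by rewrite mulf_neq0 // invr_eq0.
(* Forced by the requirement [l * al * u = u' * tau ^+ 2]; by [E] the rescaled [bt] then equals
   [l * al]. *)
pose l := u' * tau ^+ 2 / u / al.
have l0 : l != 0 by rewrite !mulf_neq0 ?invr_eq0 // expf_neq0.
exists (torus l \o Phi1), (Psi1 \o torus l^-1).
split; first exact: germ_pair_comp gP (torus_pair l0 (@zt_only_g3 _ c' m' 0 be' a' b' g')).
have [gm _ _ _] := gP; have [hX hY hZ hT] := germ_map_comp_expands gm.
have Ex j : linmx (torus l \o Phi1) (inord 0) j = l * linmx Phi1 (inord 0) j.
  rewrite !mxE -(taylorZ _ _ hX); congr (taylor _ _); apply/funext => x; exact: cx_v4.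
have Ey j : linmx (torus l \o Phi1) (inord 1) j = l^-1 * linmx Phi1 (inord 1) j.
  rewrite !mxE -(taylorZ _ _ hY); congr (taylor _ _); apply/funext => x; exact: cy_v4.
have Et : linmx (torus l \o Phi1) (inord 3) (inord 3) = tau.
  rewrite /tau !mxE; congr (taylor _ _); apply/funext => x; exact: ct_v4.
split; first split.
- by move=> j j0; rewrite Ex x0 // mulr0.
- by rewrite Ex mulf_neq0.
- by move=> j j0; rewrite Ey y0 // mulr0.
- by rewrite Ey mulf_neq0 // invr_eq0.
- by rewrite Ex Ey; exact: balance_scalar.
- by rewrite Ex Et -/al /l divfK // -/u -/u' divfK.
Qed.

End Pair.
End Type3Weights.

(** The sign of the square root is chosen so that [|b + d'|] is at least [|b|], and the root is
    written -c / (b + d'). This avoids dividing by [s ^+ 2] and keeps the root bounded as s -> 0. *)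
Lemma quadratic_root (K : numClosedFieldType) (s b c : K) : b != 0 ->
  exists2 x, s ^+ 2 * x ^+ 2 + 2 * b * x + c = 0 & `|x| <= `|c| / `|b|.
Proof.
move=> b0; pose d := sqrtC (b ^+ 2 - s ^+ 2 * c).
have dd : d ^+ 2 = b ^+ 2 - s ^+ 2 * c by exact: sqrtCK.
have [d' d'2 db] : exists2 d', d' ^+ 2 = d ^+ 2 & `|b| <= `|b + d'|.
  have [h|h] := real_leP (normr_real b) (normr_real (b + d)); first by exists d.
  exists (- d); first by rewrite sqrrN.
  have : `|2 * b| <= `|b + d| + `|b - d|.
    by rewrite (_ : 2 * b = (b + d) + (b - d)) ?ler_normD //; ring.
  rewrite normrM normr_nat mulr_natl mulr2n => H.
  by rewrite -(lerD2l `|b|) (le_trans H) // lerD2r ltW.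
have bd : b + d' != 0 by rewrite -normr_gt0 (lt_le_trans _ db) // normr_gt0.
exists (- c / (b + d')); last first.
  rewrite normrM normrN normfV; apply: ler_wpM2l => //.
  by rewrite lef_pV2 ?posrE ?normr_gt0.
have -> : s ^+ 2 * (- c / (b + d')) ^+ 2 + 2 * b * (- c / (b + d')) + c =
   c * (d' ^+ 2 - (b ^+ 2 - s ^+ 2 * c)) / (b + d') ^+ 2 by field.
by rewrite d'2 dd subrr mulr0 mul0r.
Qed.

(** The bound on x makes [s ^+ 2 * x ^+ 2] tend to 0, so the equation becomes linear in the
    limit. *)
Lemma quadratic_root_cvg (K : numFieldType) (T : Type) (F : set_system T) {FF : ProperFilter F}
    (s b c x : T -> K) (b0 c0 : K) : b0 != 0 -> s @ F --> (0 : K) -> b @ F --> b0 -> c @ F --> c0 ->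
  (forall u, b u != 0 -> s u ^+ 2 * x u ^+ 2 + 2 * b u * x u + c u = 0 /\ `|x u| <= `|c u| / `|b u|) ->
  x @ F --> - c0 / (2 * b0).
Proof.
move=> b00 s0 bb cc H.
have bn : \forall u \near F, b u != 0 by apply: (cvgr_neq0 b0).
have b1 : (fun u => (b u)^-1) @ F --> b0^-1 by exact: cvgV.
have k0 : (fun u => (`|s u| * `|s u|) * ((`|c u| * `|(b u)^-1|) * (`|c u| * `|(b u)^-1|))) @ F --> (0 : K).
  have sn : (fun u => `|s u|) @ F --> (0 : K) by rewrite -(normr0 K); exact: cvg_norm.
  have cn : (fun u => `|c u| * `|(b u)^-1|) @ F --> `|c0| * `|b0^-1|.
    by apply: cvgM; exact: cvg_norm.
  have := cvgM (cvgM sn sn) (cvgM cn cn); rewrite mul0r mul0r; exact.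
have sx : (fun u => s u ^+ 2 * x u ^+ 2) @ F --> (0 : K).
  apply/cvgrPdist_lt => e e0; move/cvgrPdist_lt : k0 => /(_ e e0) k0.
  refine (@filterS T F _ _ _ _ (filterI bn k0)) => u [/H[_ xb]]; rewrite !sub0r !normrN.
  move=> lte; apply: le_lt_trans lte; rewrite -!expr2 [leRHS]ger0_norm ?mulr_ge0 ?exprn_ge0 ?mulr_ge0 //.
  rewrite normrM !normrX.
  apply: ler_wpM2l; first by rewrite exprn_ge0.
  by rewrite lerXn2r ?nnegrE ?mulr_ge0 ?invr_ge0 // normfV.
have two0 : (2 : K) != 0 by rewrite pnatr_eq0.
have xE : \forall u \near F, - (c u + s u ^+ 2 * x u ^+ 2) * (2^-1 * (b u)^-1) = x u.
  apply: filterS bn => u bu; have [Hx _] := H u bu.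
  have -> : c u + s u ^+ 2 * x u ^+ 2 = - (2 * b u * x u).
    by apply/eqP; rewrite -addr_eq0 -Hx; apply/eqP; ring.
  by field.
have lim : (fun u => - (c u + s u ^+ 2 * x u ^+ 2) * (2^-1 * (b u)^-1)) @ F --> - c0 / (2 * b0).
  rewrite invfM -[in X in - X * _](addr0 c0); apply: cvgM; last by apply: cvgM => //; exact: cvg_cst.
  by apply: cvgN; exact: cvgD.
by apply: cvg_trans lim; exact: (near_eq_cvg xE).
Qed.

(** * Arc points of the type (3) hypersurface *)

Section Type3Arcs.
Context {R : realType}.
Local Notation C := (cplx R).
Implicit Types (q : 'rV[C]_4) (h : 'rV[C]_4 -> C).
Local Notation w := [tuple 4%N; 3%N; 2%N; 1%N].

Context (c pi_ be a b : C) (g : pwseries R 2) (gc : convergent g) (gw : wt_ge [tuple 2%N; 1%N] g 6).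

Definition type3_cst q : C := cy q ^+ 2 + 2 * c * cy q * p3f a b q + cz q ^+ 3
  + psval (wt_part [tuple 2%N; 1%N] 6 g) (czt q).

(** For given y, z, t the equation is quadratic in x; its smaller root has weight 4. *)
Lemma arc_type3 q : pi_ * cz q + be * ct q ^+ 2 != 0 ->
  cx q = - type3_cst q / (2 * (pi_ * cz q + be * ct q ^+ 2)) -> arc_point w (type3_fun c pi_ be a b g) q.
Proof.
move=> b0 xE.
pose B q := c * cy q + (pi_ * cz q + be * ct q ^+ 2 + p3f a b q).
pose D q := cy q ^+ 2 + 2 * c * cy q * p3f a b q + cz q ^+ 3 + ztf g q.
have hB : wlim w 2 B (fun q => pi_ * cz q + be * ct q ^+ 2).
  have h1 := wlimZ c (wlim_lower (isT : (2 < 3)%N) (@wlim_cy R 4 3 2 1)).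
  have h2 := wlimD (wlimZ pi_ (@wlim_cz R 4 3 2 1)) (wlimZ be (wlimX 2 (@wlim_ct R 4 3 2 1))).
  have h3 := wlim_lower (isT : (2 < 3)%N) (wlim_p3f a b 4 3).
  apply: (wlim_eq _ _ (wlimD h1 (wlimD h2 h3))) => // x.
  by rewrite mulr0 add0r addr0.
have hD : wlim w 6 D type3_cst.
  have h1 := wlimX 2 (@wlim_cy R 4 3 2 1).
  have h2 := wlimM (wlimZ (2 * c) (@wlim_cy R 4 3 2 1)) (wlim_p3f a b 4 3).
  have h3 := wlimX 3 (@wlim_cz R 4 3 2 1).
  exact: wlimD (wlimD (wlimD h1 h2) h3) (ztf_wlim 4 3 (isT : (0 < 2)%N) (isT : (0 < 1)%N) gc gw).
rewrite wlimE in hB; rewrite wlimE in hD.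
(* With s^4 X in place of x, the equation divided by s^6 reads
   [s ^+ 2 * X ^+ 2 + 2 * bs * X + ds = 0]. *)
pose bs (sx : C * 'rV[C]_4) := B (wsc w sx.1 sx.2) / sx.1 ^+ 2.
pose ds (sx : C * 'rV[C]_4) := D (wsc w sx.1 sx.2) / sx.1 ^+ 6.
have [X HX] : exists X : C * 'rV[C]_4 -> C, forall u, bs u != 0 ->
    u.1 ^+ 2 * X u ^+ 2 + 2 * bs u * X u + ds u = 0 /\ `|X u| <= `|ds u| / `|bs u|.
  have ex u : exists x, bs u != 0 -> u.1 ^+ 2 * x ^+ 2 + 2 * bs u * x + ds u = 0 /\ `|x| <= `|ds u| / `|bs u|.
    by case: (eqVneq (bs u) 0) => [|/(quadratic_root u.1 (ds u))[x ? ?]]; [exists 0|exists x].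
  by exists (fun u => proj1_sig (cid (ex u))) => u; exact: proj2_sig (cid (ex u)).
have s0 : (fun u : C * 'rV[C]_4 => u.1) @ wfilter q --> (0 : C).
  apply/cvgrPdist_lt => e e0; exists e => // s x _ se _; by rewrite /= sub0r normrN.
have := quadratic_root_cvg (FF := wfilter_proper q) b0 s0 (hB q) (hD q) HX; rewrite -xE => hX e e0.
have bn : \forall u \near wfilter q, bs u != 0 by apply: (cvgr_neq0 (pi_ * cz q + be * ct q ^+ 2)); [exact: hB|].
move/cvgrPdist_lt : hX => /(_ e e0) hX.
have near_e : \forall u \near wfilter q, [/\ u.1 != 0, `|u.1| < e & forall i, `|(u.2 : 'rV[C]_4) 0 i - q 0 i| < e].
  by exists e => // s x.
have [[s x] [[/= sn se xe] [bn' hX']]] := filter_ex (filterI near_e (filterI bn hX)).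
have [HX' _] := HX _ bn'.
exists s, (v4 (X (s, x)) (cy x) (cz x) (ct x)); split=> //.
  apply: ord4P; rewrite -?/(cx _) -?/(cy _) -?/(cz _) -?/(ct _) !v4E; try exact: xe.
  by rewrite distrC.
set Y := X (s, x) in HX' *.
have -> : type3_fun c pi_ be a b g (wsc w s (v4 Y (cy x) (cz x) (ct x))) =
   (s ^+ 4 * Y) ^+ 2 + 2 * (s ^+ 4 * Y) * B (wsc w s x) + D (wsc w s x).
  rewrite /type3_fun /B /D !wsc4 !v4E.
  have -> : ztf g (v4 (s ^+ 4 * Y) (s ^+ 3 * cy x) (s ^+ 2 * cz x) (s ^+ 1 * ct x)) =
     ztf g (v4 (s ^+ 4 * cx x) (s ^+ 3 * cy x) (s ^+ 2 * cz x) (s ^+ 1 * ct x)).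
    by rewrite (zt_onlyE _ _ _ _ (ztf_only g)) [RHS](zt_onlyE _ _ _ _ (ztf_only g)).
  by rewrite /p3f !v4E; ring.
have -> : B (wsc w s x) = bs (s, x) * s ^+ 2 by rewrite /bs /= divfK // expf_neq0.
have -> : D (wsc w s x) = ds (s, x) * s ^+ 6 by rewrite /ds /= divfK // expf_neq0.
transitivity (s ^+ 6 * (s ^+ 2 * Y ^+ 2 + 2 * bs (s, x) * Y + ds (s, x))); first by ring.
by rewrite HX' mulr0.
Qed.

End Type3Arcs.

(** * Weights of balanced maps in type (3) *)

Section Type3Weights.
Context {R : realType}.
Local Notation C := (cplx R).
Implicit Types (q : 'rV[C]_4) (h : 'rV[C]_4 -> C).
Local Notation w := [tuple 4%N; 3%N; 2%N; 1%N].
Local Notation v := [tuple 2%N; 2%N; 2%N; 1%N].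

Lemma zt_only_p3f (a b : C) : zt_only (p3f a b).
Proof. by move=> q; rewrite /p3f !v4E. Qed.

Lemma zt_only_pf (m pi_ be a b : C) : zt_only (pf m pi_ be a b).
Proof. by move=> q; rewrite /pf -zt_only_p3f !v4E. Qed.

Lemma zt_only_ef (c a b : C) g : zt_only (ef c a b g).
Proof. by move=> q; rewrite /ef -zt_only_p3f -ztf_only !v4E. Qed.

Lemma wlim_ef (c m be a b : C) g p1 p2 : type3_params c m be g ->
  exists E, wlim [tuple p1; p2; 2%N; 1%N] 6 (ef c a b g) E.
Proof.
move=> [_ _ _ gc [gw _]]; eexists.
apply: wlimD; last by apply: wlimN; apply: wlimZ; exact: (wlimX 2 (wlim_p3f a b p1 p2)).
apply: (wlimD (wlimX 3 (@wlim_cz R p1 p2 2 1))).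
exact: ztf_wlim (isT : (0 < 2)%N) (isT : (0 < 1)%N) gc gw.
Qed.

Lemma lead2_v4 h x y z t : lead v 2 h (v4 x y z t) = taylor h (texp 2) * t ^+ 2
  + taylor h (delta (inord 2)) * z + taylor h (delta (inord 1)) * y + taylor h (delta (inord 0)) * x.
Proof.
have v0 : forall i, (0 < tnth v i)%N by exact: tuple4_gt0.
rewrite lead_lin_x // lead_lin_y // lead_lin_z // (@lead_texp R 2 2 2 1 2 2) //.
by rewrite !wt_part_delta // tnth4.
Qed.

Section Pair.
Context (c m be a b : C) (g : pwseries R 2) (tp : type3_params c m be g).
Context (c' m' be' a' b' : C) (g' : pwseries R 2) (tp' : type3_params c' m' be' g').
Local Notation G := (type3_zt c m 0 be a b g).
Local Notation G' := (type3_zt c' m' 0 be' a' b' g').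
Local Notation F := (type3_fun c 0 be a b g).
Local Notation F' := (type3_fun c' 0 be' a' b' g').
Local Notation th := (theta c m 0 be a b).
Local Notation th' := (theta' c' m' 0 be' a' b').

(** [theta] destroys the weights 4 and 3: the x- and y-components both have weight 2 and the same
    leading form, which comes from the term be t^2 in [pf]. Hence the intermediate weights (2, 2, 2,
    1). *)
Lemma wlim_theta : 
  [/\ wlim w 2 (fun q => cx (th q)) (fun q => m^-1 * be * ct q ^+ 2),
      wlim w 2 (fun q => cy (th q)) (fun q => m^-1 * be * ct q ^+ 2),
      wlim w 2 (fun q => cz (th q)) (@cz R) & wlim w 1 (fun q => ct (th q)) (@ct R)].
Proof.
have hs : wlim w 2 (s1 m 0 be a b) (fun q => m^-1 * be * ct q ^+ 2).
  apply: (wlim_eq _ _ (wlimD (wlimZ m (wlim_lower (isT : (2 < 4)%N) (@wlim_cx R 4 3 2 1)))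
    (wlim_pf m be a b 4 3 (isT : (0 < 1)%N) (isT : (1 < 2)%N)))) => // x.
  by rewrite mulr0 add0r.
have hy : wlim w 2 (y1 c a b) (fun=> 0).
  have h1 := wlim_lower (isT : (2 < 3)%N) (@wlim_cy R 4 3 2 1).
  have h2 := wlimZ c (wlim_lower (isT : (2 < 4)%N) (@wlim_cx R 4 3 2 1)).
  have h3 := wlimZ c (wlim_lower (isT : (2 < 3)%N) (wlim_p3f a b 4 3)).
  by apply: (wlim_eq _ _ (wlimD (wlimD h1 h2) h3)) => // x; rewrite mulr0 !addr0.
split.
- by apply: (wlim_eq _ _ (wlimD hs (wlimZ 'i hy))) => x; rewrite ?cx_v4 // mulr0 addr0.
- by apply: (wlim_eq _ _ (wlimD hs (wlimN (wlimZ 'i hy)))) => x; rewrite ?cy_v4 // mulr0 subr0.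
- by apply: (wlim_eq _ _ (@wlim_cz R 4 3 2 1)) => x; rewrite ?cz_v4.
- by apply: (wlim_eq _ _ (@wlim_ct R 4 3 2 1)) => x; rewrite ?ct_v4.
Qed.

Lemma wlim_comp_theta d h : expands_at 0 h -> wge v d h ->
  wlim w d (fun q => h (th q))
    (fun q => lead v d h (v4 (m^-1 * be * ct q ^+ 2) (m^-1 * be * ct q ^+ 2) (cz q) (ct q))).
Proof.
move=> h0 hw; have v0 : forall i, (0 < tnth v i)%N by exact: tuple4_gt0.
have [hx hy hz ht] := wlim_theta.
have := wlim_comp4 (wge_wlim v0 h0 hw) hx hy hz ht.
by apply: wlim_eq => // x; rewrite v4K.
Qed.

(** Balance makes the terms in t^2 agree. They cancel in the difference [Df] of the x- and
    y-components, which gains weight 3, and they add up in [V]. On the hypersurface [U * V] is minus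
    a function of weight at least 6, and this pushes [U], a multiple of the new x, to weight 4. *)
Lemma balanced_weights Phi Psi : germ_pair (hyp G) (hyp G') Phi Psi -> balanced m be m' be' Phi ->
  map_weights w (th' \o (Phi \o th)).
Proof.
move=> gP [nP bal1 bal2]; have [gm _ _ _] := gP; have [x0 xx y0 yy] := nP.
have [m0 mc be0 gc [gw _]] := tp; have [m0' mc' be0' _ _] := tp'.
have w0 : forall i, (0 < tnth w i)%N by exact: tuple4_gt0.
have v0 : forall i, (0 < tnth v i)%N by exact: tuple4_gt0.
have [gth _ _ _] := theta_pair 0 be a b g m0 mc.
have gc' := germ_map_comp gth gm.
have [hX hY hZ hT] := germ_map_comp_expands gm; have [X0 Y0 Z0 T0] := germ_map_comp0 gm.
have [eX eY eZ eT] := germ_map_comp_expands gc'.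
have [_ tau0 X2 Y2] := type3_leads tp tp' gP nP; have Z1 := type3_no_t tp tp' gP nP.
set al := linmx Phi (inord 0) (inord 0) in xx bal1 bal2.
set tau := linmx Phi (inord 3) (inord 3) in tau0 bal2.
have wv h : expands_at 0 h -> h 0 = 0 -> taylor h (texp 1) = 0 -> wge v 2 h.
  move=> h0 h00 h1; apply: wge_texp => // -[|[|e]]; [|by rewrite h1 eqxx|by rewrite mul1n].
  by rewrite taylor_texp0 // h00 eqxx.
have X1 : taylor (fun x => cx (Phi x)) (texp 1) = 0.
  by rewrite texp_delta; have := x0 (inord 3); rewrite mxE; apply; rewrite ord4_neq.
have Y1 : taylor (fun x => cy (Phi x)) (texp 1) = 0.
  by rewrite texp_delta; have := y0 (inord 3); rewrite mxE; apply; rewrite ord4_neq.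
have lX : wlim w 2 (fun q => cx (Phi (th q))) (fun q => al * (m^-1 * be * ct q ^+ 2)).
  apply: (wlim_eq _ _ (wlim_comp_theta hX (wv _ hX X0 X1))) => // q.
  rewrite lead2_v4 X2 mul0r add0r.
  have := x0 (inord 2); rewrite mxE => ->; last by rewrite ord4_neq.
  have := x0 (inord 1); rewrite mxE => ->; last by rewrite ord4_neq.
  by rewrite !mul0r !add0r /al mxE.
have lY : wlim w 2 (fun q => cy (Phi (th q))) (fun q => al * (m^-1 * be * ct q ^+ 2)).
  apply: (wlim_eq _ _ (wlim_comp_theta hY (wv _ hY Y0 Y1))) => // q.
  rewrite lead2_v4 Y2 mul0r add0r.
  have := y0 (inord 2); rewrite mxE => ->; last by rewrite ord4_neq.
  have := y0 (inord 0); rewrite mxE => ->; last by rewrite ord4_neq.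
  by rewrite !mul0r add0r addr0 bal1 mxE.
have lZ := wlim_comp_theta hZ (wv _ hZ Z0 Z1).
have lT : wlim w 1 (fun q => ct (Phi (th q))) (fun q => tau * ct q).
  have wT : wge v 1 (fun x => ct (Phi x)) by apply: wge_min => //; apply: ord4P; rewrite tnth4.
  apply: (wlim_eq _ _ (wlim_comp_theta hT wT)) => // q.
  rewrite lead_lin_x // lead_lin_y // lead_lin_z // (@lead_texp R 2 2 2 1 1 1) // expr1.
  by rewrite !wt_part_delta0 ?tnth4 // !mul0r !addr0 texp_delta /tau mxE.
have lp3 := wlim_zt_comp (@zt_only_p3f a' b') (wlim_p3f a' b' 1 1) lZ lT.
have lpf : wlim w 2 (fun q => pf m' 0 be' a' b' (Phi (th q))) (fun q => al * (m^-1 * be * ct q ^+ 2)).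
  have := wlim_zt_comp (@zt_only_pf m' 0 be' a' b') (wlim_pf m' be' a' b' 1 1 (isT : (0 < 1)%N) (isT : (1 < 2)%N)) lZ lT.
  apply: wlim_eq => // q; rewrite v4E [RHS]mulrA bal2; ring.
have [E' hE'] := wlim_ef a' b' 1 1 tp'.
have lE := wlim_zt_comp (@zt_only_ef c' a' b' g') hE' lZ lT.
(* On the image point, with S = (x + y)/2 and P the value of [pf], [Df] is the coordinate [y1] of
   the target, [U] is S - P and [V] is S + P. *)
pose Df q := (2%:R * 'i)^-1 * (cx (Phi (th q)) - cy (Phi (th q))).
pose U q := 2%:R^-1 * (cx (Phi (th q)) + cy (Phi (th q))) - pf m' 0 be' a' b' (Phi (th q)).
pose V q := 2%:R^-1 * (cx (Phi (th q)) + cy (Phi (th q))) + pf m' 0 be' a' b' (Phi (th q)).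
have ePf : expands_at 0 (fun q => pf m' 0 be' a' b' (Phi (th q))).
  case: gc' => aP _ _; have e := pf_expands m' 0 be' a' b' ((Phi \o th) 0).
  exact: (expands_at_comp e aP).
have eD : expands_at 0 Df.
  apply: expands_atM; first exact: expands_at_cst.
  by apply: expands_atD => //; apply: expands_atN.
have eU : expands_at 0 U.
  apply: expands_atD; last exact: expands_atN.
  by apply: expands_atM; [exact: expands_at_cst|exact: expands_atD].
have wD : wge w 3 Df.
  apply: (wlim0_wge w0 eD).
  by apply: (wlim_eq _ _ (wlimZ (2%:R * 'i)^-1 (wlimD lX (wlimN lY)))) => // q; rewrite subrr mulr0.
have lV : wlim w 2 V (fun q => 2 * al * (m^-1 * be * ct q ^+ 2)).
  apply: (wlim_eq _ _ (wlimD (wlimZ 2%:R^-1 (wlimD lX lY)) lpf)) => // q.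
  by field.
(* [V] has weight exactly 2 and [Df ^+ 2 + ef] weight at least 6, so that [U] has weight 4. *)
have van : vanishes_on F (fun q => U q * V q + (Df q ^+ 2 + ef c' a' b' g' (Phi (th q)))).
  case: gc' => _ _; apply: nearS => q H /H; rewrite /= /hyp /type3_zt => E0; rewrite -[RHS]E0.
  rewrite /U /V /Df; set X := cx _; set Y := cy _; set P := pf _ _ _ _ _ _; set E := ef _ _ _ _ _.
  rewrite [((2%:R * 'i)^-1 * _) ^+ 2]exprMn exprVn exprMn sqrCi.
  by field.
have wU : wge w 4 U.
  apply: contrapT => /(wgeN eU)[e [e4 we [q]]]; case/negP.
  have leU := wge_wlim w0 eU we.
  have lDE : wlim w (e + 2) (fun q => Df q ^+ 2 + ef c' a' b' g' (Phi (th q))) (fun=> 0).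
    have e6 : (e + 2 < 4 + 2)%N by rewrite ltn_add2r.
    have := wlim_lower e6 (wlimD (wlimX 2 (wge_wlim w0 eD wD)) lE); exact.
  have lUV := wlimD (wlimM leU lV) lDE.
  suff -> : lead w e U q = 0 by [].
  apply: (polyline0_coord (i := inord 3)); first exact: lead_polyline.
  move=> u; rewrite -/(ct u); have [->|t0] := eqVneq (ct u) 0; first by rewrite mul0r.
  (* For t non-zero every (y, z, t) completes to an arc point by a choice of x, and forms of weight
     less than 4 do not involve x. *)
  pose q0 := v4 (- type3_cst c a b g (v4 0 (cy u) (cz u) (ct u)) / (2 * (be * ct u ^+ 2))) (cy u) (cz u) (ct u).
  have ar : arc_point w F q0.
    apply: (arc_type3 gc gw); rewrite /q0 !v4E mul0r add0r; first by rewrite !mulf_neq0.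
    by rewrite /type3_cst /p3f !v4E !czt_v4.
  have nz : 2 * al * (m^-1 * be * ct q0 ^+ 2) != 0.
    have c0 : ct q0 != 0 by rewrite /q0 ct_v4.
    by rewrite !mulf_neq0 ?invr_eq0 ?pnatr_eq0.
  have := arc_wlim w0 ar van lUV; rewrite addr0 => /eqP.
  rewrite mulf_eq0 (negPf nz) orbF => /eqP; rewrite /q0.
  have wx : tnth w (inord 0) != e by rewrite tnth4 gtn_eqF.
  rewrite lead_lin_x ?wt_part_delta0 // ?mul0r ?addr0 ?(ltnW e4) // => H.
  rewrite -[u]v4K lead_lin_x ?wt_part_delta0 // ?mul0r ?addr0 ?(ltnW e4) //.
  by rewrite H mulr0.
have xE q : cx (th' (Phi (th q))) = m'^-1 * U q by rewrite cx_v4.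
have yE q : cy (th' (Phi (th q))) = Df q - c' * (m'^-1 * U q) - c' * p3f a' b' (Phi (th q)).
  by rewrite cy_v4.
have [gth' _ _ _] := germ_pair_sym (theta_pair 0 be' a' b' g' m0' mc').
have [fX fY fZ fT] := germ_map_comp_expands (germ_map_comp gc' gth').
have lU := wge_wlim w0 eU wU.
apply: map_weights4.
- apply: (wlim_wge w0 fX); apply: (wlim_eq _ _ (wlimZ m'^-1 lU)) => q; [rewrite -xE //|reflexivity].
- apply: (wlim_wge w0 fY).
  apply: (wlim_eq _ _ (wlimD (wlimD (wge_wlim w0 eD wD) (wlimN (wlimZ c' (wlimZ m'^-1 (wlim_lower (isT : (3 < 4)%N) lU)))))
    (wlimN (wlimZ c' lp3)))) => q; [rewrite -yE //|reflexivity].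
- by apply: (wlim_wge w0 fZ); apply: (wlim_eq _ _ lZ) => q; rewrite ?cz_v4.
- by apply: (wlim_wge w0 fT); apply: (wlim_eq _ _ lT) => q; rewrite ?ct_v4.
Qed.

End Pair.
End Type3Weights.

Section Type3Germs.
Context {R : realType}.
Local Notation C := (cplx R).
Local Notation w := [tuple 4%N; 3%N; 2%N; 1%N].

(** The diagonal entries at x, y and t of the two Jacobians are inverse to each other, which turns
    both conditions around. *)
Lemma balanced_inv (c m be a b : C) g (c' m' be' a' b' : C) g' Phi Psi :
  type3_params c m be g -> type3_params c' m' be' g' ->
  germ_pair (hyp (type3_zt c m 0 be a b g)) (hyp (type3_zt c' m' 0 be' a' b' g')) Phi Psi ->
  balanced m be m' be' Phi -> balanced m' be' m be Psi.
Proof.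
move=> tp tp' gP [nP bal1 bal2]; have gQ := germ_pair_sym gP.
have E1 := linmx_inv3 (type3_mult a b tp) gP; have E2 := linmx_inv3 (type3_mult a' b' tp') gQ.
have nQ := normal_inv E2 nP; have [x0 xx y0 yy] := nP; have [x0' xx' y0' yy'] := nQ.
have diag i : (forall j, j != i -> linmx Psi i j = 0) -> linmx Psi i i * linmx Phi i i = 1.
  move=> H; have /matrixP /(_ i i) := E1; rewrite [LHS]mxE [RHS]mxE eqxx mulr1n => <-.
  by rewrite (bigD1 i) //= big1 ?addr0 // => j /H ->; rewrite mul0r.
have dx := diag _ x0'; have dy := diag _ y0'.
have dt : linmx Psi (inord 3) (inord 3) * linmx Phi (inord 3) (inord 3) = 1.
  have /matrixP /(_ (inord 3) (inord 3)) := E1; rewrite [LHS]mxE [RHS]mxE eqxx mulr1n sum4.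
  rewrite x0 ?ord4_neq // y0 ?ord4_neq // [linmx Phi (inord 2) _]mxE -texp_delta.
  by rewrite (type3_no_t tp tp' gP nP) !mulr0 !add0r.
split=> //.
  apply: (mulIf xx); rewrite dx {1}bal1; exact/esym.
set al' := linmx Psi _ _ in dx *; set tau' := linmx Psi _ _ in dt *.
set al := linmx Phi _ _ in dx bal2; set tau := linmx Phi _ _ in dt bal2.
transitivity (al' * (m'^-1 * be' * tau ^+ 2) * tau' ^+ 2).
  transitivity (al' * (m'^-1 * be') * (tau' * tau) ^+ 2); first by rewrite dt expr1n mulr1.
  ring.
rewrite -bal2; transitivity ((al' * al) * (m^-1 * be) * tau' ^+ 2); first by ring.
by rewrite dx mul1r.
Qed.

Theorem type3_weights (c m be a b : C) g (c' m' be' a' b' : C) g' Phi0 Psi0 :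
  type3_params c m be g -> type3_params c' m' be' g' ->
  germ_pair (type3_fun c 0 be a b g) (type3_fun c' 0 be' a' b' g') Phi0 Psi0 ->
  exists Phi Psi, [/\ germ_pair (type3_fun c 0 be a b g) (type3_fun c' 0 be' a' b' g') Phi Psi,
    map_weights w Phi & map_weights w Psi].
Proof.
move=> tp tp' gP0; have [m0 mc _ _ _] := tp; have [m0' mc' _ _ _] := tp'.
have tP := theta_pair 0 be a b g m0 mc; have tP' := theta_pair 0 be' a' b' g' m0' mc'.
have [Phi [Psi [gP bP]]] := balance tp tp' (germ_pair_comp (germ_pair_comp (germ_pair_sym tP) gP0) tP').
have bQ := balanced_inv tp tp' gP bP.
have gF := germ_pair_comp (germ_pair_comp tP gP) (germ_pair_sym tP').
exists (theta' c' m' 0 be' a' b' \o (Phi \o theta c m 0 be a b)).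
exists ((theta' c m 0 be a b \o Psi) \o theta c' m' 0 be' a' b').
have wP := @balanced_weights R c m be a b g tp c' m' be' a' b' g' tp' Phi Psi gP bP.
have wQ := @balanced_weights R c' m' be' a' b' g' tp' c m be a b g tp Psi Phi (germ_pair_sym gP) bQ.
by split; [exact: gF|exact wP|exact wQ].
Qed.

End Type3Germs.

(** * The centre of a weighted blowup *)

Section Centre.
Context {R : realType}.
Local Notation C := (cplx R).

Lemma small_point (K e : C) : 0 <= K -> 0 < e ->
  exists t : C, [/\ t != 0, `|t| <= 1, `|t| < e & K * `|t| < e].
Proof.
move=> K0 e0; have K1 : 0 < K + 1 by rewrite ltr_wpDl.
have [f [f0 f1 fe]] := pos_min2 (@ltr01 C) (divr_gt0 e0 K1).
have h0 : 0 < f / 2 by rewrite divr_gt0.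
have hf : f / 2 < f by rewrite ltr_pdivrMr // ltr_pMr // ltr1n.
have fK : (K + 1) * (f / 2) < e.
  by rewrite mulrC -ltr_pdivlMr // (lt_le_trans hf).
exists (f / 2); rewrite gtr0_norm //; split.
- by rewrite gt_eqF.
- by rewrite (le_trans (ltW hf)).
- by apply: le_lt_trans fK; rewrite ler_peMl ?(ltW h0) // lerDr.
- by apply: le_lt_trans fK; rewrite ler_pM2r // lerDl.
Qed.

Section Blowup.
Context (n : nat) (w : n.-tuple nat) (w0 : forall i, (0 < tnth w i)%N) (r : C) (r0 : 0 < r).
Context (F : 'rV[C]_n -> C).
Local Notation Z := (zero_locus r F).
Context (b : sub_space (wstrict w (polydisc r) Z) -> sub_space Z) (bw : is_wblowup w (polydisc r) Z b).

Lemma polydisc0 : polydisc r (0 : 'rV[C]_n).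
Proof. by move=> i; rewrite mxE normr0. Qed.

Lemma wstrict_arc (q : 'rV[C]_n) (q0 : q != 0) : arc_point w F q ->
  wstrict w (polydisc r) Z (wpr w (wdom_pcons 0 q0)).
Proof.
move=> aq; apply: wstrict_limit => //; first exact: polydisc0.
move=> e e0; have [e' e'0 He'] := near_wsc q w0 r0.
have [f [f0 fe fe']] := pos_min2 e0 e'0; have [s [x [s0 sf xf Fx]]] := aq f f0.
exists s, x; split=> //.
- exact: lt_le_trans sf fe.
- by move=> i; apply: lt_le_trans fe.
- by split=> //; apply: He' => // [|i]; apply: lt_le_trans fe'.
Qed.

(** The exceptional fibre has points arbitrarily close to [q0], so the blowup is not
    injective near it. *)
Lemma wblowup_centre_arcs (q0 : 'rV[C]_n) (i : 'I_n) : F 0 = 0 -> q0 != 0 -> q0 0 i = 0 ->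
  arc_point w F q0 ->
  (forall e : C, 0 < e -> exists q : 'rV[C]_n,
     [/\ q 0 i != 0, forall j, `|q 0 j - q0 0 j| < e & arc_point w F q]) ->
  exists2 z, set_val z = (0 : 'rV[C]_n) & centre b z.
Proof.
move=> F0 q00 qi0 aq0 H.
have Z0 : Z 0 by split=> //; exact: polydisc0.
have y0 := wstrict_arc q00 aq0.
exists (@to_sub R (analytic_space R n) Z 0 Z0); first by [].
apply: (wblowup_centre0 bw (y := to_sub y0)).
- by rewrite to_subK.
- by rewrite to_subK wpi_wpr pcons0 wsc_0l.
move=> V oV; rewrite to_subK => Vy.
have := (wquot_near _ _).1 (open_nbhs_nbhs (conj oV Vy)).
rewrite to_subK => /near_rowP[e e0 He].
have [q [qi qe aq]] := H e e0.
have qn : q != 0 by apply: contraNneq qi => ->; rewrite mxE.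
exists (wpr w (wdom_pcons 0 qn)); first exact: wstrict_arc.
split.
- apply: He => j; case: (unliftP ord0 j) => [k ->|->]; rewrite ?pconsS ?pcons0 //.
  by rewrite subrr normr0.
- move=> /wproj_eq[l l0 /rowP /(_ (lift ord0 i))] E.
  have := E; rewrite !to_subK wact_coord liftK !pconsS qi0 => /eqP.
  by rewrite eq_sym mulf_eq0 expf_eq0 (negPf l0) andbF (negPf qi).
- by rewrite wpi_wpr pcons0 wsc_0l.
Qed.

End Blowup.

(** The arc points (1, -K t^N, 0, t) approach (1, 0, 0, 0) as t tends to 0. *)
Lemma hyp_centre p1 p2 k l (r K : C) N (g G : 'rV[C]_4 -> C)
    (b : sub_space (wstrict [tuple p1; p2; k; l] (polydisc r) (zero_locus r (hyp g))) ->
         sub_space (zero_locus r (hyp g))) :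
  (0 < p1)%N -> (0 < p2)%N -> (0 < k)%N -> (0 < l)%N -> 0 < r -> g 0 = 0 -> zt_only g ->
  is_wblowup [tuple p1; p2; k; l] (polydisc r) (zero_locus r (hyp g)) b ->
  wlim [tuple p1; p2; k; l] (p1 + p2) g G -> (0 < N)%N -> (forall t, G (v4 0 0 0 t) = K * t ^+ N) ->
  exists2 z, set_val z = (0 : 'rV[C]_4) & centre b z.
Proof.
move=> p10 p20 k0 l0 r0 g0 ztg bw gG N0 GK; have w0 := tuple4_gt0 p10 p20 k0 l0.
have ztG := wlim_zt_only ztg gG.
apply: (wblowup_centre_arcs w0 r0 bw (q0 := v4 1 0 0 0) (i := inord 3)).
- by rewrite /hyp g0 /cx mxE mul0r add0r.
- by apply/eqP => /rowP /(_ (inord 0)); rewrite -/(cx _) v4E mxE => /eqP; rewrite oner_eq0.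
- by rewrite -/(ct _) v4E.
- apply: (arc_hyp_x ztg gG); last by rewrite v4E oner_eq0.
  by rewrite !v4E mulr0 add0r (zt_onlyE _ _ _ _ ztG) GK expr0n gtn_eqF // mulr0.
move=> e e0; have [t [t0 t1 te tK]] := small_point (normr_ge0 K) e0.
exists (v4 1 (- (K * t ^+ N)) 0 t); split.
- by rewrite -/(ct _) v4E.
- apply: ord4P; rewrite -?/(cx _) -?/(cy _) -?/(cz _) -?/(ct _) !v4E ?subrr ?subr0 ?normr0 //.
  rewrite normrN normrM; apply: le_lt_trans tK; apply: ler_wpM2l => //.
  by rewrite normrX -(prednK N0) exprS ger_pMr ?normr_gt0 // exprn_ile1.
- apply: (arc_hyp_x ztg gG); last by rewrite v4E oner_eq0.
  by rewrite !v4E mul1r (zt_onlyE _ _ _ _ ztG) GK addNr.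
Qed.

Lemma ztf0 k l d (g : pwseries R 2) : wt_ge [tuple k; l] g d -> (0 < d)%N -> ztf g 0 = 0.
Proof.
move=> gd d0; rewrite /ztf (psval_single (a := zt_exp 0 0)).
  rewrite (_ : g (zt_exp 0 0) = 0) ?mul0r //; apply/eqP/negPn/negP => /gd.
  by rewrite mon_wt2 !zt_expE !muln0 leqn0 gtn_eqF.
move=> e; have [E|[i ei]] : (forall i, e i = 0%N) \/ exists i, e i != 0%N.
  have [H|/forallPn/=] := boolP [forall i, e i == 0%N]; last by right.
  by left=> i; apply/eqP; exact: (forallP H).
- case/eqP; apply/ffunP => i; rewrite E; apply/esym; move: i; apply: ord2P; rewrite zt_expE //.
- move=> _; rewrite (_ : czt 0 = 0) ?(monomial_at0 ei) ?mulr0 //.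
  by apply/rowP => j; rewrite !mxE /cz /ct !mxE; case: ifP.
Qed.

(** With z = 0 and t = 1 the coordinate y is free and x = X(y) is determined by [arc_type3]; letting
    y tend to 0 gives the required points. *)
Lemma type3_centre (r c pi_ be a b : C) (g : pwseries R 2)
    (B : sub_space (wstrict [tuple 4%N; 3%N; 2%N; 1%N] (polydisc r) (zero_locus r (type3_fun c pi_ be a b g))) ->
         sub_space (zero_locus r (type3_fun c pi_ be a b g))) :
  0 < r -> convergent g -> wt_ge [tuple 2%N; 1%N] g 6 -> be != 0 ->
  is_wblowup [tuple 4%N; 3%N; 2%N; 1%N] (polydisc r) (zero_locus r (type3_fun c pi_ be a b g)) B ->
  exists2 z, set_val z = (0 : 'rV[C]_4) & centre B z.
Proof.
move=> r0 gc gw be0 Bw.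
have w0 : forall i, (0 < tnth [tuple 4%N; 3%N; 2%N; 1%N] i)%N by exact: tuple4_gt0.
pose G6 := psval (wt_part [tuple 2%N; 1%N] 6 g) (czt (v4 0 0 0 1 : 'rV[C]_4)).
pose X (y : C) := - (y ^+ 2 + 2 * c * y * b + G6) / (2 * be).
have ar y : arc_point [tuple 4%N; 3%N; 2%N; 1%N] (type3_fun c pi_ be a b g) (v4 (X y) y 0 1).
  apply: (arc_type3 gc gw); rewrite !v4E mulr0 add0r expr1n mulr1 //.
  have E : czt (v4 (X y) y 0 1) = czt (v4 0 0 0 1 : 'rV[C]_4) by rewrite !czt_v4.
  rewrite /type3_cst /p3f E -/G6 !v4E {1}/X; congr (- _ / _); ring.
apply: (wblowup_centre_arcs w0 r0 Bw (q0 := v4 (X 0) 0 0 1) (i := inord 1)) => //.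
- have g0 := ztf0 gw (isT : (0 < 6)%N).
  by rewrite /type3_fun /p3f g0 /cx /cy /cz /ct !mxE !(mulr0, mul0r, addr0, expr0n).
- by apply/eqP => /rowP /(_ (inord 3)); rewrite -/(ct _) v4E mxE => /eqP; rewrite oner_eq0.
- by rewrite -/(cy _) v4E.
(* Bounds the difference quotient of [X] at 0 for [|t| <= 1]. *)
pose K := (1 + `|2 * c * b|) / `|2 * be|.
have K0 : 0 <= K by rewrite divr_ge0 // addr_ge0.
move=> e e0; have [t [t0 t1 te tK]] := small_point K0 e0.
exists (v4 (X t) t 0 1); split=> //; first by rewrite -/(cy _) v4E.
apply: ord4P; rewrite -?/(cx _) -?/(cy _) -?/(cz _) -?/(ct _) !v4E ?subrr ?subr0 ?normr0 //.
have -> : X t - X 0 = - (t + 2 * c * b) * t / (2 * be).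
  by rewrite /X; field.
rewrite normrM normfV normrM normrN mulrAC; apply: le_lt_trans tK; apply: ler_wpM2r => //.
apply: ler_wpM2r; first by rewrite invr_ge0.
by apply: le_trans (ler_normD _ _) _; rewrite lerD2r.
Qed.

End Centre.

(** * Conclusion *)

Section Assembly.
Context {R : realType}.
Local Notation C := (cplx R).

(** [z^(n+1)] is the only monomial of degree at most [n + 1] that [g] may contain if [a > 1];
    were it absent, [xy + g] would not define a cA_n-singularity. *)
Lemma type1_series_of_germ n a (g g0 : pwseries R 2) Phi Psi : (0 < n)%N -> (0 < a)%N ->
  convergent g -> wt_eq [tuple a; 1%N] g (a * n.+1) -> convergent g0 -> mult_eq g0 n.+1 ->
  germ_pair (hyp (ztf g0)) (hyp (ztf g)) Phi Psi -> type1_series a n g.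
Proof.
move=> n0 a0 gc gw gc0 [m0 [e ge we]] gP; split=> // a1; apply/negP => /eqP gz.
have m1 : wt_ge [tuple 1%N; 1%N] g n.+2.
  move=> b gb; have := gw.1 b gb; rewrite !mon_wt2 !mul1n => H.
  rewrite ltnNge; apply/negP => le; have [E1 E2] : b ord0 = n.+1 /\ b o1 = 0%N by nia.
  by move: gb; rewrite (zt_expK b) E1 E2 gz eqxx.
have m0' := (mult_geE g0 n.+1).1 m0.
have we' : mon_wt [tuple 1%N; 1%N] e = n.+1.
  by rewrite -we; apply: eq_bigr => i _; rewrite tnth_nseq; congr (_ * _)%N; move: i; apply: ord2P.
(* Without z^(n+1) the series [g] has larger multiplicity than [g0]. For [n = 1] the rank of the
   tangent cone excludes this, for larger [n] the weights of [multiplicity_le]. *)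
have [n1|n1] := leqP n 1.
  have En : n = 1%N by lia.
  rewrite En in m1 m0' we'.
  apply: (quadric_not_cubic (ztf_expands gc0) (ztf_only g0)
    (ztf_wlim 1 1 (isT : (0 < 1)%N) (isT : (0 < 1)%N) gc0 m0') _ _ (multiplicity_ge3_ztf gc m1) gP).
    exact: ztf_polyline.
  exact: ztf_neq0 gc0 ge we'.
have scale (b : {ffun 'I_2 -> nat}) : mon_wt [tuple 2%N; 2%N] b = (2 * mon_wt [tuple 1%N; 1%N] b)%N.
  by rewrite !mon_wt2; lia.
have N2 : (2 < n.+1)%N by lia.
apply: (multiplicity_le N2 (g := ztf g0) (g' := ztf g) _ (ztf_wlim n.+1 n.+1 (isT : (0 < 2)%N) (isT : (0 < 2)%N) gc0 _) _ _ _ _ gP).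
- by apply: multiplicity_ge3_ztf => // b /m0'; apply: leq_trans.
- by move=> b /m0'; rewrite scale addnn -mul2n leq_mul2l.
- exact: ztf_polyline.
- by apply: (ztf_neq0 gc0 ge); rewrite scale we' addnn mul2n.
- by apply: multiplicity_ge3_ztf => // b /m1; apply: leq_trans; lia.
- apply: ztf_wlim0 => // b /m1; rewrite scale => H; lia.
Qed.

Section Blowups.
Context (X : fspace R) (P : X) (X_var : is_variety X).
Context (n : nat) (w : n.-tuple nat) (w0 : forall i, (0 < tnth w i)%N).

(** The origin lies in the centre of [b], and the centre of [phi] is [P] alone, so the equivalence
    of the two maps identifies the germs at these points. *)
Lemma blowup_germ (Y : fspace R) (phi : Y -> X) (r : C) (F : 'rV[C]_n -> C)
    (b : sub_space (wstrict w (polydisc r) (zero_locus r F)) -> sub_space (zero_locus r F)) :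
  is_variety Y -> is_morphism phi -> centre phi = [set P] ->
  is_wblowup w (polydisc r) (zero_locus r F) b -> locally_equivalent (an_map phi) b ->
  (exists2 z, set_val z = (0 : 'rV[C]_n) & centre b z) ->
  exists2 z : sub_space (zero_locus r F), set_val z = (0 : 'rV[C]_n) & germ_iso z (P : an X).
Proof.
move=> Y_var mphi cphi bw le [z z0 cz]; exists z => //.
have cX := variety_cst X_var; have cY := variety_cst Y_var.
have [cphi' _] := is_morphism_an cY mphi; have [cb _] := wblowup_morphism bw.
apply: (locally_equivalent_germ cb cphi' (locally_equivalent_sym le) cz).
by rewrite -cphi; exact: centre_an.
Qed.

Lemma blowup_equivalent (Y Y' : fspace R) (phi : Y -> X) (phi' : Y' -> X) (r r' : C) (F F' : 'rV[C]_n -> C)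
    (b : sub_space (wstrict w (polydisc r) (zero_locus r F)) -> sub_space (zero_locus r F))
    (b' : sub_space (wstrict w (polydisc r') (zero_locus r' F')) -> sub_space (zero_locus r' F')) Phi Psi :
  is_variety Y -> is_variety Y' -> is_morphism phi -> is_morphism phi' -> 0 < r -> 0 < r' ->
  is_wblowup w (polydisc r) (zero_locus r F) b -> is_wblowup w (polydisc r') (zero_locus r' F') b' ->
  locally_equivalent (an_map phi) b -> locally_equivalent (an_map phi') b' ->
  germ_pair F F' Phi Psi ->
  (forall i, wge w (tnth w i) (fun x => Phi x 0 i)) -> (forall i, wge w (tnth w i) (fun x => Psi x 0 i)) ->
  locally_equivalent (an_map phi) (an_map phi').
Proof.
move=> Y_var Y'_var mphi mphi' r0 r0' bw bw' le le' gP wP wQ.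
have [c1 _] := is_morphism_an (variety_cst Y_var) mphi.
have [c2 _] := is_morphism_an (variety_cst Y'_var) mphi'.
have [cb _] := wblowup_morphism bw; have [cb' _] := wblowup_morphism bw'.
have [[aP _ _] [aQ _ _] _ _] := gP.
have bb' := wblowup_equivalent_germ w0 r0 r0' bw bw' gP
  (fun i => weight_geE (aP i) (wP i)) (fun i => weight_geE (aQ i) (wQ i)).
exact: locally_equivalent_trans c1 cb c2 le
  (locally_equivalent_trans cb cb' c2 bb' (locally_equivalent_sym le')).
Qed.

End Blowups.

Lemma germ_pair_id n (F : 'rV[C]_n -> C) : germ_pair F F id id.
Proof.
have gI : germ_map F F id by split=> // [i|]; [exact: expands_at_coord|exact: filterE].
by split=> //; exact: filterE.
Qed.

Lemma map_weights_id p1 p2 k l : (0 < p1)%N -> (0 < p2)%N -> (0 < k)%N -> (0 < l)%N ->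
  map_weights [tuple p1; p2; k; l] (id : 'rV[C]_4 -> 'rV[C]_4).
Proof.
move=> p10 p20 k0 l0 i; apply: (wlim_wge (tuple4_gt0 p10 p20 k0 l0)); first exact: expands_at_coord.
exact: wlim_coord.
Qed.

Section Types.
Context (n : nat) (n0 : (0 < n)%N) (X : fspace R) (P : X) (X_var : is_variety X) (P_cA : is_cA_point n P).
Lemma cA_germ_pair (r : C) (F : 'rV[C]_4 -> C) (z : sub_space (zero_locus r F)) :
  0 < r -> set_val z = (0 : 'rV[C]_4) -> germ_iso z (P : an X) ->
  exists g0 : pwseries R 2, [/\ convergent g0, mult_eq g0 n.+1 &
    exists Phi Psi, germ_pair (hyp (ztf g0)) F Phi Psi].
Proof.
move=> r0 z0 zP; have [_ [g0 [s [s0 gs mg [Q Q0 PQ]]]]] := P_cA.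
exists g0; split=> //; first by exists s.
by apply: (germ_iso_pair s0 r0 Q0 z0); exact: germ_iso_sym (germ_iso_trans zP PQ).
Qed.

(** [m] is a square root of [1 - c ^+ 2], non-zero since [c] is neither 1 nor -1. The cA_2-point
    excludes the term z from p, so that [pi_] may be replaced by 0. *)
Lemma type3_data (Y0 : fspace R) (phi0 : Y0 -> X) :
  is_variety Y0 -> is_morphism phi0 -> centre phi0 = [set P] -> is_type3 n phi0 ->
  exists (c m be a b : C) (g : pwseries R 2) (r : C), [/\ type3_params c m be g, 0 < r &
    exists B : sub_space (wstrict [tuple 4%N; 3%N; 2%N; 1%N] (polydisc r) (zero_locus r (type3_fun c 0 be a b g))) ->
         sub_space (zero_locus r (type3_fun c 0 be a b g)),
    [/\ is_wblowup [tuple 4%N; 3%N; 2%N; 1%N] (polydisc r) (zero_locus r (type3_fun c 0 be a b g)) B,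
        locally_equivalent (an_map phi0) B &
        exists2 z : sub_space (zero_locus r (type3_fun c 0 be a b g)),
          set_val z = (0 : 'rV[C]_4) & germ_iso z (P : an X)]].
Proof.
move=> Y0_var m0 c0 [n2 [c [p [g [r [[r0 gr] [c1 c1'] [gw gd] [hp be0]]]]]]].
rewrite eq_type3E //.
set pi_ := p (zt_exp 1 0); set be := p (zt_exp 0 2) in be0 *; set a := p (zt_exp 1 1); set b := p (zt_exp 0 3).
move=> [B Bw le]; have gc : convergent g by exists r.
have [z z0 zP] := blowup_germ X_var Y0_var m0 c0 Bw le (type3_centre r0 gc gw be0 Bw).
pose m : C := sqrtC (1 - c ^+ 2).
have mc : m ^+ 2 = 1 - c ^+ 2 by exact: sqrtCK.
have mn : m != 0.
  rewrite -sqrf_eq0 mc -{1}(expr1n C 2) subr_sqr mulf_neq0 //.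
    by rewrite subr_eq0 eq_sym.
  by rewrite addrC addr_eq0.
have tp : type3_params c m be g by [].
have pi0 : pi_ = 0.
  have [g0 [gc0 mg0 [Phi [Psi gP]]]] := cA_germ_pair r0 z0 zP.
  have mg : multiplicity_ge3 (ztf g0).
    apply: multiplicity_ge3_ztf => // e /((mult_geE g0 n.+1).1 mg0.1); apply: leq_trans.
    by rewrite n2.
  exact: (type3_pi0 tp mg (germ_pair_comp (germ_pair_sym (theta_pair pi_ be a b g mn mc)) (germ_pair_sym gP))).
move: B Bw le z z0 zP; rewrite pi0 => B Bw le z z0 zP.
by exists c, m, be, a, b, g, r; split=> //; exists B; split=> //; exists z.
Qed.

Context (Y Y' : fspace R) (phi : Y -> X) (phi' : Y' -> X).
Context (Y_var : is_variety Y) (Y'_var : is_variety Y') (mphi : is_morphism phi) (mphi' : is_morphism phi').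
Context (cphi : centre phi = [set P]) (cphi' : centre phi' = [set P]).

Lemma type1_centre r1 r2 a (g : pwseries R 2) (r : C)
    (b : sub_space (wstrict [tuple r1; r2; a; 1%N] (polydisc r) (zero_locus r (eq_cA g))) ->
         sub_space (zero_locus r (eq_cA g))) :
  (0 < r1)%N -> (0 < r2)%N -> (0 < a)%N -> 0 < r -> convergent g ->
  wt_ge [tuple a; 1%N] g (r1 + r2) ->
  is_wblowup [tuple r1; r2; a; 1%N] (polydisc r) (zero_locus r (eq_cA g)) b ->
  exists2 z, set_val z = (0 : 'rV[C]_4) & centre b z.
Proof.
move=> r10 r20 a0 r0 gc gw bw; have rr0 : (0 < r1 + r2)%N by rewrite addn_gt0 r10.
have w0 := tuple4_gt0 r10 r20 a0 (isT : (0 < 1)%N).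
have e0 := ztf_expands gc.
have hG := wge_wlim w0 e0 (wlim_wge w0 e0 (ztf_wlim r1 r2 a0 (isT : (0 < 1)%N) gc gw)).
apply: (hyp_centre r10 r20 a0 (isT : (0 < 1)%N) r0 (ztf0 gw rr0) (ztf_only g) bw hG rr0).
by move=> t; apply: lead_texp => //; rewrite mul1n.
Qed.

Lemma type1_equivalent r1 r2 a : is_type1 n phi r1 r2 a -> is_type1 n phi' r1 r2 a ->
  locally_equivalent (an_map phi) (an_map phi').
Proof.
move=> [[r10 r20 a0 r12] ar co _ [g [r [r0 gr gw [b bw le]]]]].
move=> [_ _ _ _ [g' [r' [r0' gr' gw' [b' bw' le']]]]].
have gc : convergent g by exists r.
have gc' : convergent g' by exists r'.
have [z z0 zP] := blowup_germ X_var Y_var mphi cphi bw le (type1_centre r10 r20 a0 r0 gc gw.1 bw).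
have [z' z0' zP'] := blowup_germ X_var Y'_var mphi' cphi' bw' le' (type1_centre r10 r20 a0 r0' gc' gw'.1 bw').
have [g0 [gc0 mg0 [Ph [Ps gP0]]]] := cA_germ_pair r0 z0 zP.
have [g0' [gc0' mg0' [Ph' [Ps' gP0']]]] := cA_germ_pair r0' z0' zP'.
rewrite -ar in gw gw'.
have tg := type1_series_of_germ n0 a0 gc gw gc0 mg0 gP0.
have tg' := type1_series_of_germ n0 a0 gc' gw' gc0' mg0' gP0'.
have [Phi0 [Psi0 gP]] := germ_iso_pair r0 r0' z0 z0' (germ_iso_trans zP (germ_iso_sym zP')).
have [Phi [Psi [gPP wP wQ]]] := type1_weights n0 r10 r20 a0 r12 ar co tg tg' gP.
exact: (blowup_equivalent (tuple4_gt0 r10 r20 a0 (isT : (0 < 1)%N)) Y_var Y'_var mphi mphi'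
  r0 r0' bw bw' le le' gPP wP wQ).
Qed.

(** The two blowups belong to the same equation in possibly different polydiscs, so the identity
    serves in both directions. *)
Lemma type2_equivalent : is_type2 n phi -> is_type2 n phi' ->
  locally_equivalent (an_map phi) (an_map phi').
Proof.
move=> [_ [r r0 [b bw le]]] [_ [r' r0' [b' bw' le']]].
have wI := @map_weights_id 1 5 3 2 isT isT isT isT.
exact: (blowup_equivalent (@tuple4_gt0 1 5 3 2 isT isT isT isT) Y_var Y'_var mphi mphi'
  r0 r0' bw bw' le le' (germ_pair_id (@eq_type2 R)) wI wI).
Qed.

Lemma type3_equivalent : is_type3 n phi -> is_type3 n phi' ->
  locally_equivalent (an_map phi) (an_map phi').
Proof.
move=> t3 t3'.
have [c [m [be [a [b [g [r [tp r0 [B [Bw le [z z0 zP]]]]]]]]]]] := type3_data Y_var mphi cphi t3.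
have [c' [m' [be' [a' [b' [g' [r' [tp' r0' [B' [Bw' le' [z' z0' zP']]]]]]]]]]] := type3_data Y'_var mphi' cphi' t3'.
have [Phi0 [Psi0 gP]] := germ_iso_pair r0 r0' z0 z0' (germ_iso_trans zP (germ_iso_sym zP')).
have [Phi [Psi [gPP wP wQ]]] := type3_weights tp tp' gP.
exact: (blowup_equivalent (@tuple4_gt0 4 3 2 1 isT isT isT isT) Y_var Y'_var mphi mphi'
  r0 r0' Bw Bw' le le' gPP wP wQ).
Qed.

End Types.
End Assembly.

Theorem lemma6p2 (R : realType) (n : nat) (X : fspace R) (P : X)
    (Y Y' : fspace R) (phi : Y -> X) (phi' : Y' -> X) :
  (0 < n)%N ->
  is_Qgorenstein X -> is_terminal X -> is_cA_point n P ->
  divisorial_contraction phi -> centre phi = [set P] ->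
  divisorial_contraction phi' -> centre phi' = [set P] ->
  (exists r1 r2 a : nat,
      is_type1 n phi r1 r2 a /\ is_type1 n phi' r1 r2 a) \/
  (is_type2 n phi /\ is_type2 n phi') \/
  (is_type3 n phi /\ is_type3 n phi') ->
  locally_equivalent (an_map phi) (an_map phi').
Proof.
move=> n0 [X_var _ _] _ cA [[[Y_var _ _] _] _ [[mphi _] _] _ _] cphi.
move=> [[[Y'_var _ _] _] _ [[mphi' _] _] _ _] cphi'.
case=> [[r1 [r2 [a [t t']]]]|[[t t']|[t t']]].
- exact: (type1_equivalent n0 X_var cA Y_var Y'_var mphi mphi' cphi cphi' t t').
- exact: (type2_equivalent Y_var Y'_var mphi mphi' t t').
- exact: (type3_equivalent X_var cA Y_var Y'_var mphi mphi' cphi cphi' t t').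
Qed.
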